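(* Let $G$ be a subcubic graph (maximum degree at most $3$) such that no connected component of $G$ is isomorphic to $K_{3,3}$ and no connected component of $G$ is isomorphic to the $5$-prism $C_5 \,\Box\, K_2$. Then \[ 8\, i(G) \le 8n_0(G) + 5n_1(G) + 4n_2(G) + 3n_3(G) + 2\,\mathrm{tc}(G) + 2\, b(G). \]
   Context: $i(G)$ denotes the independent domination number of $G$: the minimum size of a set $S\subseteq V(G)$ that is independent and such that every vertex outside $S$ has a neighbor in $S$. For $j\in\{0,1,2,3\}$, $n_j(G)$ is the number of vertices of degree $j$ in $G$. The bad family $\mathcal{B}$: let $B_1$ be the graph obtained from $K_{2,3}$ by adding a new vertex $r$ and an edge joining $r$ to a vertex of degree $2$ of the $K_{2,3}$. Operation $\mathcal{O}_1$: from a graph $G'$, select a vertex $v'$ of degree at most $2$ in $G'$, add a vertex-disjoint copy of $K_{2,3}$, and add an edge joining $v'$ to a vertex of degree $2$ in the added copy. $\mathcal{B}$ is the family of graphs obtainable from $B_1$ by finitely many (possibly zero) applications of $\mathcal{O}_1$. For $H\in\mathcal{B}$, the root of $H$ is the unique vertex of $H$ that lies on no cycle; $\mathcal{B}_1$ denotes the set of graphs in $\mathcal{B}$ whose root has degree $1$. $b(G)$ is the number of connected components of $G$ that are isomorphic to a graph in $\mathcal{B}$. Troublesome configurations: a troublesome configuration of $G$ is a subgraph $T$ of $G$ obtained as follows. Take a graph $B\in\mathcal{B}_1$ (as a subgraph of $G$) with root $v_1$ (of degree $1$ in $B$), a vertex $v_2\notin V(B)$, and a vertex $w_2\ne v_1$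 of degree $2$ in $B$; $T$ consists of $B$ together with $v_2$ and the edges $v_1v_2$, $v_2w_2$. It is required that in $G$: every vertex of $V(B)\setminus\{v_1\}$ has the same degree in $G$ as in $T$; $v_2$ has exactly one neighbor outside $V(T)$ (so $\deg_G(v_2)=3$); and $v_1$ has at most one neighbor outside $V(T)$. $\mathrm{tc}(G)$ is the number of vertex-disjoint troublesome configurations in $G$ (i.e., the maximum number of pairwise vertex-disjoint troublesome configurations of $G$). *)

(* Defs.v *)
From mathcomp Require Import all_boot.
From mathcomp Require Import boolp.

Set Implicit Arguments.
Unset Strict Implicit.
Unset Printing Implicit Defensive.

Record sgraph := SGraph {
  vertex :> finType;
  edge : rel vertex;
  edge_sym : symmetric edge;
  edge_irrefl : irreflexive edge
}.
Arguments edge {s} x y.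

Definition nbrs (G : sgraph) (v : G) : {set G} := [set u | edge v u].
Definition deg (G : sgraph) (v : G) : nat := #|nbrs v|.
Definition subcubic (G : sgraph) : Prop := forall v : G, deg v <= 3.
Definition ndeg (j : nat) (G : sgraph) : nat := #|[set v : G | deg v == j]|.

Definition independent (G : sgraph) (S : {set G}) : bool :=
  [forall x in S, forall y in S, ~~ edge x y].
Definition dominating (G : sgraph) (S : {set G}) : bool :=
  [forall x in ~: S, exists y in S, edge x y].

(* Every maximal independent set satisfies the filter, so the minimum is over
   a nonempty range and the default value #|G| never lowers it. *)
Definition indep_dom_number (G : sgraph) : nat :=
  \big[minn/#|G|]_(S : {set G} | independent S && dominating S) #|S|.

Definition isomorphic (G H : sgraph) : Prop :=
  exists f : G -> H, bijective f /\ forall x y, edge (f x) (f y) = edge x y.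

Section Induced.
Variables (G : sgraph) (C : {set G}).
Definition induced_edge : rel {x : G | x \in C} :=
  [rel x y | edge (val x) (val y)].
Lemma induced_edge_sym : symmetric induced_edge.
Proof. by move=> x y; apply: edge_sym. Qed.
Lemma induced_edge_irrefl : irreflexive induced_edge.
Proof. by move=> x; apply: edge_irrefl. Qed.
Definition induced : sgraph := SGraph induced_edge_sym induced_edge_irrefl.
End Induced.

Definition components (G : sgraph) : {set {set G}} :=
  [set [set y | connect edge x y] | x : G].

Section CompleteBipartite.
Variables m n : nat.
Definition Kmn_edge : rel ('I_m + 'I_n) :=
  fun x y => match x, y with
             | inl _, inr _ | inr _, inl _ => true
             | _, _ => false
             end.
Lemma Kmn_edge_sym : symmetric Kmn_edge.
Proof. by move=> [?|?] [?|?]. Qed.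
Lemma Kmn_edge_irrefl : irreflexive Kmn_edge.
Proof. by case. Qed.
Definition Kmn : sgraph := SGraph Kmn_edge_sym Kmn_edge_irrefl.
End CompleteBipartite.

Section Prism5.
Definition C5_edge : rel 'I_5 := fun i j => (j == ordS i) || (i == ordS j).
Definition prism5_edge : rel ('I_5 * bool) :=
  fun x y => (x.1 == y.1) && (x.2 != y.2) || (x.2 == y.2) && C5_edge x.1 y.1.
Lemma prism5_edge_sym : symmetric prism5_edge.
Proof.
move=> x y; rewrite /prism5_edge /C5_edge.
by rewrite [x.1 == y.1]eq_sym [x.2 == y.2]eq_sym [(y.1 == _) || _]orbC.
Qed.
Lemma prism5_edge_irrefl : irreflexive prism5_edge.
Proof.
move=> [[i lt_i] a]; rewrite /prism5_edge /C5_edge /= !eqxx /= orbb.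
by move: i lt_i; do 5! [case=> //].
Qed.
Definition prism5 : sgraph := SGraph prism5_edge_sym prism5_edge_irrefl.
End Prism5.

Section SingleVertex.
Definition K1_edge : rel unit := fun _ _ => false.
Lemma K1_edge_sym : symmetric K1_edge. Proof. by []. Qed.
Lemma K1_edge_irrefl : irreflexive K1_edge. Proof. by []. Qed.
Definition K1 : sgraph := SGraph K1_edge_sym K1_edge_irrefl.
End SingleVertex.

(* Disjoint union of G and H plus the single edge joining v in G to w in H. *)
Section Attach.
Variables (G H : sgraph) (v : G) (w : H).
Definition attach_edge : rel (G + H) :=
  fun x y => match x, y with
             | inl a, inl b => edge a b
             | inr a, inr b => edge a b
             | inl a, inr b | inr b, inl a => (a == v) && (b == w)
             end.
Lemma attach_edge_sym : symmetric attach_edge.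
Proof. by move=> [x|x] [y|y] //=; apply: edge_sym. Qed.
Lemma attach_edge_irrefl : irreflexive attach_edge.
Proof. by move=> [x|x] /=; apply: edge_irrefl. Qed.
Definition attach : sgraph := SGraph attach_edge_sym attach_edge_irrefl.
End Attach.

(* The concrete graphs produced by the operations; membership in the family
   up to isomorphism is [bad]. *)
Inductive bad_built : sgraph -> Prop :=
| bad_B1 (w : Kmn 2 3) : deg w = 2 -> bad_built (attach (tt : K1) w)
| bad_O1 (G : sgraph) (v : G) (w : Kmn 2 3) :
    bad_built G -> deg v <= 2 -> deg w = 2 -> bad_built (attach v w).

Definition bad (G : sgraph) : Prop :=
  exists H : sgraph, bad_built H /\ isomorphic G H.

Definition on_cycle (G : sgraph) (v : G) : Prop :=
  exists c : seq G, [/\ 2 < size c, ucycle edge c & v \in c].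

Definition is_root (G : sgraph) (r : G) : Prop :=
  unique (fun v : G => ~ on_cycle v) r.

Definition bad_components (G : sgraph) : nat :=
  #|[set C in components G | `[< bad (induced C) >]]|.

(* B together with a new vertex None (the vertex v_2) adjacent to exactly v1
   and w2. *)
Section TroubleGraph.
Variables (B : sgraph) (v1 w2 : B).
Definition trouble_edge : rel (option B) :=
  fun x y => match x, y with
             | Some a, Some b => edge a b
             | None, Some a | Some a, None => (a == v1) || (a == w2)
             | None, None => false
             end.
Lemma trouble_edge_sym : symmetric trouble_edge.
Proof. by move=> [x|] [y|] //=; apply: edge_sym. Qed.
Lemma trouble_edge_irrefl : irreflexive trouble_edge.
Proof. by move=> [x|] //=; apply: edge_irrefl. Qed.
Definition trouble_graph : sgraph :=
  SGraph trouble_edge_sym trouble_edge_irrefl.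
End TroubleGraph.

(* S is the vertex set of a troublesome configuration of G. The configuration
   T is a not necessarily induced subgraph, given as the image of an injective
   homomorphism f from its isomorphism type. *)
Definition troublesome (G : sgraph) (S : {set G}) : Prop :=
  exists (B : sgraph) (v1 w2 : B) (f : trouble_graph v1 w2 -> G),
    [/\ bad B, is_root v1, deg v1 = 1, w2 != v1 & deg w2 = 2] /\
    [/\ injective f,
        forall x y, edge x y -> edge (f x) (f y)
      & S = [set f x | x : trouble_graph v1 w2]] /\
    [/\ forall b : B, b != v1 ->
          deg (f (Some b)) = deg (Some b : trouble_graph v1 w2),
        #|nbrs (f None) :\: S| = 1
      & #|nbrs (f (Some v1)) :\: S| <= 1].

(* Configurations are nonempty, so pairwise vertex-disjoint ones are counted by
   their vertex sets. *)
Definition tc (G : sgraph) : nat :=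
  \max_(P : {set {set G}} | trivIset P && [forall S in P, `[< troublesome S >]])
    #|P|.

(* Main.v *)
(* Every vertex x gets the weight 6 - deg x, and [sig] is the largest number of
   disjoint sets that are isolated vertices, bad components or troublesome
   configurations; the claim becomes 8 i(G) <= wt + 2 sig, as an isolated vertex
   has total weight 6 + 2.  In a minimal counterexample, deleting the closed
   neighbourhood of an independent set I must lose less than 8 |I|.  A local
   configuration is recorded as a finite [state], and a certificate for it is a
   tree of case distinctions on the unknown neighbours, ending in an independent
   set whose removal loses too much or in a configuration already excluded.
   Such certificates exclude in turn the ways two copies of K_{2,3} can lie close
   together, vertices of degree 1, K_{2,3} itself, vertices of degree 2, and the
   cycles of lengths 3 to 7; the excluded components K_{3,3} and the 5-prism are
   exactly the cases without a reduction.  The remaining graph is cubic of girth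
   at least 8, where every third vertex of a shortest cycle, suitably corrected
   modulo 3 by vertices outside the cycle, gives the last reduction. *)

Require Import Defs.
From mathcomp Require Import all_boot boolp zify.

Set Implicit Arguments.
Unset Strict Implicit.
Unset Printing Implicit Defensive.

(** Deleting [X] changes [wt] exactly: it loses 6 - deg x for each x in [X] and regains 1 for each
    edge leaving [X]. The difficulty is therefore [sig] of what remains, since every isolated
    vertex, bad component or troublesome configuration created by the deletion costs 2. A minimal
    counterexample has none of these itself ([no_bt]), so each new one leaves a trace next to the
    deleted set: a vertex that becomes isolated, or a K_{2,3} one of whose ports loses its third
    neighbour. The second trace presupposes that this third neighbour exists, which is why [reduced]
    precedes the large certificates. It cannot be had by deletion alone: a K_{2,3} with two exits is
    replaced by an edge, and that edge might create a K_{3,3} or a 5-prism, so the excluded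
    components have to be controlled inside the induction. From then on each excluded configuration
    improves the estimate [bnd] of [sig], and the better estimate makes further certificates
    possible; this dictates the order of the stages. *)

(** * Graphs on a fixed carrier: weights, deletion, trees of K_{2,3}, packings *)

Record gr (T : finType) := Gr {
  V : {set T};
  E : rel T;
  E_sym : symmetric E;
  E_irr : irreflexive E;
  E_V : forall x y, E x y -> x \in V }.

Section Graphs.
Variable T : finType.
Implicit Types (g : gr T) (B C S X : {set T}) (r v w x y : T).

Lemma E_Vr g x y : E g x y -> y \in V g.
Proof. by rewrite E_sym => /E_V. Qed.

Lemma E_neq g x y : E g x y -> x != y.
Proof. by apply: contraTneq => ->; rewrite E_irr. Qed.

Definition nb g x := [set y | E g x y].
Definition sub3 g := forall x, #|nb g x| <= 3.

Lemma in_nb g x y : (y \in nb g x) = E g x y.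
Proof. by rewrite inE. Qed.

Lemma nb_sym g x y : (y \in nb g x) = (x \in nb g y).
Proof. by rewrite !inE E_sym. Qed.

Definition wt g := \sum_(x in V g) (6 - #|nb g x|).

Definition ids g S :=
  [/\ S \subset V g, forall x y, x \in S -> y \in S -> ~~ E g x y
    & forall x, x \in V g -> x \notin S -> exists2 y, y \in S & E g x y].

Section Del.
Variables (g : gr T) (X : {set T}).
(** Deletion keeps the carrier [T] and only shrinks [V], so all graphs of the induction live on one
    type and their vertex sets can be compared directly. *)
Definition del_edge : rel T := fun x y => [&& E g x y, x \notin X & y \notin X].
Lemma del_sym : symmetric del_edge.
Proof. by move=> x y; rewrite /del_edge E_sym; case: (E g y x) => //=; rewrite andbC. Qed.
Lemma del_irr : irreflexive del_edge.
Proof. by move=> x; rewrite /del_edge E_irr. Qed.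
Lemma del_V x y : del_edge x y -> x \in V g :\: X.
Proof. by case/and3P=> /E_V xV xX _; rewrite inE xX. Qed.
Definition del := Gr del_sym del_irr del_V.
End Del.

Section Add.
Variables (g : gr T) (p q : T).
(** The guard makes this total: if [p = q] or an end lies outside [V g], nothing is added. *)
Definition add_edge : rel T := fun x y =>
  E g x y || [&& p != q, p \in V g, q \in V g
                & (x == p) && (y == q) || (x == q) && (y == p)].
Lemma add_sym : symmetric add_edge.
Proof. by move=> x y; rewrite /add_edge E_sym [X in _ || [&& _, _, _ & X]]orbC ![(_ == p) && _]andbC. Qed.
Lemma add_irr : irreflexive add_edge.
Proof.
move=> x; rewrite /add_edge E_irr /=; apply/negbTE/negP => /and4P[pq _ _].
by case/orP=> /andP[/eqP -> /eqP eqpq]; rewrite eqpq eqxx in pq.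
Qed.
Lemma add_V x y : add_edge x y -> x \in V g.
Proof.
by case/orP=> [/E_V //|/and4P[_ pV qV /orP[] /andP[/eqP -> _]]].
Qed.
Definition add := Gr add_sym add_irr add_V.
End Add.

Lemma nb_del g X x : nb (del g X) x = if x \in X then set0 else nb g x :\: X.
Proof.
apply/setP=> y; rewrite inE /= /del_edge; case: ifP => xX /=.
  by rewrite inE andbF.
by rewrite !inE /= andbC.
Qed.

Lemma sub3_del g X : sub3 g -> sub3 (del g X).
Proof.
move=> g3 x; rewrite nb_del; case: ifP => _; first by rewrite cards0.
exact: leq_trans (subset_leq_card (subsetDl _ _)) (g3 x).
Qed.

(** Both sums count the edges between [X] and its complement. *)
Lemma sum_cross g X : \sum_(x in ~: X) #|nb g x :&: X| = \sum_(x in X) #|nb g x :\: X|.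
Proof.
have sE x (Y : {set T}) : \sum_(y in Y) (E g x y : nat) = #|nb g x :&: Y|.
  rewrite -sum1_card big_mkcond [RHS]big_mkcond; apply: eq_bigr => y _.
  by rewrite !inE andbC; case: (y \in Y); case: (E g x y).
transitivity (\sum_(x in ~: X) \sum_(y in X) (E g x y : nat)).
  by apply: eq_bigr => x _; rewrite sE.
rewrite exchange_big /=; apply: eq_bigr => y _; rewrite setDE -sE.
by apply: eq_bigr => x _; rewrite E_sym.
Qed.

(** A surviving vertex gains 1 for each neighbour it loses, so the survivors gain the number of
    edges leaving [X]. The degree bound keeps the truncated subtraction exact. *)
Lemma wt_del g X : sub3 g -> X \subset V g ->
  wt (del g X) + \sum_(x in X) (6 - #|nb g x|)
  = wt g + \sum_(x in X) #|nb g x :\: X|.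
Proof.
move=> g3 XV; rewrite -sum_cross.
have -> : wt g = \sum_(x in V g :\: X) (6 - #|nb g x|) + \sum_(x in X) (6 - #|nb g x|).
  rewrite /wt (big_setID X) /= addnC; congr (_ + _).
  by apply: eq_bigl => x; move/setIidPr: XV => ->.
rewrite addnAC; congr (_ + _).
have -> : \sum_(x in ~: X) #|nb g x :&: X| = \sum_(x in V g :\: X) #|nb g x :&: X|.
  rewrite [LHS](big_setID (V g)) /= [X in _ + X]big1 ?addn0; last first.
    move=> x; rewrite !inE => /andP[xV _]; apply/eqP; rewrite cards_eq0 -subset0.
    by apply/subsetP=> y; rewrite !inE => /andP[/E_V]; rewrite (negbTE xV).
  by apply: eq_bigl => x; rewrite !inE andbC.
rewrite -big_split; apply: eq_bigr => x; rewrite inE => /andP[xX _] /=.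
rewrite nb_del (negbTE xX); have := cardsID X (nb g x); have := g3 x; lia.
Qed.

Definition clnb g X := X :|: \bigcup_(x in X) nb g x.

Lemma in_clnb g X y : reflect (y \in X \/ exists2 x, x \in X & E g x y) (y \in clnb g X).
Proof.
rewrite inE; apply: (iffP orP) => -[yX|]; [by left| |by left|].
  by case/bigcupP=> x xX; rewrite inE => xy; right; exists x.
by case=> x xX xy; right; apply/bigcupP; exists x => //; rewrite inE.
Qed.

Lemma ids_clnb g S S' : S \subset V g -> (forall x y, x \in S -> y \in S -> ~~ E g x y) ->
  ids (del g (clnb g S)) S' -> ids g (S' :|: S).
Proof.
move=> SV Si [S'V S'i S'd]; have S'N x : x \in S' -> x \notin clnb g S.
  by move/(subsetP S'V); rewrite inE => /andP[].
split.
- by apply/subUsetP; split=> //; apply: subset_trans S'V (subsetDl _ _).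
- move=> x y; rewrite !inE => /orP[xS'|xS] /orP[yS'|yS]; last exact: Si.
  + by have := S'i _ _ xS' yS'; rewrite /= /del_edge !S'N // !andbT.
  + apply/negP=> xy; case/negP: (S'N _ xS'); apply/in_clnb; right.
    by exists y; rewrite // E_sym.
  + by apply/negP=> xy; case/negP: (S'N _ yS'); apply/in_clnb; right; exists x.
- move=> x xV; rewrite inE negb_or => /andP[xS' xS].
  have [/in_clnb[xS2|[y yS yx]]|xN] := boolP (x \in clnb g S).
  + by rewrite xS2 in xS.
  + by exists y; rewrite ?inE ?yS ?orbT // E_sym.
  + have [|y yS' /and3P[xy _ _]] := S'd x _ xS'; first by rewrite inE xN.
    by exists y; rewrite // inE yS'.
Qed.

Definition uset (a b x y z : T) : {set T} := [set u in [:: a; b; x; y; z]].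
(** The subgraph need not be induced. The first two vertices, of degree 3 in it, are called sides,
    the other three ports; the five together form a unit. *)
Definition K23 g a b x y z :=
  [&& uniq [:: a; b; x; y; z], E g a x, E g a y, E g a z, E g b x, E g b y & E g b z].

(** The bad family inside [g]: root [r], vertex set [C], and the vertex sets [us] of the units, the
    one attached last in front. A lone root is allowed, so isolated vertices are covered. It
    suffices to forbid the edge [y z]: the vertices [a], [b], [x] already have three neighbours
    each, so under the degree bound the unit is induced. *)
Inductive utree g r : {set T} -> seq {set T} -> Prop :=
| ut0 : r \in V g -> utree g r [set r] [::]
| utS C us v a b x y z : utree g r C us -> v \in C -> K23 g a b x y z ->
    ~~ E g y z -> [disjoint C & uset a b x y z] -> E g v x ->
    (forall c u, c \in C -> u \in uset a b x y z -> E g c u -> c = v /\ u = x) ->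
    utree g r (C :|: uset a b x y z) (uset a b x y z :: us).

(** A component that is an isolated vertex or a bad graph. *)
Definition bt1 g B := exists r us, utree g r B us /\
  (forall c u, c \in B -> E g c u -> u \in B).

(** A troublesome configuration: [C] is the vertex set of the bad graph and [v1] its root. The
    requirement on [v2] is the degree 3; the one on the outside neighbours of [v1] is derived in
    [bt2_troublesome]. *)
Definition bt2 g B := exists v1 v2 w2 C us,
  [/\ utree g v1 C us, v2 \notin C, E g v1 v2 & E g v2 w2] /\
  [/\ w2 \in C, w2 != v1, #|nb g w2 :&: C| = 2, #|nb g v1 :&: C| = 1 & B = v2 |: C] /\
  [/\ forall c, c \in C -> c != v1 -> nb g c \subset B,
      nb g v2 :&: C = [set v1; w2] & #|nb g v2| = 3].

Definition bt g B := bt1 g B \/ bt2 g B.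

Definition pack g (P : {set {set T}}) := trivIset P /\ forall B, B \in P -> bt g B.
Definition sig g := \max_(P : {set {set T}} | `[< pack g P >]) #|P|.

Lemma sig_ge g P : pack g P -> #|P| <= sig g.
Proof. by move=> gP; apply: (leq_bigmax_cond P); apply/asboolP. Qed.

Lemma sig_wit g : exists2 P, pack g P & #|P| = sig g.
Proof.
have P0 : `[< pack g set0 >].
  by apply/asboolP; split=> [|B]; rewrite ?inE //; apply/trivIsetP=> A B; rewrite inE.
have [|P /asboolP gP sP] := @eq_bigmax_cond _ [pred P | `[< pack g P >]] (fun P : {set {set T}} => #|P|).
  by apply/card_gt0P; exists set0.
by exists P => //; rewrite -sP.
Qed.

Definition Q g := exists2 S, ids g S & 8 * #|S| <= wt g + 2 * sig g.

Lemma Q_lift g g' k : (forall S', ids g' S' -> exists2 S, ids g S & #|S| <= #|S'| + k) ->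
  8 * k + wt g' + 2 * sig g' <= wt g + 2 * sig g -> Q g' -> Q g.
Proof. by move=> lft le [S' /lft[S gS cS] cS']; exists S => //; lia. Qed.

(** The members of a packing are disjoint and share the total weight. The estimates of [sig] below
    differ in the choice of [om]. *)
Lemma sig_weight g m (om : T -> nat) : (forall B, bt g B -> m <= \sum_(h in B) om h) ->
  m * sig g <= \sum_h om h.
Proof.
move=> mB; have [P [tP bP] <-] := sig_wit g.
have le1 : \sum_(x in cover P) om x <= \sum_h om h.
  by rewrite [X in _ <= X](bigID [in cover P]) leq_addr.
apply: leq_trans le1; rewrite big_trivIset // mulnC -sum_nat_const; apply: leq_sum => B BP.
by apply: mB; apply: bP.
Qed.

End Graphs.

(** * States, case distinctions and certificates *)

(** Entry [i] holds the known neighbours of vertex [i] and a flag saying that there are no others.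
    Vertices not listed as neighbours may still be adjacent unless one of them is closed. *)
Definition state := seq (bool * seq nat).
Definition nbi (s : state) i := (nth (false, [::]) s i).2.
Definition fli (s : state) i := (nth (false, [::]) s i).1.
(** Three known neighbours also close a vertex, by the degree bound. *)
Definition cli s i := fli s i || (size (nbi s i) == 3).

(** The completion in which the unknown neighbours of [v] are the old vertices [ws] and [m] new
    ones. *)
Definition ext (s : state) v ws m : state :=
  mkseq (fun i => if i == v then (true, nbi s v ++ ws ++ iota (size s) m)
                  else if i < size s then (fli s i, nbi s i ++ (if i \in ws then [:: v] else [::]))
                  else (false, [:: v])) (size s + m).

Fixpoint subs2 (c : seq nat) : seq (seq nat) :=
  if c is a :: c' then [seq [:: a; b] | b <- c'] ++ subs2 c' else [::].
(** Sublists of length at most 2 suffice, because an expanded vertex already has a known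
    neighbour. *)
Definition subs c := [::] :: [seq [:: a] | a <- c] ++ subs2 c.

Definition cands (s : state) v :=
  [seq w <- iota 0 (size s) | [&& w != v, ~~ cli s w & w \notin nbi s v]].

(** [md] is a lower bound for all degrees; completions giving [v] a smaller degree are
    impossible. *)
Definition children md (s : state) v : seq state :=
  flatten [seq flatten [seq (let k := size ws + m in
      if (size (nbi s v) + k <= 3) && (md <= size (nbi s v) + k) then [:: ext s v ws m] else [::])
    | m <- [:: 0; 1; 2]] | ws <- subs (cands s v)].

(** [HI J] deletes the closed neighbourhood of the independent set [J]. [HP k m] finds the excluded
    configuration number [k] at the vertices [m]. [HF] deletes a six-vertex gadget whose two new
    dominating vertices are chosen only after the rest is dominated ([flex_lift]). *)
Inductive hint := HI of seq nat | HP of nat & seq nat | HF of seq nat.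
(** A node expands one vertex, tries its hints on every completion, and has one subtree for each
    completion that no hint settles. *)
Inductive tree := N of nat & seq hint & seq tree.

Definition ycnt (s : state) (Y : seq nat) w := count (mem Y) (nbi s w).
(** A lower bound for the weight of [Y] minus the number of edges leaving [Y]. A closed vertex
    contributes its exact share; an open one contributes 6 - 2 deg plus its neighbours in [Y], which
    is at least its known neighbours in [Y] since deg <= 3. *)
Definition gain (s : state) Y :=
  sumn [seq (if cli s y then 6 + ycnt s Y y - 2 * size (nbi s y) else ycnt s Y y) | y <- Y].
Definition nopen (s : state) Y := count (fun i => ~~ cli s i) Y.

(** Whether [w] can become isolated when [Y] is deleted. The unlisted neighbours of such a vertex
    are among the [o] open vertices of [Y], which limits its degree. *)
Definition iso md o (s : state) (Y : seq nat) w :=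
  [&& w \notin Y, all (mem Y) (nbi s w), nbi s w != [::] & cli s w || (md <= size (nbi s w) + o)].
Definition outs (s : state) (Y : seq nat) w := [seq a <- nbi s w | a \notin Y].
(** One direction of the test whether [a] and [b] can have equal neighbourhoods: each known
    neighbour of [a] must be, or must still be able to become, a neighbour of [b]. *)
Definition half (s : state) w a b :=
  all (fun c => [|| c == w, c \in nbi s b | ~~ cli s b && ~~ cli s c]) (nbi s a).
(** A necessary condition for [w] to be a port of a unit avoiding [Y] whose third neighbour lies in
    [Y]: the neighbours of [w] outside [Y] are the two sides, which have degree 3, no neighbour in
    [Y] and equal neighbourhoods. *)
Definition hitp (s : state) Y w :=
  [&& w \notin Y, ycnt s Y w == 1,
      all (fun a => (ycnt s Y a == 0) && (~~ cli s a || (size (nbi s a) == 3))) (outs s Y w)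
    & ~~ cli s w || (if outs s Y w is [:: a; b] then
        [&& b \notin nbi s a, half s w a b, half s w b a & size (undup (nbi s a ++ nbi s b)) <= 3]
      else false)].
(** The vertices [a] and [b] are then sides with equal neighbourhoods, so [w] is certainly a
    port. *)
Definition kport (s : state) w :=
  has (fun a => (size (nbi s a) == 3) &&
    has (fun b => [&& a != b, size (nbi s b) == 3 & all (mem (nbi s b)) (nbi s a)]) (nbi s w))
    (nbi s w).
Definition hits (s : state) Y := [seq w <- iota 0 (size s) | hitp s Y w].
(** Closed hits with the same neighbours outside [Y] are ports of one unit; the earliest of them
    represents it. *)
Definition fhits (s : state) Y := [seq w <- hits s Y | ~~ (cli s w && has (fun w' =>
  [&& w' < w, cli s w' & all (mem (outs s Y w')) (outs s Y w)]) (hits s Y))].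
Definition hityv (s : state) (Y : seq nat) :=
  undup (flatten [seq [seq a <- nbi s w | a \in Y] | w <- hits s Y]).
(** A necessary condition for [w] to be the root of a tree with a single unit, as found in
    [bt_root]: two neighbours of [w] are deleted, and the two free ports of the unit lose different
    vertices not adjacent to [w]. *)
Definition root1 (s : state) Y w :=
  [&& w \notin Y, ~~ kport s w, ycnt s Y w == 2
    & 2 <= count (fun e => e \notin nbi s w) (hityv s Y)].

(** Upper bounds for [sig] after the deletion of [Y], one for each state of knowledge. Apart from
    isolated vertices, every member must contain: at level 0 a vertex next to [Y], at 1 a hit, at 2
    two hits, at 3 two hits with different deleted neighbours, at 4 four hits or a root, at 5 a
    root. At level 6 only isolated vertices count. The proofs are [bnd_sound0] to [bnd_sound6]. *)
Definition bnd lv md (s : state) Y :=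
  let ni := count (iso md (nopen s Y) s Y) (iota 0 (size s)) in
  let nh := size (hits s Y) in
  match lv with
  | 0 => count (fun w => (w \notin Y) && (0 < ycnt s Y w)) (iota 0 (size s))
  | 1 => ni + size (fhits s Y)
  | 2 => ni + nh./2
  | 3 => ni + (if size (hityv s Y) <= 1 then 0 else nh./2)
  | 4 => ni + minn nh./2 (count (root1 s Y) (iota 0 (size s)) + nh %/ 4)
  | 5 => ni + minn nh./2 (count (root1 s Y) (iota 0 (size s)))
  | _ => ni
  end.

(** Below level 6 all of [Y] must be closed, so that every edge leaving [Y] is listed. At level 6
    fewer than [md] open vertices are harmless, as a vertex that becomes isolated still has a closed
    neighbour in [Y]. *)
Definition okY lv md (s : state) Y k :=
  [&& all (fun i => i < size s) Y, nopen s Y < md, (5 < lv) || (nopen s Y == 0)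
    & 8 * k + 2 * bnd lv md s Y <= gain s Y].

Definition clos (s : state) I := undup (I ++ flatten [seq nbi s i | i <- I]).

Definition wfs (d : state) := all (fun i => uniq (nbi d i) &&
  all (fun j => (j < size d) && (i \in nbi d j)) (nbi d i)) (iota 0 (size d)).

(** An embedding as a subgraph; only flagged vertices of [d] must keep their degree. *)
Definition embeds (d s : state) m :=
  [&& wfs d, size m == size d, uniq m, all (fun i => i < size s) m &
   all (fun i => all (fun j => nth 0 m j \in nbi s (nth 0 m i)) (nbi d i)
     && (fli d i ==> cli s (nth 0 m i) && (size (nbi s (nth 0 m i)) == size (nbi d i))))
     (iota 0 (size d))].

Definition leaf lv md (D : seq state) (s : state) h :=
  match h with
  | HI J => [&& J != [::], all (fun i => (i < size s) && cli s i) J, uniq J,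
      all (fun i => all (fun j => j \notin J) (nbi s i)) J & okY lv md s (clos s J) (size J)]
  | HP k m => (k < size D) && embeds (nth [::] D k) s m
  | HF Y => if Y is [:: a; b; x; y; z; p] then
      [&& uniq Y, all (cli s) Y,
        perm_eq (nbi s a) [:: x; y; z], perm_eq (nbi s b) [:: x; y; z],
        perm_eq (nbi s x) [:: a; b; p], perm_eq (nbi s y) [:: a; b; p], p \notin nbi s z
        & okY lv md s Y 2]
    else false
  end.

Fixpoint chk lv md D t (s : state) : bool :=
  let: N v hs ts := t in
  [&& v < size s, ~~ cli s v, nbi s v != [::] &
   (fix chks (ts : seq tree) (cs : seq state) := match ts, cs with
    | [::], [::] => true
    | t' :: ts', c :: cs' => chk lv md D t' c && chks ts' cs'
    | _, _ => false end) ts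
   [seq c <- children md s v | ~~ has (leaf lv md D c) hs]].

(** * Realizations of states in a graph *)

Section Models.
Variables (T : finType) (x0 : T) (g : gr T).
Hypothesis g3 : sub3 g.
Implicit Types (s : state) (vs : seq T).

(** Only flagged vertices are denied further neighbours, so a state stands for all graphs containing
    the configuration, not only as an induced subgraph. *)
Definition models s vs :=
  [/\ size vs = size s, uniq vs, {subset vs <= V g},
   forall i, i < size s -> uniq (nbi s i) /\ (forall j, j \in nbi s i ->
      [/\ j < size s, i \in nbi s j & E g (nth x0 vs i) (nth x0 vs j)])
 & forall i, i < size s -> fli s i -> forall u, E g (nth x0 vs i) u ->
      exists2 j, j \in nbi s i & u = nth x0 vs j].

Definition dead s := forall vs, ~ models s vs.
Definition im vs (Y : seq nat) : {set T} := [set x in [seq nth x0 vs i | i <- Y]].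

Section OneModel.
Variables (s : state) (vs : seq T).
Hypothesis ms : models s vs.
Let v i := nth x0 vs i.

Lemma m_inj i j : i < size s -> j < size s -> v i = v j -> i = j.
Proof. by case: ms => sz u _ _ _ ilt jlt /eqP; rewrite nth_uniq ?sz // => /eqP. Qed.
Lemma m_V i : i < size s -> v i \in V g.
Proof. by case: ms => sz _ sV _ _ ilt; apply: sV; rewrite mem_nth ?sz. Qed.
Lemma m_uniq i : i < size s -> uniq (nbi s i).
Proof. by case: ms => _ _ _ h _ /h[]. Qed.
Lemma m_lt i j : i < size s -> j \in nbi s i -> j < size s.
Proof. by case: ms => _ _ _ h _ /h[_] hh /hh[]. Qed.
Lemma m_sym i j : i < size s -> j \in nbi s i -> i \in nbi s j.
Proof. by case: ms => _ _ _ h _ /h[_] hh /hh[]. Qed.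
Lemma m_E i j : i < size s -> j \in nbi s i -> E g (v i) (v j).
Proof. by case: ms => _ _ _ h _ /h[_] hh /hh[]. Qed.

Lemma inj_map_v (Y : seq nat) : uniq Y -> (forall i, i \in Y -> i < size s) -> uniq [seq v i | i <- Y].
Proof.
by move=> uY Ylt; rewrite map_inj_in_uniq // => i j iY jY; apply: m_inj; apply: Ylt.
Qed.

Lemma im_sub_nb i : i < size s -> im vs (nbi s i) \subset nb g (v i).
Proof.
move=> ilt; apply/subsetP=> x; rewrite inE => /mapP[j ji ->]; rewrite in_nb.
exact: m_E.
Qed.

Lemma card_im (Y : seq nat) : uniq Y -> (forall i, i \in Y -> i < size s) -> #|im vs Y| = size Y.
Proof. by move=> uY Ylt; rewrite cardsE (card_uniqP _) ?size_map // inj_map_v. Qed.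

Lemma m_cl i : i < size s -> cli s i -> nb g (v i) = im vs (nbi s i).
Proof.
move=> ilt /orP[fi|/eqP s3].
  apply/eqP; rewrite eqEsubset im_sub_nb // andbT; apply/subsetP=> u; rewrite in_nb => iu.
  case: ms => _ _ _ _ /(_ i ilt fi u iu)[j ji ->]; rewrite inE; apply/mapP.
  by exists j.
apply/eqP; rewrite eq_sym eqEcard im_sub_nb // card_im ?m_uniq ?s3 ?g3 //.
by move=> j; apply: m_lt.
Qed.

Lemma m_clE i u : i < size s -> cli s i -> E g (v i) u -> exists2 j, j \in nbi s i & u = v j.
Proof.
move=> ilt ci; rewrite -in_nb m_cl // inE => /mapP[j ji ->]; by exists j.
Qed.

Lemma m_clEi i j : i < size s -> j < size s -> cli s i -> E g (v i) (v j) -> j \in nbi s i.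
Proof.
move=> ilt jlt ci /(m_clE ilt ci)[k ki /m_inj -> //]; exact: m_lt ki.
Qed.

Lemma m_deg i : i < size s -> cli s i -> #|nb g (v i)| = size (nbi s i).
Proof. by move=> ilt ci; rewrite m_cl // card_im ?m_uniq // => j; apply: m_lt. Qed.

Lemma m_deg_ge i : i < size s -> size (nbi s i) <= #|nb g (v i)|.
Proof.
move=> ilt; rewrite -(card_im (m_uniq ilt)); last by move=> j; apply: m_lt.
by rewrite subset_leq_card // im_sub_nb.
Qed.

Lemma mem_im i (Y : seq nat) : i < size s -> (forall i, i \in Y -> i < size s) -> (v i \in im vs Y) = (i \in Y).
Proof.
move=> ilt Ylt; rewrite inE; apply/mapP/idP=> [[j jY /m_inj -> //]|iY]; last by exists i.
exact: Ylt.
Qed.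

Lemma card_nb_im i (Y : seq nat) : i < size s -> (forall i, i \in Y -> i < size s) ->
  ycnt s Y i <= #|nb g (v i) :&: im vs Y| /\
  (cli s i -> #|nb g (v i) :&: im vs Y| = ycnt s Y i).
Proof.
move=> ilt Ylt.
have sz : #|im vs [seq j <- nbi s i | j \in Y]| = ycnt s Y i.
  rewrite card_im ?filter_uniq ?m_uniq // ?size_filter //.
  by move=> j; rewrite mem_filter => /andP[jY _]; apply: Ylt.
split=> [|ci]; rewrite -sz.
  apply: subset_leq_card; apply/subsetP=> x; rewrite inE => /mapP[j].
  rewrite mem_filter => /andP[jY ji] ->; rewrite !inE -/(v i) m_E //=.
  by apply/mapP; exists j.
congr #|pred_of_set _|; apply/setP=> x; rewrite m_cl // !inE.
apply/andP/mapP=> [[/mapP[j ji ->]]|[j]].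
  have jlt := m_lt ilt ji; move=> vY; exists j => //.
  by rewrite mem_filter ji andbT; move: (mem_im jlt Ylt); rewrite inE vY.
by rewrite mem_filter => /andP[jY ji] ->; split; apply/mapP; exists j.
Qed.

Lemma gain_ok (Y : seq nat) : uniq Y -> (forall i, i \in Y -> i < size s) ->
  gain s Y + \sum_(x in im vs Y) #|nb g x :\: im vs Y| <= \sum_(x in im vs Y) (6 - #|nb g x|).
Proof.
move=> uY Ylt.
have sumE F : \sum_(x in im vs Y) F x = \sum_(i <- Y) F (v i).
  rewrite -(big_map v xpredT F) [RHS]big_uniq ?inj_map_v //=.
  by apply: eq_bigl => x; rewrite inE.
rewrite !sumE /gain sumnE big_map -big_split /=; rewrite big_seq [X in _ <= X]big_seq.
apply: leq_sum => i iY; have ilt := Ylt i iY.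
have [c1 c2] := card_nb_im ilt Ylt; have := cardsID (im vs Y) (nb g (v i)).
have := g3 (v i); case: ifP => ci; last by lia.
by rewrite c2 // m_deg //; lia.
Qed.

Lemma clos_clnb I : all (fun i => (i < size s) && cli s i) I -> im vs (clos s I) = clnb g (im vs I).
Proof.
move=> /allP Iok; apply/setP=> x; apply/idP/in_clnb.
  rewrite inE => /mapP[j]; rewrite mem_undup mem_cat => /orP[jI|/flattenP[l /mapP[i iI ->] ji]] ->.
    by left; rewrite inE; apply/mapP; exists j.
  have /andP[ilt _] := Iok i iI; right; exists (v i); last exact: m_E.
  by rewrite inE; apply/mapP; exists i.
case=> [|[y]]; rewrite inE => /mapP[i iI].
  by move=> ->; rewrite inE; apply/mapP; exists i; rewrite // mem_undup mem_cat iI.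
have /andP[ilt ci] := Iok i iI; move=> -> /(m_clE ilt ci)[j ji ->].
rewrite inE; apply/mapP; exists j => //; rewrite mem_undup mem_cat; apply/orP; right.
by apply/flattenP; exists (nbi s i) => //; apply/mapP; exists i.
Qed.

Lemma embeds_models d m : embeds d s m -> models d [seq v i | i <- m].
Proof.
case: (ms) => sz us sV mE mc; case/and5P=> /allP wd /eqP sm um /allP mlt /allP md.
have nlt i : i < size d -> nth 0 m i < size s.
  by move=> ilt; apply: mlt; rewrite mem_nth ?sm.
have nm i : i < size d -> nth x0 [seq v i | i <- m] i = v (nth 0 m i).
  by move=> ilt; rewrite (nth_map 0) ?sm.
have dlt i : i < size d -> i \in iota 0 (size d) by rewrite mem_iota.
split=> [|||i ilt|i ilt fi u].
- by rewrite size_map.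
- exact: inj_map_v.
- by move=> x /mapP[i im ->]; apply: m_V; apply: mlt.
- have /andP[ui /allP wi] := wd i (dlt i ilt); have /andP[/allP ei _] := md i (dlt i ilt).
  split=> // j ji; have /andP[jlt ij] := wi j ji; split=> //.
  by rewrite !nm //; apply: m_E; rewrite ?nlt //; apply: ei.
have /andP[/allP ei] := md i (dlt i ilt); rewrite fi /= => /andP[ci /eqP si].
have /andP[ui /allP wi] := wd i (dlt i ilt).
rewrite nm // => /(m_clE (nlt i ilt) ci)[j ji ->].
have sub : {subset [seq nth 0 m k | k <- nbi d i] <= nbi s (nth 0 m i)}.
  by move=> k /mapP[k' k'i ->]; apply: ei.
have um' : uniq [seq nth 0 m k | k <- nbi d i].
  rewrite map_inj_in_uniq // => k k' /wi/andP[klt _] /wi/andP[k'lt _] /eqP.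
  by rewrite nth_uniq ?sm // => /eqP.
(* There are as many images as known neighbours, so every neighbour is an image. *)
have [|_ eqm] := uniq_min_size um' sub; first by rewrite size_map si.
move: ji; rewrite -eqm => /mapP[k ki ->]; exists k => //.
by have /andP[klt _] := wi k ki; rewrite nm.
Qed.
End OneModel.

Lemma subs2_filter (p : pred nat) c : size (filter p c) = 2 -> filter p c \in subs2 c.
Proof.
elim: c => //= a c IH; case: ifP => pa /=; last first.
  by move/IH; rewrite mem_cat => ->; rewrite orbT.
case=> s1; rewrite mem_cat; apply/orP; left.
case fE: (filter p c) s1 => [//|b [|//]] _; apply/mapP; exists b => //.
by have := mem_filter p b c; rewrite fE mem_head => /esym/andP[].
Qed.

Lemma subs_filter (p : pred nat) c : size (filter p c) <= 2 -> filter p c \in subs c.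
Proof.
case s2: (size (filter p c)) => [|[|[|//]]] _; rewrite inE.
- by move/size0nil: s2 => ->.
- apply/orP; right; rewrite mem_cat; apply/orP; left.
  case fE: (filter p c) s2 => [//|b [|//]] _; apply/mapP; exists b => //.
  by have := mem_filter p b c; rewrite fE mem_head => /esym/andP[].
- by rewrite mem_cat subs2_filter // !orbT.
Qed.

(** Exhaustiveness of the case distinction: the unknown neighbours of [v] split into listed vertices
    [ws] and vertices outside [vs], and the latter are appended to [vs]. *)
Lemma expand_models md s vs v : models s vs -> v < size s -> ~~ cli s v -> nbi s v != [::] ->
  (forall x, x \in V g -> md <= #|nb g x|) ->
  exists c vs', c \in children md s v /\ models c vs'.
Proof.
move=> ms vlt; rewrite negb_or => /andP[nfv n3] nb0 mdg.
have [sz us sV mE mc] := ms.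
pose n := size s; pose f i := nth x0 vs i.
pose ws := [seq w <- cands s v | E g (f v) (f w)].
pose nws := [seq u <- enum (nb g (f v)) | u \notin vs].
have wsP w : (w \in ws) = [&& w < n, w != v, ~~ cli s w, w \notin nbi s v & E g (f v) (f w)].
  rewrite mem_filter [w \in cands _ _]mem_filter mem_iota /= add0n.
  by case: (E g _ _) => /=; rewrite ?andbT ?andbF // -!andbA; do 4!bool_congr.
have nwsP u : (u \in nws) = (u \notin vs) && E g (f v) u by rewrite mem_filter mem_enum in_nb.
have unws : uniq nws by rewrite filter_uniq ?enum_uniq.
have uws : uniq ws by rewrite !filter_uniq ?iota_uniq.
pose fu := [seq f i | i <- nbi s v ++ ws] ++ nws.
have fuP u : (u \in fu) = E g (f v) u.
  rewrite mem_cat; apply/orP/idP=> [[/mapP[i]|]|vu].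
  - rewrite mem_cat => /orP[iv|iw] ->; first exact: (m_E ms).
    by move: iw; rewrite wsP => /and5P[].
  - by rewrite nwsP => /andP[].
  - have [uvs|uvs] := boolP (u \in vs); last by right; rewrite nwsP uvs.
    left; move/(nthP x0): uvs => [i]; rewrite sz => ilt fi.
    apply/mapP; exists i; last by rewrite /f fi.
    rewrite mem_cat wsP; have [//|niv] := boolP (i \in nbi s v).
    apply/and5P; split=> //; last by rewrite /f fi.
      by apply: contraTneq vu => iv; rewrite -fi iv E_irr.
    (* A closed vertex adjacent to [v] already lists [v]. *)
    apply: contra niv => ci; apply: (m_sym ms) => //; apply: (m_clEi ms) => //.
    by rewrite fi E_sym.
have ufu : uniq fu.
  rewrite cat_uniq unws andbT; apply/andP; split.
    apply: (inj_map_v ms); last first.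
      move=> i; rewrite mem_cat => /orP[/(m_lt ms vlt) //|]; by rewrite wsP => /and5P[].
    rewrite cat_uniq (m_uniq ms vlt) uws andbT /=; apply/hasPn=> w.
    by rewrite wsP => /and5P[].
  apply/hasPn=> u; rewrite nwsP => /andP[uvs _]; apply: contra uvs => /mapP[i].
  rewrite mem_cat => iI ->; apply: mem_nth; rewrite sz.
  by case/orP: iI => [/(m_lt ms vlt) //|]; rewrite wsP => /and5P[].
have degE : #|nb g (f v)| = size (nbi s v) + (size ws + size nws).
  have -> : nb g (f v) = [set u in fu] by apply/setP=> u; rewrite !inE fuP.
  by rewrite cardsE (card_uniqP ufu) size_cat size_map size_cat addnA.
have d3 := g3 (f v); have nb1 : 0 < size (nbi s v) by case: (nbi s v) nb0.
exists (ext s v ws (size nws)), (vs ++ nws); split.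
  apply/flattenP; exists (flatten [seq (let k := size ws + m in
      if (size (nbi s v) + k <= 3) && (md <= size (nbi s v) + k) then [:: ext s v ws m] else [::])
    | m <- [:: 0; 1; 2]]).
    by apply/mapP; exists ws => //; apply: subs_filter; rewrite -/ws; lia.
  apply/flattenP; exists [:: ext s v ws (size nws)]; last by rewrite inE.
  apply/mapP; exists (size nws); first by rewrite !inE; lia.
  by rewrite /= -degE d3 (mdg _ (m_V ms vlt)).
set c := ext _ _ _ _; have szc : size c = n + size nws by rewrite size_mkseq.
have nE i : i < n + size nws -> nth (false, [::]) c i =
   if i == v then (true, nbi s v ++ ws ++ iota n (size nws))
   else if i < n then (fli s i, nbi s i ++ (if i \in ws then [:: v] else [::]))
   else (false, [:: v]).
  by move=> ilt; rewrite nth_mkseq.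
have vE i : i < n -> nth x0 (vs ++ nws) i = f i by rewrite nth_cat sz => ->.
have wE i : n <= i -> nth x0 (vs ++ nws) i = nth x0 nws (i - n).
  by rewrite nth_cat sz ltnNge => ->.
have nbc i : i < n + size nws -> nbi c i =
   if i == v then nbi s v ++ ws ++ iota n (size nws)
   else if i < n then nbi s i ++ (if i \in ws then [:: v] else [::]) else [:: v].
  by move=> ilt; rewrite /nbi nE //; case: ifP => //; case: ifP.
have vn : v < n + size nws by rewrite ltn_addr.
have nvI i : n <= i -> i == v = false by move=> ni; apply/eqP=> iv; move: vlt; rewrite -iv /n in ni *; lia.
split.
- by rewrite szc size_cat sz.
- by rewrite cat_uniq us unws andbT /=; apply/hasPn=> u; rewrite nwsP => /andP[].
- by move=> u; rewrite mem_cat => /orP[/sV //|]; rewrite nwsP => /andP[_ /E_Vr].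
- rewrite szc => i ilt; rewrite nbc //; have [->|iv] := eqVneq i v.
    split.
      rewrite !cat_uniq (m_uniq ms vlt) uws iota_uniq /= andbT.
      apply/andP; split; apply/hasPn=> w.
        rewrite mem_cat wsP mem_iota => /orP[/and5P[] //|/andP[nw _]].
        by apply/negP=> /(m_lt ms vlt); rewrite ltnNge nw.
      by rewrite mem_iota => /andP[nw _]; apply/negP; rewrite wsP => /and5P[]; rewrite ltnNge nw.
    move=> j; rewrite !mem_cat mem_iota => jj.
    have [jn|nj] := ltnP j n.
      have jl : j < n + size nws by rewrite ltn_addr.
      have jv : j != v.
        case/or3P: jj => [jv||/andP[]]; [|by rewrite wsP => /and5P[]|by rewrite leqNgt jn].
        by have := m_E ms vlt jv; apply: contraTneq => ->; rewrite E_irr.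
      split=> //; first by rewrite nbc // (negbTE jv) jn mem_cat;
        case/or3P: jj => [/(m_sym ms vlt) -> //|-> |/andP[]]; rewrite ?inE ?eqxx ?orbT // leqNgt jn.
      rewrite !vE //; case/or3P: jj => [/(m_E ms vlt) //||/andP[]]; last by rewrite leqNgt jn.
      by rewrite wsP => /and5P[].
    have jl : j < n + size nws.
      case/or3P: jj => [/(m_lt ms vlt)||/andP[] //]; first by rewrite ltnNge nj.
      by rewrite wsP => /and5P[]; rewrite ltnNge nj.
    split=> //; first by rewrite nbc // nvI // ltnNge nj /= inE.
    rewrite vE // wE //; have : nth x0 nws (j - n) \in nws by rewrite mem_nth; lia.
    by rewrite nwsP => /andP[].
  have [ile|nle] := ltnP i n.
    split.
      rewrite cat_uniq (m_uniq ms ile) /=; case: ifP => //= iw; rewrite orbF andbT.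
      move: iw; rewrite wsP => /and5P[_ _ _ + _]; apply: contra => /(m_sym ms ile) //.
    move=> j; rewrite mem_cat => /orP[ji|].
      have jn := m_lt ms ile ji; have jl : j < n + size nws by rewrite ltn_addr.
      split=> //; last by rewrite !vE //; apply: (m_E ms).
      rewrite nbc //; case: eqP => [jv|_]; last by rewrite jn mem_cat (m_sym ms ile ji).
      by rewrite mem_cat; move: (m_sym ms ile ji); rewrite jv => ->.
    case: ifP => // iw; rewrite inE => /eqP ->; split=> //.
      by rewrite nbc // eqxx !mem_cat iw orbT.
    by rewrite !vE //; move: iw; rewrite wsP E_sym => /and5P[].
  split=> // j; rewrite inE => /eqP ->; split=> //.
    by rewrite nbc // eqxx !mem_cat mem_iota nle ilt !orbT.
  rewrite (vE v) // (wE i) // E_sym; have : nth x0 nws (i - n) \in nws by rewrite mem_nth; lia.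
  by rewrite nwsP => /andP[].
rewrite szc => i ilt; rewrite /fli nE //.
have [->|iv] := eqVneq i v.
  move=> _ u; rewrite vE // nbc // eqxx => vu; move: vu; rewrite -fuP mem_cat => /orP[/mapP[j]|].
    rewrite mem_cat => jI ->; have jn : j < n.
      by case/orP: jI => [/(m_lt ms vlt) //|]; rewrite wsP => /and5P[].
    by exists j; rewrite ?vE // catA mem_cat mem_cat jI.
  move=> uw; exists (n + index u nws); last by rewrite wE ?leq_addr // addKn nth_index.
  by rewrite !mem_cat mem_iota leq_addr ltn_add2l index_mem uw !orbT.
case: ltnP => // ile /= fi u; rewrite vE // => /(mc i ile fi)[j ji ->].
by have jn := m_lt ms ile ji; exists j; rewrite ?vE // nbc // (negbTE iv) ile mem_cat ji.
Qed.

End Models.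

(** The subtrees sit inside a list, so the induction hypothesis is stated for all members of that
    list. *)
Fixpoint tree_ind' (P : tree -> Prop)
    (H : forall v hs ts, (forall t, List.In t ts -> P t) -> P (N v hs ts)) t : P t :=
  let: N v hs ts := t in H v hs ts
    ((fix f ts : forall t, List.In t ts -> P t :=
       match ts with
       | [::] => fun t h => False_ind _ h
       | t' :: ts' => fun t h => match h with
           | or_introl e => eq_ind t' P (tree_ind' H t') t e
           | or_intror h' => f ts' t h' end
       end) ts).

(** * Soundness of certificates in a minimal counterexample *)

Section Sound.
Variables (T : finType) (x0 : T) (g : gr T).
Hypothesis g3 : sub3 g.
Hypothesis IHd : forall X : {set T}, X \subset V g -> X != set0 -> Q (del g X).
Hypothesis nQ : ~ Q g.
Implicit Types (s : state) (vs : seq T).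

(** If the weight lost by deleting [X] covers [k] new vertices and all new members, then [Q] passes
    from the remaining graph to [g]. *)
Lemma no_reduction (X : {set T}) k : X \subset V g -> X != set0 ->
  (forall S', ids (del g X) S' -> exists2 S, ids g S & #|S| <= #|S'| + k) ->
  8 * k + \sum_(x in X) #|nb g x :\: X| + 2 * sig (del g X) <= \sum_(x in X) (6 - #|nb g x|) ->
  False.
Proof.
move=> XV X0 lft le; apply: nQ; apply: Q_lift lft _ (IHd XV X0).
by have := wt_del g3 XV; lia.
Qed.

Lemma no_reduction_clnb (I : {set T}) : I \subset V g -> I != set0 ->
  (forall x y, x \in I -> y \in I -> ~~ E g x y) -> let X := clnb g I in
  8 * #|I| + \sum_(x in X) #|nb g x :\: X| + 2 * sig (del g X) <= \sum_(x in X) (6 - #|nb g x|) ->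
  False.
Proof.
move=> IV I0 Ii X; apply: no_reduction.
- apply/subsetP=> x /in_clnb[/(subsetP IV) //|[y _ /E_Vr //]].
- by apply: contraNneq I0 => X0; rewrite -subset0 -X0 subsetUl.
- move=> S' S'i; exists (S' :|: I); first exact: ids_clnb.
  by rewrite cardsU leq_subr.
Qed.

(* Whether the outside neighbours of p and z lie in the given independent
   dominating set decides which two vertices dominate the gadget. *)
Lemma flex_lift a b x y z p : let X := [set u in [:: a; b; x; y; z; p]] in
  uniq [:: a; b; x; y; z; p] -> X \subset V g ->
  nb g a = [set x; y; z] -> nb g b = [set x; y; z] ->
  nb g x = [set a; b; p] -> nb g y = [set a; b; p] -> ~~ E g z p ->
  forall S', ids (del g X) S' -> exists2 S, ids g S & #|S| <= #|S'| + 2.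
Proof.
move=> X uX XV na nB nx ny zp S' [S'V S'i S'd].
have S'X u : u \in S' -> u \notin X by move/(subsetP S'V); rewrite inE => /andP[].
have S'E u w : u \in S' -> w \in S' -> ~~ E g u w.
  by move=> uS wS; have := S'i _ _ uS wS; rewrite /= /del_edge !S'X // !andbT.
have Ea u : E g a u = (u \in [:: x; y; z]) by rewrite -in_nb na !inE -!orbA.
have Eb u : E g b u = (u \in [:: x; y; z]) by rewrite -in_nb nB !inE -!orbA.
have Ex u : E g x u = (u \in [:: a; b; p]) by rewrite -in_nb nx !inE -!orbA.
have Ey u : E g y u = (u \in [:: a; b; p]) by rewrite -in_nb ny !inE -!orbA.
have aX : a \in X by rewrite !inE eqxx ?orbT.
have bX : b \in X by rewrite !inE eqxx ?orbT.
have xX : x \in X by rewrite !inE eqxx ?orbT.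
have yX : y \in X by rewrite !inE eqxx ?orbT.
have zX : z \in X by rewrite !inE eqxx ?orbT.
have pX : p \in X by rewrite !inE eqxx ?orbT.
suff main c d : c \in X -> d \in X -> ~~ E g c d ->
    (forall u, u \in S' -> ~~ E g c u && ~~ E g d u) ->
    (forall u, u \in X -> u \notin [set c; d] -> exists2 w, w \in S' :|: [set c; d] & E g u w) ->
    exists2 S, ids g S & #|S| <= #|S'| + 2.
  (* The vertices [a], [b] serve if [p] has a neighbour in [S']; otherwise [x], [y] if [z] has one;
     otherwise [p], [z]. *)
  have [/exists_inP[s sS ps]|np] := boolP [exists s in S', E g p s].
    apply: (main a b) => //.
    - by rewrite Ea; move: uX; rewrite /= !inE; case/and5P; rewrite !negb_or => /and5P[_ _ _ _ _]; case/and4P=> -> -> ->.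
    - move=> u /S'X; rewrite Ea Eb !inE !negb_or => /and5P[_ _ -> ->] /andP[->].
      by rewrite !andbT.
    move=> u; rewrite !inE => /orP[/eqP ->|/orP[/eqP ->|/or4P[]/eqP ->]]; rewrite ?eqxx ?orbT // => _.
    + by exists a; rewrite ?inE ?eqxx ?orbT // E_sym Ea !inE eqxx ?orbT.
    + by exists a; rewrite ?inE ?eqxx ?orbT // E_sym Ea !inE eqxx ?orbT.
    + by exists a; rewrite ?inE ?eqxx ?orbT // E_sym Ea !inE eqxx ?orbT.
    + by exists s; rewrite // inE sS.
  have pS u : u \in S' -> ~~ E g p u by move=> uS; apply: contraNN np => pu; apply/exists_inP; exists u.
  have [/exists_inP[t tS zt]|nz] := boolP [exists t in S', E g z t].
    apply: (main x y) => //.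
    - rewrite Ex; move: uX; rewrite /= !inE !negb_or => /and5P[/and5P[_ _ ay _ _] /and4P[_ b_y _ _] /and3P[_ _ _] /andP[_ yp] _].
      by rewrite eq_sym ay eq_sym b_y.
    - move=> u /S'X; rewrite Ex Ey !inE !negb_or => /and5P[-> -> _ _] /andP[_ ->].
      by [].
    move=> u; rewrite !inE => /orP[/eqP ->|/orP[/eqP ->|/or4P[]/eqP ->]]; rewrite ?eqxx ?orbT // => _.
    + by exists x; rewrite ?inE ?eqxx ?orbT // Ea !inE eqxx.
    + by exists x; rewrite ?inE ?eqxx ?orbT // Eb !inE eqxx.
    + by exists t; rewrite // inE tS.
    + by exists x; rewrite ?inE ?eqxx ?orbT // E_sym Ex !inE eqxx ?orbT.
  apply: (main p z) => //.
  - by rewrite E_sym.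
  - move=> u uS; rewrite pS //=; apply: contraNN nz => zu; apply/exists_inP; by exists u.
  move=> u; rewrite !inE => /orP[/eqP ->|/orP[/eqP ->|/or4P[]/eqP ->]]; rewrite ?eqxx ?orbT // => _.
  + by exists z; rewrite ?inE ?eqxx ?orbT // Ea !inE eqxx ?orbT.
  + by exists z; rewrite ?inE ?eqxx ?orbT // Eb !inE eqxx ?orbT.
  + by exists p; rewrite ?inE ?eqxx ?orbT // Ex !inE eqxx ?orbT.
  + by exists p; rewrite ?inE ?eqxx ?orbT // Ey !inE eqxx ?orbT.
move=> cX dX cd cdS cdX; exists (S' :|: [set c; d]); last first.
  by apply: leq_trans (leq_card_setU _ _) _; rewrite leq_add2l cards2; case: (c != d).
split.
- apply/subUsetP; split; first exact: subset_trans S'V (subsetDl _ _).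
  by apply/subsetP=> u; rewrite !inE => /orP[] /eqP ->; apply: (subsetP XV).
- move=> u w; rewrite !inE => /orP[uS|ucd] /orP[wS|wcd]; first exact: S'E.
  + by rewrite E_sym; have /andP[cu du] := cdS u uS; case/orP: wcd => /eqP ->.
  + by have /andP[cu du] := cdS w wS; case/orP: ucd => /eqP ->.
  + by case/orP: ucd => /eqP ->; case/orP: wcd => /eqP ->; rewrite ?E_irr // E_sym.
- move=> u uV; rewrite in_setU negb_or => /andP[uS ucd].
  have [uX'|uX'] := boolP (u \in X); first exact: cdX.
  have [|w wS /and3P[uw _ _]] := S'd u _ uS; first by rewrite inE uX'.
  by exists w; rewrite // inE wS.
Qed.

Variables (lv md : nat) (D : seq state).
Hypothesis mdg : forall x, x \in V g -> md <= #|nb g x|.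
Hypothesis bnd_ok : forall s vs (Y : seq nat), models x0 g s vs -> uniq Y ->
  (forall i, i \in Y -> i < size s) -> nopen s Y < md -> (5 < lv) || (nopen s Y == 0) ->
  sig (del g (im x0 vs Y)) <= bnd lv md s Y.
Hypothesis deadD : forall k, k < size D -> dead x0 g (nth [::] D k).

Lemma okY_no s vs (Y : seq nat) k : models x0 g s vs -> uniq Y -> Y != [::] -> okY lv md s Y k ->
  (forall S', ids (del g (im x0 vs Y)) S' -> exists2 S, ids g S & #|S| <= #|S'| + k) -> False.
Proof.
move=> ms uY Y0 /and4P[/allP Ylt oY oY0 le] lft.
apply: (no_reduction _ _ lft).
- by apply/subsetP=> x; rewrite inE => /mapP[i iY ->]; apply: (m_V ms); apply: Ylt.
- case: Y Y0 {uY Ylt oY oY0 le lft} => // i Y _; apply/set0Pn; exists (nth x0 vs i).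
  by rewrite inE mem_head.
have := bnd_ok ms uY Ylt oY oY0; have := gain_ok g3 ms uY Ylt; lia.
Qed.

Lemma leaf_no s vs h : leaf lv md D s h -> models x0 g s vs -> False.
Proof.
move=> + ms; case: h => [I|k m|Y] /=.
- case/and5P=> I0 Icl uI /allP Ii okI.
  have Icl' := allP Icl; have Ilt i : i \in I -> i < size s by move/Icl'/andP=> [].
  apply: (okY_no ms _ _ okI); first exact: undup_uniq.
    case: I I0 {Icl uI Ii okI Icl' Ilt} => // i I _; apply/eqP=> c0.
    have : i \in clos s (i :: I) by rewrite mem_undup mem_head.
    by rewrite c0.
  rewrite (clos_clnb g3 ms Icl) => S' S'i; exists (S' :|: im x0 vs I).
    apply: ids_clnb => //.
      by apply/subsetP=> x; rewrite inE => /mapP[i iI ->]; apply: (m_V ms); apply: Ilt.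
    move=> x y; rewrite !inE => /mapP[i iI ->] /mapP[j jI ->]; apply/negP=> ij.
    have /andP[ilt ci] := Icl' i iI.
    have ji := m_clEi g3 ms ilt (Ilt j jI) ci ij.
    by have /allP/(_ j ji) := Ii i iI; rewrite jI.
  by rewrite cardsU (card_im ms uI Ilt) leq_subr.
- by case/andP=> kD /(embeds_models g3 ms) md'; apply: (deadD kD md').
case: Y => // a [] // b [] // x [] // y [] // z [] // p [] // /and5P[].
move=> uY /allP Yc /perm_mem pa /perm_mem pb /and4P[/perm_mem px /perm_mem py zp okk].
have Ylt : forall i, i \in [:: a; b; x; y; z; p] -> i < size s.
  by case/and4P: (okk) => /allP.
have lt_a : a < size s by apply: Ylt; rewrite !inE eqxx ?orbT.
have lt_b : b < size s by apply: Ylt; rewrite !inE eqxx ?orbT.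
have lt_x : x < size s by apply: Ylt; rewrite !inE eqxx ?orbT.
have lt_y : y < size s by apply: Ylt; rewrite !inE eqxx ?orbT.
have lt_z : z < size s by apply: Ylt; rewrite !inE eqxx ?orbT.
have lt_p : p < size s by apply: Ylt; rewrite !inE eqxx ?orbT.
have ci i : i \in [:: a; b; x; y; z; p] -> cli s i by apply: Yc.
have im3 i j k l : nbi s i =i [:: j; k; l] ->
   im x0 vs (nbi s i) = [set nth x0 vs j; nth x0 vs k; nth x0 vs l].
  move=> pi; apply/setP=> u; rewrite !inE -orbA; apply/mapP/or3P.
    by case=> n; rewrite pi !inE => /or3P[]/eqP -> ->; [constructor 1|constructor 2|constructor 3].
  by case=> /eqP ->; [exists j|exists k|exists l]; rewrite ?pi ?inE ?eqxx ?orbT.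
apply: (okY_no ms uY _ okk) => //.
have imY : im x0 vs [:: a; b; x; y; z; p] = [set u in [:: nth x0 vs a; nth x0 vs b; nth x0 vs x; nth x0 vs y; nth x0 vs z; nth x0 vs p]].
  by apply/setP=> u; rewrite !inE.
rewrite imY; apply: flex_lift.
- exact: (inj_map_v ms uY Ylt).
- rewrite -imY; apply/subsetP=> u; rewrite inE => /mapP[i iY ->].
  by apply: (m_V ms); apply: Ylt.
- by rewrite (m_cl g3 ms) ?ci ?inE ?eqxx ?orbT // (im3 _ _ _ _ pa).
- by rewrite (m_cl g3 ms) ?ci ?inE ?eqxx ?orbT // (im3 _ _ _ _ pb).
- by rewrite (m_cl g3 ms) ?ci ?inE ?eqxx ?orbT // (im3 _ _ _ _ px).
- by rewrite (m_cl g3 ms) ?ci ?inE ?eqxx ?orbT // (im3 _ _ _ _ py).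
- by apply: contra zp => zpE; apply: (m_clEi g3 ms) => //; rewrite ci ?inE ?eqxx ?orbT.
Qed.

Theorem chk_sound t s : chk lv md D t s -> dead x0 g s.
Proof.
elim/tree_ind': t s => v hs ts IH s /= /and4P[vlt ncl nb0 H] vs ms.
have [c [vs' [cin mc]]] := expand_models g3 ms vlt ncl nb0 mdg.
have nl : ~~ has (leaf lv md D c) hs.
  by elim: (hs) => //= h hs' IHh; rewrite negb_or IHh andbT; apply/negP=> lh; apply: leaf_no lh mc.
have : c \in [seq c <- children md s v | ~~ has (leaf lv md D c) hs].
  by rewrite mem_filter nl cin.
move: H; move: [seq _ <- _ | _] => cs.
elim: ts cs IH => [|t ts IHts] [|c' cs] // IH /andP[ct cts].
rewrite inE => /orP[/eqP cc'|ccs].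
  by rewrite -cc' in ct; apply: (IH t (or_introl erefl) c ct vs' mc).
by apply: (IHts cs _ cts ccs) => t' t'ts; apply: IH; right.
Qed.

End Sound.

(** * Copies of K_{2,3} in a graph of maximum degree 3, and trees of them *)

Section K23Facts.
Variables (T : finType) (g : gr T).
Hypothesis g3 : sub3 g.
Implicit Types (a b x y z u v w r : T) (B C Y : {set T}).

Lemma K23P a b x y z : K23 g a b x y z ->
  [/\ uniq [:: a; b; x; y; z], E g a x, E g a y & E g a z] /\
  [/\ E g b x, E g b y & E g b z].
Proof. by case/and5P=> u ax ay az /and3P[bx by_ bz]. Qed.

Lemma K23_swap a b x y z : K23 g a b x y z -> K23 g b a x y z.
Proof.
case/K23P=> -[u ax ay az] [bx by_ bz]; rewrite /K23 ax ay az bx by_ bz !andbT; move: u => /=.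
by rewrite !inE [b == a]eq_sym !negb_or; case/and5P=> /and4P[-> -> -> ->] /and3P[-> -> ->] -> -> _.
Qed.

Lemma K23_xy a b x y z : K23 g a b x y z -> K23 g a b y x z.
Proof.
case/K23P=> -[u ax ay az] [bx by_ bz]; rewrite /K23 ax ay az bx by_ bz !andbT; move: u => /=.
by rewrite !inE [y == x]eq_sym !negb_or; case/and5P=> /and4P[-> -> -> ->] /and3P[-> -> ->] /andP[-> ->] -> _.
Qed.

Lemma K23_yz a b x y z : K23 g a b x y z -> K23 g a b x z y.
Proof.
case/K23P=> -[u ax ay az] [bx by_ bz]; rewrite /K23 ax ay az bx by_ bz !andbT; move: u => /=.
by rewrite !inE [z == y]eq_sym !negb_or; case/and5P=> /and4P[-> -> -> ->] /and3P[-> -> ->] /andP[-> ->] -> _.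
Qed.

Lemma K23_xz a b x y z : K23 g a b x y z -> K23 g a b z y x.
Proof. by move/K23_xy/K23_yz/K23_xy. Qed.

Lemma in_uset a b x y z u : (u \in uset a b x y z) = [|| u == a, u == b, u == x, u == y | u == z].
Proof. by rewrite !inE. Qed.

Lemma uset_xy a b x y z : uset a b x y z = uset a b y x z.
Proof. by apply/setP=> u; rewrite !inE; do !bool_congr. Qed.
Lemma uset_yz a b x y z : uset a b x y z = uset a b x z y.
Proof. by apply/setP=> u; rewrite !inE; do !bool_congr. Qed.
Lemma uset_ab a b x y z : uset a b x y z = uset b a x y z.
Proof. by apply/setP=> u; rewrite !inE; do !bool_congr. Qed.

Lemma nb_card3 v x y z : uniq [:: x; y; z] -> E g v x -> E g v y -> E g v z -> nb g v = [set x; y; z].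
Proof.
move=> u vx vy vz; apply/eqP; rewrite eq_sym eqEcard; apply/andP; split.
  by apply/subsetP=> w; rewrite !inE -orbA => /or3P[]/eqP ->.
have -> : [set x; y; z] = [set w in [:: x; y; z]] by apply/setP=> w; rewrite !inE orbA.
by rewrite [X in _ <= X]cardsE (card_uniqP u) /= g3.
Qed.

Lemma K23_nba a b x y z : K23 g a b x y z -> nb g a = [set x; y; z].
Proof.
by case/K23P=> -[/= /and3P[_ _ u] ax ay az] _; apply: nb_card3.
Qed.
Lemma K23_nbb a b x y z : K23 g a b x y z -> nb g b = [set x; y; z].
Proof. by move/K23_swap/K23_nba. Qed.

Lemma K23_Ea a b x y z u : K23 g a b x y z -> E g a u -> u \in [:: x; y; z].
Proof. by move=> k; rewrite -in_nb (K23_nba k) !inE orbA. Qed.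

Lemma K23_nbx a b x y z v : K23 g a b x y z -> E g x v -> v != a -> v != b -> nb g x = [set a; b; v].
Proof.
case/K23P=> -[/= /andP[ab _] ax _ _] [bx _ _] xv va vb; apply: nb_card3; rewrite // 1?E_sym //.
by move: ab; rewrite /= !inE !negb_or => /andP[-> _]; rewrite andbT /= eq_sym va eq_sym vb.
Qed.

Lemma K23_exit a b x y z v : K23 g a b x y z -> v \notin uset a b x y z -> E g x v -> nb g x = [set a; b; v].
Proof.
move=> k; rewrite in_uset !negb_or => /and5P[va vb _ _ _] xv; exact: K23_nbx k xv va vb.
Qed.

Lemma utree_r r C us : utree g r C us -> r \in C.
Proof. by elim=> [_|C' us' v a b x y z _ rC *]; rewrite inE ?rC. Qed.

Lemma utree_V r C us : utree g r C us -> C \subset V g.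
Proof.
elim=> [rV|C' us' v a b x y z _ CV vC k _ _ vx _]; first by rewrite sub1set.
rewrite subUset CV; apply/subsetP=> u; rewrite in_uset.
case/K23P: k => -[_ ax ay az] [bx by_ bz].
by case/or4P=> [/eqP ->|/eqP ->|/eqP ->|/orP[]/eqP ->]; rewrite ?(E_V ax) ?(E_V bx) ?(E_Vr ax) ?(E_Vr ay) ?(E_Vr az).
Qed.

(** By the symmetries of K_{2,3} a vertex other than the root may be named side [a] or port [x] of
    its unit. *)
Lemma utree_cov r C us c : utree g r C us -> c \in C -> c != r ->
  exists a b x y z, [/\ K23 g a b x y z, uset a b x y z \subset C, r \notin uset a b x y z
    & c = a \/ c = x].
Proof.
elim=> [_|C' us' v a b x y z ut IH vC k nyz dis vx cr].
  by rewrite inE => /eqP ->; rewrite eqxx.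
rewrite inE => /orP[cC' nr|cU nr].
  have [a' [b' [x' [y' [z' [k' sub rn cc]]]]]] := IH cC' nr.
  exists a', b', x', y', z'; split=> //; exact: subset_trans sub (subsetUl _ _).
have rU : r \notin uset a b x y z by rewrite (disjointFr dis) // (utree_r ut).
have sU : uset a b x y z \subset C' :|: uset a b x y z by apply: subsetUr.
move: cU; rewrite in_uset => /or4P[/eqP ->|/eqP ->|/eqP ->|/orP[]/eqP ->].
- by exists a, b, x, y, z; split=> //; left.
- by exists b, a, x, y, z; rewrite -uset_ab; split=> //; [exact: K23_swap | left].
- by exists a, b, x, y, z; split=> //; right.
- by exists a, b, y, x, z; rewrite -uset_xy; split=> //; [exact: K23_xy | right].
- exists a, b, z, x, y; rewrite -(uset_xy a b x z y) -uset_yz; split=> //; last by right.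
  exact: K23_xy (K23_yz k).
Qed.

(* All neighbours of the vertices y and z of the last attached unit lie in the
   unit or outside the tree. *)
Lemma last_nb C v a b x y z u : K23 g a b x y z -> ~~ E g y z -> v \in C ->
  [disjoint C & uset a b x y z] -> E g v x ->
  (forall c u, c \in C -> u \in uset a b x y z -> E g c u -> c = v /\ u = x) ->
  E g y u -> u \in C :|: uset a b x y z -> u = a \/ u = b.
Proof.
move=> k nyz vC dis vx cr yu; have u5 : uniq [:: a; b; x; y; z] by case/K23P: k => -[].
rewrite inE => /orP[uC|].
  have yU : y \in uset a b x y z by rewrite in_uset eqxx ?orbT.
  have uy : E g u y by rewrite E_sym.
  have [_ yx] := cr u y uC yU uy.
  by move: u5; rewrite yx /= !inE eqxx !andbF.
rewrite in_uset => /or4P[/eqP ->|/eqP ->|/eqP ux|/orP[/eqP uy|/eqP uz]]; [by left|by right| | |].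
- have vU : v \notin uset a b x y z by rewrite (disjointFr dis).
  have xv : E g x v by rewrite E_sym.
  have : y \in nb g x by rewrite in_nb -ux E_sym.
  rewrite (K23_exit k vU xv) !inE; case/orP=> [/orP[]|] /eqP yy; rewrite ?yy in u5.
  + by move: u5; rewrite /= !inE eqxx !orbT.
  + by move: u5; rewrite /= !inE eqxx ?orbT !andbF.
  + by move: vU; rewrite in_uset yy eqxx !orbT.
- by rewrite uy E_irr in yu.
- by rewrite -uz yu in nyz.
Qed.

End K23Facts.

Lemma utree_eq (T : finType) (g g' : gr T) r (C : {set T}) us : (forall w, w \in C -> nb g w = nb g' w) -> C \subset V g ->
  utree g' r C us -> utree g r C us.
Proof.
move=> + + ut; elim: ut => {C us} [rV'|C us v a b x y z ut IH vC k nyz dis vx cr] nbE CV.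
  by apply: ut0; move: CV; rewrite sub1set.
have EE w u : w \in C :|: uset a b x y z -> E g w u = E g' w u.
  by move/nbE/setP/(_ u); rewrite !in_nb.
have sU u : u \in uset a b x y z -> u \in C :|: uset a b x y z by move=> uU; rewrite in_setU uU orbT.
have sC u : u \in C -> u \in C :|: uset a b x y z by move=> uC; rewrite in_setU uC.
have aU : a \in uset a b x y z by rewrite in_uset eqxx.
have bU : b \in uset a b x y z by rewrite in_uset eqxx ?orbT.
have yU : y \in uset a b x y z by rewrite in_uset eqxx ?orbT.
apply: (@utS _ _ _ C us v a b x y z) => //.
- by apply: IH => [w /sC/nbE //|]; apply: subset_trans CV; apply: subsetUl.
- by move: k; rewrite /K23 !EE ?sU.
- by rewrite EE ?sU.
- by rewrite EE ?sC.
- by move=> c u cC uU; rewrite EE ?sC //; apply: cr.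
Qed.

(** Both kinds of members depend only on the neighbourhoods of their own vertices, so they survive
    every change of the graph elsewhere. *)
Lemma bt_eq (T : finType) (g g' : gr T) (B : {set T}) : (forall w, w \in B -> nb g w = nb g' w) -> B \subset V g -> bt g' B -> bt g B.
Proof.
move=> nbE BV [[r [us [ut cl]]]|].
  left; exists r, us; split; first exact: utree_eq ut.
  by move=> c u cB; rewrite -in_nb nbE // in_nb; apply: cl.
case=> v1 [v2 [w2 [C [us [[ut v2C v12 vw] [[wC w1 w2C v1C BE] [nc nv2 c3]]]]]]].
have CB c : c \in C -> c \in B by move=> cC; rewrite BE in_setU cC orbT.
have v2B : v2 \in B by rewrite BE !inE eqxx.
have v1B := CB _ (utree_r ut).
right; exists v1, v2, w2, C, us; split; first split=> //.
- apply: utree_eq ut => [w /CB/nbE //|]; apply: subset_trans BV.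
  by apply/subsetP=> c /CB.
- by rewrite -in_nb nbE // in_nb.
- by rewrite -in_nb nbE // in_nb.
have w2B := CB _ wC; split; first by split=> //; rewrite nbE.
by split=> [c cC cv||]; rewrite nbE //; [apply: nc | apply: CB].
Qed.

Lemma K23_del (T : finType) (g : gr T) X a b x y z : K23 (del g X) a b x y z ->
  K23 g a b x y z /\ [disjoint uset a b x y z & X].
Proof.
case/K23P=> -[u /and3P[ax na nx] /and3P[ay _ ny] /and3P[az _ nz]] [/and3P[bx nB _] /and3P[by_ _ _] /and3P[bz _ _]].
split; first by rewrite /K23 u ax ay az bx by_ bz andbT.
rewrite disjoint_subset; apply/subsetP=> v; rewrite in_uset inE.
by case/or4P=> [/eqP ->|/eqP ->|/eqP ->|/orP[]/eqP ->].
Qed.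

(** * Traces that a new member leaves next to the deleted set *)

Section Hits.
Variables (T : finType) (g : gr T) (Y : {set T}).
Hypothesis g3 : sub3 g.
Hypothesis reduced : forall a b x y z, K23 g a b x y z -> #|nb g x| = 3.
Implicit Types (a b x y z u v w r : T) (B C : {set T}).
Let H := del g Y.

Definition isoS w := [&& w \in V g, w \notin Y & nb g w \subset Y].
(** As all ports have degree 3 in [g], this is a port of a surviving unit that has lost its third
    neighbour. *)
Definition hit w := `[< #|nb g w :&: Y| = 1 /\ exists a b y z, K23 H a b w y z >].

Let H3 : sub3 H := sub3_del Y g3.

(** A port left with its two sides only must have lost a neighbour, since it has degree 3 in [g]. *)
Lemma hit_of a b x y z : K23 H a b x y z -> nb H x \subset [set a; b] -> hit x.
Proof.
move=> k sub; apply/asboolP; split; last by exists a, b, y, z.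
have [kg dis] := K23_del k; have := reduced kg.
have xY : x \notin Y by rewrite (disjointFr dis) // in_uset eqxx ?orbT.
have -> : #|nb g x| = #|nb g x :&: Y| + #|nb H x| by rewrite nb_del (negbTE xY) cardsID.
suff -> : nb H x = [set a; b].
  case/K23P: kg => -[/= /andP[ab _] _ _ _] _; move: ab; rewrite !inE !negb_or => /andP[ab _].
  by rewrite cards2 ab; lia.
apply/eqP; rewrite eqEsubset sub; apply/subsetP=> u.
by case/K23P: k => -[_ ax _ _] [bx _ _]; rewrite in_set2 in_nb E_sym => /orP[]/eqP ->.
Qed.

(** Nothing hangs on the ports [y] and [z] of the unit attached last, so in a closed tree both are
    hits. A tree without units is a vertex that became isolated. *)
Lemma bt1_end B : bt1 H B -> (exists2 w, w \in B & isoS w) \/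
  exists a b x y z v C us r, [/\ utree H r C us, K23 H a b x y z, v \in C, E H v x & [disjoint C & uset a b x y z]] /\
    [/\ B = C :|: uset a b x y z, hit y, hit z, forall c u, c \in B -> E H c u -> u \in B
      & forall c u, c \in C -> u \in uset a b x y z -> E H c u -> c = v /\ u = x].
Proof.
case=> r [us [ut cl]]; case: ut cl => [rV|C us' v a b x y z ut vC k nyz dis vx cr] cl.
  left; exists r; first by rewrite inE.
  move: rV; rewrite inE => /andP[rY rV]; rewrite /isoS rV rY /=; apply/subsetP=> u.
  rewrite in_nb => ru; apply/negPn/negP=> uY.
  have := cl r u; rewrite !inE eqxx => /(_ isT); rewrite /= /del_edge ru rY uY => /(_ isT) /eqP uu.
  by rewrite uu E_irr in ru.
right; exists a, b, x, y, z, v, C, us', r; split=> //; split=> //.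
- apply: (hit_of (K23_xy k)); apply/subsetP=> u; rewrite in_nb => yu.
  have yB : y \in C :|: uset a b x y z by rewrite inE in_uset eqxx !orbT.
  by have [] := last_nb H3 k nyz vC dis vx cr yu (cl _ _ yB yu) => ->; rewrite !inE eqxx ?orbT.
- apply: (hit_of (K23_xz k)); apply/subsetP=> u; rewrite in_nb => zu.
  have zB : z \in C :|: uset a b x y z by rewrite inE in_uset eqxx !orbT.
  have uB := cl _ _ zB zu; rewrite uset_yz in dis cr uB; rewrite E_sym in nyz.
  by have [] := last_nb H3 (K23_yz k) nyz vC dis vx cr zu uB => ->; rewrite !inE eqxx ?orbT.
Qed.

Lemma bt2_hit C B v a b x y z : K23 H a b x y z -> ~~ E H y z -> v \in C ->
  [disjoint C & uset a b x y z] -> E H v x ->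
  (forall c u, c \in C -> u \in uset a b x y z -> E H c u -> c = v /\ u = x) ->
  nb H y \subset B -> (forall u, u \in B -> E H y u -> u \in C :|: uset a b x y z) -> hit y.
Proof.
move=> k nyz vC dis vx cr nyB nyC; apply: (hit_of (K23_xy k)); apply/subsetP=> u.
move=> uy; have uB := subsetP nyB _ uy; move: uy; rewrite in_nb => yu.
by have [] := last_nb H3 k nyz vC dis vx cr yu (nyC _ uB yu) => ->; rewrite !inE eqxx ?orbT.
Qed.

Definition hunit B a b w y z := [/\ K23 H a b w y z, uset a b w y z \subset B & hit w].

(** As for closed trees, except that [w2], if it is a port of the last unit, keeps [v2] as its third
    neighbour. *)
Lemma bt2_end B : bt2 H B -> exists a b x y z v C us v1 v2 w2,
  [/\ utree H v1 C us, K23 H a b x y z, v \in C, E H v x & [disjoint C & uset a b x y z]] /\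
  [/\ B = v2 |: (C :|: uset a b x y z), (y != w2 -> hit y), (z != w2 -> hit z), E H v1 v2 & E H v2 w2] /\
  [/\ w2 \in C :|: uset a b x y z, #|nb H v1 :&: (C :|: uset a b x y z)| = 1, v2 \notin C :|: uset a b x y z,
      (forall c, c \in C :|: uset a b x y z -> c != v1 -> nb H c \subset B)
    & (forall c u, c \in C -> u \in uset a b x y z -> E H c u -> c = v /\ u = x)] /\
  (w2 != v1 /\ forall c, c \in C :|: uset a b x y z -> E H c v2 -> c = v1 \/ c = w2).
Proof.
case=> v1 [v2 [w2 [C0 [us0 [[ut v2C v12 vw] [[wC w1 w2C v1C BE] [nc nv2 c3]]]]]]].
case: ut v2C wC w2C v1C BE nc nv2 => [rV|C us v a b x y z ut vC k nyz dis vx cr] v2C wC w2C v1C BE nc nv2.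
  by move: wC w1; rewrite inE => /eqP ->; rewrite eqxx.
have ncv c : c \in C :|: uset a b x y z -> E H c v2 -> c = v1 \/ c = w2.
  move=> cC cv; have : c \in nb H v2 :&: (C :|: uset a b x y z) by rewrite in_setI cC in_nb E_sym cv.
  by rewrite nv2 in_set2 => /orP[]/eqP ->; [left|right].
have yU : y \in uset a b x y z by rewrite in_uset eqxx ?orbT.
have zU : z \in uset a b x y z by rewrite in_uset eqxx ?orbT.
have yC : y \in C :|: uset a b x y z by rewrite in_setU yU orbT.
have zC : z \in C :|: uset a b x y z by rewrite in_setU zU orbT.
have y1 : y != v1 by apply: contraTneq (utree_r ut) => <-; rewrite (disjointFl dis).
have z1 : z != v1 by apply: contraTneq (utree_r ut) => <-; rewrite (disjointFl dis).
exists a, b, x, y, z, v, C, us, v1, v2, w2; split; first by split.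
split; last by split.
split=> // [yw|zw].
- apply: (bt2_hit k nyz vC dis vx cr (nc y yC y1)) => u; rewrite BE in_setU1 => /orP[/eqP -> yv|//].
  by case: (ncv y yC yv) => e; [rewrite e eqxx in y1|rewrite e eqxx in yw].
- have dis' := dis; have cr' := cr; rewrite uset_yz in dis' cr'; rewrite E_sym in nyz.
  apply: (bt2_hit (K23_yz k) nyz vC dis' vx cr' (nc z zC z1)) => u.
  rewrite BE in_setU1 => /orP[/eqP -> zv|]; last by rewrite -uset_yz.
  by case: (ncv z zC zv) => e; [rewrite e eqxx in z1|rewrite e eqxx in zw].
Qed.

Lemma bt_end1 B : bt H B -> (exists2 w, w \in B & isoS w) \/
  exists a b w y z, hunit B a b w y z.
Proof.
case=> [/bt1_end[?|[a [b [x [y [z [v [C [us [r [[_ k _ _ _] [BE hy hz _ _]]]]]]]]]]]]|/bt2_end]; first by left.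
  right; exists a, b, y, x, z; split=> //; first exact: K23_xy.
  by rewrite BE -uset_xy subsetUr.
case=> a [b [x [y [z [v [C [us [v1 [v2 [w2 [[_ k _ _ _] [[BE hy hz _ _] _]]]]]]]]]]]].
have sB : uset a b x y z \subset B by rewrite BE setUA subsetUr.
right; have [yw|/hy hy'] := eqVneq y w2; last first.
  by exists a, b, y, x, z; split=> //; [exact: K23_xy|rewrite -uset_xy].
exists a, b, z, y, x; split; first exact: K23_xz.
  by rewrite uset_xy (uset_yz a b y) uset_xy.
apply: hz; rewrite -yw; case/K23P: k => -[/= /and5P[_ _ _ + _] _ _ _] _.
by rewrite inE eq_sym.
Qed.

Hypothesis dA1 : forall a b x y z p q, K23 g a b x y z -> E g x p -> E g y q ->
  p \notin uset a b x y z -> q \notin uset a b x y z -> E g p q -> False.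

Lemma EH u w : E H u w -> [/\ E g u w, u \notin Y & w \notin Y].
Proof. by case/and3P. Qed.

(** If [w2] lies on the last unit, that unit offers only one hit, and more are sought on the unit
    attached before it. There is such a unit by [dA1]: otherwise [v1] and [v2] would be adjacent
    neighbours of two ports of the only unit. *)
Lemma bt_end2 B : bt H B -> (exists2 w, w \in B & isoS w) \/
  (exists a b x y z, [/\ K23 H a b x y z, hit y, hit z & uset a b x y z \subset B]) \/
  (exists a b x y z a' b' x' y' z', [/\ K23 H a b x y z, K23 H a' b' x' y' z', E H y' x, hit z & hit z'] /\
     [/\ uset a b x y z \subset B, uset a' b' x' y' z' \subset B & [disjoint uset a b x y z & uset a' b' x' y' z']]).
Proof.
case=> [/bt1_end[?|[a [b [x [y [z [v [C [us [r [[_ k _ _ _] [BE hy hz _ _]]]]]]]]]]]]|/bt2_end]; first by left.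
  by right; left; exists a, b, x, y, z; split; rewrite // BE subsetUr.
case=> a [b [x [y [z [v [C [us [v1 [v2 [w2 [[ut k vC vx dis] [[BE hy hz v12 vw] [[wC v1C v2C nc cr] [_ ncv]]]]]]]]]]]]]].
right; wlog yw : y z k dis BE hy hz wC v1C v2C nc cr ncv / z != w2.
  move=> wl; have [zw|] := eqVneq z w2; last by move=> nzw; apply: (wl y z).
  have yz : y != w2.
    by rewrite -zw; case/K23P: k => -[/= /and5P[_ _ _ + _] _ _ _] _; rewrite inE.
  have := wl z y (K23_yz k); rewrite -(uset_yz a b x y z) => wl'.
  exact: (wl' dis BE hz hy wC v1C v2C nc cr ncv yz).
have hz' := hz yw; have sB : uset a b x y z \subset B by rewrite BE setUA subsetUr.
have [yw2|/hy hy'] := eqVneq y w2; last by left; exists a, b, x, y, z.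
have U3 u : u \in C -> u \notin uset a b x y z by move=> uC; rewrite (disjointFr dis).
have [kg _] := K23_del k.
case: ut vC dis BE wC v1C v2C nc cr ncv U3 vw => [rV|C' us' v' a' b' x' y' z' ut' vC' k' nyz' dis' vx' cr'] vC dis BE wC v1C v2C nc cr ncv U3 vw.
  case: (@dA1 a b x y z v1 v2) => //.
  - by move: vC vx; rewrite inE => /eqP -> /EH[]; rewrite E_sym.
  - by rewrite yw2; move/EH: vw => []; rewrite E_sym.
  - by apply: U3; rewrite inE.
  - by apply: contraNN v2C => v2U; rewrite in_setU v2U orbT.
  - by have [] := EH v12.
have sB' : uset a' b' x' y' z' \subset B.
  by apply/subsetP=> u uU; rewrite BE !in_setU uU !orbT.
have wU : w2 \in uset a b x y z by rewrite -yw2 in_uset eqxx ?orbT.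
have free u : u \in uset a' b' x' y' z' -> u != v -> forall t, t \in B -> E H u t -> t \in C' :|: uset a' b' x' y' z'.
  move=> uU uv t; have uC : u \in C' :|: uset a' b' x' y' z' by rewrite in_setU uU orbT.
  rewrite BE in_setU1 in_setU => /orP[/eqP -> ut|/orP[//|tU] ut].
    case: (ncv u _ ut) => [|u1|u1]; first by rewrite in_setU uC.
      by move: (utree_r ut'); rewrite -u1 (disjointFl dis').
    by move: (U3 u uC); rewrite u1 wU.
  by have [uv' _] := cr u t uC tU ut; rewrite uv' eqxx in uv.
have ncu u : u \in uset a' b' x' y' z' -> nb H u \subset B.
  move=> uU; apply: nc; first by rewrite !in_setU uU !orbT.
  by apply: contraTneq (utree_r ut') => <-; rewrite (disjointFl dis').
have yU' : y' \in uset a' b' x' y' z' by rewrite in_uset eqxx ?orbT.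
have zU' : z' \in uset a' b' x' y' z' by rewrite in_uset eqxx ?orbT.
have hy2 : y' != v -> hit y'.
  by move=> yv; apply: (bt2_hit k' nyz' vC' dis' vx' cr' (ncu _ yU')); apply: free.
have hz2 : z' != v -> hit z'.
  move=> zv; rewrite E_sym in nyz'; have := free z' zU' zv; rewrite (uset_yz a' b' x' y' z').
  rewrite uset_yz in dis' cr'.
  by apply: (bt2_hit (K23_yz k') nyz' vC' dis' vx' cr' (ncu _ zU')).
have disU : [disjoint uset a b x y z & uset a' b' x' y' z'].
  by rewrite disjoint_sym; apply: disjointWl dis; apply: subsetUr.
have yz' : y' != z'.
  by case/K23P: (k') => -[/= /and5P[_ _ _ + _] _ _ _] _; rewrite inE.
(* At most one of [y'] and [z'] carries the last unit; the other is a hit. *)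
have [yv|/hy2 hy2'] := eqVneq y' v.
  have zv : z' != v by rewrite -yv eq_sym.
  right; exists a, b, x, y, z, a', b', x', y', z'; split; last by split.
  by split=> //; [rewrite yv|apply: hz2].
have [zv|/hz2 hz2'] := eqVneq z' v; last by left; exists a', b', x', y', z'.
right; exists a, b, x, y, z, a', b', x', z', y'; rewrite -(uset_yz a' b' x' y' z'); split; last by split.
by split=> //; [exact: K23_yz|rewrite zv].
Qed.

End Hits.

(** * Sharper traces once configurations around K_{2,3} are excluded *)

Section Ends.
Variables (T : finType) (g : gr T) (Y : {set T}).
Hypothesis g3 : sub3 g.
Hypothesis reduced : forall a b x y z, K23 g a b x y z -> #|nb g x| = 3.
Hypothesis dA1 : forall a b x y z p q, K23 g a b x y z -> E g x p -> E g y q ->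
  p \notin uset a b x y z -> q \notin uset a b x y z -> E g p q -> False.
Implicit Types (a b x y z u v w r : T) (B C : {set T}).
Let H := del g Y.
Let H3 : sub3 H := sub3_del Y g3.

Lemma bt_two_hits B : bt H B -> (exists2 w, w \in B & isoS g Y w) \/
  exists w w', [/\ w \in B, w' \in B, w != w', hit g Y w & hit g Y w'].
Proof.
move=> /(bt_end2 g3 reduced dA1) [?|[|]]; [by left| |].
  case=> a [b [x [y [z [k hy hz /subsetP sB]]]]]; right; exists y, z.
  split=> //; try by apply: sB; rewrite in_uset eqxx ?orbT.
  by case/K23P: k => -[/= /and5P[_ _ _ + _] _ _ _] _; rewrite inE.
case=> a [b [x [y [z [a' [b' [x' [y' [z' [[_ _ _ hz hz'] [/subsetP sB /subsetP sB' dis]]]]]]]]]]].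
right; exists z, z'; split=> //; try by [apply: sB; rewrite in_uset eqxx ?orbT|apply: sB'; rewrite in_uset eqxx ?orbT].
by apply: contraTneq dis => ->; apply/pred0Pn; exists z'; rewrite /= !in_uset !eqxx !orbT.
Qed.

Hypothesis dSm : forall a b x y z p, K23 g a b x y z -> E g x p -> E g y p ->
  p \notin uset a b x y z -> False.

Lemma K23H_out a b x y z e : K23 H a b x y z -> e \in Y -> e \notin uset a b x y z.
Proof. by case/K23_del=> _ dis eY; rewrite (disjointFl dis). Qed.

Section LevelB.
Hypothesis dB : forall a b x y z a' b' x' y' z' p, K23 g a b x y z -> K23 g a' b' x' y' z' ->
  [disjoint uset a b x y z & uset a' b' x' y' z'] -> E g x x' -> E g y p -> E g y' p ->
  p \notin uset a b x y z -> p \notin uset a' b' x' y' z' -> False.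

(** A common deleted neighbour of two hits contradicts [dSm] if they lie on one unit, and [dB] if
    they lie on two linked units. *)
Lemma bt_far_hits B : bt H B -> (exists2 w, w \in B & isoS g Y w) \/
  exists w w', [/\ hit g Y w, hit g Y w' & forall e, e \in Y -> E g w e -> E g w' e -> False].
Proof.
move=> /(bt_end2 g3 reduced dA1) [?|[|]]; [by left| |].
  case=> a [b [x [y [z [k hy hz /subsetP sB]]]]]; right; exists y, z.
  split=> // e eY ye ze; have [kg _] := K23_del k.
  have := K23H_out k eY; rewrite (uset_xy a b x y z) (uset_yz a b y x z).
  exact: dSm (K23_yz (K23_xy kg)) ye ze.
case=> a [b [x [y [z [a' [b' [x' [y' [z' [[k k' yx hz hz'] [_ _ dis]]]]]]]]]]].
right; exists z, z'; split=> // e eY ze z'e; have [kg _] := K23_del k; have [kg' _] := K23_del k'.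
have e1 := K23H_out k eY; have e2 := K23H_out k' eY.
apply: (@dB a b x z y a' b' y' z' x' e); rewrite -?(uset_yz a b x y z) //.
- exact: K23_yz.
- exact: K23_yz (K23_xy kg').
- by rewrite -(uset_yz a' b' y' x' z') -(uset_xy a' b' x' y' z').
- by rewrite E_sym; case/and3P: yx.
- by rewrite -(uset_yz a' b' y' x' z') -(uset_xy a' b' x' y' z').
Qed.
End LevelB.

Hypothesis dA2 : forall a b x y z a' b' x' y' z', K23 g a b x y z -> K23 g a' b' x' y' z' ->
  [disjoint uset a b x y z & uset a' b' x' y' z'] -> E g x x' -> False.

(** A side has no neighbour outside its unit, so a unit hanging on another unit would be joined to
    it port to port, against [dA2]. *)
Lemma attach_root r C us v a b x y z : utree H r C us -> v \in C -> K23 H a b x y z ->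
  [disjoint C & uset a b x y z] -> E H v x -> v = r.
Proof.
move=> ut vC k dis vx; apply/eqP/negPn/negP=> vr.
have xU : x \in uset a b x y z by rewrite in_uset eqxx ?orbT.
have [a' [b' [x' [y' [z' [k' sub _ [va|vx']]]]]]] := utree_cov ut vC vr.
  have := K23_Ea H3 k'; rewrite -va => /(_ _ vx) xin.
  have : x \in C by apply: (subsetP sub); move: xin; rewrite in_uset !inE => /or3P[]->; rewrite ?orbT.
  by rewrite (disjointFl dis).
have [kg _] := K23_del k; have [kg' _] := K23_del k'.
apply: (dA2 kg' kg); first exact: disjointWl dis.
by rewrite -vx'; case/and3P: vx.
Qed.

(** All units hang on the root [v1], which has only one neighbour in the tree, so there is a single
    unit. Then [w2] is one of its ports, and the edge [v1 v2] contradicts [dA1]. *)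
Lemma no_bt2 B : ~ bt2 H B.
Proof.
case/(bt2_end g3 reduced)=> a [b [x [y [z [v [C [us [v1 [v2 [w2 [[ut k vC vx dis] [[BE _ _ v12 vw] [[wC v1C v2C nc cr] [w1 ncv]]]]]]]]]]]]]].
have vE := attach_root ut vC k dis vx; subst v.
have [kg _] := K23_del k.
have xin : x \in nb H v1 :&: (C :|: uset a b x y z).
  by rewrite in_setI in_nb vx in_setU in_uset eqxx !orbT.
have v2U : v2 \notin uset a b x y z by apply: contraNN v2C => v2U; rewrite in_setU v2U orbT.
have v1U : v1 \notin uset a b x y z by rewrite (disjointFr dis).
have xv1 : E g x v1 by rewrite E_sym; case/and3P: vx.
have v12g : E g v1 v2 by case/and3P: v12.
have wv : E g w2 v2 by rewrite E_sym; case/and3P: vw.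
case: ut vC dis wC v1C v2C xin cr {nc BE ncv} => [rV|C' us' v' a' b' x' y' z' ut' vC' k' nyz' dis' vx' cr'] vC dis wC v1C v2C xin cr.
  move: wC; rewrite in_setU inE (negbTE w1) /= in_uset => /or4P[/eqP wE|/eqP wE|/eqP wE|/orP[]/eqP wE].
  - have := K23_Ea g3 kg; rewrite -wE => /(_ _ wv) vin.
    by move: v2U; rewrite in_uset; move: vin; rewrite !inE => /or3P[]->; rewrite !orbT.
  - have := K23_Ea g3 (K23_swap kg); rewrite -wE => /(_ _ wv) vin.
    by move: v2U; rewrite in_uset; move: vin; rewrite !inE => /or3P[]->; rewrite !orbT.
  - have : v2 \in nb g x by rewrite in_nb -wE.
    rewrite (K23_exit g3 kg v1U xv1) !inE => /orP[/orP[]|]/eqP v2E.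
    + by move: v2U; rewrite v2E in_uset eqxx.
    + by move: v2U; rewrite v2E in_uset eqxx orbT.
    + by rewrite v2E E_irr in v12g.
  - by apply: (dA1 kg xv1 _ v1U v2U v12g); rewrite -wE.
  - rewrite wE in wv; have := dA1 (K23_yz kg) xv1 wv; rewrite -(uset_yz a b x y z).
    by move/(_ v1U v2U v12g).
have v'E := attach_root ut' vC' k' dis' vx'; subst v'.
have x'in : x' \in nb H v1 :&: (C' :|: uset a' b' x' y' z' :|: uset a b x y z).
  by rewrite in_setI in_nb vx' !in_setU in_uset eqxx !orbT.
have xx' : x != x'.
  have xn : x \notin C' :|: uset a' b' x' y' z' by rewrite (disjointFl dis) // in_uset eqxx ?orbT.
  by apply/eqP=> xe; move: xn; rewrite {1}xe in_setU in_uset eqxx !orbT.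
move/eqP/cards1P: v1C => [c cE]; move: xin x'in xx'; rewrite cE !inE => /eqP -> /eqP ->.
by rewrite eqxx.
Qed.

Hypothesis dE : forall a b x y z p, K23 g a b x y z -> E g x p -> p \notin uset a b x y z -> #|nb g p| = 3.

(** By [attach_root] the units form a star at the root. Two units give four hits. With one unit, the
    root has degree 3 by [dE] and so loses two neighbours, while [dSm] and [dA1] separate the
    vertices lost by the two free ports from each other and from the root. The root is no port of a
    unit of [g]: the sides of that unit would be the two deleted neighbours, and the edge [r x]
    would contradict [dA2]. *)
Lemma bt_root B : bt H B -> [\/ exists2 w, w \in B & isoS g Y w,
   exists2 h : {set T}, h \subset B & 4 <= #|h| /\ (forall w, w \in h -> hit g Y w) /\
     exists a b x y z a' b' x' y' z' r, [/\ K23 g a b x y z, K23 g a' b' x' y' z',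
       [disjoint uset a b x y z & uset a' b' x' y' z'] , E g x r & E g x' r] /\
       [/\ r \notin uset a b x y z & r \notin uset a' b' x' y' z']
 | exists r w w' e e', [/\ r \in B, r \notin Y, #|nb g r :&: Y| = 2 & forall a b y z, ~ K23 g a b r y z] /\
     [/\ hit g Y w, hit g Y w', e \in Y, e' \in Y & E g w e] /\
     [/\ E g w' e', e != e', ~~ E g r e & ~~ E g r e']].
Proof.
case=> [|/no_bt2//]; case/(bt1_end g3 reduced)=> [?|]; first by constructor 1.
case=> a [b [x [y [z [v [C [us [r [[ut k vC vx dis] [BE hy hz cl cr]]]]]]]]]].
have vE := attach_root ut vC k dis vx; subst v.
have [kg disY] := K23_del k.
have rU : r \notin uset a b x y z by rewrite (disjointFr dis).
have xr : E g x r by rewrite E_sym; case/and3P: vx.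
have ynz : y != z by case/K23P: (kg) => -[/= /and5P[_ _ _ + _] _ _ _] _; rewrite inE.
case: ut vC dis BE cl cr => [rV|C' us' v' a' b' x' y' z' ut' vC' k' nyz' dis' vx' cr'] vC dis BE cl cr.
  constructor 3.
  have rY : r \notin Y by move: rV; rewrite inE => /andP[].
  have nbH : nb H r = [set x].
    apply/setP=> u; rewrite in_nb inE; apply/idP/eqP=> [ru|->//].
    have : u \in B by apply: cl ru; rewrite BE in_setU vC.
    rewrite BE in_setU inE => /orP[/eqP ue|uU]; first by rewrite ue E_irr in ru.
    by have [_ ->] := cr r u vC uU ru.
  have nbg := dE kg xr rU.
  have nb2 : #|nb g r :&: Y| = 2.
    have c1 : #|nb g r :\: Y| = 1 by move: (congr1 (fun A : {set T} => #|A|) nbH); rewrite nb_del (negbTE rY) cards1.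
    by have := cardsID Y (nb g r); rewrite nbg c1 addn1 => -[].
  have hitE w : hit g Y w -> exists2 e, e \in Y & E g w e.
    move/asboolP=> [c1 _]; move/eqP/cards1P: c1 => [e eE].
    have : e \in nb g w :&: Y by rewrite eE inE.
    by rewrite in_setI in_nb => /andP[we eY]; exists e.
  have [e eY ye] := hitE y hy; have [e' e'Y ze'] := hitE z hz.
  have eU := K23H_out k eY; have e'U := K23H_out k e'Y.
  exists r, y, z, e, e'; split; last first.
    split; split=> //.
    - apply/eqP=> ee; subst e'; move: eU; rewrite (uset_xy a b x y z) (uset_yz a b y x z).
      exact: (dSm (K23_yz (K23_xy kg)) ye ze').
    - by apply/negP=> re; apply: (dA1 kg xr ye rU eU re).
    - apply/negP=> re; move: rU e'U; rewrite (uset_yz a b x y z) => rU e'U.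
      exact: (dA1 (K23_yz kg) xr ze' rU e'U re).
  split=> //; first by rewrite BE in_setU vC.
  move=> al be ga de kr.
  have rx : E g r x by rewrite E_sym.
  have nbx := K23_exit g3 kg rU xr.
  (* If x were a side of a unit with port r, then y or z would be adjacent to r. *)
  have side al' be' : K23 g al' be' r ga de -> x != al'.
    move=> {al be} {}kr; apply/eqP=> xa; have nba := K23_nba g3 kr; rewrite -xa nbx in nba.
    have [[ur _ _ _] [brE bga bde]] := K23P kr.
    have ga_ab : ga \in [set a; b].
      have : ga \in [set a; b; r] by rewrite nba !inE eqxx ?orbT.
      rewrite !inE => /orP[//|/eqP gr].
      by move: ur; rewrite gr /= !inE eqxx !andbF.
    have beE : be' \in [:: x; y; z].
      move: ga_ab; rewrite in_set2 => /orP[]/eqP gE; rewrite E_sym gE in bga.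
        exact: K23_Ea kg bga.
      exact: K23_Ea (K23_swap kg) bga.
    have bx : be' != x by rewrite xa eq_sym; move: ur; rewrite /= !inE !negb_or => /andP[/andP[-> _] _].
    have rr : r \notin uset a b y x z by rewrite -uset_xy.
    have rr2 : r \notin uset a b x z y by rewrite -uset_yz.
    move: beE; rewrite !inE (negbTE bx) /= => /orP[]/eqP bE; rewrite bE in brE.
      exact: (dSm kg xr brE).
    by apply: (dSm (K23_yz kg) xr brE).
  have xal := side _ _ kr; have xbe := side _ _ (K23_swap kr).
  have [[ur alr alg ald] [ber beg bed]] := K23P kr.
  have nbr : nb g r = [set al; be; x].
    apply: nb_card3; rewrite // 1?E_sym //.
    move: ur; rewrite /= !inE !negb_or => /andP[/andP[-> _] _].
    by rewrite /= eq_sym xal eq_sym xbe.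
  have xU : x \in uset a b x y z by rewrite in_uset eqxx ?orbT.
  have albY c : c \in [set al; be] -> c \in Y.
    move=> cab; apply/negPn/negP=> cY.
    have : c \in nb H r by rewrite nb_del (negbTE rY) in_setD cY nbr in_setU cab.
    rewrite nbH inE => /eqP cx; move: cab; rewrite cx in_set2.
    by rewrite (negbTE xal) (negbTE xbe).
  have alY : al \in Y by apply: albY; rewrite !inE eqxx.
  have beY : be \in Y by apply: albY; rewrite !inE eqxx orbT.
  have alU := K23H_out k alY; have beU := K23H_out k beY.
  have albe : al != be by move: ur; rewrite /= !inE !negb_or => /andP[/andP[-> _] _].
  (* No common neighbour of [al] and [be] lies in the unit of [x], so the two units are disjoint. *)
  have two c : E g al c -> E g be c -> c \notin uset a b x y z.
    move=> ac bc; apply/negP; rewrite in_uset => /or4P[/eqP cE|/eqP cE|/eqP cE|].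
    - have := K23_Ea g3 kg; rewrite -cE E_sym in ac *; move=> /(_ _ ac); move: alU.
      by rewrite in_uset !inE !negb_or => /and5P[_ _ /negbTE-> /negbTE-> /negbTE->].
    - have := K23_Ea g3 (K23_swap kg); rewrite -cE E_sym in ac *; move=> /(_ _ ac); move: alU.
      by rewrite in_uset !inE !negb_or => /and5P[_ _ /negbTE-> /negbTE-> /negbTE->].
    - have : al \in nb g x by rewrite in_nb E_sym -cE.
      rewrite nbx !inE => /orP[/orP[]|]/eqP aE; move: alU; rewrite in_uset aE ?eqxx ?orbT //.
      by rewrite aE E_irr in alr.
    have hit_no w : hit g Y w -> E g al w -> E g be w -> False.
      move/asboolP=> [/eqP/cards1P[f fE] _]; rewrite ![E g _ w]E_sym => aw bw.
      have : al \in nb g w :&: Y by rewrite in_setI in_nb aw.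
      have : be \in nb g w :&: Y by rewrite in_setI in_nb bw.
      by rewrite fE !inE => /eqP bf /eqP af; rewrite af bf eqxx in albe.
    by case/orP=> /eqP cE; rewrite cE in ac bc; [apply: (hit_no y)|apply: (hit_no z)].
  apply: (dA2 kr kg _ rx); rewrite disjoint_subset; apply/subsetP=> c.
  rewrite in_uset inE => /or4P[/eqP ->|/eqP ->|/eqP ->|/orP[]/eqP ->] //; exact: two.
have v'E := attach_root ut' vC' k' dis' vx'; subst v'.
constructor 2.
have [kg' disY'] := K23_del k'.
have r'U : r \notin uset a' b' x' y' z' by rewrite (disjointFr dis').
have disU : [disjoint uset a b x y z & uset a' b' x' y' z'].
  by rewrite disjoint_sym; apply: disjointWl dis; apply: subsetUr.
have clU u : u \in uset a' b' x' y' z' -> forall t, E H u t -> t \in C' :|: uset a' b' x' y' z'.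
  move=> uU t ut; have uC : u \in C' :|: uset a' b' x' y' z' by rewrite in_setU uU orbT.
  have : t \in B by apply: (cl u) => //; rewrite BE in_setU uC.
  rewrite BE in_setU => /orP[//|tU]; have [uv _] := cr u t uC tU ut.
  by move: r'U; rewrite -uv uU.
have yU' : y' \in uset a' b' x' y' z' by rewrite in_uset eqxx ?orbT.
have zU' : z' \in uset a' b' x' y' z' by rewrite in_uset eqxx ?orbT.
have hy' : hit g Y y'.
  apply: (hit_of reduced (K23_xy k')); apply/subsetP=> u; rewrite in_nb => yu.
  by have [] := last_nb H3 k' nyz' vC' dis' vx' cr' yu (clU _ yU' _ yu) => ->; rewrite !inE eqxx ?orbT.
have hz' : hit g Y z'.
  apply: (hit_of reduced (K23_xz k')); apply/subsetP=> u; rewrite in_nb => zu.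
  have uB := clU _ zU' _ zu; have dis2 := dis'; have cr2 := cr'.
  rewrite uset_yz in dis2 cr2; rewrite (uset_yz a' b' x' y' z') in uB; rewrite E_sym in nyz'.
  by have [] := last_nb H3 (K23_yz k') nyz' vC' dis2 vx' cr2 zu uB => ->; rewrite !inE eqxx ?orbT.
have y'nz : y' != z' by case/K23P: (kg') => -[/= /and5P[_ _ _ + _] _ _ _] _; rewrite inE.
have nU u : u \in uset a' b' x' y' z' -> u \notin uset a b x y z by move=> uU; rewrite (disjointFl disU).
exists [set u in [:: y; z; y'; z']].
  apply/subsetP=> u; rewrite !inE => /or4P[]/eqP ->; rewrite BE !in_setU ?yU' ?zU' ?orbT //.
    by rewrite (in_uset a b x y z) eqxx !orbT.
  by rewrite (in_uset a b x y z) eqxx !orbT.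
split.
  rewrite cardsE (card_uniqP _) //= !inE !negb_or ynz y'nz !andbT.
  by have := nU _ yU'; have := nU _ zU'; rewrite !in_uset !negb_or ![_ == y']eq_sym ![_ == z']eq_sym => /and5P[_ _ _ -> ->] /and5P[_ _ _ -> ->].
split; first by move=> w; rewrite !inE => /or4P[]/eqP ->.
exists a, b, x, y, z, a', b', x', y', z', r; split=> //; split=> //.
by rewrite E_sym; case/and3P: vx'.
Qed.

End Ends.

(** * Correctness of the bounds for [sig], level by level *)

Section Bounds.
Variables (T : finType) (x0 : T) (g : gr T).
Hypothesis g3 : sub3 g.
Variable md : nat.
Hypothesis md0 : 0 < md.
Hypothesis mdg : forall x, x \in V g -> md <= #|nb g x|.

Section OneState.
Variables (s : state) (vs : seq T) (Yl : seq nat).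
Hypothesis ms : models x0 g s vs.
Hypothesis uY : uniq Yl.
Hypothesis Ylt : forall i, i \in Yl -> i < size s.
Hypothesis oY : nopen s Yl < md.
Let v i := nth x0 vs i.
Let Y := im x0 vs Yl.

Lemma card_im_le (L : seq nat) : #|im x0 vs L| <= size L.
Proof. by rewrite cardsE; apply: leq_trans (card_size _) _; rewrite size_map. Qed.

Lemma imP (L : seq nat) u : reflect (exists2 i, i \in L & u = v i) (u \in im x0 vs L).
Proof. by rewrite inE; apply: mapP. Qed.

Let Yo := im x0 vs [seq i <- Yl | ~~ cli s i].
Lemma card_Yo : #|Yo| <= nopen s Yl.
Proof. by apply: leq_trans (card_im_le _) _; rewrite size_filter. Qed.

Lemma closed_nb w j : j \in Yl -> cli s j -> E g (v j) w ->
  exists2 i, i < size s & w = v i /\ j \in nbi s i.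
Proof.
move=> jY cj /(m_clE g3 ms (Ylt jY) cj)[i ij ->]; exists i; first exact: (m_lt ms (Ylt jY) ij).
by split=> //; apply: (m_sym ms (Ylt jY) ij).
Qed.

(** Such a vertex has at least [md] neighbours, all in [Y], which is more than the open vertices of
    [Y]; so one of them is closed and lists it. *)
Lemma iso_idx w : isoS g Y w ->
  exists2 i, i < size s & w = v i /\ iso md (nopen s Yl) s Yl i.
Proof.
case/and3P=> wV wY nbY.
have [u unb uo] : exists2 u, u \in nb g w & u \notin Yo.
  apply/subsetPn; apply: contraL (mdg wV) => sub; rewrite -ltnNge.
  by apply: leq_ltn_trans (subset_leq_card sub) _; apply: leq_ltn_trans card_Yo oY.
have /imP[j jY ju] := subsetP nbY _ unb; subst u.
have cj : cli s j.
  by apply: contraNT uo => ncj; apply/imP; exists j; rewrite // mem_filter ncj.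
have jw : E g (v j) w by rewrite E_sym -in_nb.
have [i ilt [wE ji]] := closed_nb jY cj jw; exists i => //; split=> //.
apply/and4P; split.
- by apply: contra wY => iY; rewrite wE; apply/imP; exists i.
- apply/allP=> k ki; have klt := m_lt ms ilt ki; change (k \in Yl); rewrite -(mem_im ms klt Ylt).
  by apply: (subsetP nbY); rewrite in_nb wE; apply: (m_E ms ilt ki).
- by apply: contraTneq ji => ->.
- apply/orP; right; apply: leq_trans (mdg wV) _.
  have sub : nb g w \subset im x0 vs (nbi s i) :|: Yo.
    apply/subsetP=> u unb'; have /imP[k kY uE] := subsetP nbY _ unb'; rewrite in_setU.
    case ck: (cli s k); last by apply/orP; right; apply/imP; exists k; rewrite ?mem_filter ?ck.
    have kw : E g (v k) (v i) by rewrite E_sym -in_nb -wE -uE.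
    apply/orP; left; apply/imP; exists k => //.
    have ik := m_clEi g3 ms (Ylt kY) ilt ck kw; exact: (m_sym ms (Ylt kY) ik).
  apply: leq_trans (subset_leq_card sub) _; rewrite cardsU; apply: leq_trans (leq_subr _ _) _.
  exact: leq_add (card_im_le _) card_Yo.
Qed.

Lemma iso_count : #|[set w | isoS g Y w]| <= count (iso md (nopen s Yl) s Yl) (iota 0 (size s)).
Proof.
rewrite -size_filter; apply: leq_trans (card_im_le _); apply: subset_leq_card.
apply/subsetP=> w; rewrite inE => /iso_idx[i ilt [-> ii]]; apply/imP; exists i => //.
by rewrite mem_filter ii mem_iota.
Qed.

Section Closed.
Hypothesis oY0 : nopen s Yl = 0.

Lemma allcl j : j \in Yl -> cli s j.
Proof.
move=> jY; move/eqP: oY0; rewrite -leqn0 leqNgt -has_count => /hasPn/(_ j jY).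
by rewrite negbK.
Qed.

Lemma nb_Y w e : e \in Y -> E g w e -> exists i j, [/\ i < size s, w = v i, j \in Yl, e = v j & j \in nbi s i].
Proof.
move=> /imP[j jY ->]; rewrite E_sym => /(closed_nb jY (allcl jY))[i ilt [wE ji]].
by exists i, j.
Qed.

Lemma ycntE i : i < size s -> #|nb g (v i) :&: Y| = ycnt s Yl i.
Proof.
move=> ilt; apply/eqP; rewrite eqn_leq; apply/andP; split; last by have [] := card_nb_im g3 ms ilt Ylt.
rewrite /ycnt -size_filter; apply: leq_trans (card_im_le _); apply: subset_leq_card.
apply/subsetP=> u; rewrite in_setI in_nb => /andP[iu uY'].
have [k [j [klt kE jY uE jk]]] := nb_Y uY' iu; apply/imP; exists j => //.
by rewrite mem_filter /= jY (m_inj ms ilt klt kE).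
Qed.

Lemma hit_sides w a b y z : #|nb g w :&: Y| = 1 -> K23 (del g Y) a b w y z -> nb g w :\: Y = [set a; b].
Proof.
move=> c1 k; have [kg dis] := K23_del k.
have [[ku _ _ _] _] := K23P k.
have ab : a != b by move: ku; rewrite /= !inE !negb_or => /andP[/andP[]].
apply/eqP; rewrite eq_sym eqEcard; apply/andP; split.
  apply/subsetP=> u; rewrite in_set2 in_setD in_nb; case/K23P: kg => -[_ aw _ _] [bw _ _].
  by case/orP=> /eqP ->; rewrite E_sym ?aw ?bw andbT (disjointFr dis) // in_uset eqxx ?orbT.
rewrite cards2 ab -ltnS -add1n -{1}c1 cardsID; exact: g3.
Qed.

(** The deleted neighbour of [w] is closed and lists [w]. The remaining neighbours of [w] are
    exactly the two sides, and each clause of [hitp] is a consequence for them. *)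
Lemma hit_idx w : hit g Y w -> exists2 i, i < size s & w = v i /\ hitp s Yl i.
Proof.
move/asboolP=> [c1 [a [b [y [z k]]]]]; have [kg dis] := K23_del k.
have sd := hit_sides c1 k.
have [e] : exists e, e \in nb g w :&: Y by apply/card_gt0P; rewrite c1.
rewrite in_setI in_nb => /andP[we eY].
have [i [j [ilt wE jY eE ji]]] := nb_Y eY we; exists i => //; split=> //.
have wY : w \notin Y by rewrite (disjointFr dis) // in_uset eqxx ?orbT.
have nY c : c \in nb g a -> c \notin Y.
  rewrite (K23_nba g3 kg) -setUA !in_setU !in_set1 => cc; rewrite (disjointFr dis) // in_uset.
  by case/or3P: cc => /eqP ->; rewrite eqxx ?orbT.
have nab c : c \in [set a; b] -> nb g c = nb g a.
  by rewrite in_set2 => /orP[]/eqP -> //; rewrite (K23_nba g3 kg) (K23_nbb g3 kg).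
have outP c : c \in outs s Yl i -> [/\ c < size s, c \in nbi s i, v c \in [set a; b] & c \notin Yl].
  rewrite mem_filter => /andP[cY ci]; have clt := m_lt ms ilt ci; split=> //.
  rewrite -sd in_setD in_nb wE; rewrite (m_E ms ilt ci) andbT.
  by rewrite (mem_im ms clt Ylt).
have card_a : #|nb g a| = 3.
  have [[ku _ _ _] _] := K23P kg.
  have -> : nb g a = [set u in [:: w; y; z]] by rewrite (K23_nba g3 kg); apply/setP=> u; rewrite !inE orbA.
  by rewrite cardsE (card_uniqP _) //; move: ku => /= /and3P[].
apply/and4P; split.
- by apply: contra wY => iY; rewrite wE; apply/imP; exists i.
- by rewrite -ycntE // -wE c1.
- apply/allP=> c cO; have [clt ci vc cY] := outP c cO; apply/andP; split.
    rewrite -ycntE // cards_eq0 -subset0; apply/subsetP=> u; rewrite in_setI (nab _ vc).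
    by case/andP=> /nY/negbTE ->.
  by case cc: (cli s c) => //=; rewrite -(m_deg g3 ms clt cc) (nab _ vc) card_a.
case ci: (cli s i) => //=.
have oE : im x0 vs (outs s Yl i) = [set a; b].
  rewrite -sd; apply/setP=> u; apply/imP/idP=> [[c cO ->]|].
    by have [_ _ vc _] := outP c cO; rewrite sd.
  rewrite in_setD in_nb wE => /andP[uY' /(m_clE g3 ms ilt ci)[c ic uE]]; exists c => //.
  rewrite mem_filter ic andbT; apply: contra uY' => cY; rewrite uE; by apply/imP; exists c.
have uO : uniq (outs s Yl i) by rewrite filter_uniq // (m_uniq ms).
have sO : size (outs s Yl i) = 2.
  rewrite -(card_im ms uO); last by move=> c /outP[].
  have [[ku _ _ _] _] := K23P kg.
  by rewrite oE cards2; move: ku; rewrite /= !inE !negb_or => /andP[/andP[-> _] _].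
move: outP; case: (outs s Yl i) sO => [|c [|d [|//]]] // _ outP.
have [clt ic vc cY] : [/\ c < size s, c \in nbi s i, v c \in [set a; b] & c \notin Yl] by apply: outP; rewrite !inE eqxx.
have [dlt id' vd dY] : [/\ d < size s, d \in nbi s i, v d \in [set a; b] & d \notin Yl] by apply: outP; rewrite !inE eqxx orbT.
have ncd : nb g (v c) = nb g (v d) by rewrite !nab.
have hf p q : p < size s -> q < size s -> nb g (v p) = nb g (v q) -> half s i p q.
  move=> plt qlt pq; apply/allP=> l lp; apply/or3P.
  have llt := m_lt ms plt lp.
  have ql : E g (v q) (v l) by rewrite -in_nb -pq in_nb; apply: (m_E ms plt lp).
  case cq: (cli s q); first by constructor 2; apply: (m_clEi g3 ms).
  case cl: (cli s l); last by constructor 3.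
  by constructor 2; apply: (m_sym ms llt); apply: (m_clEi g3 ms) => //; rewrite E_sym.
apply/and4P; split.
- apply/negP=> dc; have := m_E ms clt dc; rewrite -/(v c) -/(v d) -in_nb ncd in_nb E_irr //.
- exact: hf.
- exact: hf.
have ul := undup_uniq (nbi s c ++ nbi s d).
rewrite -(card_im ms ul); last by move=> l; rewrite mem_undup mem_cat => /orP[/(m_lt ms clt)|/(m_lt ms dlt)].
rewrite -card_a; apply: subset_leq_card; apply/subsetP=> u /imP[l].
by rewrite mem_undup mem_cat -(nab _ vc) => /orP[] kk ->; [|rewrite ncd]; rewrite in_nb; [apply: (m_E ms clt kk)|apply: (m_E ms dlt kk)].
Qed.

Lemma hits_im w : hit g Y w -> w \in im x0 vs (hits s Yl).
Proof. by case/hit_idx=> i ilt [-> hi]; apply/imP; exists i; rewrite // mem_filter hi mem_iota. Qed.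

Lemma hit_count : #|[set w | hit g Y w]| <= size (hits s Yl).
Proof.
apply: leq_trans (card_im_le _); apply: subset_leq_card.
by apply/subsetP=> w; rewrite inE => /hits_im.
Qed.

Lemma hityv_im w e : hit g Y w -> e \in Y -> E g w e -> exists2 j, j \in hityv s Yl & e = v j.
Proof.
move=> /hit_idx[i ilt [wE hi]] eY we; have [k [j [klt kE jY eE jk]]] := nb_Y eY we.
exists j => //; rewrite mem_undup; apply/flattenP; exists [seq a <- nbi s i | a \in Yl].
  by apply/mapP; exists i; rewrite // mem_filter hi mem_iota.
have ik : i = k by apply: (m_inj ms ilt klt); rewrite -/(v i) -/(v k) -wE.
by rewrite mem_filter jY ik.
Qed.

Lemma kport_no w i : i < size s -> w = v i -> (forall a b y z, ~ K23 g a b w y z) -> ~~ kport s i.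
Proof.
move=> ilt wE nk; apply/negP=> /hasP[a ai /andP[/eqP sa /hasP[b bi /and3P[ab /eqP sb /allP sub]]]].
have alt := m_lt ms ilt ai; have blt := m_lt ms ilt bi.
have ua := m_uniq ms alt; have ia := m_sym ms ilt ai.
have pr := perm_to_rem ia; have sr : size (rem i (nbi s a)) = 2 by rewrite size_rem // sa.
have ur : uniq (i :: rem i (nbi s a)) by rewrite -(perm_uniq pr).
case rE: (rem i (nbi s a)) sr pr ur => [|y [|z [|//]]] // _ pr ur.
have inP k : k \in [:: i; y; z] -> k \in nbi s a by rewrite -(perm_mem pr).
have ya : y \in nbi s a by apply: inP; rewrite !inE eqxx orbT.
have za : z \in nbi s a by apply: inP; rewrite !inE eqxx !orbT.
have ylt := m_lt ms alt ya; have zlt := m_lt ms alt za.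
apply: (nk (v a) (v b) (v y) (v z)); rewrite wE; apply/and5P.
have EE p k : p < size s -> k \in nbi s p -> E g (v p) (v k) by move=> plt pk; apply: (m_E ms plt pk).
split; try exact: EE; last by apply/and3P; split; apply: EE => //; apply: sub.
have nb_n p q : p < size s -> q \in nbi s p -> p != q.
  by move=> plt pq; have := E_neq (m_E ms plt pq); apply: contraNneq => ->.
apply: (@inj_map_v _ x0 g s vs ms [:: a; b; i; y; z]).
  have bP k : k \in nbi s a -> b != k by move=> ka; apply: nb_n => //; apply: sub.
  by rewrite cons_uniq cons_uniq ur andbT !inE !negb_or ab !(nb_n a) // !bP.
by move=> k; rewrite !inE => /or4P[/eqP->|/eqP->|/eqP->|/orP[]/eqP->].
Qed.

End Closed.
End OneState.

Definition bnd_sound lv := forall s vs (Y : seq nat), models x0 g s vs -> uniq Y ->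
  (forall i, i \in Y -> i < size s) -> nopen s Y < md -> (5 < lv) || (nopen s Y == 0) ->
  sig (del g (im x0 vs Y)) <= bnd lv md s Y.

Lemma sum_ind_card (p : pred T) : \sum_h (p h : nat) = #|[set h | p h]|.
Proof. by rewrite -sum1_card [RHS]big_mkcond; apply: eq_bigr => h _; rewrite inE; case: (p h). Qed.

Lemma sum_mem_ge (om : T -> nat) (B : {set T}) w : w \in B -> om w <= \sum_(h in B) om h.
Proof. by move=> wB; rewrite (bigD1 w) //= leq_addr. Qed.

(** A member all of whose vertices kept their neighbours would already be a member of [g]. *)
Lemma bnd_sound0 : (forall B, ~ bt g B) -> bnd_sound 0.
Proof.
move=> nob s vs Y ms uY Ylt oY /= /eqP oY0; set Ys := im x0 vs Y.
pose bd w := (w \notin Ys) && (nb g w :&: Ys != set0).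
have mB B : bt (del g Ys) B -> 1 <= \sum_(h in B) (bd h : nat).
  move=> bB; have BV : B \subset V (del g Ys).
    case: bB => [[r [us [ut _]]]|[v1 [v2 [w2 [C [us [[ut _ v12 _] [[_ _ _ _ ->] _]]]]]]]].
      exact: utree_V ut.
    by rewrite subUset sub1set (E_Vr v12) (utree_V ut).
  have [/exists_inP[w wB bw]|nb0] := boolP [exists w in B, bd w].
    by apply: leq_trans (sum_mem_ge _ wB); rewrite bw.
  case: (nob B); apply: (bt_eq _ _ bB) => [w wB|].
    have wY : w \notin Ys by have := subsetP BV _ wB; rewrite in_setD => /andP[].
    rewrite nb_del (negbTE wY); apply/esym/setDidPl; rewrite -setI_eq0.
    by apply: contraNT nb0 => nz; apply/exists_inP; exists w; rewrite // /bd wY.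
  by apply: subset_trans BV (subsetDl _ _).
have := sig_weight mB; rewrite mul1n => /leq_trans -> //; rewrite sum_ind_card.
rewrite -size_filter; apply: leq_trans (card_im_le vs _); apply: subset_leq_card.
apply/subsetP=> w; rewrite inE => /andP[wY /set0Pn[e]]; rewrite in_setI in_nb => /andP[we eY].
have [i [j [ilt wE jY eE ji]]] := nb_Y ms Ylt oY0 eY we; apply/imP; exists i => //.
rewrite mem_filter mem_iota /= add0n ilt andbT; apply/andP; split.
  by apply: contra wY => iY; rewrite wE; apply/imP; exists i.
by rewrite /ycnt -has_count; apply/hasP; exists j.
Qed.

Section Reduced.
Hypothesis reduced : forall a b x y z, K23 g a b x y z -> #|nb g x| = 3.

Lemma bnd_sound1 : bnd_sound 1.
Proof.
move=> s vs Y ms uY Ylt oY /= /eqP oY0; set Ys := im x0 vs Y.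
pose om h := (isoS g Ys h : nat) + (h \in im x0 vs (fhits s Y)).
have mB B : bt (del g Ys) B -> 1 <= \sum_(h in B) om h.
  move/(bt_end1 g3 reduced)=> [[w wB iw]|[a [b [w [y [z [k /subsetP sub hw]]]]]]].
    by apply: leq_trans (sum_mem_ge _ wB); rewrite /om iw.
  have [i ilt [wE hi]] := hit_idx ms Ylt oY0 hw.
  have sB c : E (del g Ys) a c -> c \in B.
    move/(K23_Ea (sub3_del _ g3) k) => cc; apply: sub; rewrite in_uset.
    by move: cc; rewrite !inE => /or3P[]->; rewrite ?orbT.
  have wB : w \in B by apply: sub; rewrite in_uset eqxx ?orbT.
  suff [j jf jB] : exists2 j, j \in fhits s Y & nth x0 vs j \in B.
    apply: leq_trans (sum_mem_ge _ jB); rewrite /om.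
    have -> : nth x0 vs j \in im x0 vs (fhits s Y) by apply/imP; exists j.
    by rewrite addn1.
  have aw : E (del g Ys) w a by rewrite E_sym; case/K23P: k => -[].
  have bw : E (del g Ys) w b by rewrite E_sym; case/K23P: k => _ [].
  have aY : a \notin Ys by case/and3P: aw.
  have bY : b \notin Ys by case/and3P: bw.
  pose good i := [/\ i < size s, hitp s Y i, E g (nth x0 vs i) a & E g (nth x0 vs i) b].
  have goodB j : good j -> nth x0 vs j \in B.
    case=> jlt hj ja jb; apply: sB; rewrite /= /del_edge E_sym ja aY /=.
    by case/and4P: hj => jY _ _ _; rewrite (mem_im ms jlt Ylt).
  have gi : good i by split; rewrite // -wE; [case/and3P: aw|case/and3P: bw].
  (* Descend to earlier closed hits with the same sides until [fhits] keeps one; being adjacent to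
     the side [a], it still lies in [B]. *)
  move: gi; have [n] := ubnP i; elim: n i {ilt wE hi} => // n IH i lt_in gi.
  have [ilt hi ia ib] := gi.
  have ihit : i \in hits s Y by rewrite mem_filter hi mem_iota.
  have [|nf] := boolP (cli s i && has (fun w' => [&& w' < i, cli s w' & all (mem (outs s Y w')) (outs s Y i)]) (hits s Y)); last first.
    by exists i; [rewrite mem_filter nf|apply: goodB].
  case/andP=> ci /hasP[j]; rewrite mem_filter mem_iota => /andP[hj /= jlt] /and3P[ji cj /allP sub'].
  have adj c : c \notin Ys -> E g (nth x0 vs i) c -> E g (nth x0 vs j) c.
    move=> cY /(m_clE g3 ms ilt ci)[l li cE]; have llt := m_lt ms ilt li.
    have : l \in outs s Y j.
      by apply: sub'; rewrite mem_filter li andbT -(mem_im ms llt Ylt) -cE.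
    by rewrite mem_filter cE => /andP[_ lj]; apply: (m_E ms).
  apply: (IH j); first exact: leq_trans ji lt_in.
  by split=> //; apply: adj.
have := sig_weight mB; rewrite mul1n => /leq_trans -> //.
rewrite big_split /= !sum_ind_card; apply: leq_add; first exact: (iso_count ms Ylt oY).
apply: leq_trans (card_im_le vs _); apply: subset_leq_card.
by apply/subsetP=> h; rewrite inE.
Qed.

Hypothesis dA1 : forall a b x y z p q, K23 g a b x y z -> E g x p -> E g y q ->
  p \notin uset a b x y z -> q \notin uset a b x y z -> E g p q -> False.

(** A vertex that becomes isolated is charged 2 and a hit 1; every member carries a charge of at
    least 2. *)
Lemma bnd_half s vs (Y : seq nat) : models x0 g s vs -> (forall i, i \in Y -> i < size s) ->
  nopen s Y < md -> nopen s Y = 0 ->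
  sig (del g (im x0 vs Y)) <= count (iso md (nopen s Y) s Y) (iota 0 (size s)) + (size (hits s Y))./2.
Proof.
move=> ms Ylt oY oY0; set Ys := im x0 vs Y.
pose om h := 2 * (isoS g Ys h : nat) + (hit g Ys h).
have mB B : bt (del g Ys) B -> 2 <= \sum_(h in B) om h.
  move/(bt_two_hits g3 reduced dA1)=> [[w wB iw]|[w [w' [wB w'B ww hw hw']]]].
    by apply: leq_trans (sum_mem_ge _ wB); rewrite /om iw.
  rewrite (bigD1 w) //= (bigD1 w') /=; last by rewrite w'B eq_sym.
  by rewrite /om hw hw' !addn1 addSn addnS !ltnS leq0n.

have := sig_weight mB; rewrite big_split /= -big_distrr /= !sum_ind_card.
have := iso_count ms Ylt oY; have := hit_count ms Ylt oY0; rewrite -/Ys.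
by move: #|_| #|_| (sig _) (count _ _) (size _) => *; lia.
Qed.

Lemma bnd_sound2 : bnd_sound 2.
Proof. by move=> s vs Y ms uY Ylt oY /= /eqP oY0; apply: bnd_half. Qed.

Hypothesis dSm : forall a b x y z p, K23 g a b x y z -> E g x p -> E g y p ->
  p \notin uset a b x y z -> False.

(** If all hits lose the same vertex of [Y], no member can contain two hits with different deleted
    neighbours. *)
Lemma bnd_sound3 :
  (forall a b x y z a' b' x' y' z' p, K23 g a b x y z -> K23 g a' b' x' y' z' ->
  [disjoint uset a b x y z & uset a' b' x' y' z'] -> E g x x' -> E g y p -> E g y' p ->
  p \notin uset a b x y z -> p \notin uset a' b' x' y' z' -> False) -> bnd_sound 3.
Proof.
move=> dB s vs Y ms uY Ylt oY /= /eqP oY0; case: ifP => h1; last exact: bnd_half.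
rewrite addn0; set Ys := im x0 vs Y.
have mB B : bt (del g Ys) B -> 1 <= \sum_(h in B) (isoS g Ys h : nat).
  move/(bt_far_hits g3 reduced dA1 dSm dB)=> [[w wB iw]|[w [w' [hw hw' far]]]].
    by apply: leq_trans (sum_mem_ge _ wB); rewrite iw.
  have he u : hit g Ys u -> exists2 e, e \in Ys & E g u e.
    move/asboolP=> [/eqP/cards1P[e eE] _]; have : e \in nb g u :&: Ys by rewrite eE inE.
    by rewrite in_setI in_nb => /andP[ue eY]; exists e.
  have [e eY we] := he _ hw; have [e' e'Y we'] := he _ hw'.
  have [j jh eE] := hityv_im ms Ylt oY0 hw eY we.
  have [j' jh' eE'] := hityv_im ms Ylt oY0 hw' e'Y we'.
  case: (far e) => //; rewrite eE; suff -> : j = j' by rewrite -eE'.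
  by move: h1 jh jh'; case: (hityv s Y) => [//|c [|//]] _; rewrite !inE => /eqP -> /eqP ->.
have := sig_weight mB; rewrite mul1n sum_ind_card => /leq_trans -> //.
exact: (iso_count ms Ylt oY).
Qed.

Section Roots.
Hypothesis dA2 : forall a b x y z a' b' x' y' z', K23 g a b x y z -> K23 g a' b' x' y' z' ->
  [disjoint uset a b x y z & uset a' b' x' y' z'] -> E g x x' -> False.
Hypothesis dE : forall a b x y z p, K23 g a b x y z -> E g x p -> p \notin uset a b x y z -> #|nb g p| = 3.

Lemma root_idx s vs (Y : seq nat) r w w' e e' : models x0 g s vs -> (forall i, i \in Y -> i < size s) ->
  nopen s Y = 0 -> let Ys := im x0 vs Y in
  [/\ r \notin Ys, #|nb g r :&: Ys| = 2 & forall a b y z, ~ K23 g a b r y z] ->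
  [/\ hit g Ys w, hit g Ys w', e \in Ys, e' \in Ys & E g w e] ->
  [/\ E g w' e', e != e', ~~ E g r e & ~~ E g r e'] ->
  r \in im x0 vs [seq i <- iota 0 (size s) | root1 s Y i].
Proof.
move=> ms Ylt oY0 Ys [rY c2 nk] [hw hw' eY e'Y we] [we' ee re re'].
have [f] : exists f, f \in nb g r :&: Ys by apply/card_gt0P; rewrite c2.
rewrite in_setI in_nb => /andP[rf fY].
have [i [k [ilt rE kY fE ki]]] := nb_Y ms Ylt oY0 fY rf; apply/imP; exists i => //.
rewrite mem_filter mem_iota /= add0n ilt andbT; apply/and4P; split.
- by apply: contra rY => iY; rewrite rE; apply/imP; exists i.
- exact: (kport_no ms ilt rE).
- by rewrite -(ycntE ms Ylt oY0 ilt) -rE c2.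
have [j jh eE] := hityv_im ms Ylt oY0 hw eY we.
have [j' jh' eE'] := hityv_im ms Ylt oY0 hw' e'Y we'.
have nj l d : nth x0 vs l = d -> ~~ E g r d -> l \notin nbi s i.
  by move=> lE; apply: contra => li; rewrite rE -lE; apply: (m_E ms ilt li).
rewrite -size_filter; have u2 : uniq [:: j; j'].
  by rewrite /= inE andbT; apply: contraNneq ee => jj; rewrite eE eE' jj.
apply: (uniq_leq_size u2) => l; rewrite !inE => /orP[]/eqP ->; rewrite mem_filter ?jh ?jh' andbT.
  exact: (nj j e).
exact: (nj j' e').
Qed.

(** With 4 charged to a possible root and 1 to a hit, a star with two units is paid by its four hits
    and a star with one unit by its root. *)
Lemma bnd_sound4 : bnd_sound 4.
Proof.
move=> s vs Y ms uY Ylt oY /= /eqP oY0.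
rewrite addn_minr leq_min bnd_half //=; set Ys := im x0 vs Y.
set R := im x0 vs [seq i <- iota 0 (size s) | root1 s Y i].
pose om h := 4 * (isoS g Ys h : nat) + (4 * (h \in R) + (hit g Ys h)).
have mB B : bt (del g Ys) B -> 4 <= \sum_(h in B) om h.
  move/(bt_root g3 reduced dA1 dSm dA2 dE)=> [[w wB iw]|[h sub [h4 [hh _]]]|].
  - by apply: leq_trans (sum_mem_ge _ wB); rewrite /om iw.
  - apply: leq_trans h4 _; rewrite -sum1_card [X in _ <= X](big_setID h) /= (setIidPr sub).
    apply: leq_trans (leq_addr _ _); apply: leq_sum => w /hh hw; rewrite /om hw addn1 addnS //.
  - case=> r [w [w' [e [e' [[rB rY c2 nk] [p1 p2]]]]]].
    apply: leq_trans (sum_mem_ge _ rB); rewrite /om.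
    have -> : r \in R by apply: (root_idx ms Ylt oY0 _ p1 p2).
    by lia.
have omE : \sum_h om h = 4 * #|[set h | isoS g Ys h]| + (4 * #|[set h | h \in R]| + #|[set h | hit g Ys h]|).
  by rewrite -!sum_ind_card !big_distrr /= -!big_split.
have := sig_weight mB; rewrite omE.
have := iso_count ms Ylt oY; have := hit_count ms Ylt oY0.
have := card_im_le vs [seq i <- iota 0 (size s) | root1 s Y i]; rewrite size_filter.
have -> : #|[set h | h \in R]| = #|R| by apply: eq_card => h; rewrite inE.
rewrite -/Ys -/R.
rewrite -[count [eta root1 _ _] _]/(count (root1 s Y) _).
move: (size (hits s Y)) (count (root1 s Y) _) (count (iso _ _ _ _) _) (sig _) => n1 n2 n3 n4.
by move: #|R| #|[set h | isoS g Ys h]| #|[set h | hit g Ys h]| => *; lia.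
Qed.

(** Two units at a common root are now excluded, so every member without an isolated vertex has a
    root satisfying [root1]. *)
Lemma bnd_sound5 :
  (forall a b x y z a' b' x' y' z' r, K23 g a b x y z -> K23 g a' b' x' y' z' ->
    [disjoint uset a b x y z & uset a' b' x' y' z'] -> E g x r -> E g x' r ->
    r \notin uset a b x y z -> r \notin uset a' b' x' y' z' -> False) -> bnd_sound 5.
Proof.
move=> dA3 s vs Y ms uY Ylt oY /= /eqP oY0.
rewrite addn_minr leq_min bnd_half //=; set Ys := im x0 vs Y.
set R := im x0 vs [seq i <- iota 0 (size s) | root1 s Y i].
pose om h := (isoS g Ys h : nat) + (h \in R).
have mB B : bt (del g Ys) B -> 1 <= \sum_(h in B) om h.
  move/(bt_root g3 reduced dA1 dSm dA2 dE)=> [[w wB iw]|[h sub [_ [_]]]|].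
  - by apply: leq_trans (sum_mem_ge _ wB); rewrite /om iw.
  - case=> a [b [x [y [z [a' [b' [x' [y' [z' [r [[k k' dis xr xr'] [rU rU']]]]]]]]]]]].
    by case: (dA3 _ _ _ _ _ _ _ _ _ _ _ k k' dis xr xr' rU rU').
  - case=> r [w [w' [e [e' [[rB rY c2 nk] [p1 p2]]]]]].
    apply: leq_trans (sum_mem_ge _ rB); rewrite /om.
    have -> : r \in R by apply: (root_idx ms Ylt oY0 _ p1 p2).
    by rewrite addn1.
have := sig_weight mB; rewrite mul1n => /leq_trans -> //.
rewrite big_split /= !sum_ind_card; apply: leq_add; first exact: (iso_count ms Ylt oY).
rewrite -size_filter; apply: leq_trans (card_im_le vs _); apply: subset_leq_card.
by apply/subsetP=> h; rewrite inE.
Qed.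
End Roots.
End Reduced.

Lemma bnd_sound6 : (forall a b x y z, ~ K23 g a b x y z) -> bnd_sound 6.
Proof.
move=> noK s vs Y ms uY Ylt oY _; set Ys := im x0 vs Y.
have red a b x y z : K23 g a b x y z -> #|nb g x| = 3 by move/noK.
have mB B : bt (del g Ys) B -> 1 <= \sum_(h in B) (isoS g Ys h : nat).
  move/(bt_end1 g3 red)=> [[w wB iw]|[a [b [w [y [z [/K23_del[/noK]]]]]]]] //.
  by apply: leq_trans (sum_mem_ge _ wB); rewrite iw.
have := sig_weight mB; rewrite mul1n sum_ind_card => /leq_trans -> //.
exact: (iso_count ms Ylt oY).
Qed.

End Bounds.

(** * Transfer of trees between graphs, and counting in trees of units *)

Section Trees.
Variable T : finType.
Implicit Types (g : gr T) (B C X J : {set T}).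

Lemma K23_sub g g' C a b x y z : (forall c d, c \in C -> d \in C -> E g c d = E g' c d) ->
  uset a b x y z \subset C -> K23 g a b x y z = K23 g' a b x y z.
Proof.
move=> agr /subsetP sub; have inC u : u \in [:: a; b; x; y; z] -> u \in C by move=> uu; apply: sub; rewrite inE.
by rewrite /K23 !agr ?inC ?inE ?eqxx ?orbT.
Qed.

(** Unlike [utree_eq], this compares only the edges inside the tree, so its vertices may have other
    outside neighbours in the two graphs. *)
Lemma utree_sub g g' r C us : (forall c d, c \in C -> d \in C -> E g c d = E g' c d) ->
  C \subset V g -> utree g' r C us -> utree g r C us.
Proof.
move=> + + ut; elim: ut => {C us} [rV'|C us v a b x y z ut IH vC k nyz dis vx cr] agr CV.
  by apply: ut0; move: CV; rewrite sub1set.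
have agrU c d : c \in C :|: uset a b x y z -> d \in C :|: uset a b x y z -> E g c d = E g' c d by apply: agr.
have uU u : u \in uset a b x y z -> u \in C :|: uset a b x y z by move=> uu; rewrite in_setU uu orbT.
have uC u : u \in C -> u \in C :|: uset a b x y z by move=> uu; rewrite in_setU uu.
have inU u : u \in [:: a; b; x; y; z] -> u \in C :|: uset a b x y z by move=> uu; apply: uU; rewrite inE.
apply: (utS (v := v)) => //.
- apply: IH => [c d cC dC|]; first by rewrite (agrU _ _ (uC _ cC) (uC _ dC)).
  by move: CV; rewrite subUset => /andP[].
- by rewrite (K23_sub agr) // subsetUr.
- by rewrite (agrU _ _ (inU y _) (inU z _)) // !inE eqxx ?orbT.
- by rewrite (agrU _ _ (uC _ vC) (inU x _)) // !inE eqxx ?orbT.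
- by move=> c u cC uu; rewrite (agrU _ _ (uC _ cC) (uU _ uu)); apply: cr.
Qed.

Lemma bt2_sub g g' B v1 v2 w2 C us :
  [/\ utree g' v1 C us, v2 \notin C, E g' v1 v2 & E g' v2 w2] ->
  [/\ w2 \in C, w2 != v1, #|nb g' w2 :&: C| = 2, #|nb g' v1 :&: C| = 1 & B = v2 |: C] ->
  [/\ forall c, c \in C -> c != v1 -> nb g' c \subset B,
      nb g' v2 :&: C = [set v1; w2] & #|nb g v2| = 3] ->
  B \subset V g -> (forall c d, c \in B -> d \in B -> E g c d = E g' c d) ->
  (forall c u, c \in C -> c != v1 -> E g c u -> u \in B) -> bt2 g B.
Proof.
move=> [ut v2C v12 v2w2] [w2C w21 nw2 nv1 BE] [nbC nv2 d3] BV agr cl.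
have cB c : c \in C -> c \in B by move=> cC; rewrite BE in_setU cC orbT.
have v2B : v2 \in B by rewrite BE in_setU in_set1 eqxx.
have v1C := utree_r ut.
have nbE c : c \in B -> nb g c :&: C = nb g' c :&: C.
  move=> cB'; apply/setP=> u; rewrite !in_setI !in_nb; case uC: (u \in C); rewrite ?andbF //.
  by rewrite !andbT (agr _ _ cB' (cB _ uC)).
exists v1, v2, w2, C, us; split; [split=> //|split; split=> //].
- apply: utree_sub ut => [c d cC dC|]; first by rewrite agr ?cB.
  by apply: subset_trans BV; apply/subsetP.
- by rewrite (agr _ _ (cB _ v1C) v2B).
- by rewrite (agr _ _ v2B (cB _ w2C)).
- by rewrite nbE ?cB.
- by rewrite nbE ?cB.
- by move=> c cC c1; apply/subsetP=> u; rewrite in_nb; apply: cl.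
- by rewrite nbE.
Qed.

Lemma bt_V g B : bt g B -> B \subset V g.
Proof.
case=> [[r [us [ut _]]]|[v1 [v2 [w2 [C [us [[ut _ v12 _] [[_ _ _ _ ->] _]]]]]]]].
  exact: utree_V ut.
by rewrite subUset sub1set (E_Vr v12) (utree_V ut).
Qed.

Lemma bt_n0 g B : bt g B -> exists c, c \in B.
Proof.
case=> [[r [us [ut _]]]|[v1 [v2 [w2 [C [us [[ut _ v12 _] [[_ _ _ _ ->] _]]]]]]]].
  by exists r; apply: utree_r ut.
by exists v2; rewrite in_setU in_set1 eqxx.
Qed.

Lemma sig0 g : (forall B, ~ bt g B) -> sig g = 0.
Proof.
move=> nob; have [P [_ bP] <-] := sig_wit g.
by apply/eqP; rewrite cards_eq0 -subset0; apply/subsetP=> B /bP /nob.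
Qed.

(** A maximum packing of [g'] together with [B] is a packing of [g]. *)
Lemma sig_drop g g' B : bt g B ->
  (forall B', bt g' B' -> bt g B' /\ [disjoint B' & B]) -> sig g' + 1 <= sig g.
Proof.
move=> bB h; have [P [tP bP] <-] := sig_wit g'.
have nBP : B \notin P.
  apply/negP=> /bP /h[_]; have [c cB] := bt_n0 bB.
  by move/disjointFr/(_ cB); rewrite cB.
have -> : #|P| + 1 = #|B |: P| by rewrite cardsU1 nBP addnC.
apply: sig_ge; split=> [|B']; last by rewrite in_setU1 => /orP[/eqP -> //|/bP/h[]].
apply/trivIsetP=> B1 B2; rewrite !in_setU1 => /orP[/eqP ->|B1P] /orP[/eqP ->|B2P].
- by rewrite eqxx.
- by move=> _; rewrite disjoint_sym; have [] := h _ (bP _ B2P).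
- by move=> _; have [] := h _ (bP _ B1P).
- by move=> ne; move/trivIsetP: tP; apply.
Qed.

Section Sub3.
Variable g : gr T.
Hypothesis g3 : sub3 g.

Lemma sum_uset (a b x y z : T) (F : T -> nat) : uniq [:: a; b; x; y; z] ->
  \sum_(u in uset a b x y z) F u = F a + F b + F x + F y + F z.
Proof.
move=> u; transitivity (\sum_(i <- [:: a; b; x; y; z]) F i).
  by rewrite [RHS]big_uniq //=; apply: eq_bigl => w; rewrite inE.
by rewrite !big_cons big_nil addn0 !addnA.
Qed.

Lemma card_uset (a b x y z : T) : uniq [:: a; b; x; y; z] -> #|uset a b x y z| = 5.
Proof. by move=> u; rewrite -sum1_card (sum_uset (fun=> 1) u). Qed.

(** Each unit brings five vertices and seven edges, six of its own and the link. *)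
Lemma utree_stats r C us : utree g r C us ->
  #|C| = 5 * size us + 1 /\ \sum_(c in C) #|nb g c :&: C| <= 14 * size us.
Proof.
elim=> {C us} [rV|C us v a b x y z ut [IH1 IH2] vC k nyz dis vx cr] /=.
  rewrite cards1; split=> //; rewrite big_set1 leqn0 cards_eq0 -subset0; apply/subsetP=> u.
  by rewrite in_setI in_nb in_set1 => /andP[ru /eqP uE]; rewrite uE E_irr in ru.
have [[ku _ _ _] _] := K23P k.
set U := uset a b x y z in dis cr *; have cU : #|U| = 5 by apply: card_uset.
have CU0 : C :&: U = set0 by apply/eqP; rewrite setI_eq0.
split; first by rewrite cardsU CU0 cards0 IH1 cU; clear; lia.
have split_sum F : \sum_(c in C :|: U) F c = \sum_(c in C) F c + \sum_(c in U) F c.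
  by rewrite -bigU //=; apply: eq_bigl => c; rewrite !inE.
rewrite split_sum.
have le1 : \sum_(c in C) #|nb g c :&: (C :|: U)| <= 14 * size us + 1.
  apply: (@leq_trans (\sum_(c in C) (#|nb g c :&: C| + (c == v)))).
    apply: leq_sum => c cC; rewrite setIUr cardsU; apply: leq_trans (leq_subr _ _) _.
    rewrite leq_add2l; have [->|cv] := eqVneq c v.
      apply: (@leq_trans #|[set x]|); last by rewrite cards1.
      apply: subset_leq_card; apply/subsetP=> u; rewrite in_setI in_nb in_set1.
      by case/andP=> vu uU; have [_ ->] := cr _ _ vC uU vu.
    rewrite leqn0 cards_eq0 -subset0; apply/subsetP=> u; rewrite in_setI in_nb => /andP[cu uU].
    by have [cv' _] := cr _ _ cC uU cu; rewrite cv' eqxx in cv.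
  rewrite big_split /= leq_add // (bigD1 v) //= eqxx big1 // => c /andP[_ /negbTE -> //].
(* Degree at most 3 for both sides and the linked port, at most 2 inside the tree for the two free
   ports. *)
have le2 : \sum_(c in U) #|nb g c :&: (C :|: U)| <= 13.
  rewrite sum_uset //.
  have d3 c : #|nb g c :&: (C :|: U)| <= 3 by apply: leq_trans (subset_leq_card (subsetIl _ _)) (g3 c).
  have dy y' z' : K23 g a b x y' z' -> ~~ E g y' z' -> U = uset a b x y' z' -> #|nb g y' :&: (C :|: U)| <= 2.
    move=> k' ny UE; apply: (@leq_trans #|[set a; b]|); last by rewrite cards2; case: (_ != _).
    apply: subset_leq_card; apply/subsetP=> u; rewrite in_setI in_nb => /andP[yu uC].
    rewrite UE in dis cr uC.
    by have [] := last_nb g3 k' ny vC dis vx cr yu uC => ->; rewrite !inE eqxx ?orbT.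
  have := dy y z k nyz erefl; have := dy z y (K23_yz k) _ (uset_yz _ _ _ _ _); rewrite E_sym nyz => /(_ isT).
  by have := d3 a; have := d3 b; have := d3 x; move: #|_| #|_| #|_| #|_| #|_| ; clear; lia.
by move: le1 le2; move: (\sum_(_ in _) _) (\sum_(_ in U) _) ; clear; lia.
Qed.

(* The sides of all the units dominate everything but the root. *)
Lemma utree_sides r C us : utree g r C us -> exists J : {set T},
  [/\ #|J| <= 2 * size us, J \subset C :\ r, (forall j u, j \in J -> E g j u -> u \in C :\ r),
      (forall i j, i \in J -> j \in J -> ~~ E g i j)
    & forall c, c \in C -> c != r -> c \in J \/ exists2 j, j \in J & E g j c].
Proof.
elim=> {C us} [rV|C us v a b x y z ut [J [cJ JC nJ iJ dJ]] vC k nyz dis vx cr] /=.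
  exists set0; split=> [|||i j|c]; rewrite ?cards0 ?sub0set //.
  - by move=> j u; rewrite inE.
  - by rewrite inE.
  - by rewrite in_set1 => ->.
have [[ku ax ay az] [bx by_ bz]] := K23P k; have rC := utree_r ut.
set U := uset a b x y z in dis cr *.
have Ur u : u \in U -> u \in (C :|: U) :\ r.
  move=> uU; rewrite in_setD1 in_setU uU orbT andbT; apply: contraTneq uU => ->.
  by rewrite (disjointFr dis rC).
have abU u : u \in [set a; b] -> u \in U by rewrite in_set2 in_uset => /orP[]->; rewrite ?orbT.
have abE s u : s \in [set a; b] -> E g s u -> u \in U /\ u \in [:: x; y; z].
  have h : E g a u || E g b u -> u \in U /\ u \in [:: x; y; z].
    move=> e; have : u \in [:: x; y; z] by case/orP: e => [/(K23_Ea g3 k) //|/(K23_Ea g3 (K23_swap k))].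
    by rewrite in_uset !inE => ->; rewrite !orbT.
  by rewrite in_set2 => /orP[]/eqP -> e; apply: h; rewrite e ?orbT.
exists (J :|: [set a; b]); split.
- apply: leq_trans (leq_card_setU _ _) _; rewrite mulnS addnC leq_add // cards2; by case: (_ != _).
- rewrite subUset; apply/andP; split; last by apply/subsetP=> u /abU/Ur.
  by apply: subset_trans JC _; apply: setSD; apply: subsetUl.
- move=> j u; rewrite in_setU => /orP[jJ ju|jab ju]; last by have [/Ur] := abE _ _ jab ju.
  by move: (nJ _ _ jJ ju); rewrite !in_setD1 in_setU => /andP[-> ->].
- move=> i j; rewrite in_setU [j \in _]in_setU.
  have JU i' j' : i' \in J -> j' \in [set a; b] -> ~~ E g i' j'.
    move=> iJ' jab; apply/negP=> /(nJ _ _ iJ'); rewrite in_setD1 => /andP[_ jC].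
    by have := abU _ jab; rewrite (disjointFr dis jC).
  case/orP=> iI /orP[] jI; first exact: iJ; first exact: JU; first by rewrite E_sym JU.
  apply/negP=> /(abE _ _ iI)[_]; move: jI ku; rewrite in_set2 /= !inE !negb_or.
  by case/orP=> /eqP ->; case/and5P=> /and4P[_ n1 n2 n3] /and3P[m1 m2 m3] _ _ _;
    rewrite ?(negbTE n1) ?(negbTE n2) ?(negbTE n3) ?(negbTE m1) ?(negbTE m2) ?(negbTE m3).
- move=> c; rewrite in_setU => /orP[cC cr'|]; last first.
    rewrite in_uset => /or4P[/eqP->|/eqP->|/eqP->|/orP[]/eqP->] _.
    + by left; rewrite !inE eqxx ?orbT.
    + by left; rewrite !inE eqxx ?orbT.
    + by right; exists a; rewrite // !inE eqxx ?orbT.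
    + by right; exists a; rewrite // !inE eqxx ?orbT.
    + by right; exists a; rewrite // !inE eqxx ?orbT.
  have [cJ'|[j jJ jc]] := dJ c cC cr'; first by left; rewrite in_setU cJ'.
  by right; exists j; rewrite // in_setU jJ.
Qed.

(** A vertex of degree at most 2 other than the root is a port, and its neighbours are the two sides
    of its unit. *)
Lemma port_nb r C us c : utree g r C us -> c \in C -> c != r -> #|nb g c| <= 2 ->
  forall u, E g c u -> #|nb g u| = 3.
Proof.
move=> ut cC cr d2 u cu; have [a [b [x [y [z [k _ _ cE]]]]]] := utree_cov ut cC cr.
have [[ku ax ay az] [bx by_ bz]] := K23P k.
have c3 a' : nb g a' = [set x; y; z] -> #|nb g a'| = 3.
  move=> ->; have -> : [set x; y; z] = [set w in [:: x; y; z]] by apply/setP=> w; rewrite !inE orbA.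
  by rewrite cardsE (card_uniqP _) //; move: ku => /= /and3P[].
case: cE => cE; first by rewrite cE c3 ?(K23_nba g3 k) in d2.
suff : u \in [set a; b].
  by rewrite in_set2 => /orP[]/eqP ->; rewrite c3 ?(K23_nba g3 k) ?(K23_nbb g3 k).
have ab : #|[set a; b]| = 2 by rewrite cards2; move: ku; rewrite /= !inE !negb_or => /andP[/andP[-> _] _].
have sub : [set a; b] \subset nb g c by apply/subsetP=> w; rewrite in_set2 in_nb cE E_sym => /orP[]/eqP ->.
have -> : [set a; b] = nb g c by apply/eqP; rewrite eqEcard sub ab.
by rewrite in_nb.
Qed.

(** By [port_nb], an edge between two vertices of degree at most 2 can touch a member only at its
    root. A closed tree would also contain the other end, as a port with a poor neighbour; in a
    troublesome configuration the root would have three neighbours. *)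
Lemma low_edge u w B : E g u w -> #|nb g u| <= 2 -> #|nb g w| <= 2 -> bt g B -> u \in B -> False.
Proof.
move=> uw du dw [[r [us [ut cl]]]|[v1 [v2 [w2 [C [us [[ut v2C v12 _] [[_ _ _ nv1 ->] [_ _ d3]]]]]]]]] uB.
  have wB := cl _ _ uB uw; have [ur|ur] := eqVneq u r.
    have wr : w != r by rewrite -ur eq_sym; apply: E_neq uw.
    by have := port_nb ut wB wr dw (u := u); rewrite E_sym => /(_ uw) d; rewrite d in du.
  by have d := port_nb ut uB ur du uw; rewrite d in dw.
have noC c d : E g c d -> #|nb g c| <= 2 -> #|nb g d| <= 2 -> c \in C -> c = v1.
  move=> cd dc dd cC; apply: contraTeq dd => c1.
  by rewrite (port_nb ut cC c1 dc cd).
have uC : u \in C by move: uB; rewrite in_setU1 => /orP[/eqP uE|//]; rewrite uE d3 in du.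
have u1 := noC _ _ uw du dw uC.
have wu : E g w u by rewrite E_sym.
have wC : w \notin C by apply/negP=> /(noC _ _ wu dw du) w1; move: uw; rewrite u1 w1 E_irr.
have /card_gt0P[c] : 0 < #|nb g v1 :&: C| by rewrite nv1.
rewrite in_setI in_nb => /andP[v1c cC].
have wc : w != c by apply: contraNneq wC => ->.
have w2v : w != v2 by apply: contraTneq dw => ->; rewrite d3.
have cv2 : c != v2 by apply: contraTneq cC => ->.
have : #|[set z in [:: w; c; v2]]| <= #|nb g u|.
  apply: subset_leq_card; apply/subsetP=> z; rewrite in_nb !inE => /or3P[]/eqP -> //; by rewrite u1.
by rewrite cardsE (card_uniqP _) /= ?inE ?negb_or ?wc ?w2v ?cv2 //; move: du; clear; lia.
Qed.

(** Each unit has 5 vertices and accounts for degree sum 14: the edge counted at the root in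
    [utree_stats] is made up for by the edge from [w2] to [v2]. Thus 30 - 14 = 16 per unit. *)
Lemma bt2_weight v1 v2 w2 C us : utree g v1 C us -> v2 \notin C -> w2 \in C -> w2 != v1 ->
  #|nb g w2 :&: C| = 2 -> #|nb g v1 :&: C| = 1 ->
  (forall c, c \in C -> c != v1 -> nb g c \subset v2 |: C) -> nb g v2 :&: C = [set v1; w2] ->
  16 * size us <= \sum_(x in C :\ v1) (6 - #|nb g x|).
Proof.
move=> ut v2C w2C w21 nw2 nv1 nbC nv2; have [c1 c2] := utree_stats ut.
have rC := utree_r ut; pose X := C :\ v1; rewrite -/X.
have Xin c : (c \in X) = (c != v1) && (c \in C) by rewrite in_setD1.
have w2X : w2 \in X by rewrite Xin w21.
have EX x u : x \in X -> E g x u -> u = v1 \/ u = v2 \/ u \in X.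
  rewrite Xin => /andP[x1 xC] xu; have := subsetP (nbC x xC x1) u; rewrite in_nb => /(_ xu).
  by rewrite in_setU1 Xin; have [->|] := eqVneq u v1; [left|move=> u1 /orP[/eqP ->|->]; right; [left|right]].
have e1 : \sum_(x in X) (6 - #|nb g x| + #|nb g x|) = 6 * #|X|.
  by rewrite mulnC -sum_nat_const; apply: eq_bigr => c cB; have := g3 c; clear; lia.
have cX : #|X| = 5 * size us by have := cardsD1 v1 C; rewrite rC c1; rewrite -/X; clear; lia.
have e2 : \sum_(x in X) #|nb g x| <= \sum_(x in X) #|nb g x :&: C| + 1.
  rewrite (bigD1 w2) //= [X in _ <= X + 1](bigD1 w2) //= addnAC; apply: leq_add.
    rewrite nw2; exact: g3.
  apply: leq_sum => x /andP[xX xw2]; apply: subset_leq_card; apply/subsetP=> u.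
  rewrite in_setI in_nb => xu; rewrite xu /=; case: (EX _ _ xX xu) => [->|[ue|]] //; last by rewrite Xin => /andP[].
  have : x \in nb g v2 :&: C.
    by rewrite in_setI in_nb -ue E_sym xu; move: xX; rewrite Xin => /andP[].
  by rewrite nv2 in_set2 (negbTE xw2) orbF; move: xX; rewrite Xin => /andP[/negbTE ->].
have e3 : \sum_(x in C) #|nb g x :&: C| = 1 + \sum_(x in X) #|nb g x :&: C|.
  by rewrite (bigD1 v1) //= nv1; congr (_ + _); apply: eq_bigl => x; rewrite Xin andbC.
move: e1 c2 e2; rewrite big_split /= cX e3.
by move: (\sum_(_ in X) #|nb g _ :&: C|) (\sum_(_ in X) #|nb g _|) (\sum_(_ in X) (_ - _)) ; clear; lia.
Qed.

End Sub3.
End Trees.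

(** * A minimal counterexample has no bad component and no troublesome configuration *)

Section NoBt.
Variables (T : finType) (g : gr T).
Hypothesis g3 : sub3 g.
Hypothesis IHd : forall X : {set T}, X \subset V g -> X != set0 -> Q (del g X).
Hypothesis nQ : ~ Q g.

Lemma no_reduction_sig (I X : {set T}) : I \subset V g -> I != set0 ->
  (forall x y, x \in I -> y \in I -> ~~ E g x y) -> clnb g I = X ->
  8 * #|I| + \sum_(x in X) #|nb g x :\: X| + 2 * sig (del g X) <=
    \sum_(x in X) (6 - #|nb g x|) + 2 * sig g -> False.
Proof.
move=> IV I0 Ii XE le; apply: nQ; subst X.
have XV : clnb g I \subset V g by apply/subsetP=> x /in_clnb[/(subsetP IV) //|[y _ /E_Vr //]].
apply: (@Q_lift _ _ (del g (clnb g I)) #|I|) (IHd XV _).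
- move=> S' S'i; exists (S' :|: I); first exact: ids_clnb.
  by rewrite cardsU leq_subr.
- by have := wt_del g3 XV; move: le; move: (\sum_(_ in _) _) (\sum_(_ in _) _) ; clear; lia.
- by apply: contraNneq I0 => X0; rewrite -subset0 -X0 subsetUl.
Qed.

(** With n units, the root and the sides dominate the component with at most 2n + 1 vertices. Its
    weight is at least 16n + 6, and the lost member supplies the missing 2. *)
Lemma no_bt1 B : ~ bt1 g B.
Proof.
move=> bB; have [r [us [ut cl]]] := bB; have [c1 c2] := utree_stats g3 ut.
have [J [cJ JC nJ iJ dJ]] := utree_sides g3 ut.
have rB := utree_r ut; have BV := utree_V ut.
have nbB c : c \in B -> nb g c \subset B by move=> cB; apply/subsetP=> u; rewrite in_nb; apply: cl.
have rJ : r \notin J by apply/negP=> /(subsetP JC); rewrite in_setD1 eqxx.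
have JB j : j \in J -> j \in B by move/(subsetP JC); rewrite in_setD1 => /andP[].
apply: (@no_reduction_sig (r |: J) B).
- by rewrite subUset sub1set (subsetP BV) //=; apply/subsetP=> j /JB /(subsetP BV).
- by apply/set0Pn; exists r; rewrite in_setU1 eqxx.
- have rj j : j \in J -> ~~ E g r j.
    by move=> jJ; apply/negP; rewrite E_sym => /(nJ _ _ jJ); rewrite in_setD1 eqxx.
  move=> i j; rewrite !in_setU1 => /orP[/eqP->|iJ'] /orP[/eqP->|jJ].
  + by rewrite E_irr.
  + exact: rj.
  + by rewrite E_sym rj.
  + exact: iJ.
- apply/setP=> c; apply/in_clnb/idP=> [[|[j]]|cB]; rewrite ?in_setU1.
  + by case/orP=> [/eqP -> //|/JB].
  + by case/orP=> [/eqP ->|/JB jB]; apply: cl.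
  + have [->|cr] := eqVneq c r; first by left.
    have [cJ'|[j jJ jc]] := dJ c cB cr; first by left; rewrite cJ'.
    by right; exists j; rewrite // in_setU1 jJ orbT.
have s0 : \sum_(x in B) #|nb g x :\: B| = 0.
  apply: big1 => c cB; apply/eqP; rewrite cards_eq0 setD_eq0; exact: nbB.
have s1 : 16 * size us + 6 <= \sum_(x in B) (6 - #|nb g x|).
  have : \sum_(x in B) (6 - #|nb g x| + #|nb g x :&: B|) = 6 * #|B|.
    rewrite mulnC -sum_nat_const; apply: eq_bigr => c cB; rewrite (setIidPl (nbB c cB)).
    by have := g3 c; clear; lia.
  rewrite big_split /= c1; move: c2; move: (\sum_(_ in _) _) (\sum_(_ in _) _) ; clear; lia.
have s2 : sig (del g B) + 1 <= sig g.
  apply: (sig_drop (or_introl bB)) => B' bB'; have := bt_V bB' => /= B'V.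
  have dis : [disjoint B' & B].
    by rewrite disjoint_subset; apply/subsetP=> c /(subsetP B'V); rewrite in_setD => /andP[].
  split=> //; apply: bt_eq bB' => [c cB'|]; last exact: subset_trans B'V (subsetDl _ _).
  rewrite nb_del (disjointFr dis cB'); apply/esym/setDidPl.
  rewrite disjoint_subset; apply/subsetP=> u; rewrite in_nb => cu; apply/negP=> uB.
  by have : c \in B; [apply: cl uB _; rewrite E_sym|rewrite (disjointFr dis cB')].
rewrite s0 addn0; have := cardsU1 r J; rewrite rJ; move: s1 s2 cJ.
by move: (\sum_(_ in _) _) (sig _) (sig _) #|_ |: _| #|_| ; clear; lia.
Qed.

(** The sides dominate exactly the tree without its root, and 16 per unit is both price and gain.
    The two cut edges, at [v1] and at [v2], are paid by the lost member: [v1] and [v2] stay behind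
    as adjacent vertices of degree at most 2, so by [low_edge] no new member touches them. *)
Lemma no_bt2' B : ~ bt2 g B.
Proof.
move=> bB; have [v1 [v2 [w2 [C [us [[ut v2C v12 v2w2] [[w2C w21 nw2 nv1 BE] [nbC nv2 d3]]]]]]]] := bB.
have [c1 c2] := utree_stats g3 ut; have [J [cJ JC nJ iJ dJ]] := utree_sides g3 ut.
have rC := utree_r ut; have CV := utree_V ut; pose X := C :\ v1.
have nbC' c : c \in C -> c != v1 -> nb g c \subset v2 |: C by rewrite -BE; apply: nbC.
have Xin c : (c \in X) = (c != v1) && (c \in C) by rewrite in_setD1.
have w2X : w2 \in X by rewrite Xin w21.
apply: (@no_reduction_sig J X).
- by apply: subset_trans JC _; apply: subset_trans (subsetDl _ _) CV.
- by have [w2J|[j jJ _]] := dJ w2 w2C w21; apply/set0Pn; [exists w2|exists j].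
- exact: iJ.
- apply/setP=> c; apply/in_clnb/idP=> [[/(subsetP JC) //|[j jJ /(nJ _ _ jJ) //]]|].
  by rewrite Xin => /andP[cr cC]; apply: dJ.
have EX x u : x \in X -> E g x u -> u = v1 \/ u = v2 \/ u \in X.
  rewrite Xin => /andP[x1 xC] xu; have := subsetP (nbC x xC x1) u; rewrite in_nb => /(_ xu).
  by rewrite BE in_setU1 Xin; have [->|] := eqVneq u v1; [left|move=> u1 /orP[/eqP ->|->]; right; [left|right]].
have s0 : \sum_(x in X) #|nb g x :\: X| <= 2.
  rewrite -sum_cross (bigID [in [set v1; v2]]) /= [X in _ + X]big1 ?addn0; last first.
    move=> u; rewrite in_setC in_set2 negb_or => /andP[uX /andP[u1 u2]]; apply/eqP.
    rewrite cards_eq0 -subset0; apply/subsetP=> x; rewrite in_setI in_nb E_sym => /andP[ux xX].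
    by case: (EX _ _ xX ux) => [ue|[ue|ue]]; rewrite ?ue ?eqxx in u1 u2 uX.
  apply: (@leq_trans (\sum_(u in [set v1; v2]) 1)); last by rewrite sum1_card cards2; case: (_ != _).
  rewrite big_mkcond [X in _ <= X]big_mkcond /=; apply: leq_sum => u _.
  case: ifP => [/andP[_ uu]|_]; rewrite ?leq0n // uu; move: uu.
  rewrite in_set2 => /orP[]/eqP ->; first by rewrite -nv1 subset_leq_card // setIS // subsetDl.
  rewrite /X setIDA nv2; apply: leq_trans (_ : #|[set w2]| <= 1); last by rewrite cards1.
  by apply: subset_leq_card; apply/subsetP=> u'; rewrite in_setD in_set2 !in_set1; case: eqP.
have s1 := bt2_weight g3 ut v2C w2C w21 nw2 nv1 nbC' nv2.
have s2 : sig (del g X) + 1 <= sig g.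
  apply: (sig_drop (or_intror bB)) => B' bB'; have := bt_V bB' => /= B'V.
  have nX c : c \in B' -> c \notin X by move/(subsetP B'V); rewrite in_setD => /andP[].
  have v1X : v1 \notin X by rewrite Xin eqxx.
  have v2X : v2 \notin X by rewrite Xin negb_and v2C orbT.
  have h12 : E (del g X) v1 v2 by rewrite /= /del_edge v12 v1X v2X.
  have d1 : #|nb (del g X) v1| <= 2.
    rewrite nb_del (negbTE v1X); have := cardsID X (nb g v1).
    have -> : nb g v1 :&: X = nb g v1 :&: C.
      apply/setP=> u; rewrite !in_setI Xin in_nb; case: eqP => [->|//]; by rewrite E_irr.
    by rewrite nv1; have := g3 v1; clear; lia.
  have d2 : #|nb (del g X) v2| <= 2.
    rewrite nb_del (negbTE v2X); have := cardsID X (nb g v2); rewrite d3.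
    have : 0 < #|nb g v2 :&: X| by apply/card_gt0P; exists w2; rewrite in_setI in_nb v2w2.
    by clear; lia.
  have h21 : E (del g X) v2 v1 by rewrite E_sym.
  have n1 : v1 \notin B' by apply/negP; exact: (low_edge (sub3_del _ g3) h12 d1 d2 bB').
  have n2 : v2 \notin B' by apply/negP; exact: (low_edge (sub3_del _ g3) h21 d2 d1 bB').
  have nB c : c \in B' -> c \notin B.
    move=> cB'; rewrite BE in_setU1 negb_or; apply/andP; split; first by apply: contraNneq n2 => <-.
    by have := nX _ cB'; rewrite Xin negb_and negbK => /orP[/eqP ce|//]; rewrite -ce cB' in n1.
  have dis : [disjoint B' & B].
    by rewrite disjoint_subset; apply/subsetP=> c /nB; rewrite !inE.
  split=> //; apply: bt_eq bB' => [c cB'|]; last exact: subset_trans B'V (subsetDl _ _).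
  rewrite nb_del (negbTE (nX _ cB')); apply/esym/setDidPl.
  rewrite disjoint_subset; apply/subsetP=> u; rewrite in_nb => cu; apply/negP=> uX.
  have uc : E g u c by rewrite E_sym.
  case: (EX _ _ uX uc) => [ce|[ce|ce]]; [by rewrite -ce cB' in n1|by rewrite -ce cB' in n2|].
  by rewrite (negbTE (nX _ cB')) in ce.
move: s0 s1 s2 cJ.
by rewrite -/X; clear; lia.
Qed.

Lemma no_bt B : ~ bt g B.
Proof. by case=> [/no_bt1|/no_bt2']. Qed.

End NoBt.

(** * Concrete configurations given by edge lists *)

Definition adj (es : seq (nat * nat)) i :=
  pmap (fun e => if e.1 == i then Some e.2 else if e.2 == i then Some e.1 else None) es.
Definition mk n es (fl : seq nat) : state := mkseq (fun i => (i \in fl, adj es i)) n.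
Definition mk_ok n es := all (fun i => (adj es i != [::]) && uniq (adj es i) &&
  all (fun j => (j < n) && (i \in adj es j)) (adj es i)) (iota 0 n) &&
  all (fun e => (e.1 < n) && (e.2 < n)) es.

Section Models.
Variables (T : finType) (x0 : T) (g : gr T).

Lemma mem_adj es i j : (j \in adj es i) -> exists2 e, e \in es & e = (i, j) \/ e = (j, i).
Proof.
rewrite mem_pmap => /mapP[[e1 e2] ees /=]; case: eqP => [ei [je]|_].
  by exists (e1, e2) => //; left; rewrite ei je.
by case: eqP => // ei [je]; exists (e1, e2) => //; right; rewrite ei je.
Qed.

Lemma adj_mem es e : e \in es -> e.2 \in adj es e.1.
Proof. by move=> ees; rewrite mem_pmap; apply/mapP; exists e; rewrite ?eqxx. Qed.

Lemma nbi_mk n es fl i : i < n -> nbi (mk n es fl) i = adj es i.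
Proof. by move=> ilt; rewrite /nbi nth_mkseq. Qed.

(** For a flagged vertex the degree bound suffices: its listed neighbours are distinct, so there are
    no others. *)
Lemma mk_models n es fl vs : mk_ok n es -> size vs = n -> uniq vs ->
  all (fun e => E g (nth x0 vs e.1) (nth x0 vs e.2)) es ->
  all (fun i => #|nb g (nth x0 vs i)| <= size (adj es i)) fl ->
  models x0 g (mk n es fl) vs.
Proof.
case/andP=> /allP ok _ sz u /allP eE /allP fE; have szm : size (mk n es fl) = n by rewrite size_mkseq.
have EE i j : j \in adj es i -> E g (nth x0 vs i) (nth x0 vs j).
  by case/mem_adj=> e /eE ee [eq|eq]; move: ee; rewrite eq //= E_sym.
have ok' i : i < n -> (adj es i != [::]) && uniq (adj es i) &&
  all (fun j => (j < n) && (i \in adj es j)) (adj es i) by move=> ilt; apply: ok; rewrite mem_iota.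
have adjlt i j : i < n -> j \in adj es i -> j < n.
  by move=> ilt ji; have /andP[_ /allP/(_ j ji)/andP[]] := ok' i ilt.
split; rewrite ?szm //.
- move=> v /(nthP x0)[i]; rewrite sz => ilt <-; have /andP[/andP[]] := ok' i ilt.
  by case aE: (adj es i) => [//|j l] _ _ _; apply: (@E_V _ _ _ (nth x0 vs j)); apply: EE; rewrite aE mem_head.
- move=> i ilt; rewrite nbi_mk //; have /andP[/andP[_ ui] /allP ai] := ok' i ilt; split=> // j ji.
  by have /andP[jlt ij] := ai j ji; rewrite (nbi_mk _ _ jlt); split=> //; apply: EE.
- move=> i ilt; rewrite /fli nth_mkseq //= => /fE le w iw; rewrite nbi_mk //.
  have /andP[/andP[_ ui] _] := ok' i ilt.
  pose A := [set v in [seq nth x0 vs j | j <- adj es i]].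
  have AE : A = nb g (nth x0 vs i).
    apply/eqP; rewrite eqEcard; apply/andP; split.
      by apply/subsetP=> v; rewrite !inE => /mapP[j ji ->]; apply: EE.
    have -> : #|A| = size (adj es i).
      rewrite cardsE (card_uniqP _) ?size_map // map_inj_in_uniq // => j k /(adjlt _ _ ilt) jlt /(adjlt _ _ ilt) klt /eqP.
      by rewrite nth_uniq ?sz // => /eqP.
    exact: le.
  have : w \in A by rewrite AE in_nb.
  by rewrite inE => /mapP[j ji ->]; exists j.
Qed.

Lemma models_edge n es fl vs e : models x0 g (mk n es fl) vs -> mk_ok n es -> e \in es ->
  E g (nth x0 vs e.1) (nth x0 vs e.2).
Proof.
move=> ms /andP[_ /allP lt] ees; have /andP[e1 e2] := lt _ ees.
apply: (m_E ms); rewrite ?size_mkseq // nbi_mk //; exact: adj_mem.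
Qed.

End Models.

(** A unit with sides [o], [o+1] and ports [o+2], [o+3], [o+4]. *)
Definition uedges o := [:: (o, o+2); (o, o+3); (o, o+4); (o+1, o+2); (o+1, o+3); (o+1, o+4)].
Definition K33_es := uedges 0 ++ [:: (2,5); (3,5); (4,5)].
Definition prism_es := [:: (0,1); (1,2); (2,3); (3,4); (4,0); (5,6); (6,7); (7,8); (8,9); (9,5);
  (0,5); (1,6); (2,7); (3,8); (4,9)].
Definition cyc_es k := (k.-1, 0) :: [seq (i, i.+1) | i <- iota 0 k.-1].
Definition sK33 := mk 6 K33_es [::].
Definition sPr := mk 10 prism_es [::].

(* The edge e = pq subdivided by a unit whose port n+4 has degree 2. *)
Definition ins_es n (es : seq (nat * nat)) e :=
  [seq d <- es | d != e] ++ uedges n ++ [:: (e.1, n+2); (e.2, n+3)].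
Definition ins_dead n es hs := all (fun eh => (mk_ok (n+5) (ins_es n es eh.1) &&
  (2 <= size (adj (ins_es n es eh.1) (n+4)))) &&
  leaf 0 1 [::] (mk (n+5) (ins_es n es eh.1) [:: n+4]) (HI eh.2)) (zip es hs).

(* The edge e replaced by the path e.1, n+5, n+6, e.2 in the A1 gadget. *)
Definition ins7_es n (es : seq (nat * nat)) e :=
  [seq d <- es | d != e] ++ uedges n ++ [:: (n+2,n+5); (n+3,n+6); (n+5,n+6); (e.1,n+5); (e.2,n+6)].
Definition ins7_dead n es hs := all (fun eh => mk_ok (n+7) (ins7_es n es eh.1) &&
  leaf 0 1 [::] (mk (n+7) (ins7_es n es eh.1) [::]) (HI eh.2)) (zip es hs).

(** For each edge, in the order of the edge list, an independent set refuting the graph in which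
    that edge is replaced by the gadget. *)
Definition K33_hs := [:: [:: 7; 6; 2; 0]; [:: 7; 6; 3; 0]; [:: 7; 6; 4; 0];
  [:: 7; 6; 1; 2]; [:: 7; 6; 1; 3]; [:: 7; 6; 1; 4];
  [:: 7; 6; 5; 2]; [:: 7; 6; 5; 3]; [:: 7; 6; 5; 4]].
Definition prism_hs := [:: [:: 11; 10; 8; 1; 0]; [:: 11; 10; 9; 2; 1]; [:: 11; 10; 3; 2; 5];
  [:: 11; 10; 3; 6; 4]; [:: 11; 10; 4; 7; 0]; [:: 11; 10; 3; 6; 5]; [:: 11; 10; 7; 6; 4];
  [:: 11; 10; 8; 7; 0]; [:: 11; 10; 9; 8; 1]; [:: 11; 10; 9; 2; 5]; [:: 14; 8; 5; 2; 0];
  [:: 14; 8; 6; 1; 4]; [:: 14; 9; 7; 2; 0]; [:: 14; 8; 6; 3; 0]; [:: 14; 7; 9; 1; 4]].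
Definition prism7_hs := [:: [:: 12; 13; 8; 1; 0]; [:: 12; 6; 8; 16; 0]; [:: 13; 6; 8; 15; 0];
  [:: 13; 9; 15; 7; 0]; [:: 12; 13; 4; 7; 0]; [:: 12; 8; 16; 2; 0]; [:: 13; 8; 15; 2; 0];
  [:: 12; 13; 8; 7; 0]; [:: 12; 16; 3; 7; 0]; [:: 13; 15; 3; 7; 0]; [:: 13; 9; 2; 6; 15];
  [:: 12; 8; 16; 2; 0]; [:: 13; 6; 8; 15; 0]; [:: 13; 9; 15; 7; 0]; [:: 12; 16; 3; 7; 0]].

Lemma ins_dead_K33 : ins_dead 6 K33_es K33_hs. Proof. by vm_compute. Qed.
Lemma ins_dead_prism : ins_dead 10 prism_es prism_hs. Proof. by vm_compute. Qed.
Lemma ins7_dead_prism : ins7_dead 10 prism_es prism7_hs. Proof. by vm_compute. Qed.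

Lemma zip_all_l (S U : eqType) (p : pred (S * U)) es hs : size es = size hs -> all p (zip es hs) ->
  forall e, e \in es -> exists h, p (e, h).
Proof.
elim: es hs => [|e' es IH] [|h hs] //= [sz] /andP[pe al] e; rewrite inE.
by case/orP=> [/eqP ->|ees]; [exists h|apply: IH al _ ees].
Qed.

(** Two units, the second of which lacks an edge whose two ends are joined to two ports of the
    first. In [S1es] the missing edge ends at the port 9, which [S1_no] assumes to have degree at
    most 2; in [S2es] it ends at another port. *)
Definition S1es := uedges 0 ++ [:: (2,5); (3,9); (5,7); (5,8); (6,7); (6,8); (6,9)].
Definition S2es := uedges 0 ++ [:: (2,5); (3,8); (5,7); (5,9); (6,7); (6,8); (6,9)].

(** * Trees of units in a graph with a distinguished edge *)

Section Chain.
Variables (T : finType) (H : gr T) (p q : T).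
Hypothesis H3 : sub3 H.
Hypothesis Hpq : E H p q.
Hypothesis nopend : forall a b x y z, K23 H a b x y z -> nb H y = [set a; b] -> nb H z = [set a; b] ->
  p \in uset a b x y z /\ q \in uset a b x y z.
Implicit Types (C J : {set T}).

(** A unit with a free port [z] that contains the edge [p q]; up to symmetry one end is the side
    [a], the other [z] or a further port [y]. *)
Definition bad_unit := exists a b x y z, [/\ K23 H a b x y z, nb H z = [set a; b]
  & [\/ p = a /\ q = z, p = a /\ q = y, q = a /\ p = z | q = a /\ p = y]].

Lemma bad_unit_of C v a b x y z : K23 H a b x y z -> ~~ E H y z -> v \in C ->
  [disjoint C & uset a b x y z] -> E H v x ->
  (forall c u, c \in C -> u \in uset a b x y z -> E H c u -> c = v /\ u = x) ->
  p \in uset a b x y z -> q \in uset a b x y z -> nb H z = [set a; b] -> bad_unit.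
Proof.
move=> k nyz vC dis vx cr pU qU nz.
have side a' b' s t : K23 H a' b' x y z -> [set a'; b'] = [set a; b] -> E H s t -> s = a' -> t \in uset a b x y z ->
    exists y', K23 H a' b' (if t == x then y else x) y' z /\ (t = z \/ t = y').
  move=> k' ab st sE; have : E H a' t by rewrite -sE.
  move/(K23_Ea H3 k'); rewrite !inE => /or3P[/eqP->|/eqP->|/eqP->] _.
  - by exists x; rewrite eqxx; split; [apply: K23_xy|right].
  - exists y; split; last by right.
    have [[ku _ _ _] _] := K23P k'; move: ku; rewrite /= !inE !negb_or.
    by case/and5P=> _ _ /andP[/negbTE xy _] _ _; rewrite eq_sym xy.
  - exists y; split; last by left.
    have [[ku _ _ _] _] := K23P k'; move: ku; rewrite /= !inE !negb_or.
    by case/and5P=> _ _ /andP[_ /negbTE xy] _ _; rewrite eq_sym xy.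
have Hqp : E H q p by rewrite E_sym.
have ba : [set b; a] = [set a; b] by rewrite setUC.
have k2 := K23_swap k.
have done_p a' b' : K23 H a' b' x y z -> [set a'; b'] = [set a; b] -> p = a' -> bad_unit.
  move=> k' ab pE; have [y' [k'' [qz|qy]]] := side a' b' p q k' ab Hpq pE qU.
    by eexists a', b', _, y', z; split; [exact: k''|by rewrite ab|constructor 1].
  by eexists a', b', _, y', z; split; [exact: k''|by rewrite ab|constructor 2].
have done_q a' b' : K23 H a' b' x y z -> [set a'; b'] = [set a; b] -> q = a' -> bad_unit.
  move=> k' ab pE; have [y' [k'' [qz|qy]]] := side a' b' q p k' ab Hqp pE pU.
    by eexists a', b', _, y', z; split; [exact: k''|by rewrite ab|constructor 3].
  by eexists a', b', _, y', z; split; [exact: k''|by rewrite ab|constructor 4].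
have port s t : E H s t -> s \in uset a b x y z -> t \in uset a b x y z -> s = a \/ s = b \/ t = a \/ t = b.
  move=> st sU tU; have tC : t \in C :|: uset a b x y z by rewrite in_setU tU orbT.
  move: sU; rewrite in_uset => /or4P[/eqP->|/eqP->|/eqP sE|/orP[]/eqP sE]; [by left|by right; left| | |].
  - rewrite sE in st; have vU : v \notin uset a b x y z by rewrite (disjointFr dis vC).
    have : t \in nb H x by rewrite in_nb.
    rewrite (K23_exit H3 k vU); last by rewrite E_sym.
    rewrite -setUA !in_setU !in_set1 => /or3P[/eqP->|/eqP->|/eqP tv]; [by right; right; left|by right; right; right|].
    by rewrite tv (negbTE vU) in tU.
  - by rewrite sE in st; right; right; have [->|->] := last_nb H3 k nyz vC dis vx cr st tC; auto.
  - rewrite sE in st; right; right; have nzy : ~~ E H z y by rewrite E_sym.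
    rewrite uset_yz in dis cr tC.
    by have [->|->] := last_nb H3 (K23_yz k) nzy vC dis vx cr st tC; auto.
have [e|[e|[e|e]]] := port p q Hpq pU qU.
- exact: (done_p a b).
- exact: (done_p b a).
- exact: (done_q a b).
- exact: (done_q b a).
Qed.

Lemma last_nbE C v a b x y z : K23 H a b x y z -> ~~ E H y z -> v \in C ->
  [disjoint C & uset a b x y z] -> E H v x ->
  (forall c u, c \in C -> u \in uset a b x y z -> E H c u -> c = v /\ u = x) ->
  nb H y \subset C :|: uset a b x y z -> nb H y = [set a; b].
Proof.
move=> k nyz vC dis vx cr sub; apply/setP=> u; rewrite in_nb in_set2.
apply/idP/orP=> [yu|]; last by case/K23P: k => -[_ _ ay _] [_ b_y _] [/eqP->|/eqP->]; rewrite E_sym.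
have uC : u \in C :|: uset a b x y z by apply: (subsetP sub); rewrite in_nb.
by have [->|->] := last_nb H3 k nyz vC dis vx cr yu uC; rewrite eqxx; auto.
Qed.

Lemma utree_root_nb r C us : utree H r C us -> us <> [::] -> exists2 u, u \in C & E H r u.
Proof.
elim=> {C us} [//|C us v a b x y z ut IH vC k nyz dis vx cr] _.
case: us ut IH => [|u us] ut IH.
  exists x; first by rewrite in_setU in_uset eqxx !orbT.
  by inversion ut as [rV CE|]; subst C; move: vC; rewrite in_set1 => /eqP <-.
by have [//|w wC rw] := IH; exists w; rewrite // in_setU wC.
Qed.

(** One vertex less than two per unit is enough if [r], [w] and the neighbours of [r] are dominated
    from elsewhere. *)
Definition chainJ r C (us : seq {set T}) w := exists J : {set T},
  [/\ #|J| + 1 <= 2 * size us, J \subset (C :\ r) :\ w,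
      (forall i j, i \in J -> j \in J -> ~~ E H i j),
      (forall j, j \in J -> ~~ E H r j /\ ~~ E H w j)
    & forall c, c \in C -> c != r -> c != w -> ~~ E H r c -> c \in J \/ exists2 j, j \in J & E H j c].

(* In a troublesome configuration every unit but the last carries one further
   unit, at the port w: the unit at the end is reached by peeling. *)
Lemma chain r C us w : utree H r C us -> w \in C -> w != r -> #|nb H w :&: C| = 2 ->
  #|nb H r :&: C| = 1 -> (forall c, c \in C -> c != r -> c != w -> nb H c \subset C) ->
  bad_unit \/ (chainJ r C us w /\ forall u, u \in us -> ~~ ((p \in u) && (q \in u))).
Proof.
move=> ut; elim: ut w => {C us} [rV|C us v a b x y z ut IH vC k nyz dis vx cr] w.
  by rewrite in_set1 => ->.
have [[ku ax ay az] [bx by_ bz]] := K23P k.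
have rC := utree_r ut; set U := uset a b x y z in dis cr *.
have aU : a \in U by rewrite in_uset eqxx ?orbT.
have bU : b \in U by rewrite in_uset eqxx ?orbT.
have xU : x \in U by rewrite in_uset eqxx ?orbT.
have yU : y \in U by rewrite in_uset eqxx ?orbT.
have zU : z \in U by rewrite in_uset eqxx ?orbT.
have rU u : u \in U -> u != r by apply: contraTneq => ->; rewrite (disjointFr dis rC).
have CU u : u \in C -> u \in U = false by exact: disjointFr.
have ny' : nb H y \subset C :|: U -> nb H y = [set a; b] by exact: last_nbE k nyz vC dis vx cr.
have nz' : nb H z \subset C :|: U -> nb H z = [set a; b].
  rewrite /U uset_yz; apply: (@last_nbE C v a b x z y) => //; [exact: K23_yz|by rewrite E_sym| |].
  + by rewrite -(uset_yz a b x y z).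
  + by rewrite -(uset_yz a b x y z).
move=> wC wr nw nr clo.
have main y0 z0 : K23 H a b x y0 z0 -> ~~ E H y0 z0 -> uset a b x y0 z0 = U -> nb H z0 = [set a; b] -> w = y0 ->
   bad_unit \/ (chainJ r (C :|: U) (U :: us) w /\ forall u, u \in U :: us -> ~~ ((p \in u) && (q \in u))).
  move=> k0 ny0 UE nz0 wE.
  have [[ku0 _ ay0 az0] [_ by0 bz0]] := K23P k0.
  have [/andP[pU qU]|npq] := boolP ((p \in U) && (q \in U)).
    by left; apply: (@bad_unit_of C v a b x y0 z0) => //; rewrite UE.
  have z0U : z0 \in U by rewrite -UE in_uset eqxx ?orbT.
  have y0U : y0 \in U by rewrite -UE in_uset eqxx ?orbT.
  have inUE u : u \in U -> [\/ u = a, u = b, u = x | u = y0 \/ u = z0].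
    rewrite -UE in_uset => /or4P[/eqP|/eqP|/eqP|/orP[]/eqP]; [constructor 1|constructor 2|constructor 3|constructor 4; left|constructor 4; right]; done.
  have z0N u : E H z0 u -> u = a \/ u = b.
    by rewrite -in_nb nz0 in_set2 => /orP[/eqP|/eqP]; auto.
  have Ew u : E H w u -> u \in C :|: U -> u = a \/ u = b.
    rewrite wE => yu uC; apply: (@last_nb _ H H3 C v a b x y0 z0 u); rewrite ?UE //.
  move: ku0; rewrite /= !inE !negb_or => /and5P[/and4P[nab nax nay naz] /and3P[nbx nby nbz] /andP[nxy nxz] nyz0 _].
  (* If [v = r] this is the only unit, because [r] has one neighbour in the tree; the free port [z0]
     then dominates both sides. *)
  have [vr|vr] := eqVneq v r.
    have us0 : us = [::].
      case: us ut {IH} => // u us' ut; have [//|c cC rc] := utree_root_nb ut.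
      have : #|[set c; x]| <= #|nb H r :&: (C :|: U)|.
        by apply: subset_leq_card; apply/subsetP=> d; rewrite in_set2 => /orP[]/eqP->; rewrite in_setI in_nb in_setU ?cC ?xU ?rc ?orbT //= ?andbT -vr.
      by rewrite nr cards2; have -> : c != x by apply: contraTneq xU => <-; rewrite CU.
    have CE : C = [set r] by rewrite us0 in ut; inversion ut.
    right; split; last by move=> u; rewrite us0 inE => /eqP ->.
    exists [set z0]; rewrite us0 cards1; split=> //.
    - by rewrite sub1set !in_setD1 in_setU z0U orbT rU // wE eq_sym nyz0.
    - by move=> i j; rewrite !in_set1 => /eqP-> /eqP->; rewrite E_irr.
    - move=> j; rewrite in_set1 => /eqP ->; split; apply/negP; rewrite E_sym => /z0N[] e.
        by move: aU; rewrite -e CU.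
        by move: bU; rewrite -e CU.
        by move: nay; rewrite -wE e eqxx.
        by move: nby; rewrite -wE e eqxx.
    - move=> c; rewrite CE in_setU in_set1 => /orP[->//|/inUE[->|->|->|[->|->]]] _ cw nrc.
      + by right; exists z0; rewrite ?in_set1 // E_sym.
      + by right; exists z0; rewrite ?in_set1 // E_sym.
      + by rewrite -vr vx in nrc.
      + by rewrite wE eqxx in cw.
      + by left; rewrite in_set1.
  have nbv : #|nb H v :&: C| = 2.
    have le2 : #|nb H v :&: C| <= 2.
      rewrite -ltnS; apply: leq_trans (H3 v); apply: proper_card; apply/properP; split; first exact: subsetIl.
      exists x; first by rewrite in_nb.
      by rewrite in_setI negb_and; apply/orP; right; apply: contraL xU => /CU ->.
    apply/eqP; rewrite eqn_leq le2 /=.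
    have [a' [b' [x' [y' [z' [k' /subsetP sub _ vE]]]]]] := utree_cov ut vC vr.
    have [[ku' ax' ay' az'] [bx' by' bz']] := K23P k'.
    have two s t : s != t -> s \in C -> t \in C -> E H v s -> E H v t -> 2 <= #|nb H v :&: C|.
      move=> st sC tC vs vt; have <- : #|[set s; t]| = 2 by rewrite cards2 st.
      by apply: subset_leq_card; apply/subsetP=> d; rewrite in_set2 in_setI in_nb => /orP[]/eqP->; rewrite ?vs ?vt ?sC ?tC.
    move: ku'; rewrite /= !inE !negb_or => /and5P[/and4P[nab' _ _ _] _ /andP[nxy' _] _ _].
    case: vE => vE.
      by apply: (two x' y') => //; rewrite ?vE //; apply: sub; rewrite in_uset eqxx ?orbT.
    by apply: (two a' b') => //; rewrite ?vE 1?E_sym //; apply: sub; rewrite in_uset eqxx ?orbT.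
  have nrC : #|nb H r :&: C| = 1.
    rewrite -nr; congr #|pred_of_set _|; apply/setP=> u; rewrite !in_setI in_nb in_setU.
    case ru: (E H r u) => //=; case uU: (u \in U); rewrite ?orbF //.
    by have [rv _] := cr _ _ rC uU ru; rewrite rv eqxx in vr.
  have cloC c : c \in C -> c != r -> c != v -> nb H c \subset C.
    move=> cC cr' cv; apply/subsetP=> u; rewrite in_nb => cu.
    have cw : c != w by rewrite wE; apply: contraTneq y0U => <-; rewrite CU.
    have : u \in C :|: U by apply: (subsetP (clo c _ cr' cw)); rewrite ?in_setU ?cC ?in_nb.
    rewrite in_setU => /orP[//|uU]; have [cv' _] := cr _ _ cC uU cu; by rewrite cv' eqxx in cv.
  have [bad|[[J [cJ JC iJ rJ dJ]] nus]] := IH v vC vr nbv nrC cloC; first by left.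
  right; split; last by move=> u; rewrite inE => /orP[/eqP ->|/nus].
  have JCC j : j \in J -> [/\ j \in C, j != r & j != v].
    by move/(subsetP JC); rewrite !in_setD1 => /and3P[].
  have Jx j : j \in J -> forall u, u \in U -> ~~ E H j u.
    move=> jJ u uU; have [jC jr jv] := JCC _ jJ; apply/negP=> ju.
    by have [jv' _] := cr _ _ jC uU ju; rewrite jv' eqxx in jv.
  have xN u : E H x u -> [\/ u = a, u = b | u = v].
    rewrite -in_nb (K23_exit H3 k0 (v := v)) ?UE; last by rewrite E_sym.
      by rewrite -setUA !in_setU !in_set1 => /or3P[]/eqP; [constructor 1|constructor 2|constructor 3].
    by rewrite CU.
  (* Peeling off the last unit makes its link vertex [v] the new [w]. Here [x] dominates [v] and
     both sides, and [z0] itself. *)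
  exists (J :|: [set x; z0]); split.
  - apply: leq_trans (_ : #|J| + 2 + 1 <= _).
      rewrite leq_add2r; apply: leq_trans (leq_card_setU _ _) _; rewrite leq_add2l cards2; by case: (_ != _).
    by rewrite /= mulnS; move: cJ; clear; lia.
  - rewrite subUset; apply/andP; split; apply/subsetP=> j.
      move=> jJ; have [jC jr jv] := JCC _ jJ; rewrite !in_setD1 in_setU jC jr /= wE andbT.
      by apply: contraTneq y0U => <-; rewrite CU.
    rewrite in_set2 !in_setD1 in_setU => /orP[]/eqP->; rewrite ?xU ?z0U ?orbT rU // wE; rewrite ?andbT //.
    by rewrite eq_sym.
  - move=> i j; rewrite in_setU [j \in _]in_setU.
    have nzx : ~~ E H z0 x by apply/negP=> /z0N[] e; [rewrite e eqxx in nax|rewrite e eqxx in nbx].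
    have xz i' j' : i' \in [set x; z0] -> j' \in [set x; z0] -> ~~ E H i' j'.
      by rewrite !in_set2 => /orP[]/eqP-> /orP[]/eqP->; rewrite ?E_irr // E_sym.
    have xzU j' : j' \in [set x; z0] -> j' \in U by rewrite in_set2 => /orP[]/eqP->.
    case/orP=> iI /orP[] jI; [exact: iJ|by apply: Jx => //; apply: xzU|by rewrite E_sym; apply: Jx => //; apply: xzU|exact: xz].
  - move=> j; rewrite in_setU => /orP[jJ|jx].
      have [rj _] := rJ _ jJ; split=> //; rewrite E_sym; apply: Jx => //; by rewrite wE.
    split; apply/negP.
      move=> rj; have jU : j \in U by move: jx; rewrite in_set2 => /orP[]/eqP->.
      by have [rv _] := cr _ _ rC jU rj; rewrite rv eqxx in vr.
    move=> wj; have jU : j \in C :|: U by move: jx; rewrite in_set2 => /orP[]/eqP->; rewrite in_setU ?xU ?z0U orbT.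
    by have [e|e] := Ew _ wj jU; move: jx; rewrite e in_set2 ?(negbTE nax) ?(negbTE naz) ?(negbTE nbx) ?(negbTE nbz).
  - move=> c; rewrite in_setU => /orP[cC|/inUE[->|->|->|[->|->]]] cr' cw nrc.
    + have [->|cv] := eqVneq c v.
        by right; exists x; [rewrite in_setU in_set2 eqxx orbT|rewrite E_sym].
      have [cJ'|[j jJ jc]] := dJ c cC cr' cv nrc; first by left; rewrite in_setU cJ'.
      by right; exists j; rewrite // in_setU jJ.
    + by right; exists x; [rewrite in_setU in_set2 eqxx orbT|rewrite E_sym].
    + by right; exists x; [rewrite in_setU in_set2 eqxx orbT|rewrite E_sym].
    + by left; rewrite in_setU in_set2 eqxx orbT.
    + by rewrite wE eqxx in cw.
    + by left; rewrite in_setU in_set2 eqxx !orbT.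
have clU u : u \in U -> u != w -> nb H u \subset C :|: U.
  by move=> uU uw; apply: clo; rewrite ?rU // in_setU uU orbT.
have [wy|wy] := eqVneq w y.
  apply: (main y z) => //; apply: nz'; apply: clU => //.
  by rewrite wy; move: ku; rewrite /= !inE !negb_or [y == z]eq_sym => /and5P[_ _ _ ->].
have nyE : nb H y = [set a; b] by apply: ny'; apply: clU; rewrite // eq_sym.
have [wz|wz] := eqVneq w z.
  by apply: (main z y) => //; [exact: K23_yz|rewrite E_sym|rewrite -uset_yz].
have nzE : nb H z = [set a; b] by apply: nz'; apply: clU; rewrite // eq_sym.
by have [pU qU] := nopend k nyE nzE; left; apply: (@bad_unit_of C v a b x y z).
Qed.

End Chain.

Lemma uniq5 (T : eqType) (a b x y z : T) : uniq [:: a; b; x; y; z] ->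
  [/\ a != b, a != x, a != y & a != z] /\ [/\ b != x, b != y & b != z] /\ [/\ x != y, x != z & y != z].
Proof.
by rewrite /= !inE !negb_or => /and5P[/and4P[-> -> -> ->] /and3P[-> -> ->] /andP[-> ->] -> _].
Qed.

(** * Every port of a K_{2,3} has a third neighbour *)

Section MinCounter.
Variables (T : finType) (x0 : T) (g : gr T).
Hypothesis g3 : sub3 g.
Hypothesis IH : forall g' : gr T, #|V g'| < #|V g| -> sub3 g' ->
  dead x0 g' sK33 -> dead x0 g' sPr -> Q g'.
Hypothesis nQ : ~ Q g.
Hypothesis dK : dead x0 g sK33.
Hypothesis dP : dead x0 g sPr.

Lemma dead_mono (h h' : gr T) n es : mk_ok n es -> (forall x y, E h' x y -> E h x y) ->
  dead x0 h (mk n es [::]) -> dead x0 h' (mk n es [::]).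
Proof.
move=> ok sub dh vs ms; apply: (dh vs); have [sz u _ _ _] := ms; apply: mk_models => //.
  by rewrite sz size_mkseq.
by apply/allP=> e ees; apply: sub; apply: (models_edge ms ok ees).
Qed.

Lemma IHd (X : {set T}) : X \subset V g -> X != set0 -> Q (del g X).
Proof.
move=> XV /set0Pn[c cX]; apply: IH.
- apply: proper_card; apply/properP; split; first exact: subsetDl.
  by exists c; [apply: (subsetP XV)|rewrite in_setD cX].
- exact: sub3_del.
- by apply: dead_mono dK => // x y /and3P[].
- by apply: dead_mono dP => // x y /and3P[].
Qed.

Lemma nobt B : ~ bt g B.
Proof. exact: (no_bt g3 IHd nQ). Qed.

Lemma nb1 x : x \in V g -> 1 <= #|nb g x|.
Proof.
move=> xV; rewrite lt0n; apply/negP=> /eqP n0; apply: (@nobt [set x]); left; exists x, [::].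
split=> [|c u]; first exact: ut0.
by rewrite in_set1 => /eqP ->; rewrite -in_nb (cards0_eq n0) in_set0.
Qed.

Lemma leaf0 s vs h : leaf 0 1 [::] s h -> models x0 g s vs -> False.
Proof. by apply: (leaf_no g3 IHd nQ (bnd_sound0 g3 nobt)). Qed.

Lemma chk0 t s : chk 0 1 [::] t s -> dead x0 g s.
Proof. by apply: (chk_sound g3 IHd nQ nb1 (bnd_sound0 g3 nobt)). Qed.

Lemma yz_no a b x y z : K23 g a b x y z -> ~~ E g y z.
Proof.
move=> k; apply/negP=> yz; have [[u ax ay az] [bx by_ bz]] := K23P k.
apply: (@leaf0 (mk 5 (uedges 0 ++ [:: (3,4)]) [::]) [:: a; b; x; y; z] (HI [:: 3])); first by vm_compute.
by apply: mk_models => //; rewrite /= ax ay az bx by_ bz yz.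
Qed.

Lemma K23_U (a b x y z u : T) : u \in [:: a; b; x; y; z] -> u \in uset a b x y z.
Proof. by rewrite in_uset !inE. Qed.

Lemma port_out a b x y z u : K23 g a b x y z -> E g x u -> [\/ u = a, u = b | u \notin uset a b x y z].
Proof.
move=> k xu; rewrite in_uset; have [->|ua] := eqVneq u a; first by constructor 1.
have [->|ub] := eqVneq u b; first by constructor 2.
constructor 3; rewrite /= !negb_or; apply/and3P; split; apply: contraTneq xu => ->.
- by rewrite E_irr.
- exact: (yz_no (K23_yz (K23_xz k))).
- exact: (yz_no (K23_xy k)).
Qed.

Lemma card_nbz (a b z : T) : nb g z = [set a; b] -> #|nb g z| <= 2.
Proof. by move=> ->; rewrite cards2; case: (_ != _). Qed.

Lemma sum_unit a b x y z : K23 g a b x y z -> nb g z = [set a; b] ->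
  16 <= \sum_(u in uset a b x y z) (6 - #|nb g u|).
Proof.
move=> k nz; have [[ku _ _ _] _] := K23P k; rewrite sum_uset //; have := card_nbz nz.
by have := g3 a; have := g3 b; have := g3 x; have := g3 y; clear; lia.
Qed.

(** [g] has no members, so each member of the remaining graph contains an end of a cut edge. *)
Lemma sig_crude (X : {set T}) : sig (del g X) <= \sum_(x in X) #|nb g x :\: X|.
Proof.
pose om h := if h \in ~: X then #|nb g h :&: X| else 0.
have mB B : bt (del g X) B -> 1 <= \sum_(h in B) om h.
  move=> bB; have BV := bt_V bB.
  have nX w : w \in B -> w \notin X by move/(subsetP BV); rewrite in_setD => /andP[].
  have [/exists_inP[w wB bw]|nb0] := boolP [exists w in B, 0 < om w].
    by apply: leq_trans (sum_mem_ge _ wB).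
  case: (@nobt B); apply: (bt_eq _ _ bB) => [w wB|].
    rewrite nb_del (negbTE (nX _ wB)); apply/esym/setDidPl; rewrite -setI_eq0 -cards_eq0.
    apply: contraNT nb0 => nz; apply/exists_inP; exists w => //.
    by rewrite /om in_setC nX // lt0n.
  by apply: subset_trans BV (subsetDl _ _).
have := sig_weight mB; rewrite mul1n -sum_cross => /leq_trans -> //.
by rewrite [X in _ <= X]big_mkcond; exact: leqnn.
Qed.

(* Deleting the closed neighbourhood X of a dominated core D: a vertex of X
   outside D spends at most 3 more than its weight. *)
Lemma no_core (I D : {set T}) : I \subset V g -> I != set0 ->
  (forall x y, x \in I -> y \in I -> ~~ E g x y) -> D \subset clnb g I ->
  (forall x, x \in D -> nb g x \subset clnb g I) ->
  (forall x, x \in clnb g I -> x \notin D -> exists2 d, d \in D & E g x d) ->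
  8 * #|I| + 3 * #|clnb g I :\: D| <= \sum_(x in D) (6 - #|nb g x|) -> False.
Proof.
move=> IV I0 Ii; set X := clnb g I => DX nD Dnb le; apply: (no_reduction_clnb g3 IHd nQ IV I0 Ii); rewrite -/X.
have := sig_crude X.
have sp F : \sum_(x in X) F x = \sum_(x in D) F x + \sum_(x in X :\: D) F x.
  by rewrite [LHS](big_setID D) /= (setIidPr DX).
rewrite !sp (_ : \sum_(x in D) #|nb g x :\: X| = 0); last first.
  by apply: big1 => x xD; apply/eqP; rewrite cards_eq0 setD_eq0 nD.
(* A cut edge costs 1 of weight and at most 2 through [sig]. A vertex of degree d with a neighbour
   in [D] has at most d - 1 cut edges, and 3(d - 1) <= (6 - d) + 3 for d <= 3. *)
have : 3 * \sum_(x in X :\: D) #|nb g x :\: X| <= \sum_(x in X :\: D) (6 - #|nb g x|) + 3 * #|X :\: D|.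
  rewrite big_distrr /= mulnC -sum_nat_const -big_split /=; apply: leq_sum => x.
  rewrite in_setD => /andP[xD xX]; have [d dD xd] := Dnb x xX xD.
  have : #|nb g x :\: X| < #|nb g x|.
    apply: proper_card; apply/properP; split; first exact: subsetDl.
    by exists d; rewrite ?in_nb // in_setD (subsetP DX).
  by have := g3 x; clear; lia.
by move: le; rewrite !add0n; clear; lia.
Qed.

Section Pendant.
Variables a b x y z : T.
Hypothesis k : K23 g a b x y z.
Hypothesis ny : nb g y = [set a; b].
Hypothesis nz : nb g z = [set a; b].
Let U := uset a b x y z.
Let H := del g U.

Lemma pend_out u c : u \in U -> c \notin U -> E g u c -> u = x.
Proof.
have [[ku ax ay az] [bx by_ bz]] := K23P k.
rewrite in_uset => /or4P[/eqP->|/eqP->|/eqP->|/orP[]/eqP->] // cU uc; case/negP: cU; apply: K23_U.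
- by have := K23_Ea g3 k uc; rewrite !inE => ->; rewrite !orbT.
- by have := K23_Ea g3 (K23_swap k) uc; rewrite !inE => ->; rewrite !orbT.
- by move: uc; rewrite -in_nb ny !inE => /orP[]->; rewrite ?orbT.
- by move: uc; rewrite -in_nb nz !inE => /orP[]->; rewrite ?orbT.
Qed.

(** If [x] has degree 3, the unit weighs 17, one edge is cut and the two sides cost 16, so no member
    may arise in [H]. A member that did would contain the outside neighbour [v] of [x]; putting the
    unit back at [v], or leaving it out when [v] is the root of a troublesome configuration, gives a
    member of [g]. *)
Lemma pendant_no : False.
Proof.
have [[ku ax ay az] [bx by_ bz]] := K23P k; have [[nab nax nay naz] [[nbx nby nbz] [nxy nxz nyz]]] := uniq5 ku.
have aU : a \in U by rewrite in_uset eqxx ?orbT.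
have bU : b \in U by rewrite in_uset eqxx ?orbT.
have xU : x \in U by rewrite in_uset eqxx ?orbT.
have yU : y \in U by rewrite in_uset eqxx ?orbT.
have zU : z \in U by rewrite in_uset eqxx ?orbT.
have nyz' := yz_no k.
have UV u : u \in U -> u \in V g.
  by rewrite in_uset => /or4P[/eqP->|/eqP->|/eqP->|/orP[]/eqP->]; [apply: E_V ax|apply: E_V bx|apply: E_Vr ax|apply: E_Vr ay|apply: E_Vr az].
have cE : clnb g [set a; b] = U.
  apply/setP=> c; apply/in_clnb/idP=> [[|[s]]|]; rewrite in_set2.
  - by case/orP=> /eqP->.
  - case/orP=> /eqP-> sc; apply: K23_U.
      by have := K23_Ea g3 k sc; rewrite !inE => ->; rewrite !orbT.
    by have := K23_Ea g3 (K23_swap k) sc; rewrite !inE => ->; rewrite !orbT.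
  - rewrite in_uset => /or4P[->|->|/eqP->|/orP[]/eqP->]; rewrite ?orbT; auto;
      by right; exists a; rewrite // in_set2 eqxx.
apply: (no_reduction_clnb g3 IHd nQ (I := [set a; b])).
- by apply/subsetP=> u; rewrite in_set2 => /orP[]/eqP->; apply: UV.
- by apply/set0Pn; exists a; rewrite in_set2 eqxx.
- have nE : ~~ E g a b by apply/negP=> /(K23_Ea g3 k); rewrite !inE (negbTE nbx) (negbTE nby) (negbTE nbz).
  by move=> i j; rewrite !in_set2 => /orP[]/eqP-> /orP[]/eqP->; rewrite ?E_irr // E_sym.
rewrite cE cards2 nab !sum_uset //.
have s0 : sig H = 0.
  apply: sig0 => B bB; have BV := bt_V bB.
  have nU w : w \in B -> w \notin U by move/(subsetP BV); rewrite in_setD => /andP[].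
  have BVg : B \subset V g by apply: subset_trans BV (subsetDl _ _).
  have EH c d : c \notin U -> d \notin U -> E g c d = E H c d by move=> cU dU; rewrite /= /del_edge cU dU !andbT.
  have nbE w : w \notin U -> ~~ E g x w -> nb g w = nb H w.
    move=> wU nxw; rewrite nb_del (negbTE wU); apply/esym/setDidPl; rewrite disjoint_subset.
    apply/subsetP=> u; rewrite in_nb => wu; apply/negP=> uU; have uw : E g u w by rewrite E_sym.
    by have ux := pend_out uU wU uw; rewrite -ux uw in nxw.
  have [/exists_inP[v vB xv]|nex] := boolP [exists v in B, E g x v]; last first.
    apply: (@nobt B); apply: (bt_eq _ BVg bB) => w wB; apply: nbE; first exact: nU.
    by apply: contraNN nex => xw; apply/exists_inP; exists w.
  have vU := nU _ vB; have vx : E g v x by rewrite E_sym.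
  have nx := K23_exit g3 k vU xv.
  have out u c : u \in U -> c \notin U -> E g u c -> u = x /\ c = v.
    move=> uU cU uc; have ux := pend_out uU cU uc; split=> //.
    move: uc; rewrite ux -in_nb nx -setUA !in_setU !in_set1 => /or3P[]/eqP // ce; by rewrite ce ?aU ?bU in cU.
  have nbE' w : w \notin U -> w != v -> nb g w = nb H w.
    by move=> wU wv; apply: nbE => //; apply: contraNN wv => xw; have [_ ->] := out _ _ xU wU xw.
  have grow r C us : utree H r C us -> C \subset B -> v \in C -> utree g r (C :|: U) (U :: us).
    move=> ut /subsetP CB vC; apply: (utS (v := v)) => //.
    - apply: utree_sub ut => [c d /CB/nU cU /CB/nU dU|]; first exact: EH.
      by apply: subset_trans BVg; apply/subsetP.
    - by rewrite disjoint_subset; apply/subsetP=> c /CB/nU; rewrite !inE.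
    - by move=> c u /CB/nU cU uU; rewrite E_sym => /(out _ _ uU cU)[-> ->].
  have clU u w : u \in U -> E g u w -> w \in U \/ w = v.
    by move=> uU uw; have [|wU] := boolP (w \in U); [left|right; have [_ ->] := out _ _ uU wU uw].
  case: bB => [[r [us [ut cl]]]|[v1 [v2 [w2 [C [us [[ut v2C v12 v2w2] [[w2C w21 nw2 nv1 BE] [nbC nv2 d3]]]]]]]]].
    apply: (@nobt (B :|: U)); left; exists r, (U :: us); split; first exact: grow.
    move=> c u; rewrite !in_setU => /orP[cB|cU] cu.
      have [uU|uU] := boolP (u \in U); first by rewrite orbT.
      have cuH : E H c u by rewrite -(EH _ _ (nU _ cB) uU).
      by rewrite orbF; apply: cl cB cuH.
    by have [->|->] := clU _ _ cU cu; rewrite ?vB ?orbT.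
  have v2B : v2 \in B by rewrite BE in_setU1 eqxx.
  have CB c : c \in C -> c \in B by move=> cC; rewrite BE in_setU1 cC orbT.
  have CsB : C \subset B by apply/subsetP.
  (* Neither [v2] nor [w2] can be [v]: each already has three neighbours other than [x]. *)
  have vv2 : v2 != v.
    apply: contraTneq (g3 v) => ve; rewrite -ltnNge -ve -d3; apply: proper_card.
    rewrite nb_del (negbTE (nU _ v2B)); apply/properP; split; first exact: subsetDl.
    by exists x; rewrite ?in_nb ?ve // in_setD xU.
  have vC : v \in C by move: vB; rewrite BE in_setU1 eq_sym (negbTE vv2).
  have n2 := nbE' _ (nU _ v2B) vv2.
  have clC c u : c \in C -> c != v1 -> E g c u -> u \notin U -> u \in B.
    by move=> cC c1 cu uU; apply: (subsetP (nbC c cC c1)); rewrite in_nb -(EH _ _ (nU _ (CB _ cC)) uU).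
  have [v1v|v1v] := eqVneq v1 v.
    apply: (@nobt B); right.
    apply: (bt2_sub (And4 ut v2C v12 v2w2) (And5 w2C w21 nw2 nv1 BE)) => //; first by split=> //; rewrite n2.
      by move=> c d cB dB; apply: EH; apply: nU.
    move=> c u cC c1 cu; apply: (clC c u cC c1 cu); apply/negP=> uU.
    have uc : E g u c by rewrite E_sym.
    by have [_ cv] := out _ _ uU (nU _ (CB _ cC)) uc; rewrite cv v1v eqxx in c1.
  have w2v : w2 != v.
    apply: contraTneq (g3 v) => we; rewrite -ltnNge.
    have <- : #|x |: (v2 |: (nb H v :&: C))| = 4.
      rewrite !cardsU1 in_setU1 !in_setI (negbTE v2C) andbF negb_or -we nw2.
      have -> : x != v2 by apply: contraTneq xU => ->; apply: nU.
      by rewrite (_ : (x \in C) = false) ?andbF //; apply/negP=> /CB/nU; rewrite xU.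
    apply: subset_leq_card; apply/subsetP=> d; rewrite !in_setU1 in_setI => /or3P[/eqP->|/eqP->|/andP[dv _]]; rewrite in_nb //.
      by rewrite -we E_sym; case/and3P: v2w2.
    by move: dv; rewrite in_nb => /and3P[].
  have nCU c : c \in C -> c != v -> nb g c :&: (C :|: U) = nb H c :&: C.
    move=> cC cv; rewrite nbE' ?nU ?CB // setIUr [nb H c :&: U](_ : _ = set0) ?setU0 //.
    by apply/setP=> u; rewrite in_setI in_nb in_set0; apply/negP=> /andP[/and3P[_ _ /negbTE ->]].
  apply: (@nobt (v2 |: (C :|: U))); right; exists v1, v2, w2, (C :|: U), (U :: us).
  split; [split|split; split] => //.
  - exact: grow.
  - by rewrite in_setU negb_or v2C nU.
  - by case/and3P: v12.
  - by case/and3P: v2w2.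
  - by rewrite in_setU w2C.
  - by rewrite nCU.
  - by rewrite nCU ?(utree_r ut).
  - move=> c cCU c1; apply/subsetP=> u; rewrite in_nb in_setU1 in_setU => cu.
    have [uU|uU] := boolP (u \in U); first by rewrite !orbT.
    rewrite orbF; move: cCU; rewrite in_setU => /orP[cC|cU].
      by have := clC _ _ cC c1 cu uU; rewrite BE in_setU1.
    by have [uU'|->] := clU _ _ cU cu; [rewrite uU' in uU|rewrite vC orbT].
  - rewrite n2 setIUr nv2 [nb H v2 :&: U](_ : _ = set0) ?setU0 //.
    by apply/setP=> u; rewrite in_setI in_nb in_set0; apply/negP=> /andP[/and3P[_ _ /negbTE ->]].
  - by rewrite n2.
have ox : #|nb g x :\: U| <= 1.
  have := cardsID U (nb g x); have : 2 <= #|nb g x :&: U|.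
    have <- : #|[set a; b]| = 2 by rewrite cards2 nab.
    by apply: subset_leq_card; apply/subsetP=> d; rewrite in_set2 in_setI in_nb => /orP[]/eqP->; rewrite E_sym ?ax ?bx ?aU ?bU.
  by have := g3 x; clear; lia.
have o0 u : u \in U -> u != x -> #|nb g u :\: U| = 0.
  move=> uU ux; apply/eqP; rewrite cards_eq0 setD_eq0; apply/subsetP=> w; rewrite in_nb => uw.
  by apply: contraNT ux => wU; rewrite (pend_out uU wU uw).
have nyx : y != x by rewrite eq_sym.
have nzx : z != x by rewrite eq_sym.
rewrite -/U -/H s0 (o0 a aU nax) (o0 b bU nbx) (o0 y yU nyx) (o0 z zU nzx).
have := card_nbz ny; have := card_nbz nz; have := g3 a; have := g3 b; have := g3 x; move: ox.
by clear; lia.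
Qed.
End Pendant.

(** A copy that uses the edge [p q] turns, with the unit put back in place of that edge, into a
    configuration refuted by [ins_dead]; any other copy already lies in [g]. *)
Lemma ins_no n es hs p q a b x y z : mk_ok n es -> all (fun e => (e.2, e.1) \notin es) es ->
  size es = size hs -> ins_dead n es hs -> dead x0 g (mk n es [::]) ->
  K23 g a b x y z -> nb g z = [set a; b] -> E g x p -> E g y q -> p != q ->
  p \notin uset a b x y z -> q \notin uset a b x y z ->
  dead x0 (add (del g (uset a b x y z)) p q) (mk n es [::]).
Proof.
move=> ok /allP nrev shs ideal dg k nz xp yq pq pU qU vs ms.
have [sz u VV _ _] := ms; rewrite size_mkseq in sz.
set U := uset a b x y z in VV ms pU qU *; set H := add _ p q in ms VV *.
have [[ku ax ay az] [bx by_ bz]] := K23P k; have [[nab nax nay naz] [[nbx nby nbz] [nxy nxz nyz]]] := uniq5 ku.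
have lt e : e \in es -> (e.1 < n) && (e.2 < n) by case/andP: ok => _ /allP; apply.
pose v i := nth x0 vs i.
have EE e : e \in es -> E H (v e.1) (v e.2) by apply: (models_edge ms ok).
pose isE e := (v e.1 == p) && (v e.2 == q) || (v e.1 == q) && (v e.2 == p).
have Eg e : e \in es -> ~~ isE e -> E g (v e.1) (v e.2).
  move=> /EE; rewrite /isE /= /add_edge => /orP[/and3P[] //|/and4P[_ _ _ ->]] //.
have [/hasP[e ees ie]|/hasPn nis] := boolP (has isE es); last first.
  apply: (dg vs); apply: mk_models => //; apply/allP=> e ees; apply: Eg => //; exact: nis.
have vinj i j : i < n -> j < n -> v i = v j -> i = j.
  by move=> ilt jlt /eqP; rewrite nth_uniq ?sz // => /eqP.
have uniqE d : d \in es -> isE d -> d = e.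
  move=> des; have /andP[d1 d2] := lt _ des; have /andP[e1 e2] := lt _ ees.
  have same : v d.1 = v e.1 -> v d.2 = v e.2 -> d = e.
    by move=> /(vinj _ _ d1 e1) h1 /(vinj _ _ d2 e2) h2; rewrite [d]surjective_pairing h1 h2 -surjective_pairing.
  have opp : v d.1 = v e.2 -> v d.2 = v e.1 -> d = e.
    move=> /(vinj _ _ d1 e2) h1 /(vinj _ _ d2 e1) h2; have := nrev _ ees.
    by rewrite -h1 -h2 -surjective_pairing des.
  by case/orP: ie => /andP[/eqP i1 /eqP i2]; case/orP=> /andP[/eqP j1 /eqP j2]; [apply: same|apply: opp|apply: opp|apply: same]; rewrite ?i1 ?i2 ?j1 ?j2.
have fin x1 y1 : uniq [:: a; b; x1; y1; z] -> (forall u, u \in [:: a; b; x1; y1; z] -> u \in U) ->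
   [/\ E g a x1, E g a y1, E g b x1 & E g b y1] -> E g (v e.1) x1 -> E g (v e.2) y1 -> False.
  move=> ku1 U1 [ax1 ay1 bx1 by1] ex ey.
  have [h /andP[/andP[ok' sz2] lf]] := zip_all_l shs ideal ees.
  pose ws := [:: a; b; x1; y1; z].
  apply: (@leaf0 _ (vs ++ ws) _ lf); apply: mk_models => //.
  - by rewrite size_cat sz.
  - rewrite cat_uniq; apply/and3P; split=> //; apply/hasPn=> c cw; apply/negP=> /VV /=.
    by rewrite in_setD U1.
  - have nw j : nth x0 (vs ++ ws) (n + j) = nth x0 ws j by rewrite nth_cat sz ltnNge leq_addr /= addKn.
    have nw0 : nth x0 (vs ++ ws) n = a by have := nw 0; rewrite addn0.
    have nv i : i < n -> nth x0 (vs ++ ws) i = v i by move=> ilt; rewrite nth_cat sz ilt.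
    rewrite !all_cat; apply/and3P; split.
    + apply/allP=> d; rewrite mem_filter => /andP[de des]; have /andP[d1 d2] := lt _ des.
      by rewrite !nv //; apply: Eg => //; apply: contraNN de => /(uniqE _ des) ->.
    + by rewrite /= !nw nw0 /= ax1 ay1 az bx1 by1 bz.
    + by have /andP[e1 e2] := lt _ ees; rewrite /= !nw !nv //= ex ey.
  - rewrite /= andbT nth_cat sz ltnNge leq_addr /= addKn /=.
    exact: leq_trans (card_nbz nz) sz2.
case/orP: ie => /andP[/eqP i1 /eqP i2].
  apply: (fin x y) => //; rewrite ?i1 ?i2 1?E_sym //.
  by move=> w ww; apply: K23_U.
have k' := K23_xy k; have [[ku' _ _ _] _] := K23P k'.
apply: (fin y x) => //; rewrite ?i1 ?i2 1?E_sym //.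
by move=> w ww; rewrite /U uset_xy; apply: K23_U.
Qed.

Lemma S1_no a b x y z a' b' x' y' z' : K23 g a b x y z -> nb g z = [set a; b] ->
  uniq [:: a; b; x; y; z; a'; b'; x'; y'; z'] -> E g x a' -> E g y z' ->
  [/\ E g a' x', E g a' y', E g b' x', E g b' y' & E g b' z'] -> #|nb g z'| <= 2 -> False.
Proof.
move=> k nz u xa yz' [ax' ay' bx' by' bz'] z2; have [[ku ax ay az] [bx by_ bz]] := K23P k.
apply: (@chk0 (N 7 [::HI [::0;1;5;6]] [::N 8 [::HI [::4;5;9]] [::];N 8 [::HI [::4;5;9]] [::]])
  (mk 10 S1es [:: 4; 9]) _ [:: a; b; x; y; z; a'; b'; x'; y'; z']); first by vm_compute.
apply: mk_models => //.
  by rewrite /= ax ay az bx by_ bz xa yz' ax' ay' bx' by' bz'.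
by rewrite /= z2 (card_nbz nz).
Qed.

Lemma S2_no a b x y z a' b' x' y' z' : K23 g a b x y z -> nb g z = [set a; b] ->
  uniq [:: a; b; x; y; z; a'; b'; x'; y'; z'] -> E g x a' -> E g y y' ->
  [/\ E g a' x', E g a' z', E g b' x', E g b' y' & E g b' z'] -> #|nb g z'| <= 2 -> False.
Proof.
move=> k nz u xa yz' [ax' ay' bx' by' bz'] z2; have [[ku ax ay az] [bx by_ bz]] := K23P k.
apply: (@chk0 (N 7 [::HI [::0;1;5;6];HI [::4;5]] [::N 8 [::HI [::4;5;8]] [::N 11 [::HI [::4;5;8]] [::];N 10 [::HI [::4;5;8]] [::]]])
  (mk 10 S2es [:: 4; 9]) _ [:: a; b; x; y; z; a'; b'; x'; y'; z']); first by vm_compute.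
apply: mk_models => //.
  by rewrite /= ax ay az bx by_ bz xa yz' ax' ay' bx' by' bz'.
by rewrite /= z2 (card_nbz nz).
Qed.

Lemma two_same a b x y z p : K23 g a b x y z -> nb g z = [set a; b] -> E g x p -> E g y p ->
  p \notin uset a b x y z -> False.
Proof.
move=> k nz xp yp pU; have [[ku ax ay az] [bx by_ bz]] := K23P k.
apply: (@chk0 (N 5 [:: HF [:: 0; 1; 2; 3; 4; 5]] [::]) (mk 6 (uedges 0 ++ [:: (2,5); (3,5)]) [:: 4]) _ [:: a; b; x; y; z; p]).
  by vm_compute.
apply: mk_models => //.
- by rewrite -[[:: _; _; _; _; _; _]]/(rcons [:: a; b; x; y; z] p) rcons_uniq ku andbT; move: pU; rewrite inE.
- by rewrite /= ax ay az bx by_ bz xp yp.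
- by rewrite /= (card_nbz nz).
Qed.

Section TwoExit.
Variables a b x y z p q : T.
Hypothesis k : K23 g a b x y z.
Hypothesis nz : nb g z = [set a; b].
Hypothesis xp : E g x p.
Hypothesis yq : E g y q.
Let U := uset a b x y z.
Hypothesis pU : p \notin U.
Hypothesis qU : q \notin U.
Hypothesis pq : p != q.

Lemma two_out u c : u \in U -> c \notin U -> E g u c -> u = x /\ c = p \/ u = y /\ c = q.
Proof.
have nx := K23_exit g3 k pU xp.
have qU' : q \notin uset a b y x z by rewrite -uset_xy.
have ny := K23_exit g3 (K23_xy k) qU' yq.
rewrite in_uset => /or4P[/eqP->|/eqP->|/eqP->|/orP[]/eqP->] // cU uc.
- case/negP: cU; apply: K23_U; have := K23_Ea g3 k uc; rewrite !inE => ->; by rewrite !orbT.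
- case/negP: cU; apply: K23_U; have := K23_Ea g3 (K23_swap k) uc; rewrite !inE => ->; by rewrite !orbT.
- left; split=> //; move: uc; rewrite -in_nb nx -setUA !in_setU !in_set1 => /or3P[]/eqP // ce.
    by case/negP: cU; rewrite ce in_uset eqxx.
  by case/negP: cU; rewrite ce in_uset eqxx ?orbT.
- right; split=> //; move: uc; rewrite -in_nb ny -setUA !in_setU !in_set1 => /or3P[]/eqP // ce.
    by case/negP: cU; rewrite ce in_uset eqxx.
  by case/negP: cU; rewrite ce in_uset eqxx ?orbT.
- by case/negP: cU; move: uc; rewrite -in_nb nz in_set2 in_uset => /orP[]->; rewrite ?orbT.
Qed.

(** The unit with [p] and [q] would be a troublesome configuration with [v1 = p], [v2 = q] and
    [w2 = y]. *)
Lemma two_adj : E g p q -> #|nb g q| = 3 -> False.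
Proof.
move=> epq d3; have [[ku ax ay az] [bx by_ bz]] := K23P k.
have [[nab nax nay naz] [[nbx nby nbz] [nxy nxz nyz]]] := uniq5 ku.
have inU u : u \in [:: a; b; x; y; z] -> u \in U by exact: K23_U.
have yU : y \in U by rewrite inU // !inE eqxx !orbT.
have xU : x \in U by rewrite inU // !inE eqxx !orbT.
have pUE u : u \in U -> E g p u -> u = x.
  move=> uU; rewrite E_sym => /(two_out uU pU)[[]//|[_ pq']]; by move: pq; rewrite pq' eqxx.
have qUE u : u \in U -> E g q u -> u = y.
  move=> uU; rewrite E_sym => /(two_out uU qU)[[_ pq']|[]//]; by move: pq; rewrite pq' eqxx.
have neq c u : c \notin U -> u \in U -> c != u by move=> cU; apply: contraTneq => <-.
apply: (@nobt (q |: ([set p] :|: U))); right; exists p, q, y, ([set p] :|: U), [:: U].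
split; [split|split; split] => //.
- apply: (utS (v := p)) => //.
  + by apply: ut0; apply: E_Vr xp.
  + by rewrite in_set1.
  + exact: (yz_no k).
  + by rewrite disjoints1.
  + by rewrite E_sym.
  + by move=> c u; rewrite in_set1 => /eqP-> uU /(pUE _ uU) ->.
- by rewrite in_setU in_set1 negb_or eq_sym pq.
- by rewrite E_sym.
- by rewrite in_setU yU orbT.
- by rewrite eq_sym neq.
- have -> : nb g y :&: ([set p] :|: U) = [set a; b]; last by rewrite cards2 nab.
  apply/setP=> u; rewrite in_setI in_nb in_setU in_set1 in_set2; apply/andP/orP.
    case=> yu /orP[/eqP ue|uU].
      by have := pUE _ yU; rewrite E_sym -ue => /(_ yu) ye; rewrite ye eqxx in nxy.
    by have [->|->|] := port_out (K23_xy k) yu; rewrite ?eqxx; [left|right|rewrite -uset_xy uU].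
  by case=> /eqP->; rewrite E_sym ?ay ?by_ inU ?orbT // !inE eqxx ?orbT.
- have -> : nb g p :&: ([set p] :|: U) = [set x]; last by rewrite cards1.
  apply/setP=> u; rewrite in_setI in_nb in_setU !in_set1; apply/andP/eqP=> [[pu /orP[/eqP ue|uU]]|->].
  + by rewrite ue E_irr in pu.
  + exact: pUE.
  + by rewrite E_sym xU orbT.
- move=> c; rewrite in_setU in_set1 => /orP[->//|cU] _; apply/subsetP=> u; rewrite in_nb => cu.
  rewrite in_setU1 in_setU in_set1; have [uU|uU] := boolP (u \in U); first by rewrite !orbT.
  by have [[_ ->]|[_ ->]] := two_out cU uU cu; rewrite eqxx ?orbT.
- apply/setP=> u; rewrite in_setI in_nb in_setU in_set1 in_set2; apply/andP/orP=> [[qu /orP[->|uU]]|[/eqP->|/eqP->]].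
  + by left.
  + by right; rewrite (qUE _ uU qu).
  + by rewrite E_sym epq eqxx.
  + by rewrite E_sym yq yU orbT.
Qed.

Section Add.
Hypothesis npq : ~~ E g p q.
Let H := add (del g U) p q.

Let xU : x \in U. Proof. by rewrite in_uset eqxx ?orbT. Qed.
Let yU : y \in U. Proof. by rewrite in_uset eqxx ?orbT. Qed.
Let UV u : u \in U -> u \in V g.
Proof.
have [[ku ax ay az] [bx by_ bz]] := K23P k.
by rewrite in_uset => /or4P[/eqP->|/eqP->|/eqP->|/orP[]/eqP->]; [apply: E_V ax|apply: E_V bx|apply: E_Vr ax|apply: E_Vr ay|apply: E_Vr az].
Qed.
Let pV : p \in V (del g U). Proof. by rewrite in_setD pU (E_Vr xp). Qed.
Let qV : q \in V (del g U). Proof. by rewrite in_setD qU (E_Vr yq). Qed.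

Lemma EHE c d : E H c d = [&& E g c d, c \notin U & d \notin U] ||
  ((c == p) && (d == q) || (c == q) && (d == p)).
Proof. by rewrite /= /add_edge pq pV qV. Qed.

Lemma EHpq : E H p q. Proof. by rewrite EHE !eqxx orbT. Qed.

Lemma EHg c d : ~~ ((c == p) && (d == q) || (c == q) && (d == p)) -> c \notin U -> d \notin U -> E g c d = E H c d.
Proof. by move=> /negbTE n cU dU; rewrite EHE n cU dU orbF !andbT. Qed.

Lemma agrH (D : {set T}) : (forall c, c \in D -> c \notin U) -> ~~ ((p \in D) && (q \in D)) ->
  forall c d, c \in D -> d \in D -> E g c d = E H c d.
Proof.
move=> DU nD c d cD dD; apply: EHg; rewrite ?DU //; apply: contraNN nD.
by case/orP=> /andP[/eqP <- /eqP <-]; rewrite cD dD.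
Qed.

Lemma nbH c : c \notin U -> c != p -> c != q -> nb H c = nb g c.
Proof.
move=> cU cp cq; apply/setP=> u; rewrite !in_nb EHE (negbTE cp) (negbTE cq) /= orbF cU /=.
case cu: (E g c u) => //=; apply/negP=> uU; have uc : E g u c by rewrite E_sym.
by have [[_ ce]|[_ ce]] := two_out uU cU uc; rewrite ce eqxx in cp cq.
Qed.

Lemma nbHp : nb H p = q |: (nb g p :\ x).
Proof.
apply/setP=> u; rewrite in_nb in_setU1 in_setD1 in_nb EHE eqxx (negbTE pq) /= orbF pU /= orbC.
congr (_ || _); rewrite andbC; case pu: (E g p u); rewrite ?andbF //= !andbT.
have up : E g u p by rewrite E_sym.
apply/idP/idP=> [|ux]; first by apply: contraNneq => ->.
by apply/negP=> uU; have [[ue _]|[_ pe]] := two_out uU pU up; [rewrite ue eqxx in ux|move: pq; rewrite pe eqxx].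
Qed.

Lemma nbHq : nb H q = p |: (nb g q :\ y).
Proof.
apply/setP=> u; rewrite in_nb in_setU1 in_setD1 in_nb EHE eqxx eq_sym (negbTE pq) /= qU /= orbC.
congr (_ || _); rewrite andbC; case pu: (E g q u); rewrite ?andbF //= !andbT.
have up : E g u q by rewrite E_sym.
apply/idP/idP=> [|ux]; first by apply: contraNneq => ->.
by apply/negP=> uU; have [[_ pe]|[ue _]] := two_out uU qU up; [move: pq; rewrite pe eqxx|rewrite ue eqxx in ux].
Qed.

Lemma cardH c : c \notin U -> #|nb H c| = #|nb g c|.
Proof.
move=> cU; have [->|cp] := eqVneq c p.
  rewrite nbHp cardsU1 in_setD1 in_nb (negbTE npq) andbF /= (cardsD1 x (nb g p)).
  by rewrite in_nb E_sym xp.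
have [->|cq] := eqVneq c q; last by rewrite nbH.
rewrite nbHq cardsU1 in_setD1 in_nb E_sym (negbTE npq) andbF /= (cardsD1 y (nb g q)).
by rewrite in_nb E_sym yq.
Qed.

Lemma VH c : c \in V H -> c \notin U. Proof. by rewrite in_setD => /andP[]. Qed.

Lemma H3 : sub3 H.
Proof.
move=> c; have [cU|cU] := boolP (c \in U); last by rewrite cardH.
suff -> : nb H c = set0 by rewrite cards0.
apply/setP=> u; rewrite in_nb in_set0; apply/negP=> /E_V /VH; by rewrite cU.
Qed.

Lemma wtH : wt g >= wt H + 16.
Proof.
rewrite /wt [X in _ <= X](big_setID U) /= [X in _ <= X]addnC; apply: leq_add; last first.
  have <- : U = V g :&: U by apply/esym/setIidPr; apply/subsetP=> u /UV.
  exact: sum_unit k nz.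
rewrite leq_eqVlt; apply/orP; left; apply/eqP; apply: eq_bigr => c; rewrite in_setD => /andP[cU _].
by rewrite -/H cardH.
Qed.

(** The edge [p q] of [H] keeps [p] and [q] from both lying in [S']. If [p] does, then [x] is
    dominated, and [y], [z] take care of the rest of the unit and of [q], which may have relied on
    the edge to [p]. The case of [q] is symmetric; if neither lies in [S'], the sides are added. *)
Lemma liftH S' : ids H S' -> exists2 S, ids g S & #|S| <= #|S'| + 2.
Proof.
move=> [S'V S'i S'd]; have [[ku ax ay az] [bx by_ bz]] := K23P k.
have [[nab nax nay naz] [[nbx nby nbz] [nxy nxz nyz]]] := uniq5 ku.
have S'U u : u \in S' -> u \notin U by move/(subsetP S'V)/VH.
have S'E u w : u \in S' -> w \in S' -> ~~ E g u w.
  move=> uS wS; apply: contra (S'i _ _ uS wS) => uw; by rewrite EHE uw !S'U.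
have inU u : u \in [:: a; b; x; y; z] -> u \in U by exact: K23_U.
have aU : a \in U by rewrite inU // !inE eqxx.
have bU : b \in U by rewrite inU // !inE eqxx orbT.
have zU : z \in U by rewrite inU // !inE eqxx !orbT.
suff main c d : c \in U -> d \in U -> ~~ E g c d ->
    (forall u, u \in S' -> ~~ E g c u && ~~ E g d u) ->
    (forall u, u \in U -> u \notin [set c; d] -> exists2 w, w \in S' :|: [set c; d] & E g u w) ->
    (p \notin S' -> q \in S' -> E g p c) -> (q \notin S' -> p \in S' -> E g q c) ->
    exists2 S, ids g S & #|S| <= #|S'| + 2.
  have NU u c : u \in U -> c \in S' -> E g u c -> u = x /\ c = p \/ u = y /\ c = q.
    by move=> uU cS; apply: two_out => //; apply: S'U.
  have nS u c : u \in [:: a; b; z] -> c \in S' -> ~~ E g u c.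
    rewrite !inE => uu cS; apply/negP=> uc; have uU : u \in U by apply: inU; rewrite !inE; case/or3P: uu => ->; rewrite ?orbT.
    have [[ue _]|[ue _]] := NU _ _ uU cS uc; move: uu; rewrite ue.
      by rewrite [x == a]eq_sym [x == b]eq_sym (negbTE nax) (negbTE nbx) (negbTE nxz).
    by rewrite [y == a]eq_sym [y == b]eq_sym (negbTE nay) (negbTE nby) (negbTE nyz).
  have npqS : ~~ ((p \in S') && (q \in S')).
    by apply/negP=> /andP[pS qS]; have := S'i _ _ pS qS; rewrite EHpq.
  have mxz x1 y1 p1 q1 : K23 g a b x1 y1 z -> x1 \in U -> p1 \notin S' -> q1 \in S' -> E g x1 p1 -> E g y1 q1 ->
     (forall c, c \in S' -> E g x1 c -> c = p1) -> (forall u, u \in U -> [\/ u = a, u = b, u = x1 | u = y1 \/ u = z]) ->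
     (p \notin S' -> q \in S' -> E g p x1) -> (q \notin S' -> p \in S' -> E g q x1) ->
     exists2 S, ids g S & #|S| <= #|S'| + 2.
    move=> k1 x1U p1S q1S xp1 yq1 xn inUE hp hq; have [[ku1 ax1 ay1 _] [bx1 by1 _]] := K23P k1.
    apply: (main x1 z) => //.
    - exact: (yz_no (K23_xy k1)).
    - move=> u uS; rewrite (nS z u _ uS) ?inE ?eqxx ?orbT // andbT; apply/negP=> xu.
      by rewrite -(xn _ uS xu) uS in p1S.
    - move=> u /inUE[->|->|->|[->|->]]; rewrite in_set2 ?eqxx ?orbT // => _.
      + by exists x1 => //; rewrite !in_setU !in_set1 eqxx !orbT.
      + by exists x1 => //; rewrite !in_setU !in_set1 eqxx !orbT.
      + by exists q1; rewrite ?in_setU ?q1S.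
  have [pS|pS] := boolP (p \in S').
    have qS : q \notin S' by move: npqS; rewrite pS.
    apply: (mxz y x q p) => //; first exact: K23_xy.
    - by move=> c cS yc; have [[ye _]|[_ //]] := NU _ _ yU cS yc; rewrite ye eqxx in nxy.
    - by move=> u; rewrite in_uset => /or4P[/eqP|/eqP|/eqP|/orP[]/eqP]; [constructor 1|constructor 2|constructor 4; left|constructor 3|constructor 4; right].
    - by rewrite pS.
    - by rewrite E_sym.
  have [qS|qS] := boolP (q \in S').
    apply: (mxz x y p q) => //.
    - by move=> c cS yc; have [[_ //]|[ye _]] := NU _ _ xU cS yc; rewrite ye eqxx in nxy.
    - by move=> u; rewrite in_uset => /or4P[/eqP|/eqP|/eqP|/orP[]/eqP]; [constructor 1|constructor 2|constructor 3|constructor 4; left|constructor 4; right].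
    - by rewrite E_sym.
    - by rewrite qS.
  apply: (main a b) => //.
  - by apply/negP=> /(K23_Ea g3 k); rewrite !inE (negbTE nbx) (negbTE nby) (negbTE nbz).
  - by move=> u uS; rewrite !nS ?inE ?eqxx ?orbT.
  - move=> u; rewrite in_uset in_set2 negb_or => /or4P[->|->|/eqP->|/orP[]/eqP->] //; rewrite ?andbF // => _;
      by exists a; [rewrite !in_setU !in_set1 eqxx !orbT|rewrite E_sym].
  - by rewrite (negbTE qS).
  - by rewrite (negbTE pS).
move=> cU dU cd cdS cdX hp hq; exists (S' :|: [set c; d]); last first.
  by apply: leq_trans (leq_card_setU _ _) _; rewrite leq_add2l cards2; case: (_ != _).
have cI : c \in S' :|: [set c; d] by rewrite in_setU in_set2 eqxx orbT.
split.
- apply/subUsetP; split; first by apply: subset_trans S'V (subsetDl _ _).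
  by apply/subsetP=> u; rewrite in_set2 => /orP[] /eqP ->; apply: UV.
- move=> u w; rewrite !in_setU !in_set1 => /orP[uS|ucd] /orP[wS|wcd]; first exact: S'E.
  + by rewrite E_sym; have /andP[cu du] := cdS u uS; case/orP: wcd => /eqP ->.
  + by have /andP[cu du] := cdS w wS; case/orP: ucd => /eqP ->.
  + by case/orP: ucd => /eqP ->; case/orP: wcd => /eqP ->; rewrite ?E_irr // E_sym.
- move=> u uV; rewrite in_setU negb_or => /andP[uS ucd].
  have [uU|uU] := boolP (u \in U); first exact: cdX.
  have [|w wS] := S'd u _ uS; first by rewrite in_setD uU.
  rewrite EHE => /orP[/and3P[uw _ _]|/orP[]/andP[/eqP ue /eqP we]]; first by exists w; rewrite // in_setU wS.
    by exists c => //; rewrite ue; apply: hp; rewrite -?ue -?we.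
  by exists c => //; rewrite ue; apply: hq; rewrite -?ue -?we.
Qed.

Lemma ids_V (h : gr T) c d : E h c d -> c \in V h /\ d \in V h.
Proof. by move=> cd; split; [apply: E_V cd|apply: E_Vr cd]. Qed.

Lemma K23_VH a' b' x' y' z' : K23 H a' b' x' y' z' -> forall u, u \in uset a' b' x' y' z' -> u \notin U.
Proof.
case/K23P=> -[_ /ids_V[ha hx] /ids_V[_ hy] /ids_V[_ hz]] [/ids_V[hb _] _ _] u.
by rewrite in_uset => /or4P[/eqP->|/eqP->|/eqP->|/orP[]/eqP->]; apply: VH.
Qed.

(** A unit with two free ports that does not contain both [p] and [q] would be one of [g], against
    [pendant_no]. *)
Lemma nopendH a' b' x' y' z' : K23 H a' b' x' y' z' -> nb H y' = [set a'; b'] -> nb H z' = [set a'; b'] ->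
  p \in uset a' b' x' y' z' /\ q \in uset a' b' x' y' z'.
Proof.
move=> k' ny' nz'; have WU := K23_VH k'; apply/andP; apply/negPn/negP=> nW.
have kg : K23 g a' b' x' y' z' by rewrite (K23_sub (agrH WU nW)).
have nbg w : w \in uset a' b' x' y' z' -> nb H w = [set a'; b'] -> nb g w = [set a'; b'].
  move=> wW nw; rewrite -nw; apply/esym/nbH; first exact: WU.
    apply: contraNneq nW => wp; rewrite -wp wW /=.
    have : q \in nb H w by rewrite wp in_nb EHpq.
    by rewrite nw in_set2 in_uset => /orP[]->; rewrite ?orbT.
  apply: contraNneq nW => wq; rewrite -wq wW andbT.
  have : p \in nb H w by rewrite wq in_nb E_sym EHpq.
  by rewrite nw in_set2 in_uset => /orP[]->; rewrite ?orbT.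
apply: (pendant_no kg); apply: nbg => //; by rewrite in_uset eqxx ?orbT.
Qed.

Lemma bad_unit_no : bad_unit H p q -> False.
Proof.
case=> a' [b' [x' [y' [z' [k' nz' ps]]]]]; have WU := K23_VH k'.
have [[ku' ax' ay' az'] [bx' by' bz']] := K23P k'.
have [[nab nax nay naz] [[nbx nby nbz] [nxy nxz nyz]]] := uniq5 ku'.
have inW u : u \in [:: a'; b'; x'; y'; z'] -> u \notin U by move=> uu; apply: WU; apply: K23_U.
have z2 : #|nb g z'| <= 2.
  rewrite -cardH ?inW ?inE ?eqxx ?orbT // nz' cards2; by case: (_ != _).
have un x1 y1 : uniq [:: a; b; x1; y1; z] -> uset a b x1 y1 z = U -> uniq [:: a; b; x1; y1; z; a'; b'; x'; y'; z'].
  move=> u1 UE; rewrite -[[:: a, b & _]]/([:: a; b; x1; y1; z] ++ [:: a'; b'; x'; y'; z']) cat_uniq.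
  apply/and3P; split=> //; apply/hasPn=> c cW; have := inW c cW; rewrite -UE; apply: contra => cc.
  by rewrite inE.
have [[ku _ _ _] _] := K23P k; have kk := K23_xy k; have [[ku2 _ _ _] _] := K23P kk.
have u1 := un x y ku erefl; have u2 := un y x ku2 (esym (uset_xy _ _ _ _ _)).
have eg c d : E H c d -> c \in [:: a'; b'; x'; y'; z'] -> d \in [:: a'; b'; x'; y'; z'] ->
   ~~ ((c == p) && (d == q) || (c == q) && (d == p)) -> E g c d.
  by move=> cd cW dW n; rewrite EHg ?inW.
have mm i : i \in [:: 0; 1; 2; 3; 4] -> nth a' [:: a'; b'; x'; y'; z'] i \in [:: a'; b'; x'; y'; z'].
  by rewrite !inE => /or4P[/eqP->|/eqP->|/eqP->|/orP[]/eqP->]; rewrite /= ?eqxx ?orbT.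
have ma := mm 0 isT; have mb := mm 1 isT; have mx := mm 2 isT; have my := mm 3 isT; have mz := mm 4 isT.
rewrite /= in ma mb mx my mz.
have ba : b' == a' = false by rewrite eq_sym (negbTE nab).
have [xa ya za] : [/\ x' == a' = false, y' == a' = false & z' == a' = false] by rewrite ![_ == a']eq_sym (negbTE nax) (negbTE nay) (negbTE naz).
have [xb yb zb] : [/\ x' == b' = false, y' == b' = false & z' == b' = false] by rewrite ![_ == b']eq_sym (negbTE nbx) (negbTE nby) (negbTE nbz).
have [yx zx zy] : [/\ y' == x' = false, z' == x' = false & z' == y' = false] by rewrite [y' == x']eq_sym [z' == x']eq_sym [z' == y']eq_sym (negbTE nxy) (negbTE nxz) (negbTE nyz).
have simp := (ba, xa, ya, za, xb, yb, zb, yx, zx, zy, negbTE nab, (negbTE nax, negbTE nay, negbTE naz), (negbTE nbx, negbTE nby, negbTE nbz), (negbTE nxy, negbTE nxz, negbTE nyz)).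
case: ps => [[pe qe]|[pe qe]|[pe qe]|[pe qe]].
- have hx : E g x a' by rewrite -pe.
  have hy : E g y z' by rewrite -qe.
  apply: (S1_no k nz u1 hx hy _ z2); split; [apply: (eg _ _ ax' ma mx)|apply: (eg _ _ ay' ma my)|apply: (eg _ _ bx' mb mx)|apply: (eg _ _ by' mb my)|apply: (eg _ _ bz' mb mz)]; by rewrite pe qe ?simp ?andbF.
- have hx : E g x a' by rewrite -pe.
  have hy : E g y y' by rewrite -qe.
  apply: (S2_no k nz u1 hx hy _ z2); split; [apply: (eg _ _ ax' ma mx)|apply: (eg _ _ az' ma mz)|apply: (eg _ _ bx' mb mx)|apply: (eg _ _ by' mb my)|apply: (eg _ _ bz' mb mz)]; by rewrite pe qe ?simp ?andbF.
- have hx : E g y a' by rewrite -pe.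
  have hy : E g x z' by rewrite -qe.
  apply: (S1_no kk nz u2 hx hy _ z2); split; [apply: (eg _ _ ax' ma mx)|apply: (eg _ _ ay' ma my)|apply: (eg _ _ bx' mb mx)|apply: (eg _ _ by' mb my)|apply: (eg _ _ bz' mb mz)]; by rewrite pe qe ?simp ?andbF.
- have hx : E g y a' by rewrite -pe.
  have hy : E g x y' by rewrite -qe.
  apply: (S2_no kk nz u2 hx hy _ z2); split; [apply: (eg _ _ ax' ma mx)|apply: (eg _ _ az' ma mz)|apply: (eg _ _ bx' mb mx)|apply: (eg _ _ by' mb my)|apply: (eg _ _ bz' mb mz)]; by rewrite pe qe ?simp ?andbF.
Qed.

(** No unit contains both ends of [p q], so this edge is the link of some unit. Inserting [U] there
    hangs [U] on one end and the old unit on another port of [U]. *)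
Lemma utree_ins r C us : utree H r C us -> p \in C -> q \in C ->
  (forall u, u \in us -> ~~ ((p \in u) && (q \in u))) -> exists us', utree g r (C :|: U) us'.
Proof.
elim=> {C us} [rV|C us v a' b' x' y' z' ut IHu vC k' nyz dis vx cr].
  by rewrite !in_set1 => /eqP pr /eqP qr; move: pq; rewrite pr qr eqxx.
move=> pC qC nus; set L := uset a' b' x' y' z' in dis cr pC qC nus *.
have LU := K23_VH k'; have CU c : c \in C -> c \notin U by move/(subsetP (utree_V ut))/VH.
have nL : ~~ ((p \in L) && (q \in L)) by apply: nus; rewrite inE eqxx.
have kg : K23 g a' b' x' y' z' by rewrite (K23_sub (agrH LU nL)).
have yL : y' \in L by rewrite in_uset eqxx ?orbT.
have zL : z' \in L by rewrite in_uset eqxx ?orbT.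
have x'L : x' \in L by rewrite in_uset eqxx ?orbT.
have nyzg : ~~ E g y' z' by rewrite (agrH LU nL).
have CL c : c \in C -> c \in L = false by exact: disjointFr.
have EgH c u : c \in C -> u \in L -> E g c u -> c = v /\ u = x'.
  by move=> cC uL cu; apply: cr => //; rewrite EHE cu CU ?LU.
have dU (D : {set T}) : (forall c, c \in D -> c \notin U) -> [disjoint D & U].
  by move=> h; rewrite disjoint_subset; apply/subsetP=> c /h; rewrite !inE.
have dCUL : [disjoint C :|: U & L].
  rewrite disjoint_subset; apply/subsetP=> c; rewrite in_setU => /orP[/CL|cU]; first by rewrite !inE => ->.
  by rewrite inE /=; apply: contraL cU => /LU.
have step x1 y1 p1 q1 : K23 g a b x1 y1 z -> uset a b x1 y1 z = U -> E g x1 p1 -> E g y1 q1 ->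
    (forall u c, u \in U -> c \notin U -> E g u c -> u = x1 /\ c = p1 \/ u = y1 /\ c = q1) -> ~~ E g p1 q1 ->
    E H p1 q1 -> ~~ ((p \in C) && (q \in C)) -> p1 \in C -> q1 \in L -> exists us', utree g r (C :|: L :|: U) us'.
  move=> k1 UE xp1 yq1 out1 npq1 e1 nC p1C q1L; have [pv qx] := cr _ _ p1C q1L e1.
  have x1U : x1 \in U by rewrite -UE in_uset eqxx ?orbT.
  have y1U : y1 \in U by rewrite -UE in_uset eqxx ?orbT.
  exists (L :: U :: us); rewrite setUAC; apply: (utS (v := y1)) => //.
  - rewrite -UE; apply: (utS (v := p1)) => //.
    + apply: (utree_sub _ _ ut); first exact: agrH.
      by apply: subset_trans (utree_V ut) (subsetDl _ _).
    + exact: (yz_no k1).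
    + by rewrite UE; apply: dU.
    + by rewrite E_sym.
    + move=> c u cC; rewrite UE => uU; rewrite E_sym => /(out1 _ _ uU (CU _ cC))[[-> ->] //|[_ ce]].
      by move: q1L; rewrite -ce CL.
  - by rewrite in_setU y1U orbT.
  - by rewrite -qx.
  - move=> c u; rewrite in_setU => /orP[cC|cU] uL cu.
      have [cv ux] := EgH _ _ cC uL cu; by move: npq1; rewrite pv qx -cv -ux cu.
    have [[_ ue]|[-> ue]] := out1 _ _ cU (LU _ uL) cu; last by rewrite ue qx.
    by move: uL; rewrite ue CL.
move: pC qC; rewrite !in_setU.
have [pC|npC] := boolP (p \in C); have [qC|nqC] := boolP (q \in C); rewrite ?orbF /=.
- move=> _ _; have [|us' ut'] := IHu pC qC _; first by move=> u uus; apply: nus; rewrite inE uus orbT.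
  exists (L :: us'); rewrite setUAC; apply: (utS (v := v)) => //.
  + by rewrite in_setU vC.
  + rewrite (EHg _ (CU _ vC) (LU _ x'L)) //; apply/negP=> /orP[]/andP[_ /eqP xe]; move: (CL _ pC) (CL _ qC); rewrite -?xe x'L //.
  + move=> c u; rewrite in_setU => /orP[cC|cU] uL cu; first exact: EgH.
    by have [[_ ue]|[_ ue]] := two_out cU (LU _ uL) cu; move: uL; rewrite ue CL.
- move=> _ qL; apply: (step x y p q) => //; [exact: two_out|exact: EHpq|by rewrite pC (negbTE nqC)].
- move=> pL _; apply: (step y x q p) => //.
  + exact: K23_xy.
  + by rewrite -uset_xy.
  + by move=> u c uU cU /(two_out uU cU)[]; auto.
  + by rewrite E_sym.
  + by rewrite E_sym EHpq.
  + by rewrite (negbTE npC).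
- by move=> pL qL; move: nL; rewrite pL qL.
Qed.

Lemma cardCU x1 p1 q1 (C : {set T}) : nb H p1 = q1 |: (nb g p1 :\ x1) -> E g x1 p1 -> x1 \in U -> ~~ E g p1 q1 ->
  (forall u, u \in U -> E g p1 u -> u = x1) -> q1 \in C -> (forall c, c \in C -> c \notin U) ->
  #|nb g p1 :&: (C :|: U)| = #|nb H p1 :&: C|.
Proof.
move=> nbp xp1 x1U npq1 on q1C CU.
have xC : x1 \notin C by apply: contraL x1U => /CU.
have -> : nb g p1 :&: (C :|: U) = x1 |: ((nb H p1 :&: C) :\ q1).
  apply/setP=> u; rewrite in_setI in_setU in_setU1 in_setD1 in_setI nbp in_setU1 in_setD1 in_nb.
  have [->|ux] /= := eqVneq u x1; first by rewrite x1U E_sym xp1 orbT.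
  have [->|uq] /= := eqVneq u q1; first by rewrite (negbTE npq1).
  case pu: (E g p1 u) => //=; case uU: (u \in U); rewrite ?orbF //.
  by move: ux; rewrite (on _ uU pu) eqxx.
rewrite cardsU1 in_setD1 in_setI (negbTE xC) !andbF /= [RHS](cardsD1 q1) in_setI q1C andbT nbp in_setU1 eqxx.
by [].
Qed.

(** A closed tree ends in a unit with two free ports, hence in a bad unit. A troublesome
    configuration not containing both [p] and [q] is one of [g], and if both lie in [C] it is
    enlarged to one of [g] by [utree_ins]. If one of them is [v2], the other is [w2] or [v1]: in the
    former case [U] is attached at [w2], in the latter the set [J] of [chain] gives a direct
    reduction. *)
Lemma nobtH B : ~ bt H B.
Proof.
have [[ku ax ay az] [bx by_ bz]] := K23P k; have [[nab nax nay naz] [[nbx nby nbz] [nxy nxz nyz]]] := uniq5 ku.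
have inU u : u \in [:: a; b; x; y; z] -> u \in U by exact: K23_U.
have zU : z \in U by rewrite inU // !inE eqxx !orbT.
have aU : a \in U by rewrite inU // !inE eqxx.
have bU : b \in U by rewrite inU // !inE eqxx orbT.
case=> [[r [us [ut cl]]]|[v1 [v2 [w2 [C [us [[ut v2C v12 v2w2] [[w2C w21 nw2 nv1 BE] [nbC nv2 d3]]]]]]]]].
  move: ut cl; case=> [rV|C us' v a' b' x' y' z' ut vC k' nyz' dis vx cr] cl.
    have rU := VH rV; have := @nb1 r; rewrite -cardH // => h.
    have /h : r \in V g by move: rV; rewrite in_setD => /andP[].
    case/card_gt0P=> u; rewrite in_nb => ru; have := cl r u; rewrite in_set1 eqxx => /(_ isT ru).
    by rewrite in_set1 => /eqP ue; rewrite ue E_irr in ru.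
  have sub c : c \in C :|: uset a' b' x' y' z' -> nb H c \subset C :|: uset a' b' x' y' z'.
    by move=> cC; apply/subsetP=> u; rewrite in_nb; apply: cl.
  have ny' : nb H y' = [set a'; b'].
    apply: (last_nbE H3 k' nyz' vC dis vx cr); apply: sub; by rewrite in_setU in_uset eqxx !orbT.
  have nz' : nb H z' = [set a'; b'].
    have nzy : ~~ E H z' y' by rewrite E_sym.
    have szz : nb H z' \subset C :|: uset a' b' x' y' z' by apply: sub; rewrite in_setU in_uset eqxx !orbT.
    rewrite uset_yz in dis cr szz; exact: (last_nbE H3 (K23_yz k') nzy vC dis vx cr szz).
  have [pL qL] := nopendH k' ny' nz'.
  exact: bad_unit_no (bad_unit_of H3 EHpq k' nyz' vC dis vx cr pL qL nz').
have CU c : c \in C -> c \notin U by move/(subsetP (utree_V ut))/VH.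
have v2U : v2 \notin U by apply: VH; apply: E_Vr v12.
have BU c : c \in B -> c \notin U by rewrite BE in_setU1 => /orP[/eqP->|/CU].
have v1C := utree_r ut.
have CB c : c \in C -> c \in B by move=> cC; rewrite BE in_setU1 cC orbT.
have v2B : v2 \in B by rewrite BE in_setU1 eqxx.
have BV : B \subset V g.
  apply/subsetP=> c; rewrite BE in_setU1 => /orP[/eqP->|/(subsetP (utree_V ut))]; last by rewrite in_setD => /andP[].
  by have := E_Vr v12; rewrite in_setD => /andP[].
have clo c : c \in C -> c != v1 -> c != w2 -> nb H c \subset C.
  move=> cC c1 c2; apply/subsetP=> u unb; have := subsetP (nbC c cC c1) _ unb; rewrite BE in_setU1.
  case/orP=> [/eqP ue|//]; have : c \in nb H v2 :&: C by rewrite in_setI cC andbT nb_sym -ue.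
  by rewrite nv2 in_set2 (negbTE c1) (negbTE c2).
have d3g : #|nb g v2| = 3 by rewrite -cardH.
have [bad|[[J [cJ JC iJ rJ dJ]] nus]] := chain H3 EHpq nopendH ut w2C w21 nw2 nv1 clo; first exact: bad_unit_no bad.
have EgH c u : c \notin U -> u \notin U -> E g c u -> E H c u by move=> cU uU cu; rewrite EHE cu cU uU.
have clg c u : c \in C -> c != v1 -> E g c u -> u \notin U -> u \in B.
  by move=> cC c1 cu uU; apply: (subsetP (nbC c cC c1)); rewrite in_nb; apply: EgH => //; apply: CU.
have [/andP[pB qB]|npqB] := boolP ((p \in B) && (q \in B)); last first.
  apply: (@nobt B); right.
  apply: (bt2_sub (And4 ut v2C v12 v2w2) (And5 w2C w21 nw2 nv1 BE)) => //.
    exact: agrH.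
  move=> c u cC c1 cu; have [uU|uU] := boolP (u \in U); last exact: (clg c).
  have uc : E g u c by rewrite E_sym.
  case/negP: npqB; have [[_ ce]|[_ ce]] := two_out uU (CU _ cC) uc; rewrite -ce (CB _ cC) ?andbT /=.
    by apply: (subsetP (nbC c cC c1)); rewrite in_nb ce EHpq.
  by apply: (subsetP (nbC c cC c1)); rewrite in_nb ce E_sym EHpq.
have clU u w : u \in U -> E g u w -> [\/ w \in U, w = p | w = q].
  move=> uU uw; have [|wU] := boolP (w \in U); first by constructor 1.
  by have [[_ ->]|[_ ->]] := two_out uU wU uw; [constructor 2|constructor 3].
have onp u : u \in U -> E g p u -> u = x.
  by move=> uU; rewrite E_sym => /(two_out uU pU)[[]//|[_ pe]]; move: pq; rewrite pe eqxx.
have onq u : u \in U -> E g q u -> u = y.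
  by move=> uU; rewrite E_sym => /(two_out uU qU)[[_ pe]|[]//]; move: pq; rewrite pe eqxx.
have onc c u : c \notin U -> c != p -> c != q -> u \in U -> ~~ E g c u.
  move=> cU cp cq uU; apply/negP; rewrite E_sym => /(two_out uU cU)[[_ ce]|[_ ce]]; by rewrite ce eqxx in cp cq.
have nbCU c : c \notin U -> c != p -> c != q -> nb g c :&: (C :|: U) = nb H c :&: C.
  move=> cU cp cq; rewrite nbH // setIUr [nb g c :&: U](_ : _ = set0) ?setU0 //.
  apply/setP=> u; rewrite in_setI in_nb in_set0; apply/negP=> /andP[cu uU].
  by have := onc _ _ cU cp cq uU; rewrite cu.
have [/andP[pC qC]|npqC] := boolP ((p \in C) && (q \in C)).
  have [us' ut'] := utree_ins ut pC qC nus.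
  have v2p : v2 != p by apply: contraNneq v2C => ->.
  have v2q : v2 != q by apply: contraNneq v2C => ->.
  have cCU c : c \in C -> #|nb g c :&: (C :|: U)| = #|nb H c :&: C|.
    move=> cC; have [->|cp] := eqVneq c p; first exact: (cardCU nbHp xp).
    have [->|cq] := eqVneq c q; last by rewrite nbCU ?CU.
    by apply: (cardCU nbHq yq) => //; rewrite E_sym.
  apply: (@nobt (v2 |: (C :|: U))); right; exists v1, v2, w2, (C :|: U), us'; split; [split|split; split] => //.
  - by rewrite in_setU negb_or v2C.
  - by have := v12; rewrite E_sym -in_nb nbH // in_nb E_sym.
  - by have := v2w2; rewrite -in_nb nbH // in_nb.
  - by rewrite in_setU w2C.
  - by rewrite cCU.
  - by rewrite cCU.
  - move=> c cCU' c1; apply/subsetP=> u; rewrite in_nb in_setU1 in_setU => cu.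
    have [uU|uU] := boolP (u \in U); first by rewrite !orbT.
    rewrite orbF; move: cCU'; rewrite in_setU => /orP[cC|cU].
      by have := clg _ _ cC c1 cu uU; rewrite BE in_setU1.
    by have [uU'|->|->] := clU _ _ cU cu; [rewrite uU' in uU|rewrite pC orbT|rewrite qC orbT].
  - by rewrite nbCU.
have fin x1 y1 p1 q1 : K23 g a b x1 y1 z -> uset a b x1 y1 z = U -> E g x1 p1 -> E g y1 q1 ->
    (forall u c, u \in U -> c \notin U -> E g u c -> u = x1 /\ c = p1 \/ u = y1 /\ c = q1) -> ~~ E g p1 q1 ->
    E H p1 q1 -> (forall u, u \in U -> E g q1 u -> u = y1) ->
    (forall c, (c == p1) || (c == q1) = (c == p) || (c == q)) -> q1 = v2 -> p1 \in C -> False.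
  move=> k1 UE xp1 yq1 out1 npq1 e1 onq1 sm qe p1C.
  have x1U : x1 \in U by rewrite -UE in_uset eqxx ?orbT.
  have y1U : y1 \in U by rewrite -UE in_uset eqxx ?orbT.
  have p1q1 : p1 != q1 by rewrite qe; apply: contraNneq v2C => <-.
  have npq' c : c != p1 -> c != q1 -> c != p /\ c != q.
    by move=> c1 c2; apply/andP; rewrite -negb_or -sm negb_or c1 c2.
  have utg : utree g v1 C us.
    apply: (utree_sub _ _ ut); last by apply: subset_trans (utree_V ut) (subsetDl _ _).
    exact: agrH.
  have HEg c u : c != p1 -> c != q1 -> E H c u -> E g c u.
    by move=> c1 c2 cu; have [cp cq] := npq' _ c1 c2; move: cu; rewrite EHE (negbTE cp) (negbTE cq) orbF => /and3P[].
  have Cq1 c : c \in C -> c != q1 by rewrite qe; apply: contraTneq => ->.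
  have uC_nU u : u \in C -> u \in U = false by move/CU/negbTE.
  have [p1v|p1v] := eqVneq p1 v1; last first.
    have p1w : p1 = w2.
      have : p1 \in nb H v2 :&: C by rewrite in_setI p1C in_nb -qe E_sym e1.
      by rewrite nv2 in_set2 (negbTE p1v) => /eqP.
    have v1p : v1 != p1 by rewrite eq_sym.
    have [v1p' v1q'] := npq' _ v1p (Cq1 _ v1C).
    apply: (@nobt (v2 |: (C :|: U))); right; exists v1, v2, y1, (C :|: U), (U :: us); split; [split|split; split] => //.
    - rewrite -UE; apply: (utS (v := p1)) => //.
      + exact: (yz_no k1).
      + by rewrite UE disjoint_subset; apply/subsetP=> c /CU; rewrite !inE.
      + by rewrite E_sym.
      + move=> c u cC; rewrite UE => uU; rewrite E_sym => /(out1 _ _ uU (CU _ cC))[[-> ->] //|[_ ce]].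
        by have := Cq1 _ cC; rewrite ce eqxx.
    - by rewrite in_setU negb_or v2C.
    - exact: (HEg _ _ v1p (Cq1 _ v1C)).
    - by rewrite -qe E_sym.
    - by rewrite in_setU y1U orbT.
    - by apply: contraTneq y1U => ->; apply: CU.
    - have -> : nb g y1 :&: (C :|: U) = [set a; b]; last by rewrite cards2 nab.
      have [[_ _ ay1 _] [_ by1 _]] := K23P k1.
      apply/setP=> u; rewrite in_setI in_nb in_setU in_set2; apply/andP/orP.
        case=> yu uCU; have [->|->|uu] := port_out (K23_xy k1) yu; rewrite ?eqxx; [by left|by right|].
        rewrite -uset_xy UE in uu; have [[ye _]|[_ ue]] := out1 _ _ y1U uu yu.
          by have [[kk _ _ _] _] := K23P k1; have [_ [_ [ne _ _]]] := uniq5 kk; rewrite ye eqxx in ne.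
        by move: uCU; rewrite ue (negbTE (_ : q1 \notin U)) -?ue // orbF => /Cq1; rewrite ue eqxx.
      by case=> /eqP->; rewrite E_sym ?ay1 ?by1 ?aU ?bU ?orbT.
    - by rewrite nbCU ?CU.
    - move=> c cCU' c1; apply/subsetP=> u; rewrite in_nb in_setU1 in_setU => cu.
      have [uU|uU] := boolP (u \in U); first by rewrite !orbT.
      rewrite orbF; move: cCU'; rewrite in_setU => /orP[cC|cU].
        by have := clg _ _ cC c1 cu uU; rewrite BE in_setU1.
      by have [[_ ->]|[_ ->]] := out1 _ _ cU uU cu; rewrite ?p1C ?orbT // qe eqxx.
    - apply/setP=> u; rewrite in_setI in_nb in_setU in_set2; apply/andP/orP.
        case=> vu /orP[uC|uU]; last by right; rewrite (onq1 _ uU) ?qe.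
        have : u \in nb H v2 :&: C by rewrite in_setI uC in_nb (EgH _ _ v2U (CU _ uC) vu).
        rewrite nv2 in_set2 => /orP[->|/eqP ue]; first by left.
        by move: npq1; rewrite p1w -ue E_sym qe vu.
      case=> /eqP->; first by rewrite E_sym (HEg _ _ v1p (Cq1 _ v1C)) // v1C.
      by rewrite -qe E_sym yq1 y1U orbT.
  have JCC j : j \in J -> [/\ j \in C, j != v1 & j != w2] by move/(subsetP JC); rewrite !in_setD1 => /and3P[].
  have nbgC c : c \in C -> c != v1 -> nb g c = nb H c.
    move=> cC c1; have c1' : c != p1 by rewrite p1v.
    by have [cp cq] := npq' _ c1' (Cq1 _ cC); rewrite nbH ?CU.
  have EJ j u : j \in J -> E g j u = E H j u.
    by move=> jJ; have [jC j1 _] := JCC _ jJ; rewrite -!in_nb nbgC.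
  have zN u : E g z u -> u = a \/ u = b by rewrite -in_nb nz in_set2 => /orP[]/eqP->; auto.
  have zn u : u \notin U -> ~~ E g z u by move=> uU; apply/negP=> /zN[] ue; rewrite ue ?aU ?bU in uU.
  (* With n units, [I] has at most 2n + 2 vertices. The core [D] weighs at least 16n + 16, plus 3
     for [v2] and the weight of [v1]; these last two pay 3 for each neighbour of [v1] and [v2]
     outside [D]. *)
  pose I := v1 |: (v2 |: (z |: J)); pose D := v2 |: (C :|: U).
  have inI u : u \in I = [|| u == v1, u == v2, u == z | u \in J] by rewrite !in_setU1.
  have ID u : u \in I -> u \in D.
    rewrite inI in_setU1 in_setU => /or4P[/eqP->|->|/eqP->|/JCC[jC _ _]] //; by rewrite ?v1C ?zU ?jC ?orbT.
  have DV u : u \in D -> u \in V g.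
    rewrite in_setU1 in_setU => /or3P[/eqP->|/CB/(subsetP BV)//|/UV //]; exact: (subsetP BV).
  have w2g : E g v2 w2.
    by rewrite E_sym; apply: HEg; rewrite ?p1v ?Cq1 // E_sym.
  have DX u : u \in D -> u \in clnb g I.
    rewrite in_setU1 in_setU => /or3P[/eqP->|uC|uU]; apply/in_clnb.
    - by left; rewrite inI eqxx orbT.
    - have [->|u1] := eqVneq u v1; first by left; rewrite inI eqxx.
      have [->|u2] := eqVneq u w2; first by right; exists v2; rewrite ?inI ?eqxx ?orbT.
      have [v1u|v1u] := boolP (E H v1 u).
        right; exists v1; rewrite ?inI ?eqxx // E_sym; apply: HEg; rewrite ?p1v ?Cq1 // E_sym //.
      have [uJ|[j jJ ju]] := dJ _ uC u1 u2 v1u; first by left; rewrite inI uJ !orbT.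
      by right; exists j; rewrite ?inI ?jJ ?orbT // EJ.
    - move: uU; rewrite -UE in_uset => /or4P[/eqP->|/eqP->|/eqP->|/orP[]/eqP->].
      + by right; exists z; rewrite ?inI ?eqxx ?orbT // E_sym.
      + by right; exists z; rewrite ?inI ?eqxx ?orbT // E_sym.
      + by right; exists v1; rewrite ?inI ?eqxx // -p1v E_sym.
      + by right; exists v2; rewrite ?inI ?eqxx ?orbT // -qe E_sym.
      + by left; rewrite inI eqxx !orbT.
  have nbI u w : u \in I -> E g u w -> w \in D \/ (u = v1 \/ u = v2).
    rewrite inI => /or4P[/eqP->|/eqP->|/eqP->|uJ] uw; auto; left; rewrite in_setU1 in_setU.
      by have [->|->] := zN _ uw; rewrite ?aU ?bU !orbT.
    have [uC u1 u2] := JCC _ uJ; rewrite EJ // in uw.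
    by rewrite (subsetP (clo _ uC u1 u2)) ?orbT // in_nb.
  apply: (@no_core I D).
  - by apply/subsetP=> u /ID/DV.
  - by apply/set0Pn; exists v1; rewrite inI eqxx.
  - have n12 : ~~ E g v1 v2 by rewrite -p1v -qe.
    have n1j j : j \in J -> ~~ E g v1 j by move=> jJ; rewrite E_sym EJ // E_sym; have [] := rJ _ jJ.
    have n2j j : j \in J -> ~~ E g v2 j.
      move=> jJ; have [jC j1 j2] := JCC _ jJ; rewrite E_sym EJ //; apply/negP=> jv.
      have : j \in nb H v2 :&: C by rewrite in_setI jC in_nb E_sym jv.
      by rewrite nv2 in_set2 (negbTE j1) (negbTE j2).
    have nz1 := zn _ (CU _ v1C); have nz2 := zn _ v2U.
    have nzj j : j \in J -> ~~ E g z j by move=> /JCC[/CU/zn].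
    move=> u w; rewrite !inI => /or4P[/eqP->|/eqP->|/eqP->|uJ] /or4P[/eqP->|/eqP->|/eqP->|wJ]; rewrite ?E_irr //; try by rewrite ?n1j ?n2j ?nzj.
    all: try by rewrite E_sym // ?n1j ?n2j ?nzj.
    by rewrite EJ // iJ.
  - by apply/subsetP.
  - move=> u; rewrite in_setU1 in_setU => /or3P[/eqP->|uC|uU]; apply/subsetP=> w; rewrite in_nb => uw.
    + by apply/in_clnb; right; exists v2; rewrite ?inI ?eqxx ?orbT.
    + have [u1|u1] := eqVneq u v1; first by apply/in_clnb; right; exists v1; rewrite ?inI ?eqxx // -u1.
      apply: DX; have : w \in B by apply: (subsetP (nbC u uC u1)); rewrite -nbgC // in_nb.
      by rewrite BE !in_setU1 in_setU => /orP[]->; rewrite ?orbT.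
    + apply: DX; rewrite in_setU1 in_setU; have [wU|wU] := boolP (w \in U); first by rewrite !orbT.
      by have [[_ ->]|[_ ->]] := out1 _ _ uU wU uw; rewrite ?p1C ?orbT // qe eqxx.
  - move=> u /in_clnb[/ID ->//|[w wI wu]] uD; exists w; [exact: ID|by rewrite E_sym].
  have cI : #|I| <= 3 + #|J|.
    rewrite !cardsU1; move: (v1 \notin _) (v2 \notin _) (z \notin _) => [] [] []; rewrite /= ?add0n ?addnA //; clear; lia.
  have cX : #|clnb g I :\: D| <= #|nb g v1 :\: D| + #|nb g v2 :\: D|.
    apply: leq_trans (leq_card_setU _ _); apply: subset_leq_card; apply/subsetP=> u.
    rewrite in_setD => /andP[uD /in_clnb[/ID uD'|[w wI wu]]]; first by rewrite uD' in uD.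
    have [uD'|[we|we]] := nbI _ _ wI wu; first by rewrite uD' in uD.
      by rewrite in_setU !in_setD !in_nb uD -we wu.
    by rewrite in_setU !in_setD !in_nb uD -we wu orbT.
  have two c s t : s != t -> E g c s -> E g c t -> s \in D -> t \in D -> #|nb g c :\: D| + 2 <= #|nb g c|.
    move=> st cs ct sD tD; rewrite -(cardsID D (nb g c)) addnC leq_add2r.
    have <- : #|[set s; t]| = 2 by rewrite cards2 st.
    by apply: subset_leq_card; apply/subsetP=> d; rewrite in_set2 in_setI in_nb => /orP[]/eqP->; rewrite ?cs ?ct ?sD ?tD.
  have y1D : y1 \in D by rewrite in_setU1 in_setU y1U !orbT.
  have x1D : x1 \in D by rewrite in_setU1 in_setU x1U !orbT.
  have CD c : c \in C -> c \in D by move=> cC; rewrite in_setU1 in_setU cC orbT.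
  have t2 : #|nb g v2 :\: D| + 2 <= #|nb g v2|.
    apply: (two v2 w2 y1) => //; [|by rewrite -qe E_sym|exact: CD].
    by apply: contraTneq y1U => <-; apply: CU.
  have t1 : #|nb g v1 :\: D| + 2 <= #|nb g v1|.
    have [c] : exists c, c \in nb H v1 :&: C by apply/card_gt0P; rewrite nv1.
    rewrite in_setI in_nb => /andP[v1c cC].
    apply: (two v1 c x1) => //; [| |by rewrite -p1v E_sym|exact: CD].
      by apply: contraTneq x1U => <-; apply: CU.
    rewrite E_sym; apply: HEg; rewrite ?p1v ?Cq1 // 1?E_sym //.
    by apply: contraTneq v1c => ->; rewrite E_irr.
  have sD : \sum_(u in D) (6 - #|nb g u|) = (6 - #|nb g v2|) + ((6 - #|nb g v1|) + \sum_(u in C :\ v1) (6 - #|nb g u|) + \sum_(u in U) (6 - #|nb g u|)).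
    rewrite big_setU1 /=; last by rewrite in_setU negb_or v2C.
    have dis : [disjoint C & U] by rewrite disjoint_subset; apply/subsetP=> c /CU; rewrite !inE.
    congr (_ + _); rewrite -(big_setD1 v1 v1C) /= -bigU //=; apply: eq_bigl => c; by rewrite !inE.
  have w1 : 16 * size us <= \sum_(u in C :\ v1) (6 - #|nb g u|).
    have nbC' c : c \in C -> c != v1 -> nb H c \subset v2 |: C by rewrite -BE; apply: nbC.
    rewrite (eq_bigr (fun u => 6 - #|nb H u|)).
      exact: (bt2_weight H3 ut v2C w2C w21 nw2 nv1 nbC' nv2).
    by move=> c; rewrite in_setD1 => /andP[c1 cC]; rewrite nbgC.
  have w2' := sum_unit k nz; rewrite -/U in w2'.
  rewrite sD d3g; move: t2; rewrite d3g; have := g3 v1; move: cI cX t1 w1 w2' cJ.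
  move: #|I| #|J| #|nb g v1| #|_ :\: D| #|_ :\: D| #|_ :\: D| (size us) (\sum_(_ in U) _) (\sum_(_ in _) _).
  by clear; lia.
have [pe|pe] := eqVneq p v2.
  apply: (fin y x q p) => //.
  - exact: K23_xy.
  - by rewrite -uset_xy.
  - by move=> u c uU cU /(two_out uU cU)[]; auto.
  - by rewrite E_sym.
  - by rewrite E_sym EHpq.
  - by move=> c; rewrite orbC.
  - by move: qB; rewrite BE in_setU1 -pe eq_sym (negbTE pq).
have pC : p \in C by move: pB; rewrite BE in_setU1 (negbTE pe).
have qe : q = v2 by apply/eqP; move: qB npqC; rewrite BE in_setU1 pC /= => /orP[//|->].
by apply: (fin x y p q) => //; [exact: two_out|exact: EHpq].
Qed.

(** [U] weighs at least 16, the price of two vertices, and putting the edge [p q] in its place keeps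
    all other degrees. *)
Lemma two_exit_no : False.
Proof.
apply: nQ; apply: (Q_lift (g' := H) (k := 2)).
- exact: liftH.
- rewrite (sig0 nobtH) muln0 addn0; apply: leq_trans (leq_addr _ _).
  by have := wtH; rewrite addnC.
apply: IH.
- apply: proper_card; apply/properP; split; first exact: subsetDl.
  by exists x; [apply: UV|rewrite in_setD xU].
- exact: H3.
- exact: (ins_no _ _ _ ins_dead_K33).
- exact: (ins_no _ _ _ ins_dead_prism).
Qed.

End Add.
End TwoExit.

(** A port without third neighbour leaves at most two exits. At most one exit is [pendant_no]. Two
    exits to the same vertex are [two_same], to non-adjacent vertices [two_exit_no], and to adjacent
    vertices [two_adj], unless both have degree at most 2, when one deletion suffices. *)
Theorem reduced a b x y z : K23 g a b x y z -> #|nb g x| = 3.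
Proof.
have ex a1 b1 x1 y1 z1 : K23 g a1 b1 x1 y1 z1 -> nb g x1 = [set a1; b1] \/
    exists2 p, E g x1 p & p \notin uset a1 b1 x1 y1 z1.
  move=> k; have [[ku ax ay az] [bx by_ bz]] := K23P k.
  have [/exists_inP[p xp pU]|ne] := boolP [exists p in nb g x1, p \notin uset a1 b1 x1 y1 z1].
    by right; exists p; rewrite // -in_nb.
  left; apply/setP=> u; rewrite in_nb in_set2; apply/idP/orP=> [xu|[]/eqP->]; rewrite 1?E_sym //.
  have [->|->|uU] := port_out k xu; rewrite ?eqxx; [by left|by right|].
  by case/negP: ne; apply/exists_inP; exists u; rewrite ?in_nb.
move=> k; apply/eqP; rewrite eqn_leq g3 /=; have [nx|[p xp pU]] := ex _ _ _ _ _ k; last first.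
  have [[ku ax _ _] [bx _ _]] := K23P k; have [[nab _ _ _] _] := uniq5 ku.
  rewrite (K23_exit g3 k pU xp); move: pU; rewrite in_uset !negb_or => /and5P[pa pb _ _ _].
  by rewrite setUC cardsU1 in_set2 negb_or pa pb cards2 nab.
have k1 := K23_xz k; exfalso; move: k1; move: x z nx {k} => z x nz k.
have [nx|[p xp pU]] := ex _ _ _ _ _ k.
  apply: (pendant_no (K23_xy k) nx nz).
have k' := K23_xy k; have [ny|[q yq qU']] := ex _ _ _ _ _ k'; first exact: (pendant_no k ny nz).
have qU : q \notin uset a b x y z by rewrite uset_xy.
have pU' : p \notin uset a b y x z by rewrite -uset_xy.
have [pe|pq] := eqVneq p q; first by rewrite -pe in yq; apply: (two_same k nz xp yq pU).
have qp : q != p by rewrite eq_sym.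
have [epq|npq] := boolP (E g p q); last exact: (two_exit_no k nz xp yq pU qU pq npq).
have eqp : E g q p by rewrite E_sym.
have dq : #|nb g q| <= 2.
  by rewrite -ltnS ltn_neqAle g3 andbT; apply/eqP=> d3; apply: (two_adj k nz xp yq pU qU pq epq d3).
have dp : #|nb g p| <= 2.
  by rewrite -ltnS ltn_neqAle g3 andbT; apply/eqP=> d3; apply: (two_adj k' nz yq xp qU' pU' qp eqp d3).
have [[ku ax ay az] [bx by_ bz]] := K23P k.
apply: (@leaf0 (mk 7 (uedges 0 ++ [:: (2,5); (3,6); (5,6)]) [:: 4; 5; 6]) [:: a; b; x; y; z; p; q] (HI [:: 0; 1; 5])).
  by vm_compute.
apply: mk_models => //.
- rewrite -[[:: a, b & _]]/([:: a; b; x; y; z] ++ [:: p; q]) cat_uniq ku /=.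
  by move: pU qU; rewrite !inE (negbTE pq) => /negbTE -> /negbTE ->.
- by rewrite /= ax ay az bx by_ bz xp yq epq.
- by rewrite /= (card_nbz nz) dp dq.
Qed.

End MinCounter.

(** * Two further reductions that replace a gadget by an edge *)

(** The trace argument with nothing deleted: a member would contain an isolated vertex or a port
    without third neighbour. *)
Lemma nobt_reduced (T : finType) (H : gr T) : sub3 H -> (forall c, c \in V H -> 0 < #|nb H c|) ->
  (forall a b x y z, K23 H a b x y z -> #|nb H x| = 3) -> forall B, ~ bt H B.
Proof.
move=> H3 H1 red B bB.
have : bt (del H set0) B.
  apply: (bt_eq _ _ bB) => [w _|]; first by rewrite nb_del in_set0 setD0.
  by rewrite /= setD0; apply: bt_V.
case/(bt_end1 H3 red)=> [[w _ /and3P[wV _]]|[a [b [w [y [z [_ _ /asboolP[]]]]]]]].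
  by rewrite subset0 -cards_eq0; have := H1 _ wV; case: #|_|.
by rewrite setI0 cards0.
Qed.

(** By symmetry the edge missing in [g] may be taken between the first side and the first port. *)
Lemma K23_broken (T : finType) (h g : gr T) a b x y z : K23 h a b x y z -> ~~ K23 g a b x y z ->
  exists s o t r1 r2, K23 h s o t r1 r2 /\ ~~ E g s t.
Proof.
move=> k; rewrite /K23; have [[-> _ _ _] _] := K23P k; have k' := K23_swap k.
rewrite /= !negb_and => /orP[e|/orP[e|/orP[e|/orP[e|/orP[e|e]]]]].
- by exists a, b, x, y, z.
- by exists a, b, y, x, z; split=> //; apply: K23_xy.
- by exists a, b, z, y, x; split=> //; apply: K23_xz.
- by exists b, a, x, y, z.
- by exists b, a, y, x, z; split=> //; apply: K23_xy.
- by exists b, a, z, y, x; split=> //; apply: K23_xz.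
Qed.

(** K_{3,3} is the union of two copies of K_{2,3} with a common side, and is transferred with
    them. *)
Lemma K33_of_K23 (T : finType) (x0 : T) (h g : gr T) : dead x0 g sK33 ->
  (forall a b x y z, K23 h a b x y z -> K23 g a b x y z) -> dead x0 h sK33.
Proof.
move=> dg tr vs ms; have [sz u _ _ _] := ms.
have EE e : e \in K33_es -> E h (nth x0 vs e.1) (nth x0 vs e.2) by apply: (models_edge ms).
case: vs sz u EE {ms} => [//|v0 [//|v1 [//|v2 [//|v3 [//|v4 [//|v5 [|//]]]]]]] _ u EE.
have /(_ _) E' := EE; have e02 := EE (0,2) isT; have e03 := EE (0,3) isT; have e04 := EE (0,4) isT.
have e12 := EE (1,2) isT; have e13 := EE (1,3) isT; have e14 := EE (1,4) isT.
have e25 := EE (2,5) isT; have e35 := EE (3,5) isT; have e45 := EE (4,5) isT.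
rewrite /= in e02 e03 e04 e12 e13 e14 e25 e35 e45.
have : uniq ([:: v0; v1; v2; v3; v4] ++ [:: v5]) by [].
rewrite cat_uniq => /and3P[u5 /hasPn h5 _]; have := h5 v5; rewrite inE eqxx => /(_ isT); rewrite !inE !negb_or => /and5P[n0 n1 n2 n3 n4].
have k1 : K23 g v0 v1 v2 v3 v4 by apply: tr; rewrite /K23 u5 e02 e03 e04 e12 e13 e14.
have k2 : K23 g v5 v0 v2 v3 v4.
  apply: tr; rewrite /K23 ![E h v5 _]E_sym e25 e35 e45 e02 e03 e04 !andbT.
  by have [[_ m1 m2 m3] [_ [m4 m5 m6]]] := uniq5 u5; rewrite /= !inE !negb_or n0 n2 n3 n4 m1 m2 m3 m4 m5 m6.
apply: (dg [:: v0; v1; v2; v3; v4; v5]); apply: mk_models => //.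
have [[_ f02 f03 f04] [f12 f13 f14]] := K23P k1; have [[_ f1 f2 f3] _] := K23P k2.
by rewrite /= f02 f03 f04 f12 f13 f14 E_sym f1 E_sym f2 E_sym f3.
Qed.

Section MinCounter.
Variables (T : finType) (x0 : T) (g : gr T).
Hypothesis g3 : sub3 g.
Hypothesis IH : forall g' : gr T, #|V g'| < #|V g| -> sub3 g' ->
  dead x0 g' sK33 -> dead x0 g' sPr -> Q g'.
Hypothesis nQ : ~ Q g.
Hypothesis dK : dead x0 g sK33.
Hypothesis dP : dead x0 g sPr.

Let red := reduced g3 IH nQ dK dP.
Let lf0 := leaf0 g3 IH nQ dK dP.
Let n1 := nb1 g3 IH nQ dK dP.

Section AddEdge.
Variables (X : {set T}) (p q : T).
Hypothesis pX : p \notin X.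
Hypothesis qX : q \notin X.
Hypothesis pV : p \in V g.
Hypothesis qV : q \in V g.
Hypothesis pq : p != q.
Hypothesis npq : ~~ E g p q.
Let H := add (del g X) p q.

Lemma addE c d : E H c d = [&& E g c d, c \notin X & d \notin X] ||
  ((c == p) && (d == q) || (c == q) && (d == p)).
Proof. by rewrite /= /add_edge pq !in_setD pX qX pV qV. Qed.

Lemma addEpq : E H p q. Proof. by rewrite addE !eqxx orbT. Qed.

Lemma addVH c : c \in V H -> c \notin X /\ c \in V g.
Proof. by rewrite in_setD => /andP[]. Qed.

Lemma addEg c d : E H c d -> ~~ ((c == p) && (d == q) || (c == q) && (d == p)) -> E g c d.
Proof. by move=> cd /negbTE n; move: cd; rewrite addE n orbF => /and3P[]. Qed.

Lemma addEg' c d : E g c d -> c \notin X -> d \notin X -> E H c d.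
Proof. by move=> cd cX dX; rewrite addE cd cX dX. Qed.

(* Each end of the new edge has lost exactly one neighbour. *)
Lemma add_card c e : c \notin X -> e \in X -> E g c e -> (forall u, u \in X -> E g c u -> u = e) ->
  (c == p) || (c == q) -> #|nb H c| = #|nb g c|.
Proof.
move=> cX eX ce on cpq; pose d := if c == p then q else p.
have dc : ~~ E g c d.
  by rewrite /d; have [->|] //= := eqVneq c p; move=> cp; move: cpq; rewrite (negbTE cp) => /eqP ->; rewrite E_sym.
have -> : nb H c = d |: (nb g c :\ e).
  apply/setP=> u; rewrite in_nb in_setU1 in_setD1 in_nb addE cX /= orbC; congr (_ || _).
    rewrite /d; case: (eqVneq c p) => [->|cp] /=; first by rewrite (negbTE pq) orbF.
    by move: cpq; rewrite (negbTE cp) /= => ->.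
  case cu: (E g c u); rewrite ?andbF //= andbT; apply/idP/idP=> [|ue]; first by apply: contraNneq => ->.
  by apply/negP=> uX; rewrite (on _ uX cu) eqxx in ue.
by rewrite cardsU1 in_setD1 in_nb (negbTE dc) andbF /= (cardsD1 e (nb g c)) in_nb ce.
Qed.

Lemma add_nb c : c \notin X -> c != p -> c != q -> nb H c = nb g c :\: X.
Proof. by move=> cX /negbTE cp /negbTE cq; apply/setP=> u; rewrite in_nb in_setD in_nb addE cp cq cX orbF andbC. Qed.

Lemma add_nb0 c : c \in X -> nb H c = set0.
Proof. by move=> cX; apply/setP=> u; rewrite in_nb in_set0; apply/negP=> /E_V/addVH[]; rewrite cX. Qed.

Lemma add_lt e : e \in X -> e \in V g -> #|V H| < #|V g|.
Proof.
move=> eX eV; apply: proper_card; apply/properP; split; first exact: subsetDl.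
by exists e => //; rewrite in_setD eX.
Qed.

Lemma add_lift S' (Y : {set T}) : ids H S' -> Y \subset X -> X \subset V g ->
  (forall c d, c \in Y -> d \in Y -> ~~ E g c d) -> (forall c d, c \in Y -> d \in S' -> ~~ E g c d) ->
  (forall c, c \in X -> c \in Y \/ exists2 d, d \in S' :|: Y & E g c d) ->
  (p \notin S' -> q \in S' -> exists2 d, d \in S' :|: Y & E g p d) ->
  (q \notin S' -> p \in S' -> exists2 d, d \in S' :|: Y & E g q d) ->
  ids g (S' :|: Y).
Proof.
move=> [S'V S'i S'd] YX XV Yi YS dX dp dq.
have S'X c : c \in S' -> c \notin X by move/(subsetP S'V)/addVH=> [].
split.
- rewrite subUset (subset_trans YX XV) andbT; apply: subset_trans S'V (subsetDl _ _).
- move=> c d; rewrite !in_setU => /orP[cS|cY] /orP[dS|dY].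
  + apply: contra (S'i _ _ cS dS) => cd; apply: addEg' => //; exact: S'X.
  + by rewrite E_sym; apply: YS.
  + exact: YS.
  + exact: Yi.
- move=> c cV; rewrite in_setU negb_or => /andP[cS cY].
  have [cX|cX] := boolP (c \in X).
    by have [cY'|//] := dX _ cX; rewrite cY' in cY.
  have [|d dS] := S'd c _ cS; first by rewrite in_setD cX.
  rewrite addE => /orP[/and3P[cd _ _]|/orP[]/andP[/eqP ce /eqP de]]; first by exists d; rewrite // in_setU dS.
    by rewrite ce; apply: dp; rewrite -?ce -?de.
  by rewrite ce; apply: dq; rewrite -?ce -?de.
Qed.

End AddEdge.

Section A1.
Hypothesis dSm : forall a b x y z p, K23 g a b x y z -> E g x p -> E g y p ->
  p \notin uset a b x y z -> False.
Hypothesis dA1d : dead x0 g (mk 7 (uedges 0 ++ [:: (2,5); (3,6); (5,6)]) [:: 5]).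
Hypothesis dA1s : dead x0 g (mk 8 (uedges 0 ++ [:: (2,5); (3,6); (5,6); (5,7); (6,7)]) [::]).
Hypothesis dA1a : dead x0 g (mk 9 (uedges 0 ++ [:: (2,5); (3,6); (5,6); (5,7); (6,8); (7,8)]) [::]).
Hypothesis dA1k : dead x0 g (mk 12 (uedges 0 ++ [:: (2,5); (3,6); (5,6); (5,7); (6,8); (7,10); (7,11); (8,9); (9,10); (9,11)]) [::]).

(** By [dA1d] the vertex [p] has a third neighbour. It lies outside the unit: the neighbours of [y]
    are its sides and [q], and [z] is excluded by [dSm]. *)
Lemma A1_third a b x y z p q : K23 g a b x y z -> E g x p -> E g y q -> p \notin uset a b x y z ->
  q \notin uset a b x y z -> E g p q -> exists2 p', [/\ E g p p', p' != x & p' != q] &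
    nb g p = [set x; q; p'] /\ p' \notin uset a b x y z.
Proof.
move=> k xp yq pU qU epq; have [[ku ax ay az] [bx by_ bz]] := K23P k.
have xq : x != q by apply: contraNneq qU => <-; rewrite in_uset eqxx ?orbT.
have px : E g p x by rewrite E_sym.
have [d2|d3] := leqP #|nb g p| 2.
  case: (dA1d (vs := [:: a; b; x; y; z; p; q])); apply: mk_models => //.
  - rewrite -[[:: a, b & _]]/([:: a; b; x; y; z] ++ [:: p; q]) cat_uniq ku /=.
    by move: pU qU; rewrite !inE (negbTE (E_neq epq)) => /negbTE -> /negbTE ->.
  - by rewrite /= ax ay az bx by_ bz xp yq epq.
  - by rewrite /= d2.
have [p' pp'] : exists p', p' \in nb g p :\: [set x; q].
  apply/card_gt0P; have := cardsID [set x; q] (nb g p).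
  have : #|nb g p :&: [set x; q]| <= 2 by apply: leq_trans (subset_leq_card (subsetIr _ _)) _; rewrite cards2; case: (_ != _).
  by move: d3; clear; lia.
move: pp'; rewrite in_setD in_set2 negb_or in_nb => /andP[/andP[p'x p'q] pp']; exists p'; first by split.
split.
  apply: nb_card3 => //; by rewrite /= !inE negb_or xq eq_sym p'x eq_sym p'q.
apply/negP=> p'U; have p'p : E g p' p by rewrite E_sym.
move: p'U; rewrite in_uset => /or4P[/eqP e|/eqP e|/eqP e|/orP[]/eqP e]; rewrite e in p'p p'x.
- case/negP: pU; apply: K23_U; have := K23_Ea g3 k p'p; rewrite !inE => ->; by rewrite !orbT.
- case/negP: pU; apply: K23_U; have := K23_Ea g3 (K23_swap k) p'p; rewrite !inE => ->; by rewrite !orbT.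
- by rewrite eqxx in p'x.
- have qU' : q \notin uset a b y x z by rewrite -uset_xy.
  have : p \in nb g y by rewrite in_nb.
  rewrite (K23_exit g3 (K23_xy k) qU' yq) -setUA !in_setU !in_set1 => /or3P[]/eqP pe.
  + by rewrite pe in_uset eqxx in pU.
  + by rewrite pe in_uset eqxx orbT in pU.
  + by rewrite pe E_irr in epq.
- by apply: (dSm (K23_yz k) xp p'p); rewrite -uset_yz.
Qed.

(** The set [X], which is the unit without its port [z] together with [p] and [q], is replaced by an
    edge [p' q']. It weighs at least 18, [z] falls to degree 1 and gains 2, and two new vertices
    cost 16. The poor vertex [z] lies in no K_{2,3} and no 5-prism of the new graph. A K_{2,3}
    through the new edge is refuted by [dA1k], a 5-prism by [ins7_dead_prism], and K_{3,3} is
    reduced to K_{2,3}. *)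
Lemma A1_no a b x y z p q : K23 g a b x y z -> E g x p -> E g y q ->
  p \notin uset a b x y z -> q \notin uset a b x y z -> E g p q -> False.
Proof.
move=> k xp yq pU qU epq; have [[ku ax ay az] [bx by_ bz]] := K23P k.
have [[nab nax nay naz] [[mbx mby mbz] [nxy nxz nyz]]] := uniq5 ku.
have kk := K23_xy k; have [[ku2 _ _ _] _] := K23P kk.
have pU2 : p \notin uset a b y x z by rewrite -uset_xy.
have qU2 : q \notin uset a b y x z by rewrite -uset_xy.
have eqp : E g q p by rewrite E_sym.
have [p' [pp' p'x p'q] [nbp p'U]] := A1_third k xp yq pU qU epq.
have [q' [qq' q'y q'p] [nbq q'U2]] := A1_third kk yq xp qU2 pU2 eqp.
have q'U : q' \notin uset a b x y z by rewrite uset_xy.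
have npq := E_neq epq; have nqp := E_neq eqp; have npp' := E_neq pp'; have nqq' := E_neq qq'.
have nbx := K23_exit g3 k pU xp; have nby := K23_exit g3 kk qU2 yq.
set U := uset a b x y z in pU qU p'U q'U.
have U7 x1 y1 p1 q1 l : uniq [:: a; b; x1; y1; z] -> uset a b x1 y1 z = U -> p1 \notin U -> q1 \notin U -> p1 != q1 ->
    uniq l -> (forall c, c \in l -> [/\ c \notin U, c != p1 & c != q1]) -> uniq ([:: a; b; x1; y1; z; p1; q1] ++ l).
  move=> u1 UE p1U q1U p1q1 ul hl; rewrite cat_uniq ul andbT; apply/andP; split.
    rewrite -[[:: a, b & _]]/([:: a; b; x1; y1; z] ++ [:: p1; q1]) cat_uniq u1 /=.
    by move: p1U q1U; rewrite -UE !inE (negbTE p1q1) => /negbTE -> /negbTE ->.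
  apply/hasPn=> c /hl[cU cp cq]; apply: contraNN cU => cc; rewrite -UE in_uset; move: cc.
  by rewrite /= !inE (negbTE cp) (negbTE cq) !orbF.
have [p'q'|np'q'] := eqVneq p' q'.
  apply: (dA1s (vs := [:: a; b; x; y; z; p; q] ++ [:: p'])); apply: mk_models => //.
    by apply: U7 => // c; rewrite inE => /eqP ->; rewrite p'U eq_sym npp' p'q.
  by rewrite /= ax ay az bx by_ bz xp yq epq pp' p'q' qq'.
have [ep'q'|nep'q'] := boolP (E g p' q').
  apply: (dA1a (vs := [:: a; b; x; y; z; p; q] ++ [:: p'; q'])); apply: mk_models => //.
    apply: U7 => //; first by rewrite /= inE np'q'.
    have np'p : p' != p by rewrite eq_sym.
    have nq'q : q' != q by rewrite eq_sym.
    by move=> c; rewrite inE => /orP[/eqP->|]; [|rewrite inE => /eqP->]; split.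
  by rewrite /= ax ay az bx by_ bz xp yq epq pp' qq' ep'q'.
pose X : {set T} := [set c in [:: a; b; x; y; p; q]].
have inX c : (c \in X) = [|| c == a, c == b, c == x, c == y, c == p | c == q] by rewrite !inE.
have UX c : c \in X -> [|| c \in U, c == p | c == q].
  by rewrite inX in_uset => /or4P[->|->|->|/or3P[]->]; rewrite ?orbT.
have Xn c : c \notin U -> c != p -> c != q -> c \notin X.
  by move=> cU cp cq; apply/negP=> /UX; rewrite (negbTE cU) (negbTE cp) (negbTE cq).
have p'X : p' \notin X by apply: Xn => //; rewrite eq_sym.
have q'X : q' \notin X by apply: Xn => //; rewrite eq_sym.
have p'V := E_Vr pp'; have q'V := E_Vr qq'.
have zX : z \notin X.
  rewrite inX !negb_or ![z == _]eq_sym naz mbz nxz nyz /=.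
  by apply/andP; split; [apply: contraNneq pU|apply: contraNneq qU] => ->; rewrite in_uset eqxx !orbT.
pose H := add (del g X) p' q'.
have XVg : X \subset V g.
  apply/subsetP=> c; rewrite inX => /or4P[/eqP->|/eqP->|/eqP->|/or3P[]/eqP->]; [apply: E_V ax|apply: E_V bx|apply: E_Vr ax|apply: E_Vr ay|apply: E_V epq|apply: E_Vr epq].
have nba : nb g a = [set x; y; z] := K23_nba g3 k.
have nbb : nb g b = [set x; y; z] := K23_nbb g3 k.
have in3 c s t r : c \in [set s; t; r] -> [\/ c = s, c = t | c = r].
  by rewrite !in_setU !in_set1 -orbA => /or3P[]/eqP; [constructor 1|constructor 2|constructor 3].
have pX : p \in X by rewrite inX eqxx !orbT.
have qX : q \in X by rewrite inX eqxx !orbT.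
have aX : a \in X by rewrite inX eqxx.
have bX : b \in X by rewrite inX eqxx !orbT.
have xX : x \in X by rewrite inX eqxx !orbT.
have yX : y \in X by rewrite inX eqxx !orbT.
have out u c : u \in X -> c \notin X -> E g u c -> [\/ u = a /\ c = z, u = b /\ c = z, u = p /\ c = p' | u = q /\ c = q'].
  rewrite inX => /or4P[/eqP->|/eqP->|/eqP->|/or3P[]/eqP->] cX; rewrite -in_nb ?nba ?nbb ?nbx ?nby ?nbp ?nbq => /in3[] ce;
    try (by rewrite ce ?aX ?bX ?xX ?yX ?pX ?qX in cX).
  - by constructor 1.
  - by constructor 2.
  - by constructor 3.
  - by constructor 4.
have cardz : #|nb H z| = 1 /\ #|nb g z| = 3.
  have d3 := red (K23_xz k); split=> //.
  have z1 : z != p' by apply: contraNneq p'U => <-; rewrite in_uset eqxx !orbT.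
  have z2 : z != q' by apply: contraNneq q'U => <-; rewrite in_uset eqxx !orbT.
  rewrite add_nb //; have := cardsID X (nb g z); rewrite d3.
  suff -> : nb g z :&: X = [set a; b] by rewrite cards2 nab; clear; lia.
  apply/setP=> c; rewrite in_setI in_nb in_set2; apply/andP/orP=> [[zc cX]|[]/eqP->]; last 2 first.
  - by rewrite E_sym.
  - by rewrite E_sym.
  have cz : E g c z by rewrite E_sym.
  by have [[-> _]|[-> _]|[_ e]|[_ e]] := out _ _ cX zX cz; rewrite ?eqxx; [left|right|rewrite e eqxx in z1|rewrite e eqxx in z2].
have cardH c : c \notin X -> c != z -> #|nb H c| = #|nb g c|.
  move=> cX cz; have [->|cp] := eqVneq c p'.
    apply: (add_card p'X q'X p'V q'V np'q' nep'q' p'X pX); rewrite ?eqxx // 1?E_sym //.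
    move=> u uX; rewrite E_sym => /(out _ _ uX p'X)[[_ e]|[_ e]|[]//|[_ e]]; last by rewrite e eqxx in np'q'.
      by rewrite e in_uset eqxx !orbT in p'U.
    by rewrite e in_uset eqxx !orbT in p'U.
  have [->|cq] := eqVneq c q'.
    apply: (add_card p'X q'X p'V q'V np'q' nep'q' q'X qX); rewrite ?eqxx ?orbT // 1?E_sym //.
    move=> u uX; rewrite E_sym => /(out _ _ uX q'X)[[_ e]|[_ e]|[_ e]|[]//]; last by rewrite e eqxx in np'q'.
      by rewrite e in_uset eqxx !orbT in q'U.
    by rewrite e in_uset eqxx !orbT in q'U.
  rewrite add_nb //; congr #|pred_of_set _|; apply/setDidPl; rewrite disjoint_subset; apply/subsetP=> u.
  rewrite in_nb => cu; apply/negP=> uX; have uc : E g u c by rewrite E_sym.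
  by have [[_ e]|[_ e]|[_ e]|[_ e]] := out _ _ uX cX uc; rewrite e eqxx in cz cp cq.
have H3 : sub3 H.
  move=> c; have [cX|cX] := boolP (c \in X); first by rewrite add_nb0 ?cards0.
  have [->|cz] := eqVneq c z; first by have [-> _] := cardz.
  by rewrite cardH.
have low a' b' x' y' z' : K23 H a' b' x' y' z' -> forall c, c \in uset a' b' x' y' z' -> c \notin X /\ c != z.
  move=> k' c cW; have [[ku' ax' ay' az'] [bx' by' bz']] := K23P k'.
  have [[nab' _ _ _] [_ [nxy' _ _]]] := uniq5 ku'.
  have two s t : s != t -> E H c s -> E H c t -> 1 < #|nb H c|.
    move=> st cs ct; have <- : #|[set s; t]| = 2 by rewrite cards2 st.
    by apply: subset_leq_card; apply/subsetP=> d; rewrite in_set2 in_nb => /orP[]/eqP->.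
  have c2 : 1 < #|nb H c|.
    move: cW; rewrite in_uset => /or4P[/eqP e|/eqP e|/eqP e|/orP[]/eqP e].
    - by apply: (two x' y'); rewrite ?e.
    - by apply: (two x' y'); rewrite ?e.
    - by apply: (two a' b'); rewrite ?e 1?E_sym.
    - by apply: (two a' b'); rewrite ?e 1?E_sym.
    - by apply: (two a' b'); rewrite ?e 1?E_sym.
  split; first by apply: contraTN c2 => cX; rewrite add_nb0 ?cards0.
  by apply: contraTneq c2 => ->; have [-> _] := cardz.
have K23_Hg a' b' x' y' z' : K23 H a' b' x' y' z' -> K23 g a' b' x' y' z'.
  move=> k'; apply/negPn/negP=> nk; have [s [o [t [r1 [r2 [ks nst]]]]]] := K23_broken k' nk.
  have lw := low _ _ _ _ _ ks; have [[kus st sr1 sr2] [ot or1 or2]] := K23P ks.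
  have [[nso nst' nsr1 nsr2] [[not nor1 nor2] [ntr1 ntr2 nr12]]] := uniq5 kus.
  have stE : (s == p') && (t == q') || (s == q') && (t == p').
    by apply: contraNT nst => n; apply: (addEg p'X q'X p'V q'V np'q' st n).
  have eg c d : E H c d -> ~~ ((c == p') && (d == q') || (c == q') && (d == p')) -> E g c d.
    exact: (addEg p'X q'X p'V q'V np'q').
  have fin x1 y1 p1 q1 : K23 g a b x1 y1 z -> uset a b x1 y1 z = U -> E g x1 p1 -> E g y1 q1 -> E g p1 q1 ->
      p1 \notin U -> q1 \notin U -> E g p1 s -> E g q1 t -> p1 \in X -> q1 \in X -> False.
    move=> k1 UE xp1 yq1 epq1 p1U q1U ps qt p1X q1X; have [[u1 ax1 ay1 az1] [bx1 by1 bz1]] := K23P k1.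
    have ne d : d != s -> d != t -> forall c, ~~ ((c == p') && (d == q') || (c == q') && (d == p')).
      by move=> ds dt c; case/orP: stE => /andP[/eqP se /eqP te]; rewrite -se -te (negbTE ds) (negbTE dt) !andbF.
    have ne' c : c != s -> c != t -> forall d, ~~ ((c == p') && (d == q') || (c == q') && (d == p')).
      by move=> ds dt d; case/orP: stE => /andP[/eqP se /eqP te]; rewrite -se -te (negbTE ds) (negbTE dt).
    apply: (dA1k (vs := [:: a; b; x1; y1; z; p1; q1] ++ [:: s; t; o; r1; r2])); apply: mk_models => //.
      apply: U7 => //.
      - exact: (E_neq epq1).
      - by rewrite /= !inE !negb_or nst' nso nsr1 nsr2 ntr1 ntr2 nor1 nor2 nr12 eq_sym not.
      move=> c cc; have cW : c \in uset s o t r1 r2 by move: cc; rewrite in_uset !inE => /or4P[->|->|->|/orP[]->]; rewrite ?orbT.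
      have [cX cz] := lw _ cW; split.
      + apply: contraNN cX; rewrite inX in_uset => /or4P[->|->|->|/orP[->|ce]]; rewrite ?orbT //.
        by rewrite ce in cz.
      + by apply: contraNneq cX => ->.
      + by apply: contraNneq cX => ->.
    rewrite /= ax1 ay1 az1 bx1 by1 bz1 xp1 yq1 epq1 ps qt /= (eg _ _ sr1) ?(eg _ _ sr2) ?(eg _ _ or1) ?(eg _ _ or2) //=.
    + by rewrite E_sym (eg _ _ ot) //; apply: ne'; rewrite ?not // eq_sym.
    + by apply: ne'; rewrite ?not // eq_sym.
    + by apply: ne'; rewrite ?not // eq_sym.
    + by apply: ne; rewrite // eq_sym.
    + by apply: ne; rewrite // eq_sym.
  case/orP: stE => /andP[/eqP se /eqP te].
    by apply: (fin x y p q) => //; rewrite ?se ?te.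
  by apply: (fin y x q p) => //; rewrite ?se ?te // -uset_xy.
have K23_red a' b' x' y' z' : K23 H a' b' x' y' z' -> #|nb H x'| = 3.
  move=> k'; have x'W : x' \in uset a' b' x' y' z' by rewrite in_uset eqxx !orbT.
  have [cX cz] := low _ _ _ _ _ k' _ x'W.
  by rewrite cardH //; apply: (red (K23_Hg _ _ _ _ _ k')).
have nbtH : forall B, ~ bt H B.
  apply: nobt_reduced => // c /addVH[cX cV].
  have [->|cz] := eqVneq c z; first by have [-> _] := cardz.
  by rewrite cardH //; apply: n1.
apply: nQ; apply: (Q_lift (g' := H) (k := 2)).
- move=> S' iS; have [S'V S'i S'd] := iS.
  have S'X c : c \in S' -> c \notin X by move/(subsetP S'V)/addVH=> [].
  have fin x1 y1 p1 q1 q1' : K23 g a b x1 y1 z -> E g x1 p1 -> E g y1 q1 -> E g p1 q1 -> E g q1 q1' ->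
     nb g x1 = [set a; b; p1] -> nb g q1 = [set y1; p1; q1'] ->
     (forall c, (c \in X) = [|| c == a, c == b, c == x1, c == y1, c == p1 | c == q1]) -> q1' \notin S' ->
     ~~ E g x1 q1 ->
     (p' \notin S' -> q' \in S' -> p' = q1') -> (q' \notin S' -> p' \in S' -> q' = q1') ->
     exists2 S, ids g S & #|S| <= #|S'| + 2.
    move=> k1 xp1 yq1 epq1 eqq1 nbx1 nbq1 inX1 q1S nxq h1 h2; have [[u1 ax1 ay1 az1] [bx1 by1 bz1]] := K23P k1.
    have x1X : x1 \in X by rewrite inX1 eqxx !orbT.
    have p1X : p1 \in X by rewrite inX1 eqxx !orbT.
    have q1X : q1 \in X by rewrite inX1 eqxx !orbT.
    have y1X : y1 \in X by rewrite inX1 eqxx !orbT.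
    have xI : x1 \in S' :|: [set x1; q1] by rewrite !in_setU !in_set1 eqxx !orbT.
    have qI : q1 \in S' :|: [set x1; q1] by rewrite !in_setU !in_set1 eqxx !orbT.
    exists (S' :|: [set x1; q1]); last by apply: leq_trans (leq_card_setU _ _) _; rewrite leq_add2l cards2; case: (_ != _).
    apply: (add_lift p'X q'X p'V q'V np'q' iS) => //.
    - by apply/subsetP=> c; rewrite in_set2 => /orP[]/eqP->.
    - by move=> c d; rewrite !in_set2 => /orP[]/eqP-> /orP[]/eqP->; rewrite ?E_irr // E_sym.
    - move=> c d; rewrite in_set2 => cc dS; apply/negP; have dX := S'X _ dS.
      case/orP: cc => /eqP ->; rewrite -in_nb ?nbx1 ?nbq1 => /in3[] e.
      + by rewrite e aX in dX.
      + by rewrite e bX in dX.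
      + by rewrite e p1X in dX.
      + by rewrite e y1X in dX.
      + by rewrite e p1X in dX.
      + by rewrite -e dS in q1S.
    - move=> c; rewrite inX1 => /or4P[/eqP->|/eqP->|/eqP->|/or3P[]/eqP->].
      + by right; exists x1.
      + by right; exists x1.
      + by left; rewrite in_set2 eqxx.
      + by right; exists q1.
      + by right; exists q1.
      + by left; rewrite in_set2 eqxx orbT.
    - by move=> pS qS; exists q1; rewrite // (h1 pS qS) E_sym.
    - by move=> qS pS; exists q1; rewrite // (h2 qS pS) E_sym.
  have nxq : ~~ E g x q.
    rewrite -in_nb nbx; apply/negP=> /in3[] e; last by rewrite e eqxx in npq.
      by rewrite e in_uset eqxx in qU.
    by rewrite e in_uset eqxx orbT in qU.
  have nyp : ~~ E g y p.
    rewrite -in_nb nby; apply/negP=> /in3[] e; last by rewrite e eqxx in npq.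
      by rewrite e in_uset eqxx in pU.
    by rewrite e in_uset eqxx orbT in pU.
  (* If [q'] is chosen, [y] and [p] are added, otherwise [x] and [q]: in each case the new vertices
     have no neighbour in [S'], and they dominate the end that may have relied on the new edge. *)
  have [qS|qS] := boolP (q' \in S').
    have pS : p' \notin S' by apply/negP=> pS; have := S'i _ _ pS qS; rewrite (addEpq p'X q'X p'V q'V np'q').
    apply: (fin y x q p p') => //.
    - by move=> c; rewrite inX; do !bool_congr; rewrite ?[_ || (c == x)]orbC; do !bool_congr; rewrite orbC.
    - by rewrite qS.
  apply: (fin x y p q q') => //.
  + by move=> _ qS'; rewrite qS' in qS.
- rewrite (sig0 nbtH) muln0 addn0; apply: leq_trans (leq_addr _ _).
  rewrite /wt [X in _ <= X](big_setID X) /= (setIidPr XVg).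
  have uX6 : uniq [:: a; b; x; y; p; q].
    have := U7 x y p q [::] ku erefl pU qU npq isT; rewrite cats0 => /(_ _)/= h.
    have /h : forall c, c \in [::] -> [/\ c \notin U, c != p & c != q] by [].
    rewrite !inE !negb_or => /and5P[/and5P[-> -> -> _ /andP[-> ->]] /and5P[-> -> _ -> ->] /and4P[-> _ -> ->] /and3P[_ -> ->]].
    by case/and3P=> _ ->.
  have s18 : 18 <= \sum_(c in X) (6 - #|nb g c|).
    rewrite (_ : \sum_(c in X) _ = \sum_(c <- [:: a; b; x; y; p; q]) (6 - #|nb g c|)); last first.
      by rewrite [RHS]big_uniq //=; apply: eq_bigl => c; rewrite inE.
    rewrite !big_cons big_nil; have := g3 a; have := g3 b; have := g3 x; have := g3 y; have := g3 p; have := g3 q.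
    by clear; lia.
  have zV : z \in V g :\: X by rewrite in_setD zX (E_Vr az).
  rewrite (bigD1 z) //= [X in _ <= _ + X](bigD1 z) //=; have [-> ->] := cardz.
  rewrite (eq_bigr (fun c => 6 - #|nb g c|)); last by move=> c /andP[]; rewrite in_setD => /andP[cX _] cz; rewrite cardH.
  by move: s18; clear; lia.
apply: IH => //.
- by apply: add_lt; [exact: aX|exact: E_V ax].
- exact: (K33_of_K23 dK K23_Hg).
move=> vs ms; have [sz u VV _ _] := ms; rewrite size_mkseq in sz.
have ok : mk_ok 10 prism_es by [].
have lt e : e \in prism_es -> (e.1 < 10) && (e.2 < 10) by case/andP: ok => _ /allP; apply.
pose v i := nth x0 vs i.
have EE e : e \in prism_es -> E H (v e.1) (v e.2) by apply: (models_edge ms ok).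
pose isE e := (v e.1 == p') && (v e.2 == q') || (v e.1 == q') && (v e.2 == p').
have Eg e : e \in prism_es -> ~~ isE e -> E g (v e.1) (v e.2).
  by move=> /EE ee n; apply: (addEg p'X q'X p'V q'V np'q' ee n).
have [/hasP[e ees ie]|/hasPn nis] := boolP (has isE prism_es); last first.
  apply: (dP (vs := vs)); apply: mk_models => //; apply/allP=> e ees; apply: Eg => //; exact: nis.
have vinj i j : i < 10 -> j < 10 -> v i = v j -> i = j.
  by move=> ilt jlt /eqP; rewrite nth_uniq ?sz // => /eqP.
have uniqE d : d \in prism_es -> isE d -> d = e.
  move=> des; have /andP[d1 d2] := lt _ des; have /andP[e1 e2] := lt _ ees.
  have same : v d.1 = v e.1 -> v d.2 = v e.2 -> d = e.
    by move=> /(vinj _ _ d1 e1) h1 /(vinj _ _ d2 e2) h2; rewrite [d]surjective_pairing h1 h2 -surjective_pairing.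
  have opp : v d.1 = v e.2 -> v d.2 = v e.1 -> d = e.
    move=> /(vinj _ _ d1 e2) h1 /(vinj _ _ d2 e1) h2.
    have : (e.2, e.1) \notin prism_es by apply: (allP (_ : all (fun e => (e.2, e.1) \notin prism_es) prism_es)) ees.
    by rewrite -h1 -h2 -surjective_pairing des.
  by case/orP: ie => /andP[/eqP i1 /eqP i2]; case/orP=> /andP[/eqP j1 /eqP j2]; [apply: same|apply: opp|apply: opp|apply: same]; rewrite ?i1 ?i2 ?j1 ?j2.
have vsX c : c \in vs -> c \notin X /\ c != z.
  move=> cv; have /addVH[cX _] := VV _ cv; split=> //; apply/negP=> /eqP ce.
  have [i ilt ci] : exists2 i, i < 10 & v i = z by move/(nthP x0): cv; rewrite sz ce.
  have := m_deg_ge ms (i := i); rewrite size_mkseq => /(_ ilt); rewrite -/(v i) ci; have [-> _] := cardz.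
  by rewrite nbi_mk //; move: i ilt {ci}; do 10?[case=> //].
have fin x1 y1 p1 q1 : K23 g a b x1 y1 z -> uset a b x1 y1 z = U -> E g x1 p1 -> E g y1 q1 -> E g p1 q1 ->
   p1 \notin U -> q1 \notin U -> p1 \in X -> q1 \in X ->
   E g (v e.1) p1 -> E g (v e.2) q1 -> False.
  move=> k1 UE xp1 yq1 epq1 p1U q1U p1X q1X ep eq; have [[u1 ax1 ay1 az1] [bx1 by1 bz1]] := K23P k1.
  have [h /andP[ok' lf]] := zip_all_l (erefl : size prism_es = size prism7_hs) ins7_dead_prism ees.
  pose ws := [:: a; b; x1; y1; z; p1; q1].
  apply: (lf0 (vs := vs ++ ws) lf); apply: mk_models => //.
  - by rewrite size_cat sz.
  - rewrite uniq_catC; apply: U7 => //; first exact: (E_neq epq1).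
    move=> c /vsX[cX cz]; split.
    + apply: contraNN cX; rewrite inX in_uset => /or4P[->|->|->|/orP[->|ce]]; rewrite ?orbT //.
      by rewrite ce in cz.
    + by apply: contraNneq cX => ->.
    + by apply: contraNneq cX => ->.
  - have nw j : nth x0 (vs ++ ws) (10 + j) = nth x0 ws j by rewrite nth_cat sz ltnNge leq_addr /= addKn.
    have nv i : i < 10 -> nth x0 (vs ++ ws) i = v i by move=> ilt; rewrite nth_cat sz ilt.
    rewrite !all_cat; apply/and3P; split.
    + apply/allP=> d; rewrite mem_filter => /andP[de des]; have /andP[d1 d2] := lt _ des.
      by rewrite !nv //; apply: Eg => //; apply: contraNN de => /(uniqE _ des) ->.
    + by apply/and5P; split; [| | | |apply/and3P; split=> //]; rewrite /= -?[nth x0 _ 10]/(nth x0 (vs ++ ws) (10+0)) ?(nw 0) ?(nw 1) ?(nw 2) ?(nw 3) ?(nw 4).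
    + have /andP[e1 e2] := lt _ ees.
      have nw2 : nth x0 (vs ++ ws) 12 = x1 := nw 2; have nw3 : nth x0 (vs ++ ws) 13 = y1 := nw 3.
      have nw5 : nth x0 (vs ++ ws) 15 = p1 := nw 5; have nw6 : nth x0 (vs ++ ws) 16 = q1 := nw 6.
      by rewrite /= (nv _ e1) (nv _ e2) nw2 nw3 nw5 nw6 xp1 yq1 epq1 ep eq.
case/orP: ie => /andP[/eqP i1 /eqP i2].
  by apply: (fin x y p q) => //; rewrite ?i1 ?i2 E_sym.
by apply: (fin y x q p) => //; rewrite ?i1 ?i2 1?E_sym // -uset_xy.
Qed.
End A1.

(** Delete [u] and its leaf, which weigh at least 8, and join [s1] to [s2]. The leaves at [s1] and
    [s2] keep the new edge out of every K_{2,3}, K_{3,3} and 5-prism, and a leaf is chosen, and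
    dominates its neighbour, whenever that neighbour is not chosen. *)
Lemma Comb_no u l s1 l1 s2 l2 : uniq [:: u; l; s1; l1; s2; l2] -> [/\ E g u l, E g u s1, E g u s2, E g s1 l1 & E g s2 l2] ->
  [/\ #|nb g l| <= 1, #|nb g l1| <= 1 & #|nb g l2| <= 1] -> False.
Proof.
move=> un [ul us1 us2 sl1 sl2] [dl dl1 dl2].
have [s12|ns12] := boolP (E g s1 s2).
  apply: (lf0 (s := mk 6 [:: (0,1); (0,2); (0,4); (2,3); (4,5); (2,4)] [:: 1; 3; 5]) (vs := [:: u; l; s1; l1; s2; l2]) (h := HI [:: 0; 3; 5])).
    by vm_compute.
  by apply: mk_models => //; rewrite /= ?ul ?us1 ?us2 ?sl1 ?sl2 ?s12 ?dl ?dl1 ?dl2.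
move: (un); rewrite /= !inE !negb_or => /and5P[/and5P[nul nus1 nul1 nus2 nul2] /and4P[nls1 nll1 nls2 nll2] /and3P[ns1l1 ns1s2 ns1l2] /andP[nl1s2 nl1l2] /andP[ns2l2 _]].
have leaf_nb c d e : #|nb g c| <= 1 -> E g c d -> E g c e -> e = d.
  by move=> /card_le1_eqP h cd ce; apply: h; rewrite in_nb.
have lu : E g l u by rewrite E_sym.
have l1s : E g l1 s1 by rewrite E_sym.
have l2s : E g l2 s2 by rewrite E_sym.
have nbu : nb g u = [set l; s1; s2] by apply: nb_card3 => //; rewrite /= !inE negb_or nls1 nls2 ns1s2.
pose X := [set u; l]; pose H := add (del g X) s1 s2.
have uX : u \in X by rewrite in_set2 eqxx.
have lX : l \in X by rewrite in_set2 eqxx orbT.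
have nX c : c != u -> c != l -> c \notin X by move=> cu cl; rewrite in_set2 negb_or cu cl.
have s1X : s1 \notin X by apply: nX; rewrite eq_sym.
have s2X : s2 \notin X by apply: nX; rewrite eq_sym.
have l1X : l1 \notin X by apply: nX; rewrite eq_sym.
have l2X : l2 \notin X by apply: nX; rewrite eq_sym.
have s1V := E_Vr us1; have s2V := E_Vr us2.
have out c d : c \in X -> d \notin X -> E g c d -> c = u /\ (d = s1 \/ d = s2).
  rewrite in_set2 => /orP[]/eqP-> dX.
    rewrite -in_nb nbu -setUA !in_setU !in_set1 => /or3P[]/eqP e; [by rewrite e lX in dX|by split; auto|by split; auto].
  by move=> ld; rewrite (leaf_nb _ _ _ dl lu ld) uX in dX.
have cardH c : c \notin X -> #|nb H c| = #|nb g c|.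
  move=> cX; have [c1|c1] := eqVneq c s1.
    rewrite c1; apply: (add_card s1X s2X s1V s2V ns1s2 ns12 s1X uX); rewrite ?eqxx // 1?E_sym //.
    by move=> w wX; rewrite E_sym => /(out _ _ wX s1X)[].
  have [c2|c2] := eqVneq c s2.
    rewrite c2; apply: (add_card s1X s2X s1V s2V ns1s2 ns12 s2X uX); rewrite ?eqxx ?orbT // 1?E_sym //.
    by move=> w wX; rewrite E_sym => /(out _ _ wX s2X)[].
  rewrite add_nb //; congr #|pred_of_set _|; apply/setDidPl; rewrite disjoint_subset; apply/subsetP=> w.
  rewrite in_nb => cw; apply/negP=> wX; have wc : E g w c by rewrite E_sym.
  by have [_ [e|e]] := out _ _ wX cX wc; rewrite e eqxx in c1 c2.
have H3 : sub3 H.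
  by move=> c; have [cX|cX] := boolP (c \in X); [rewrite add_nb0 ?cards0|rewrite cardH].
have hl1 : E H s1 l1 by apply: addEg'.
have hl2 : E H s2 l2 by apply: addEg'.
have dH1 : #|nb H l1| <= 1 by rewrite cardH.
have dH2 : #|nb H l2| <= 1 by rewrite cardH.
have two c s t : s != t -> E H c s -> E H c t -> 1 < #|nb H c|.
  move=> st cs ct; have <- : #|[set s; t]| = 2 by rewrite cards2 st.
  by apply: subset_leq_card; apply/subsetP=> d; rewrite in_set2 in_nb => /orP[]/eqP->.
have eg c d : E H c d -> ~~ ((c == s1) && (d == s2) || (c == s2) && (d == s1)) -> E g c d.
  exact: (addEg s1X s2X s1V s2V ns1s2).
have K23_Hg a' b' x' y' z' : K23 H a' b' x' y' z' -> K23 g a' b' x' y' z'.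
  move=> k'; apply/negPn/negP=> nk; have [s [o [t [r1 [r2 [ks nst]]]]]] := K23_broken k' nk.
  have [[kus st sr1 sr2] [ot or1 or2]] := K23P ks; have [[nso _ _ _] _] := uniq5 kus.
  have stE : (s == s1) && (t == s2) || (s == s2) && (t == s1) by apply: contraNT nst; apply: eg.
  have port c : E H s c -> 1 < #|nb H c|.
    move/(K23_Ea H3 ks); rewrite !inE => /or3P[]/eqP->; apply: (two _ s o) => //; by rewrite E_sym.
  case/orP: stE => /andP[/eqP se _].
    by have := port l1; rewrite se => /(_ hl1); rewrite ltnNge dH1.
  by have := port l2; rewrite se => /(_ hl2); rewrite ltnNge dH2.
have cubic_no n es : mk_ok n es -> all (fun i => size (adj es i) == 3) (iota 0 n) ->
    dead x0 g (mk n es [::]) -> dead x0 H (mk n es [::]).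
  move=> ok /allP c3 dg vs ms; have [sz uu VV _ _] := ms; rewrite size_mkseq in sz.
  have d3 c : c \in vs -> 2 < #|nb H c| /\ forall d, E H c d -> d \in vs.
    move/(nthP x0)=> [i]; rewrite sz => ilt <-.
    have ii : size (adj es i) == 3 by apply: c3; rewrite mem_iota.
    have ilt' : i < size (mk n es [::]) by rewrite size_mkseq.
    split; first by have := m_deg_ge ms ilt'; rewrite nbi_mk // (eqP ii).
    move=> d; have ci : cli (mk n es [::]) i by rewrite /cli nbi_mk // ii orbT.
    move/(m_clE H3 ms ilt' ci)=> [j ji ->]; apply: mem_nth; rewrite sz.
    by have := m_lt ms ilt' ji; rewrite size_mkseq.
  have no s l' : E H s l' -> #|nb H l'| <= 1 -> s \notin vs.
    move=> sl' d1; apply/negP=> /d3[_ /(_ _ sl')/d3[h _]]; move: (leq_trans h d1); by [].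
  have n1' := no _ _ hl1 dH1; have n2' := no _ _ hl2 dH2.
  apply: (dg vs); apply: mk_models => //; apply/allP=> e ees; apply: eg; first exact: (models_edge ms ok).
  have /andP[e1 _] : (e.1 < n) && (e.2 < n) by case/andP: ok => _ /allP; apply.
  have : nth x0 vs e.1 \in vs by rewrite mem_nth ?sz.
  by move=> iv; apply/negP=> /orP[]/andP[/eqP ie _]; rewrite ie ?(negbTE n1') ?(negbTE n2') in iv.
have nbtH : forall B, ~ bt H B.
  apply: nobt_reduced => // [c /addVH[cX cV]|a' b' x' y' z' k'].
    by rewrite cardH //; apply: n1.
  have x'X : x' \notin X.
    by have [[_ /E_Vr/addVH[]]] := K23P k'.
  by rewrite cardH //; apply: (red (K23_Hg _ _ _ _ _ k')).
have XVg : X \subset V g by apply/subsetP=> c; rewrite in_set2 => /orP[]/eqP->; [apply: E_V ul|apply: E_Vr ul].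
apply: nQ; apply: (Q_lift (g' := H) (k := 1)).
- move=> S' iS; have [S'V S'i S'd] := iS.
  have S'X c : c \in S' -> c \notin X by move/(subsetP S'V)/addVH=> [].
  have leafS s l' : E H s l' -> #|nb H l'| <= 1 -> l' \in V H -> s \notin S' -> l' \in S'.
    move=> sl' d1 lV sS; apply/negPn/negP=> lS; have [w wS lw] := S'd _ lV lS.
    have ls : E H l' s by rewrite E_sym.
    have : w = s by move/card_le1_eqP: d1; apply; rewrite in_nb.
    by move=> we; rewrite -we wS in sS.
  have l1S := leafS _ _ hl1 dH1 (E_Vr hl1); have l2S := leafS _ _ hl2 dH2 (E_Vr hl2).
  have n12S : ~~ ((s1 \in S') && (s2 \in S')).
    by apply/negP=> /andP[a1 a2]; have := S'i _ _ a1 a2; rewrite (addEpq s1X s2X s1V s2V ns1s2).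
  have dp : s1 \notin S' -> forall Y : {set T}, exists2 d, d \in S' :|: Y & E g s1 d.
    by move=> h Y; exists l1; rewrite // in_setU l1S.
  have dq : s2 \notin S' -> forall Y : {set T}, exists2 d, d \in S' :|: Y & E g s2 d.
    by move=> h Y; exists l2; rewrite // in_setU l2S.
  have one (c : T) : #|S' :|: [set c]| <= #|S'| + 1 by apply: leq_trans (leq_card_setU _ _) _; rewrite cards1.
  have [/orP s12S|ns12S] := boolP ((s1 \in S') || (s2 \in S')).
    exists (S' :|: [set l]); last exact: one.
    apply: (add_lift s1X s2X s1V s2V ns1s2 iS) => //.
    + by rewrite sub1set.
    + by move=> c d; rewrite !in_set1 => /eqP-> /eqP->; rewrite E_irr.
    + move=> c d; rewrite in_set1 => /eqP-> dS; apply/negP=> ld; have := S'X _ dS.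
      by rewrite (leaf_nb _ _ _ dl lu ld) uX.
    + move=> c; rewrite in_set2 => /orP[]/eqP->; last by left; rewrite in_set1.
      by right; exists l; rewrite ?in_setU ?in_set1 ?eqxx ?orbT.
    + by move=> h _; apply: dp.
    + by move=> h _; apply: dq.
  move: ns12S; rewrite negb_or => /andP[s1S s2S]; exists (S' :|: [set u]); last exact: one.
  apply: (add_lift s1X s2X s1V s2V ns1s2 iS) => //.
  + by rewrite sub1set.
  + by move=> c d; rewrite !in_set1 => /eqP-> /eqP->; rewrite E_irr.
  + move=> c d; rewrite in_set1 => /eqP-> dS; apply/negP; rewrite -in_nb nbu -setUA !in_setU !in_set1 => /or3P[]/eqP e.
    * by have := S'X _ dS; rewrite e lX.
    * by rewrite -e dS in s1S.
    * by rewrite -e dS in s2S.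
  + move=> c; rewrite in_set2 => /orP[]/eqP->; first by left; rewrite in_set1.
    by right; exists u; rewrite ?in_setU ?in_set1 ?eqxx ?orbT.
  + by move=> h _; apply: dp.
  + by move=> h _; apply: dq.
- rewrite (sig0 nbtH) muln0 addn0; apply: leq_trans (leq_addr _ _).
  rewrite /wt [X in _ <= X](big_setID X) /= (setIidPr XVg) big_setU1 ?in_set1 //= big_set1.
  rewrite (eq_bigr (fun c => 6 - #|nb g c|)); last by move=> c; rewrite in_setD => /andP[cX _]; rewrite cardH.
  by have := g3 u; move: dl; clear; lia.
apply: IH => //.
- by apply: add_lt; [exact: uX|exact: E_V ul].
- by apply: cubic_no => //; exact: dK.
- by apply: cubic_no => //; exact: dP.
Qed.

End MinCounter.

(** * The excluded configurations and their certificates *)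

(** [Sm_es]: two ports of a unit with a common outside neighbour. [A1_es]: with adjacent outside
    neighbours. [A2_es]: two units joined port to port. [B_es]: in addition two further ports, one
    of each unit, have a common neighbour. [A3_es]: ports of two units with a common neighbour.
    [Comb_es]: a path on three vertices, each carrying a pendant edge. *)
Definition Sm_es := uedges 0 ++ [:: (2,5); (3,5)].
Definition A1_es := uedges 0 ++ [:: (2,5); (3,6); (5,6)].
Definition B_es := uedges 0 ++ uedges 5 ++ [:: (2,7); (3,10); (8,10)].
Definition A2_es := uedges 0 ++ uedges 5 ++ [:: (2,7)].
Definition A3_es := uedges 0 ++ uedges 5 ++ [:: (2,10); (7,10)].
Definition Comb_es := [:: (0,1); (0,2); (0,4); (2,3); (4,5)].

(* The entry k of this list is what the certificate hint [HP k _] refers to. *)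
Definition configs : seq state :=
  [:: sK33; mk 5 (uedges 0) [:: 2]; mk 6 Sm_es [::]; mk 6 (uedges 0 ++ [:: (2,5)]) [:: 5];
      mk 7 A1_es [::]; mk 11 B_es [::]; mk 10 A2_es [::]; mk 7 (uedges 0 ++ [:: (2,5); (5,6)]) [:: 5];
      mk 6 Comb_es [:: 1; 3; 5]; mk 11 A3_es [::]; mk 5 (uedges 0) [::]; mk 3 (cyc_es 3) [::];
      mk 4 (cyc_es 4) [::]; mk 5 (cyc_es 5) [::]; mk 6 (cyc_es 6) [::]; sPr].

Definition config k := nth [::] configs k.
(** The repeated neighbour makes this state impossible both to realize and to embed, so it can stand
    in for a configuration that is not yet excluded. *)
Definition unusable : state := [:: (false, [:: 0; 0])].
Definition Dl (mask : seq nat) := mkseq (fun k => if k \in mask then config k else unusable) 16.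

(** The trees from here on are pure data; all that matters is that [chk] accepts them in the stages
    below. *)
Definition tA1a := N 4 [::HP 1 [::0; 1; 4; 2; 3]] [::N 7 [::HI [::3; 5]] [::N 8 [::HI [::2; 6]] [::N 10 [::HI [::3; 5]]
[::N 11 [::HI [::2; 3; 7]] [::]; N 11 [::HI [::2; 6]; HI [::2; 3; 8]] [::N 12 [::HI [::3; 5]; HI
[::2; 6]] [::N 13 [::HI [::3; 5]] [::N 16 [::HI [::2; 6]; HI [::2; 3; 7; 16]; HP 1 [::12; 13; 16;
10; 17]] [::N 17 [::HI [::2; 6; 10]; HP 1 [::12; 13; 17; 10; 16]] [::]; N 17 [::HI [::2; 6; 10]; HP
1 [::12; 13; 17; 10; 16]] [::]]]; N 13 [::HI [::3; 5]; HI [::2; 3; 7; 9]] [::]; N 13 [::HI [::3; 5];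
HI [::2; 6; 10]] [::]]; N 9 [::HI [::2; 3; 7; 9]; HI [::2; 6]] [::N 14 [::HI [::4]; HI [::3; 5; 9]]
[::N 12 [::HI [::2; 6]; HI [::4]] [::N 13 [::HI [::2; 6]] [::N 17 [::HI [::2; 3; 7; 11]; HP 1 [::12;
13; 17; 10; 11]] [::]]]]; N 12 [::HI [::2; 6]] [::N 16 [::HI [::2; 6]; HI [::2; 3; 7; 11]; HP 1
[::12; 13; 16; 10; 11]] [::]; N 13 [::HI [::2; 6]; HI [::2; 3; 7; 11]] [::]; N 13 [::HI [::2; 6]; HI
[::2; 3; 7; 11]] [::]]]]]]; N 8 [::HI [::2; 6]; HI [::3; 5]] [::]]; N 8 [::HI [::2; 3; 7]] [::N 9
[::HI [::2; 3; 7]] [::]]; N 7 [::HI [::2; 3; 8]] [::N 9 [::HI [::2; 3; 8]] [::]]].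
Definition tA1d := N 4 [::HI [::2]; HP 1 [::0; 1; 4; 2; 3]] [::].
Definition tA1k := N 4 [::HI [::2; 3; 8]; HI [::2; 10]; HI [::2; 11]; HP 1 [::0; 1; 4; 2; 3]] [::N 8 [::HI [::2; 6]]
[::N 10 [::HI [::2; 11]] [::N 11 [::HI [::3; 5]] [::]; N 11 [::HI [::3; 5]] [::]; N 11 [::HI [::3;
5]] [::]; N 11 [::HI [::3; 5]; HP 2 [::9; 13; 10; 11; 8; 7]] [::]]; N 10 [::HI [::2; 6]] [::N 11
[::HI [::3; 5]] [::]]]].
Definition tA1s := N 4 [::HI [::0; 1; 5]; HP 1 [::0; 1; 4; 2; 3]] [::N 7 [::HI [::2; 6]] [::N 9 [::HI [::2; 6]] [::]]].
Definition tA2 := N 3 [::HI [::2; 3]; HI [::2; 8]; HI [::2; 9]; HP 1 [::0; 1; 3; 2; 4]] [::N 4 [::HI [::2; 8]; HI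
[::2; 9]; HP 1 [::0; 1; 4; 2; 3]; HP 2 [::0; 1; 3; 4; 2; 10]] [::N 8 [::HI [::2; 9]; HP 1 [::5; 6;
8; 7; 9]; HP 5 [::0; 1; 2; 3; 4; 5; 6; 7; 8; 9; 10]; HP 5 [::0; 1; 2; 4; 3; 5; 6; 7; 8; 9; 11]] [::N
9 [::HP 1 [::5; 6; 9; 7; 8]; HP 2 [::5; 6; 8; 9; 7; 12]; HP 5 [::0; 1; 2; 3; 4; 5; 6; 7; 9; 8; 10];
HP 5 [::0; 1; 2; 4; 3; 5; 6; 7; 9; 8; 11]] [::N 10 [::HI [::3; 7]; HP 4 [::0; 1; 3; 4; 2; 10; 11]]
[::N 12 [::HI [::2; 8]; HP 4 [::5; 6; 8; 9; 7; 12; 13]] [::N 14 [::HI [::3; 7]; HI [::2; 8]] [::N 15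
[::HI [::2; 10]] [::]; N 15 [::HI [::3; 7]; HI [::2; 10]] [::]; N 15 [::HI [::3; 7]; HI [::2; 10]]
[::]; N 15 [::HI [::2; 10]; HI [::3; 7]] [::]; N 15 [::HI [::3; 7]; HI [::2; 10]] [::]; N 15 [::HI
[::3; 7]; HI [::2; 10]] [::]; N 15 [::HI [::3; 7]; HI [::2; 10]] [::]; N 15 [::HI [::3; 7]; HI [::2;
10]] [::]; N 15 [::HI [::3; 7]; HI [::2; 10]] [::]; N 15 [::HI [::3; 7]; HI [::2; 10]] [::]; N 15
[::HI [::3; 7]; HI [::2; 10]] [::]; N 15 [::HI [::3; 7]; HI [::2; 10]] [::]; N 15 [::HI [::3; 7]; HI
[::2; 10]] [::]; N 15 [::HI [::3; 7]; HI [::2; 10]] [::]; N 15 [::HI [::3; 7]; HI [::2; 10]] [::]; N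
15 [::HI [::3; 7]; HI [::2; 10]] [::]]; N 11 [::HI [::4; 7]] [::N 16 [::HI [::2; 8]; HI [::4; 7;
12]] [::]]; N 15 [::HI [::3; 7]] [::N 14 [::HI [::2; 10]] [::]]; N 14 [::HI [::3; 7]] [::N 15 [::HI
[::2; 10]] [::]]]; N 12 [::HI [::2; 8]] [::N 14 [::HI [::3; 7]; HI [::2; 10]] [::]]; N 13 [::HI
[::2; 9]] [::N 14 [::HI [::3; 7]; HI [::2; 10]] [::]]]]]]].
Definition tA3 := N 3 [::HI [::3]; HP 1 [::0; 1; 3; 2; 4]; HP 2 [::0; 1; 2; 3; 4; 10]; HP 6 [::0; 1; 3; 2; 4; 5; 6; 8;
7; 9]; HP 6 [::0; 1; 3; 2; 4; 5; 6; 9; 7; 8]] [::N 4 [::HP 1 [::0; 1; 4; 2; 3]; HP 2 [::0; 1; 2; 4;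
3; 10]; HP 2 [::0; 1; 3; 4; 2; 11]; HP 6 [::0; 1; 4; 2; 3; 5; 6; 8; 7; 9]; HP 6 [::0; 1; 4; 2; 3; 5;
6; 9; 7; 8]] [::N 10 [::HP 2 [::5; 6; 7; 8; 9; 10]; HP 2 [::5; 6; 7; 9; 8; 10]; HP 4 [::0; 1; 2; 3;
4; 10; 11]; HP 4 [::0; 1; 2; 4; 3; 10; 12]; HP 7 [::0; 1; 2; 3; 4; 10; 7]] [::N 13 [::HI [::10]; HP
4 [::5; 6; 7; 8; 9; 10; 13]; HP 4 [::5; 6; 7; 9; 8; 10; 13]] [::N 11 [::HI [::3]; HP 4 [::0; 1; 3;
4; 2; 11; 12]; HI [::3; 8; 10]; HI [::3; 9; 10]] [::N 8 [::HI [::9; 10]; HP 1 [::5; 6; 8; 7; 9]]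
[::N 9 [::HI [::3; 9; 10]; HP 2 [::5; 6; 8; 9; 7; 18]] [::N 14 [::HI [::3; 10]] [::N 15 [::HI [::3;
10]] [::N 16 [::HI [::3; 10]] [::N 18 [::HI [::3; 8; 10]] [::N 17 [::HI [::3; 10]] [::]]; N 18 [::HI
[::3; 8; 10]] [::N 17 [::HI [::3; 10]] [::]]; N 18 [::HI [::3; 8; 10]] [::N 17 [::HI [::3; 10]]
[::]]]; N 16 [::HI [::3; 10]; HI [::3; 10; 20]] [::N 17 [::HI [::3; 10]; HI [::3; 10; 20]; HP 6
[::0; 1; 3; 2; 4; 16; 17; 11; 22; 23]] [::N 18 [::HI [::3; 8; 10]] [::]]]]]; N 12 [::HI [::4; 9;
10]] [::]; N 14 [::HI [::3; 10]] [::]; N 15 [::HI [::3; 10]] [::]; N 16 [::HI [::3; 10]] [::]; N 17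
[::HI [::3; 10]] [::]]; N 12 [::HI [::4; 8; 10]] [::N 9 [::HI [::4; 8; 10]; HP 1 [::5; 6; 9; 7; 8]]
[::]; N 9 [::HI [::4; 8; 10]; HP 1 [::5; 6; 9; 7; 8]] [::]]; N 14 [::HI [::3; 10]; HI [::8; 10]]
[::]; N 15 [::HI [::3; 10]; HI [::8; 10]] [::]; N 16 [::HI [::3; 10]; HI [::3; 9; 10]] [::]; N 17
[::HI [::3; 10]; HI [::3; 9; 10]] [::]]; N 14 [::HI [::3; 10]] [::N 16 [::HI [::2; 11]] [::]; N 15
[::HI [::3; 10]; HI [::3; 8; 10]] [::N 16 [::HI [::3; 10]; HI [::3; 8; 10]] [::N 12 [::HI [::3; 10];
HI [::4; 10; 11]] [::N 17 [::HI [::2; 11]] [::]; N 20 [::HI [::2; 11]] [::]]; N 12 [::HI [::4; 10;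
11]] [::]]]; N 16 [::HI [::2; 11]] [::]]; N 15 [::HI [::3; 10]] [::N 16 [::HI [::2; 11]] [::]; N 14
[::HI [::3; 10]; HI [::3; 8; 10]] [::N 16 [::HI [::3; 10]; HI [::3; 8; 10]] [::N 12 [::HI [::3; 10];
HI [::4; 10; 11]] [::N 17 [::HI [::2; 11]] [::]; N 20 [::HI [::2; 11]] [::]]; N 12 [::HI [::4; 10;
11]] [::]]]; N 16 [::HI [::2; 11]] [::]]; N 9 [::HI [::3; 8; 10]; HP 1 [::5; 6; 9; 7; 8]] [::]; N 9
[::HI [::3; 8; 10]; HP 1 [::5; 6; 9; 7; 8]] [::]; N 8 [::HI [::3; 9; 10]; HI [::8; 10]] [::]; N 8
[::HI [::3; 9; 10]; HI [::8; 10]] [::]; N 8 [::HI [::3; 8; 10]; HP 1 [::5; 6; 8; 7; 9]] [::N 9 [::HI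
[::9; 10]; HP 2 [::5; 6; 8; 9; 7; 16]] [::N 16 [::HI [::8; 10]] [::N 14 [::HI [::8; 10]] [::]; N 12
[::HI [::8; 10]] [::]]; N 12 [::HI [::9; 10]] [::]]; N 12 [::HI [::4; 10]] [::]]]; N 11 [::HI [::3;
10]] [::]; N 12 [::HI [::4; 10]] [::]; N 11 [::HI [::3; 10]] [::]]]]].
Definition tB := N 4 [::HI [::2; 9]; HP 1 [::0; 1; 4; 2; 3]; HP 2 [::0; 1; 3; 4; 2; 10]] [::N 10 [::HI [::2; 10]; HP
2 [::5; 6; 8; 9; 7; 10]; HP 4 [::0; 1; 3; 4; 2; 10; 11]] [::N 9 [::HP 1 [::5; 6; 9; 7; 8]; HP 4
[::5; 6; 8; 9; 7; 10; 12]] [::N 11 [::HI [::4; 7]] [::N 12 [::HI [::4; 7; 10]] [::N 14 [::HI [::4;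
7; 10]] [::N 15 [::HI [::2; 3; 8; 11]] [::N 18 [::HI [::2; 11]] [::]]; N 15 [::HI [::4; 7; 10]; HI
[::2; 11]] [::]; N 15 [::HI [::4; 7; 10]] [::N 18 [::HI [::2; 11]] [::]; N 16 [::HI [::4; 7; 10]]
[::]; N 16 [::HI [::4; 7; 10]] [::]]; N 15 [::HI [::4; 7; 10]; HI [::2; 11]] [::]; N 15 [::HI [::4;
7; 10]; HI [::2; 11]] [::]]; N 13 [::HI [::2; 9; 10]] [::]; N 15 [::HI [::4; 7; 10]] [::]; N 14
[::HI [::4; 7; 10]] [::]]; N 12 [::HI [::4; 7; 10]] [::]; N 12 [::HI [::4; 7; 10]] [::N 13 [::HI
[::2; 9; 10]] [::N 14 [::HI [::4; 7; 10]; HI [::2; 11]] [::]]]]; N 12 [::HI [::2; 10]; HI [::2; 3;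
8; 11]] [::N 11 [::HI [::2; 9; 10]] [::N 15 [::HI [::2; 3; 8; 11]] [::N 13 [::HI [::2; 9; 10]] [::N
14 [::HI [::2; 9; 10]] [::]]]]]]]].
Definition tC3 := N 0 [::] [::N 1 [::HI [::0]] [::N 2 [::HI [::0]; HI [::1]] [::]]].
Definition tC4 := N 0 [::HP 11 [::0; 1; 2]] [::N 1 [::HP 11 [::0; 1; 3]; HP 11 [::0; 1; 4]] [::N 2 [::HP 10 [::0; 2;
1; 3; 4]; HP 11 [::1; 2; 5]] [::N 3 [::HP 10 [::1; 3; 0; 2; 5]; HP 11 [::0; 3; 4]; HP 11 [::2; 3;
6]] [::N 4 [::HI [::2; 4]] [::N 6 [::HI [::0; 6]] [::N 8 [::HI [::2; 4]] [::N 5 [::HI [::2; 4]; HI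
[::0; 5]] [::]; N 7 [::HI [::2; 4]; HI [::0; 7]] [::]; N 9 [::HI [::2; 4]; HI [::0; 6]; HI [::4; 6]]
[::]; N 9 [::HI [::2; 4]; HI [::0; 6]; HI [::4; 6]] [::]; N 5 [::HI [::0; 8]; HI [::1; 4]] [::]; N 5
[::HI [::3; 5]; HI [::0; 5]] [::]; N 5 [::HI [::3; 5]; HI [::0; 5]] [::]; N 7 [::HI [::1; 7]; HI
[::0; 7]] [::]; N 7 [::HI [::1; 7]; HI [::0; 7]] [::]; N 9 [::HI [::4; 6]; HI [::2; 4]] [::]]; N 5
[::HI [::0; 6]] [::]; N 7 [::HI [::1; 7]] [::]; N 8 [::HI [::0; 6]] [::]; N 8 [::HI [::0; 6]; HI
[::2; 4]] [::]]; N 5 [::HI [::3; 5]] [::N 6 [::HI [::3; 5]] [::N 8 [::HI [::1; 8]; HI [::1; 7]; HP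
15 [::0; 3; 7; 8; 4; 1; 2; 6; 9; 5]] [::]]]; N 6 [::HI [::0; 6]] [::]; N 7 [::HI [::1; 7]] [::N 5
[::HI [::1; 7]] [::N 9 [::HI [::1; 7]; HP 15 [::0; 1; 5; 8; 4; 3; 2; 6; 9; 7]] [::]]]; N 5 [::HI
[::3; 5]] [::]]]]]].
Definition tC5 := N 0 [::HP 11 [::0; 1; 2]; HP 11 [::0; 4; 3]] [::N 1 [::HP 11 [::0; 1; 4]; HP 11 [::0; 1; 5]; HP 11
[::1; 2; 3]] [::N 2 [::HP 11 [::1; 2; 6]; HP 11 [::2; 3; 4]; HP 12 [::0; 1; 2; 5]] [::N 3 [::HP 11
[::2; 3; 7]; HP 12 [::0; 4; 3; 5]; HP 12 [::1; 2; 3; 6]] [::N 4 [::HP 11 [::0; 4; 5]; HP 11 [::3; 4;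
8]; HP 12 [::0; 1; 6; 4]; HP 12 [::2; 3; 4; 7]] [::N 5 [::HP 12 [::0; 1; 6; 5]; HP 12 [::0; 4; 9;
5]; HI [::0; 2]; HI [::0; 3]] [::N 7 [::HP 12 [::1; 2; 7; 6]; HP 12 [::2; 3; 8; 7]; HI [::2; 4]; HP
12 [::5; 10; 7; 11]] [::N 8 [::HP 12 [::3; 4; 9; 8]; HI [::1; 3]; HP 12 [::5; 10; 8; 11]; HP 12
[::7; 12; 8; 13]] [::N 12 [::HI [::4; 7]; HP 11 [::7; 12; 13]; HP 12 [::5; 10; 12; 11]; HP 12 [::8;
14; 12; 15]] [::N 13 [::HP 12 [::7; 12; 16; 13]; HP 12 [::7; 12; 17; 13]; HI [::4; 7]; HP 12 [::5;
10; 13; 11]; HP 12 [::8; 14; 13; 15]] [::N 14 [::HI [::1; 8]; HI [::0; 7; 8]; HP 12 [::5; 10; 14;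
11]; HP 12 [::12; 16; 14; 17]; HP 12 [::13; 18; 14; 19]] [::N 6 [::HI [::3; 6]] [::]; N 9 [::HI
[::0; 2; 14]; HI [::0; 3; 9]] [::]; N 10 [::HI [::0; 7; 8]; HP 12 [::8; 14; 10; 15]] [::]; N 11
[::HI [::0; 7; 8]; HI [::3; 11]] [::]; N 15 [::HI [::0; 7; 8]; HP 12 [::8; 14; 16; 15]] [::]; N 15
[::HI [::0; 7; 8]; HI [::3; 17]] [::]; N 15 [::HI [::0; 7; 8]; HP 12 [::8; 14; 18; 15]] [::]; N 15
[::HI [::0; 7; 8]; HI [::3; 19]] [::]; N 9 [::HI [::0; 2; 14]] [::]; N 9 [::HI [::0; 2; 14]] [::]; N
9 [::HI [::0; 2; 14]; HI [::0; 3; 9]] [::]; N 9 [::HI [::0; 2; 14]; HI [::0; 3; 9]] [::]; N 9 [::HI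
[::0; 2; 14]; HI [::0; 3; 9]] [::]; N 9 [::HI [::0; 2; 14]; HI [::0; 3; 9]] [::]; N 10 [::HI [::0;
2; 14]; HI [::0; 3; 10]] [::]; N 10 [::HI [::0; 2; 14]; HI [::0; 3; 10]] [::]; N 10 [::HI [::0; 2;
14]; HI [::0; 3; 10]] [::]; N 10 [::HI [::0; 2; 14]; HI [::0; 3; 10]] [::]; N 11 [::HI [::0; 2; 14];
HI [::0; 3; 11]] [::]; N 11 [::HI [::0; 2; 14]; HI [::0; 3; 11]] [::]; N 11 [::HI [::0; 2; 14]; HI
[::0; 3; 11]] [::]; N 11 [::HI [::0; 2; 14]; HI [::0; 3; 11]] [::]; N 15 [::HI [::0; 7; 8]; HI [::8;
13]; HI [::3; 16]] [::]; N 15 [::HI [::0; 7; 8]; HI [::7; 14]; HI [::3; 19]] [::]; N 15 [::HI [::0;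
7; 8]; HI [::7; 14]; HI [::3; 17]] [::]; N 15 [::HI [::0; 7; 8]; HI [::7; 14]; HI [::3; 19]] [::]];
N 6 [::HI [::0; 2; 6]; HI [::0; 3; 13]; HI [::1; 8]] [::]; N 10 [::HI [::0; 2; 10]; HI [::0; 3; 13]]
[::N 14 [::HI [::2; 4; 10]; HI [::1; 3; 10]; HI [::5; 8]; HI [::7; 14]] [::]; N 15 [::HI [::2; 4;
10]; HI [::2; 15]; HI [::5; 8]; HI [::8; 13]] [::]]; N 11 [::HI [::0; 2; 11]; HI [::0; 3; 13]] [::N
14 [::HI [::2; 4; 11]; HI [::1; 3; 11]; HI [::5; 8]; HI [::8; 13]] [::]; N 15 [::HI [::2; 4; 11]; HI
[::1; 3; 11]; HI [::5; 8]; HI [::8; 13]] [::]]; N 14 [::HI [::2; 14]] [::]; N 15 [::HI [::0; 7; 8]]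
[::]; N 6 [::HI [::0; 3; 13]] [::]; N 6 [::HI [::0; 3; 13]] [::]; N 6 [::HI [::3; 13]; HI [::1; 4];
HI [::1; 8]] [::]; N 6 [::HI [::3; 13]; HI [::1; 4]; HI [::1; 8]] [::]; N 10 [::HI [::0; 3; 13]]
[::]; N 10 [::HI [::0; 3; 13]] [::]; N 11 [::HI [::0; 3; 13]] [::]; N 11 [::HI [::0; 3; 13]] [::]];
N 6 [::HI [::0; 2; 6]; HI [::1; 8]; HI [::0; 3; 12]] [::]; N 9 [::HI [::2; 9]] [::]; N 10 [::HI
[::0; 2; 10]; HI [::0; 3; 12]] [::N 14 [::HI [::1; 3; 10]; HI [::2; 4; 10]; HI [::5; 8]; HP 12
[::10; 12; 16; 14]] [::]; N 15 [::HI [::1; 3; 10]; HI [::2; 4; 10]; HI [::5; 8]; HP 12 [::10; 12;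
16; 15]] [::]]; N 11 [::HI [::0; 2; 11]; HI [::0; 3; 12]] [::N 14 [::HI [::1; 3; 11]; HI [::2; 4;
11]; HI [::5; 8]; HP 12 [::11; 12; 16; 14]] [::]; N 15 [::HI [::1; 3; 11]; HI [::2; 4; 11]; HI [::5;
8]; HP 12 [::11; 12; 16; 15]] [::]]; N 14 [::HI [::0; 2; 14]] [::]; N 15 [::HI [::0; 2; 15]] [::]; N
6 [::HI [::0; 3; 12]] [::]; N 6 [::HI [::0; 3; 12]] [::]; N 6 [::HI [::0; 3; 12]] [::]; N 6 [::HI
[::0; 3; 12]] [::]; N 10 [::HI [::0; 3; 12]] [::]; N 10 [::HI [::0; 3; 12]] [::]; N 11 [::HI [::0;
3; 12]] [::]; N 11 [::HI [::0; 3; 12]] [::]]; N 10 [::HI [::2; 10]; HI [::2; 4; 10]; HI [::3; 5]]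
[::]; N 11 [::HI [::3; 5]; HI [::0; 8]; HI [::2; 4; 11]] [::]; N 12 [::HI [::0; 3; 12]] [::N 13
[::HI [::0; 7; 8]; HP 12 [::7; 12; 15; 13]; HI [::4; 7]; HI [::1; 3; 7]; HP 12 [::5; 10; 13; 11]]
[::N 14 [::HI [::0; 7; 8]; HI [::3; 5; 7]; HP 12 [::5; 10; 14; 11]] [::]; N 14 [::HI [::0; 7; 8]; HI
[::0; 3; 13]; HI [::3; 5; 7]] [::]]]; N 13 [::HI [::0; 3; 13]] [::N 12 [::HI [::0; 7; 8]; HP 12
[::7; 12; 15; 13]; HI [::4; 7]; HI [::1; 3; 7]; HP 12 [::5; 10; 12; 11]] [::N 14 [::HI [::0; 7; 8];
HI [::3; 5; 7]; HP 12 [::5; 10; 14; 11]] [::]; N 14 [::HI [::0; 7; 8]; HI [::3; 5; 7]; HP 12 [::5;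
10; 14; 11]] [::]]]; N 9 [::HI [::3; 5]; HI [::0; 2; 10]] [::]; N 9 [::HI [::3; 5]; HI [::4; 10]]
[::]; N 9 [::HI [::3; 5]; HI [::0; 2; 11]] [::]; N 9 [::HI [::3; 5]; HI [::4; 11]] [::]]; N 10 [::HI
[::0; 7]; HI [::1; 10]; HI [::2; 5]] [::]; N 11 [::HI [::0; 7]; HI [::1; 11]; HI [::2; 5]] [::]]; N
6 [::HI [::2; 5]; HI [::0; 7]] [::]]]]]]].
Definition tC6 := N 0 [::HP 11 [::0; 1; 2]; HP 11 [::0; 5; 4]; HP 12 [::0; 1; 2; 3]] [::N 1 [::HP 11 [::0; 1; 5]; HP
11 [::0; 1; 6]; HP 11 [::1; 2; 3]; HP 12 [::0; 1; 4; 5]] [::N 2 [::HP 11 [::1; 2; 7]; HP 11 [::2; 3;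
4]; HP 12 [::0; 1; 2; 5]; HP 12 [::0; 1; 2; 6]] [::N 3 [::HP 11 [::2; 3; 8]; HP 11 [::3; 4; 5]; HP
12 [::1; 2; 3; 7]; HP 13 [::0; 1; 2; 3; 6]] [::N 4 [::HP 11 [::3; 4; 9]; HP 12 [::0; 5; 4; 6]; HP 12
[::2; 3; 4; 8]; HP 13 [::0; 1; 7; 4; 5]] [::N 5 [::HP 11 [::0; 5; 6]; HP 11 [::4; 5; 10]; HP 12
[::0; 1; 7; 5]; HP 12 [::3; 4; 5; 9]; HP 13 [::0; 1; 2; 8; 5]] [::N 6 [::HI [::0; 3]; HP 12 [::0; 1;
7; 6]; HP 12 [::0; 5; 11; 6]; HP 13 [::0; 1; 2; 8; 6]; HP 13 [::0; 5; 4; 10; 6]] [::]]]]]]].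
Definition tC7 := N 0 [::HP 11 [::0; 1; 2]; HP 11 [::0; 6; 5]; HP 12 [::0; 1; 2; 3]; HP 12 [::0; 6; 5; 4]] [::N 1
[::HP 11 [::0; 1; 6]; HP 11 [::0; 1; 7]; HP 11 [::1; 2; 3]; HP 12 [::0; 1; 5; 6]; HP 12 [::1; 2; 3;
4]] [::N 2 [::HP 11 [::1; 2; 8]; HP 11 [::2; 3; 4]; HP 12 [::0; 1; 2; 6]; HP 12 [::0; 1; 2; 7]; HP
12 [::2; 3; 4; 5]] [::N 3 [::HP 11 [::2; 3; 9]; HP 11 [::3; 4; 5]; HP 12 [::1; 2; 3; 8]; HP 12 [::3;
4; 5; 6]; HP 13 [::0; 1; 2; 3; 7]] [::N 4 [::HP 11 [::3; 4; 10]; HP 11 [::4; 5; 6]; HP 12 [::2; 3;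
4; 9]; HP 13 [::0; 6; 5; 4; 7]; HP 13 [::1; 2; 3; 4; 8]] [::N 5 [::HP 11 [::4; 5; 11]; HP 12 [::0;
6; 5; 7]; HP 12 [::3; 4; 5; 10]; HP 13 [::0; 1; 8; 5; 6]; HP 13 [::2; 3; 4; 5; 9]] [::N 6 [::HP 11
[::0; 6; 7]; HP 11 [::5; 6; 12]; HP 12 [::0; 1; 8; 6]; HP 12 [::4; 5; 6; 11]; HP 13 [::0; 1; 2; 9;
6]; HP 13 [::3; 4; 5; 6; 10]] [::N 7 [::HP 12 [::0; 1; 8; 7]; HP 12 [::0; 6; 13; 7]; HP 13 [::0; 1;
2; 9; 7]; HP 13 [::0; 6; 5; 12; 7]; HP 14 [::0; 1; 2; 3; 10; 7]; HP 14 [::0; 6; 5; 4; 11; 7]] [::N 8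
[::HP 12 [::1; 2; 9; 8]; HP 13 [::0; 1; 8; 13; 6]; HP 13 [::0; 1; 8; 14; 7]; HP 13 [::0; 1; 8; 15;
7]; HP 13 [::1; 2; 3; 10; 8]; HP 14 [::0; 1; 8; 12; 5; 6]; HP 14 [::1; 2; 3; 4; 11; 8]] [::N 9 [::HP
12 [::2; 3; 10; 9]; HP 13 [::1; 2; 9; 16; 8]; HP 13 [::1; 2; 9; 17; 8]; HP 13 [::2; 3; 4; 11; 9]; HP
14 [::0; 1; 2; 9; 13; 6]; HP 14 [::0; 1; 2; 9; 14; 7]; HP 14 [::0; 1; 2; 9; 15; 7]; HP 14 [::2; 3;
4; 5; 12; 9]] [::N 10 [::HP 12 [::3; 4; 11; 10]; HP 13 [::2; 3; 10; 18; 9]; HP 13 [::2; 3; 10; 19;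
9]; HP 13 [::3; 4; 5; 12; 10]; HP 14 [::1; 2; 3; 10; 16; 8]; HP 14 [::1; 2; 3; 10; 17; 8]; HP 14
[::3; 4; 5; 6; 13; 10]; HP 12 [::7; 14; 10; 15]] [::N 16 [::HP 11 [::8; 16; 17]; HP 14 [::0; 1; 8;
16; 13; 6]; HP 14 [::0; 1; 8; 16; 14; 7]; HP 14 [::0; 1; 8; 16; 15; 7]; HP 14 [::1; 2; 9; 18; 16;
8]; HP 14 [::1; 2; 9; 19; 16; 8]; HP 12 [::10; 20; 16; 21]; HP 13 [::4; 5; 12; 16; 11]; HP 14 [::3;
4; 11; 16; 20; 10]; HP 14 [::3; 4; 11; 16; 21; 10]] [::N 17 [::HI [::3; 6; 8]; HP 12 [::8; 16; 22;
17]; HP 12 [::8; 16; 23; 17]; HP 14 [::0; 1; 8; 17; 14; 7]; HP 14 [::0; 1; 8; 17; 15; 7]; HP 14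
[::1; 2; 9; 18; 17; 8]; HP 14 [::1; 2; 9; 19; 17; 8]; HP 12 [::10; 20; 17; 21]; HP 13 [::4; 5; 12;
17; 11]; HP 14 [::3; 4; 11; 17; 20; 10]; HP 14 [::3; 4; 11; 17; 21; 10]] [::N 11 [::HI [::3; 6; 8];
HP 13 [::4; 5; 6; 13; 11]] [::]; N 12 [::HI [::0; 3; 12]] [::]; N 13 [::HI [::3; 6; 8]; HI [::0; 3;
17]; HP 12 [::13; 20; 17; 24]] [::]; N 13 [::HI [::3; 6; 8]; HI [::0; 3; 17]; HP 12 [::13; 21; 17;
24]] [::]; N 13 [::HI [::3; 6; 8]; HP 12 [::5; 6; 13; 12]; HP 14 [::5; 6; 13; 20; 17; 12]] [::]; N
13 [::HI [::3; 6; 8]; HP 12 [::5; 6; 13; 12]; HP 14 [::5; 6; 13; 21; 17; 12]] [::]]; N 11 [::HI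
[::0; 3; 16]; HP 12 [::8; 16; 11; 17]; HP 13 [::3; 4; 11; 20; 10]; HP 13 [::3; 4; 11; 21; 10]; HP 13
[::4; 5; 6; 13; 11]] [::N 14 [::HI [::0; 3; 16]; HP 12 [::11; 16; 22; 14]] [::]; N 15 [::HI [::0; 3;
16]; HP 12 [::11; 16; 22; 15]] [::]]; N 12 [::HI [::0; 3; 12]; HP 12 [::8; 16; 12; 17]] [::]; N 17
[::HP 12 [::8; 16; 22; 17]; HI [::0; 3; 16]; HP 14 [::0; 1; 8; 17; 13; 6]; HP 14 [::0; 1; 8; 17; 14;
7]; HP 14 [::0; 1; 8; 17; 15; 7]; HP 14 [::1; 2; 9; 18; 17; 8]; HP 14 [::1; 2; 9; 19; 17; 8]; HP 14
[::8; 16; 20; 10; 21; 17]; HP 13 [::4; 5; 12; 17; 11]] [::N 13 [::HI [::3; 6; 8]; HI [::0; 3; 16];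
HP 12 [::13; 20; 16; 22]] [::]; N 13 [::HI [::3; 6; 8]; HP 13 [::4; 5; 6; 13; 11]; HI [::0; 3; 16];
HP 12 [::13; 20; 16; 22]] [::]; N 12 [::HI [::0; 3; 12]] [::]]; N 17 [::HP 12 [::8; 16; 22; 17]; HI
[::0; 3; 16]; HP 14 [::0; 1; 8; 17; 13; 6]; HP 14 [::0; 1; 8; 17; 14; 7]; HP 14 [::0; 1; 8; 17; 15;
7]; HP 14 [::1; 2; 9; 18; 17; 8]; HP 14 [::1; 2; 9; 19; 17; 8]; HP 14 [::8; 16; 21; 10; 20; 17]; HP
13 [::4; 5; 12; 17; 11]] [::N 13 [::HI [::3; 6; 8]; HI [::0; 3; 16]; HP 12 [::13; 21; 16; 22]] [::];
N 13 [::HI [::3; 6; 8]; HP 13 [::4; 5; 6; 13; 11]; HI [::0; 3; 16]; HP 12 [::13; 21; 16; 22]] [::];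
N 12 [::HI [::0; 3; 12]] [::]]; N 17 [::HP 12 [::8; 16; 12; 17]; HP 12 [::8; 16; 20; 17]; HP 14
[::0; 1; 8; 17; 13; 6]; HP 14 [::0; 1; 8; 17; 14; 7]; HP 14 [::0; 1; 8; 17; 15; 7]; HP 14 [::1; 2;
9; 18; 17; 8]; HP 14 [::1; 2; 9; 19; 17; 8]; HP 14 [::8; 16; 20; 10; 21; 17]] [::N 13 [::HI [::3; 6;
8]; HP 12 [::5; 6; 13; 12]; HP 14 [::5; 6; 13; 20; 16; 12]] [::]; N 13 [::HI [::3; 6; 8]; HI [::0;
3; 12]; HP 13 [::4; 5; 6; 13; 11]; HP 14 [::5; 6; 13; 20; 16; 12]] [::]]; N 17 [::HP 12 [::8; 16;
12; 17]; HI [::0; 3; 17]; HP 14 [::0; 1; 8; 17; 13; 6]; HP 14 [::0; 1; 8; 17; 14; 7]; HP 14 [::0; 1;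
8; 17; 15; 7]; HP 14 [::1; 2; 9; 18; 17; 8]; HP 14 [::1; 2; 9; 19; 17; 8]; HP 14 [::8; 16; 21; 10;
20; 17]] [::N 13 [::HI [::3; 6; 8]; HP 12 [::5; 6; 13; 12]; HP 14 [::5; 6; 13; 21; 16; 12]] [::]; N
13 [::HI [::3; 6; 8]; HI [::0; 3; 12]; HP 13 [::4; 5; 6; 13; 11]; HP 14 [::5; 6; 13; 21; 16; 12]]
[::]]]; N 14 [::HP 11 [::7; 14; 15]; HP 11 [::10; 14; 20]; HP 13 [::0; 6; 13; 14; 7]; HP 13 [::3; 4;
11; 14; 10]; HP 14 [::0; 1; 8; 16; 14; 7]; HP 14 [::0; 1; 8; 17; 14; 7]; HP 14 [::0; 6; 5; 12; 14;
7]; HP 14 [::2; 3; 10; 14; 18; 9]; HP 14 [::2; 3; 10; 14; 19; 9]] [::N 11 [::HI [::1; 4; 14]; HP 12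
[::4; 5; 12; 11]; HP 13 [::3; 4; 11; 20; 10]; HP 13 [::4; 5; 6; 13; 11]; HP 14 [::2; 3; 4; 11; 18;
9]; HP 14 [::2; 3; 4; 11; 19; 9]; HP 12 [::8; 16; 11; 17]] [::N 15 [::HI [::1; 4; 14]; HP 12 [::7;
14; 21; 15]] [::]; N 21 [::HI [::1; 4; 14]; HI [::0; 2; 4; 21]; HI [::2; 6; 14]; HP 12 [::10; 14;
21; 20]] [::]; N 21 [::HI [::1; 4; 14]; HI [::0; 2; 4; 21]; HI [::2; 6; 14]; HP 12 [::10; 14; 21;
20]] [::]; N 21 [::HI [::1; 4; 14]; HP 14 [::7; 14; 21; 16; 11; 15]; HI [::0; 2; 4; 21]; HP 12
[::10; 14; 21; 20]] [::]; N 21 [::HI [::1; 4; 14]; HP 12 [::7; 14; 21; 15]; HP 14 [::7; 14; 21; 17;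
11; 15]] [::]]]; N 15 [::HP 11 [::7; 14; 15]; HP 11 [::10; 15; 20]; HP 13 [::0; 6; 13; 15; 7]; HP 13
[::3; 4; 11; 15; 10]; HP 14 [::0; 1; 8; 16; 15; 7]; HP 14 [::0; 1; 8; 17; 15; 7]; HP 14 [::0; 6; 5;
12; 15; 7]; HP 14 [::2; 3; 10; 15; 18; 9]; HP 14 [::2; 3; 10; 15; 19; 9]] [::N 11 [::HI [::1; 4;
15]; HP 12 [::4; 5; 12; 11]; HP 13 [::3; 4; 11; 20; 10]; HP 13 [::4; 5; 6; 13; 11]; HP 14 [::2; 3;
4; 11; 18; 9]; HP 14 [::2; 3; 4; 11; 19; 9]; HP 12 [::8; 16; 11; 17]] [::N 14 [::HI [::1; 4; 15]; HP
12 [::7; 14; 21; 15]] [::]; N 21 [::HI [::1; 4; 15]; HI [::0; 3; 21]; HP 12 [::8; 16; 21; 17]; HP 12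
[::11; 16; 21; 22]; HP 14 [::4; 5; 12; 21; 16; 11]] [::]; N 21 [::HI [::1; 4; 15]; HI [::0; 3; 21];
HI [::2; 6; 15]; HP 14 [::4; 5; 12; 21; 17; 11]] [::]; N 21 [::HI [::1; 4; 15]; HP 12 [::7; 14; 21;
15]; HP 14 [::7; 14; 11; 16; 21; 15]] [::]; N 21 [::HI [::1; 4; 15]; HP 12 [::7; 14; 21; 15]; HP 14
[::7; 14; 11; 17; 21; 15]] [::]]]]]]]]]]]]]].
Definition tD1 := N 1 [::HI [::0]] [::N 2 [::HI [::0]; HI [::1]] [::]; N 2 [::] [::N 3 [::HI [::1]] [::]; N 3 [::HI
[::1]] [::N 4 [::HI [::1]; HI [::4]] [::]]; N 3 [::HI [::1]; HP 3 [::2; 3; 1; 4; 5; 0]] [::N 6 [::HI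
[::1]; HI [::0; 3]] [::]; N 4 [::HI [::1]] [::N 5 [::HI [::0; 2]] [::N 6 [::HI [::1]; HI [::0; 2];
HP 8 [::1; 0; 2; 4; 3; 6]] [::N 7 [::HI [::1]; HI [::0; 3]] [::]; N 7 [::HI [::1]; HP 8 [::1; 0; 2;
4; 3; 7]] [::]; N 7 [::HI [::1]; HP 8 [::1; 0; 2; 4; 3; 7]] [::]; N 7 [::HI [::1]; HP 8 [::1; 0; 2;
4; 3; 7]] [::]; N 7 [::HI [::1]; HP 8 [::1; 0; 2; 4; 3; 7]] [::]; N 7 [::HI [::1]; HP 8 [::1; 0; 2;
4; 3; 7]] [::]]; N 7 [::HI [::1]; HP 8 [::1; 0; 2; 4; 3; 7]] [::]; N 6 [::HI [::1]; HP 8 [::1; 0; 2;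
4; 3; 6]] [::]]; N 5 [::HI [::1]; HI [::0; 2]] [::N 6 [::HI [::1]] [::N 7 [::HI [::1]; HI [::0; 3]]
[::]]; N 6 [::HI [::1]] [::N 7 [::HI [::1]; HI [::0; 3]] [::]]; N 8 [::HI [::0; 2]; HI [::1; 8]]
[::]; N 6 [::HI [::1]] [::N 7 [::HI [::1]; HI [::0; 3]] [::]]]; N 6 [::HI [::1]] [::N 7 [::HI [::0;
3]; HI [::1]] [::N 5 [::HI [::1]; HP 8 [::1; 0; 2; 5; 3; 6]] [::]; N 5 [::HI [::1]; HP 8 [::1; 0; 2;
5; 3; 6]] [::]; N 5 [::HI [::1]; HP 8 [::1; 0; 2; 5; 3; 6]] [::]]; N 7 [::HI [::1]; HI [::0; 3]]
[::]; N 5 [::HI [::1]] [::N 7 [::HI [::1]; HP 8 [::1; 0; 2; 5; 3; 7]] [::]; N 7 [::HI [::1]] [::]; N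
7 [::HI [::1]] [::]; N 7 [::HI [::1]] [::]]; N 7 [::HI [::1]; HI [::0; 3]] [::]; N 5 [::HI [::1]]
[::N 7 [::HI [::1]; HP 8 [::1; 0; 2; 5; 3; 7]] [::]]; N 7 [::HI [::1]; HI [::0; 3]] [::]; N 5 [::HI
[::1]] [::N 7 [::HI [::1]; HP 8 [::1; 0; 2; 5; 3; 7]] [::]]; N 5 [::HI [::1]; HI [::0; 2]; HI [::1;
9]] [::N 7 [::HI [::1]] [::]]]; N 5 [::HI [::1]; HI [::5]] [::N 8 [::HI [::4]; HI [::5]] [::]]; N 6
[::HI [::1]] [::N 7 [::HI [::1]; HI [::0; 3]] [::]]; N 5 [::HI [::1]; HI [::0; 2]] [::]; N 5 [::HI
[::1]] [::N 7 [::HI [::1]; HP 8 [::1; 0; 2; 5; 3; 7]] [::]]; N 5 [::HI [::1]; HI [::0; 2]] [::]; N 5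
[::HI [::1]] [::N 6 [::HI [::1]; HP 8 [::1; 0; 2; 5; 3; 6]] [::]]]; N 4 [::HI [::1]] [::N 5 [::HI
[::0; 2]; HI [::0; 4]] [::N 6 [::HI [::0; 4]; HI [::0; 3]] [::]; N 6 [::HI [::0; 4]; HI [::0; 3]]
[::]]; N 5 [::HI [::1]] [::N 6 [::HI [::1]; HP 8 [::1; 0; 2; 5; 3; 6]] [::]]]; N 5 [::HI [::1]] [::N
4 [::HI [::0; 2]; HI [::0; 5]] [::N 6 [::HI [::0; 5]; HI [::0; 3]] [::]; N 6 [::HI [::0; 5]; HI
[::0; 3]] [::]]; N 4 [::HI [::1]] [::N 6 [::HI [::1]; HI [::0; 3; 4]] [::]]]]; N 3 [::HI [::1]]
[::]; N 3 [::HI [::1]] [::]]].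
Definition tD2 := N 1 [::HI [::0]] [::N 2 [::HI [::0]; HI [::1]] [::]; N 3 [::HI [::1]] [::N 2 [::HI [::1]; HI [::2]]
[::]; N 4 [::HI [::1]; HP 10 [::3; 4; 1; 5; 6]] [::N 2 [::HI [::1]; HI [::2]] [::]; N 5 [::HI [::1];
HI [::4]] [::]; N 6 [::HI [::1]; HI [::4]] [::]; N 2 [::HI [::2]] [::]; N 2 [::HI [::2]] [::]]; N 2
[::HI [::2]; HP 10 [::1; 2; 0; 3; 4]] [::N 4 [::HI [::1]; HI [::2]] [::]]; N 2 [::HI [::1]] [::]]; N
2 [::HI [::2]] [::]].
Definition tE1 := N 3 [::HI [::2]; HP 1 [::0; 1; 3; 2; 4]] [::].
Definition tE2 := N 3 [::HI [::2; 3]; HP 1 [::0; 1; 3; 2; 4]; HP 4 [::0; 1; 2; 3; 4; 5; 6]] [::N 4 [::HP 1 [::0; 1; 4;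
2; 3]; HP 2 [::0; 1; 3; 4; 2; 7]; HP 4 [::0; 1; 2; 4; 3; 5; 6]] [::N 6 [::HI [::2]; HI [::5]] [::]]].
Definition tK23 := N 2 [::HI [::2]; HP 1 [::0; 1; 2; 3; 4]] [::N 3 [::HI [::3]; HP 1 [::0; 1; 3; 2; 4]; HP 2 [::0; 1;
2; 3; 4; 5]] [::N 4 [::HP 1 [::0; 1; 4; 2; 3]; HP 2 [::0; 1; 2; 4; 3; 5]; HP 2 [::0; 1; 3; 4; 2; 6]]
[::N 5 [::HI [::2]; HP 4 [::0; 1; 2; 3; 4; 5; 6]; HP 4 [::0; 1; 2; 4; 3; 5; 7]] [::N 8 [::] [::N 9
[::HI [::5]] [::N 10 [::HI [::5]; HI [::8]] [::]; N 6 [::HI [::3; 5]] [::]; N 6 [::HI [::3; 5]]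
[::]]; N 6 [::HI [::3]; HP 4 [::0; 1; 3; 4; 2; 6; 7]] [::N 9 [::HI [::3; 5]; HP 6 [::0; 1; 2; 3; 4;
8; 9; 5; 10; 11]] [::N 10 [::HI [::3; 5]; HI [::2; 10]] [::]; N 11 [::HI [::3; 5]; HI [::2; 11]]
[::]; N 12 [::HI [::3; 5]] [::N 13 [::HI [::2; 6]] [::]]; N 13 [::HI [::3; 5]] [::N 12 [::HI [::2;
6]] [::]]; N 10 [::HI [::3; 5]; HI [::2; 10]] [::]; N 11 [::HI [::3; 5]; HI [::2; 11]] [::]; N 7
[::HI [::4; 5]] [::]; N 7 [::HI [::4; 5]] [::]; N 10 [::HI [::2; 10]] [::N 12 [::HI [::3; 5]; HI
[::9]] [::]; N 12 [::HI [::3; 5]; HI [::9]] [::]; N 7 [::HI [::4; 5]] [::]; N 12 [::HI [::3; 5]; HI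
[::9]] [::]]; N 10 [::HI [::2; 10]] [::N 13 [::HI [::3; 5]; HI [::9]] [::]; N 13 [::HI [::3; 5]; HI
[::9]] [::]; N 7 [::HI [::4; 5]] [::]; N 13 [::HI [::3; 5]; HI [::9]] [::]]; N 11 [::HI [::2; 11]]
[::N 12 [::HI [::3; 5]; HI [::9]] [::]; N 12 [::HI [::3; 5]; HI [::9]] [::]; N 7 [::HI [::4; 5]]
[::]; N 12 [::HI [::3; 5]; HI [::9]] [::]]; N 11 [::HI [::2; 11]] [::N 13 [::HI [::3; 5]; HI [::9]]
[::]; N 13 [::HI [::3; 5]; HI [::9]] [::]; N 7 [::HI [::4; 5]] [::]; N 13 [::HI [::3; 5]; HI [::9]]
[::]]; N 12 [::HI [::2; 6]] [::N 13 [::HI [::5; 6]] [::]; N 13 [::HI [::3; 5]; HI [::5; 6]] [::]; N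
13 [::HI [::3; 5]; HI [::5; 6]] [::]; N 13 [::HI [::3; 5]; HI [::5; 6]] [::]; N 13 [::HI [::3; 5];
HI [::5; 6]] [::]]]; N 9 [::HI [::3; 5]] [::]; N 10 [::] [::N 12 [::HI [::2; 6]] [::]; N 9 [::HI
[::3; 5]] [::N 11 [::HI [::3; 5]; HI [::8]] [::]; N 12 [::HI [::3; 5]; HI [::5; 6]] [::]; N 7 [::HI
[::4; 5]] [::]; N 7 [::HI [::4; 5]] [::]; N 12 [::HI [::2; 6]] [::N 7 [::HI [::4; 5; 6]] [::]]; N 11
[::HI [::3; 5]; HI [::2; 11]] [::]; N 12 [::HI [::3; 5]; HI [::5; 6]] [::]]; N 12 [::HI [::2; 6]; HI
[::4; 6]] [::N 7 [::HI [::4; 6]] [::]; N 7 [::HI [::4; 6]] [::]]; N 9 [::HI [::3; 5; 10]; HP 6 [::0;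
1; 2; 3; 4; 8; 9; 5; 10; 11]] [::N 12 [::HI [::2; 6]] [::]; N 7 [::HI [::4; 5]] [::]; N 12 [::HI
[::5; 6]] [::]]; N 11 [::HI [::8]; HI [::10]] [::]; N 12 [::HI [::2; 6]] [::]]; N 11 [::] [::N 12
[::HI [::2; 6]] [::]; N 9 [::HI [::3; 5]] [::N 10 [::HI [::3; 5]; HI [::8]] [::]; N 12 [::HI [::2;
6]; HI [::3; 5]] [::]; N 7 [::HI [::4; 5]] [::]; N 7 [::HI [::4; 5]] [::]; N 12 [::HI [::2; 6]] [::N
7 [::HI [::4; 5; 6]] [::]]; N 10 [::HI [::3; 5]; HI [::2; 10]] [::]; N 12 [::HI [::2; 6]] [::]]; N
12 [::HI [::2; 6]; HI [::3; 7]] [::N 7 [::HI [::4; 6]] [::]; N 7 [::HI [::4; 6]] [::]]; N 9 [::HI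
[::3; 5]; HP 6 [::0; 1; 2; 3; 4; 8; 9; 5; 10; 11]] [::N 12 [::HI [::2; 6]] [::]; N 7 [::HI [::4; 5]]
[::]; N 12 [::HI [::5; 6]] [::]]; N 10 [::HI [::8]; HI [::11]] [::]; N 12 [::HI [::2; 6]] [::]]; N 9
[::HI [::3; 5]] [::N 10 [::HI [::2; 6]] [::]]; N 9 [::HI [::3; 5]] [::N 10 [::HI [::3; 5]; HI [::2;
10]] [::]]; N 10 [::HI [::2; 10]] [::N 11 [::HI [::6]] [::]; N 11 [::HI [::6]; HP 6 [::0; 1; 3; 2;
4; 10; 11; 6; 8; 12]] [::N 9 [::HI [::3; 5]] [::]; N 7 [::HI [::4; 6]] [::]; N 9 [::HI [::5; 6]]
[::]]; N 9 [::HI [::3; 5]; HI [::3; 7]; HI [::5; 6]] [::N 11 [::HI [::3; 5]; HI [::2; 6; 8]] [::]];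
N 7 [::HI [::4; 5]; HI [::4; 6]; HP 7 [::0; 1; 4; 2; 3; 7; 12]] [::N 9 [::HI [::4; 5]] [::N 11 [::HI
[::5; 6]] [::]; N 11 [::HI [::5; 6]] [::]]]]]; N 9 [::HI [::5]] [::]; N 6 [::HI [::2; 6]; HP 4 [::0;
1; 3; 4; 2; 6; 7]] [::N 9 [::HI [::3; 5]] [::N 10 [::HI [::3; 5]; HI [::2; 10]] [::]]; N 9 [::HI
[::3; 5]] [::]; N 9 [::HI [::3; 5]] [::]]; N 9 [::HI [::5]] [::]; N 7 [::HI [::2; 7]; HP 4 [::0; 1;
3; 4; 2; 6; 7]] [::N 9 [::HI [::4; 5]] [::N 10 [::HI [::4; 5]; HI [::2; 10]] [::]]; N 9 [::HI [::2;
7]] [::]; N 9 [::HI [::4; 5]] [::]]; N 9 [::HI [::5]] [::]; N 9 [::HI [::5]] [::N 6 [::HI [::3; 5]]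
[::]]; N 9 [::HI [::2; 7]; HI [::3; 5]; HI [::5]] [::N 6 [::HI [::3; 5]] [::]]; N 9 [::HI [::5]]
[::]; N 9 [::HI [::5]] [::]]]]]].
Definition tSm7 := N 5 [::HP 1 [::2; 3; 5; 0; 1]] [::N 6 [::HF [::2; 3; 0; 1; 5; 4]; HI [::4]] [::N 7 [::HF [::2; 3; 0;
1; 5; 4]; HI [::5]] [::N 8 [::HI [::4]; HI [::4; 5]; HI [::6]] [::N 9 [::HI [::4; 5]; HF [::2; 3; 0;
1; 5; 4]] [::N 10 [::HI [::4; 5]] [::]]]]; N 7 [::HI [::4; 5]; HF [::2; 3; 0; 1; 5; 4]] [::N 8 [::HF
[::2; 3; 0; 1; 5; 4]; HI [::4; 5]] [::N 9 [::HF [::2; 3; 0; 1; 5; 4]; HI [::4; 5]] [::]]; N 8 [::HF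
[::2; 3; 0; 1; 5; 4]; HI [::4; 5]] [::N 9 [::HF [::2; 3; 0; 1; 5; 4]; HI [::4; 5]; HI [::6]] [::N 12
[::HI [::6]] [::]; N 10 [::HF [::2; 3; 0; 1; 5; 4]] [::N 11 [::HF [::2; 3; 0; 1; 5; 4]] [::N 12
[::HI [::4; 5]] [::N 13 [::HI [::4; 5]] [::N 14 [::HI [::4; 5]] [::N 15 [::HI [::4; 5; 8]] [::N 16
[::HI [::2; 6; 16]] [::N 17 [::HI [::2; 3; 6]] [::N 18 [::HI [::0; 7; 18]] [::N 20 [::HI [::0; 7;
18]; HI [::2; 6; 16]] [::N 19 [::HI [::4; 5; 14]; HI [::2; 6; 16]] [::N 21 [::HI [::0; 7; 18]; HI
[::4; 5; 14]] [::N 22 [::HI [::0; 7; 18]] [::]]]]]]]]]]]]; N 11 [::HI [::4; 5; 8]] [::]; N 11 [::HI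
[::4; 5; 8]] [::]; N 11 [::HF [::2; 3; 0; 1; 5; 4]; HI [::4; 5; 12]] [::]]]; N 10 [::HF [::2; 3; 0;
1; 5; 4]; HI [::4; 5]] [::N 11 [::HF [::2; 3; 0; 1; 5; 4]] [::N 9 [::HI [::4; 5]] [::]]; N 11 [::HF
[::2; 3; 0; 1; 5; 4]; HI [::4; 5; 12]] [::]]; N 9 [::HF [::2; 3; 0; 1; 5; 4]; HI [::4; 5]] [::N 10
[::HF [::2; 3; 0; 1; 5; 4]] [::N 11 [::HF [::2; 3; 0; 1; 5; 4]] [::N 12 [::HI [::4; 5; 9]] [::N 13
[::HI [::4; 5; 9]] [::N 14 [::HI [::4; 5; 9]] [::N 15 [::HI [::4; 5; 9]] [::N 16 [::HI [::2; 6; 16]]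
[::N 17 [::HI [::2; 3; 6]] [::N 18 [::HI [::0; 7; 18]] [::N 20 [::HI [::0; 7; 18]; HI [::4; 5; 14]]
[::N 19 [::HI [::4; 5; 14]; HI [::2; 6; 16]] [::N 21 [::HI [::0; 7; 18]; HI [::4; 5; 14]] [::N 22
[::HI [::0; 7; 18]] [::]]]]]]]]]]]]; N 11 [::HI [::4; 5; 9]] [::]; N 11 [::HI [::4; 5; 9]] [::]; N
11 [::HF [::2; 3; 0; 1; 5; 4]; HI [::4; 5; 12]] [::]]; N 10 [::HI [::4; 5]; HF [::2; 3; 0; 1; 5; 4]]
[::N 11 [::HF [::2; 3; 0; 1; 5; 4]; HI [::4; 5]] [::]; N 11 [::HI [::4; 5]] [::]; N 11 [::HI [::4;
5]] [::]]; N 10 [::HF [::2; 3; 0; 1; 5; 4]; HI [::4; 5]] [::N 11 [::HF [::2; 3; 0; 1; 5; 4]] [::N 16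
[::HI [::4; 5]] [::N 17 [::HI [::4; 5]] [::N 18 [::HI [::4; 5]; HF [::2; 3; 0; 1; 5; 4]; HP 1 [::16;
17; 18; 10; 11]] [::N 19 [::HI [::0; 7; 18]; HI [::4; 5]] [::N 20 [::HI [::4; 5; 16]] [::N 21 [::HI
[::0; 7; 18]] [::]; N 21 [::HI [::0; 7; 18]] [::]; N 21 [::HI [::0; 7; 18]] [::]]]]]]]; N 11 [::HI
[::4; 5]] [::]; N 11 [::HI [::4; 5]] [::]; N 11 [::HI [::4; 5]] [::]; N 11 [::HI [::4; 5]] [::]; N
11 [::HF [::2; 3; 0; 1; 5; 4]; HI [::4; 5]] [::]; N 11 [::HF [::2; 3; 0; 1; 5; 4]; HI [::4; 5]]
[::]]; N 10 [::HI [::4; 5]; HF [::2; 3; 0; 1; 5; 4]] [::N 11 [::HI [::4; 5]] [::]]; N 10 [::HI [::4;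
5]; HF [::2; 3; 0; 1; 5; 4]] [::N 11 [::HI [::4; 5]] [::]]; N 10 [::HI [::4; 5]; HF [::2; 3; 0; 1;
5; 4]] [::N 11 [::HI [::4; 5]] [::]]; N 10 [::HI [::4; 5]; HF [::2; 3; 0; 1; 5; 4]] [::N 11 [::HI
[::4; 5]] [::]]; N 10 [::HI [::4; 5]; HI [::2; 6; 10]] [::N 11 [::HI [::4; 5]; HI [::7]] [::N 12
[::HI [::4; 5]] [::N 13 [::HI [::4; 5]] [::N 14 [::HI [::4; 5]] [::N 15 [::HI [::4; 5]] [::N 16
[::HI [::0; 7; 16]; HF [::2; 3; 0; 1; 5; 4]; HP 1 [::12; 13; 16; 8; 9]] [::N 19 [::HI [::2; 6; 16];
HI [::7]] [::N 17 [::HI [::4; 5; 12]; HI [::7]] [::N 18 [::HI [::7]] [::N 20 [::HI [::4; 5; 12]]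
[::N 21 [::HI [::2; 6; 16]] [::]]]]]]]]]]]; N 11 [::HI [::4; 5]] [::]; N 11 [::HI [::4; 5]] [::N 12
[::HI [::4; 5]] [::N 13 [::HI [::4; 5]] [::N 14 [::HI [::4; 5]] [::N 15 [::HI [::4; 5]] [::N 16
[::HI [::0; 1; 7]; HF [::2; 3; 0; 1; 5; 4]; HP 1 [::12; 13; 16; 8; 9]] [::N 19 [::HI [::2; 6; 16];
HI [::0; 1; 7]] [::N 17 [::HI [::0; 1; 7]; HI [::4; 5; 12]] [::N 18 [::HI [::0; 1; 7]] [::N 20 [::HI
[::4; 5; 12]] [::N 21 [::HI [::2; 6; 16]] [::]]]]]]]]]]; N 12 [::HI [::4; 5]] [::N 13 [::HI [::4;
5]] [::N 18 [::HI [::4; 5; 13]] [::N 19 [::HI [::4; 5; 13]; HI [::2; 6; 18]] [::N 20 [::HI [::4; 5;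
13]] [::N 21 [::HI [::2; 6; 18]] [::]; N 21 [::HI [::2; 6; 18]] [::]; N 21 [::HI [::2; 6; 18]]
[::]]]]]]]]]; N 9 [::HF [::2; 3; 0; 1; 5; 4]; HI [::0; 1; 8]] [::N 10 [::HI [::4; 5]; HF [::2; 3; 0;
1; 5; 4]] [::N 11 [::HI [::4; 5]] [::]]]; N 10 [::HI [::4; 5]; HF [::2; 3; 0; 1; 5; 4]] [::N 11
[::HI [::4; 5]] [::]]; N 9 [::HF [::2; 3; 0; 1; 5; 4]; HI [::4; 5]] [::]; N 9 [::HF [::2; 3; 0; 1;
5; 4]; HI [::4; 5]] [::]]]]; N 6 [::HI [::4; 5]] [::]].

(** * Exclusion of the configurations, stage by stage *)

Section Stages.
Variables (T : finType) (x0 : T) (g : gr T).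
Hypothesis g3 : sub3 g.
Hypothesis IH : forall g' : gr T, #|V g'| < #|V g| -> sub3 g' ->
  dead x0 g' sK33 -> dead x0 g' sPr -> Q g'.
Hypothesis nQ : ~ Q g.
Hypothesis dK : dead x0 g sK33.
Hypothesis dP : dead x0 g sPr.

Let red := reduced g3 IH nQ dK dP.
Let n1 := nb1 g3 IH nQ dK dP.

(** [mask] names the excluded configurations that the certificate may refer to; the others are
    masked by [unusable]. *)
Lemma stage lv md mask t s : (forall x, x \in V g -> md <= #|nb g x|) -> bnd_sound x0 g md lv ->
  {in mask, forall k, dead x0 g (config k)} -> chk lv md (Dl mask) t s -> dead x0 g s.
Proof.
move=> mdg bs dm; apply: (chk_sound g3 (IHd g3 IH dK dP) nQ mdg bs) => k.
rewrite size_mkseq => klt; rewrite nth_mkseq //; case: ifP => [/dm //|_] vs [_ _ _ h _].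
by have [] := h 0 isT.
Qed.

Lemma models_K23 n es fl vs o : models x0 g (mk n es fl) vs -> mk_ok n es -> o + 4 < n ->
  {subset uedges o <= es} ->
  K23 g (nth x0 vs o) (nth x0 vs (o+1)) (nth x0 vs (o+2)) (nth x0 vs (o+3)) (nth x0 vs (o+4)).
Proof.
move=> ms ok lt sub; have EE e : e \in uedges o -> E g (nth x0 vs e.1) (nth x0 vs e.2).
  by move=> /sub; apply: (models_edge ms ok).
rewrite /K23; apply/and5P; split.
- have := @inj_map_v _ x0 g _ _ ms [:: o; o+1; o+2; o+3; o+4]; apply; last first.
    by move=> i; rewrite size_mkseq !inE => ii; move: lt ii; clear; lia.
  by rewrite /= !inE; clear; lia.
- by apply: (EE (o, o+2)); rewrite !inE eqxx ?orbT.
- by apply: (EE (o, o+3)); rewrite !inE eqxx ?orbT.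
- by apply: (EE (o, o+4)); rewrite !inE eqxx ?orbT.
- apply/and3P; split.
  + by apply: (EE (o+1, o+2)); rewrite !inE eqxx ?orbT.
  + by apply: (EE (o+1, o+3)); rewrite !inE eqxx ?orbT.
  + by apply: (EE (o+1, o+4)); rewrite !inE eqxx ?orbT.
Qed.

Lemma d1 : dead x0 g (config 1).
Proof.
move=> vs ms; have k := @models_K23 5 (uedges 0) [:: 2] vs 0 ms isT isT (fun _ h => h).
have := red k; have -> : nth x0 vs (0+2) = nth x0 vs 2 by [].
by rewrite (m_deg g3 ms (i := 2)).
Qed.

Let bs1 := bnd_sound1 (x0 := x0) g3 n1 red.

Lemma mask0 (P : nat -> Prop) : {in [::], forall k, P k}. Proof. by []. Qed.
Lemma maskS (P : nat -> Prop) k l : P k -> {in l, forall k, P k} -> {in k :: l, forall k, P k}.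
Proof. by move=> Pk Pl i; rewrite inE => /orP[/eqP->|/Pl]. Qed.
Lemma d0 : dead x0 g (config 0). Proof. exact: dK. Qed.
Lemma d15 : dead x0 g (config 15). Proof. exact: dP. Qed.

(** The remaining port has a third neighbour by [d1]. If it is the common neighbour of the other two
    ports, the unit extends to K_{3,3}; if it is a new vertex, [tSm7] takes over. *)
Lemma d2 : dead x0 g (config 2).
Proof.
apply: (@stage 1 1 [:: 0; 1] (N 4 [:: HP 1 [:: 0; 1; 4; 2; 3]; HP 0 [:: 0; 1; 2; 3; 4; 5]] [:: tSm7])); [exact: n1|exact: bs1|exact: (maskS d0 (maskS d1 (@mask0 _)))|exact_no_check (erefl true)].
Qed.

Lemma sSm a b x y z p : K23 g a b x y z -> E g x p -> E g y p -> p \notin uset a b x y z -> False.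
Proof.
move=> k xp yp pU; have [[ku ax ay az] [bx by_ bz]] := K23P k.
apply: (d2 (vs := [:: a; b; x; y; z; p])); apply: mk_models => //.
  by rewrite -[[:: _; _; _; _; _; _]]/(rcons [:: a; b; x; y; z] p) rcons_uniq ku andbT; move: pU; rewrite inE.
by rewrite /= ax ay az bx by_ bz xp yp.
Qed.

Lemma d3 : dead x0 g (config 3).
Proof.
apply: (@stage 1 1 [:: 0; 1; 2] tE1); [exact: n1|exact: bs1|exact: (maskS d0 (maskS d1 (maskS d2 (@mask0 _))))|exact_no_check (erefl true)].
Qed.

Lemma sA1 a b x y z p q : K23 g a b x y z -> E g x p -> E g y q ->
  p \notin uset a b x y z -> q \notin uset a b x y z -> E g p q -> False.
Proof.
apply: (A1_no g3 IH nQ dK dP sSm).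
- by apply: (@stage 1 1 [:: 0; 1; 2; 3] tA1d); [exact: n1|exact: bs1|exact: (maskS d0 (maskS d1 (maskS d2 (maskS d3 (@mask0 _)))))|exact_no_check (erefl true)].
- by apply: (@stage 1 1 [:: 0; 1; 2; 3] tA1s); [exact: n1|exact: bs1|exact: (maskS d0 (maskS d1 (maskS d2 (maskS d3 (@mask0 _)))))|exact_no_check (erefl true)].
- by apply: (@stage 1 1 [:: 0; 1; 2; 3] tA1a); [exact: n1|exact: bs1|exact: (maskS d0 (maskS d1 (maskS d2 (maskS d3 (@mask0 _)))))|exact_no_check (erefl true)].
- by apply: (@stage 1 1 [:: 0; 1; 2; 3] tA1k); [exact: n1|exact: bs1|exact: (maskS d0 (maskS d1 (maskS d2 (maskS d3 (@mask0 _)))))|exact_no_check (erefl true)].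
Qed.

Lemma d4 : dead x0 g (config 4).
Proof.
have sub : {subset uedges 0 <= A1_es} by move=> e h; rewrite mem_cat h.
move=> vs ms; have k := @models_K23 7 A1_es [::] vs 0 ms isT isT sub.
have ok : mk_ok 7 A1_es by [].
have EE e : e \in A1_es -> E g (nth x0 vs e.1) (nth x0 vs e.2) by apply: (models_edge ms ok).
have out i : i \in [:: 5; 6] -> nth x0 vs i \notin uset (nth x0 vs 0) (nth x0 vs 1) (nth x0 vs 2) (nth x0 vs 3) (nth x0 vs 4).
  move=> ii; have [sz u _ _ _] := ms; rewrite size_mkseq in sz.
  have ilt : i < 7 by move: ii; rewrite !inE => /orP[]/eqP->.
  by rewrite in_uset !nth_uniq ?sz //; move: ii; rewrite !inE => /orP[]/eqP->.
exact: (sA1 k (EE (2,5) isT) (EE (3,6) isT) (out 5 isT) (out 6 isT) (EE (5,6) isT)).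
Qed.

Lemma bs2 : bnd_sound x0 g 1 2.
Proof. by have h1 := sA1; apply: bnd_sound2. Qed.

(** Two units joined port to port are first excluded when they have this extra common neighbour,
    because level 3 of [bnd], with which [d6] is proved, rests on it. *)
Lemma d5 : dead x0 g (config 5).
Proof.
apply: (@stage 2 1 [:: 0; 1; 2; 3; 4] tB); [exact: n1|exact: bs2|exact: (maskS d0 (maskS d1 (maskS d2 (maskS d3 (maskS d4 (@mask0 _))))))|exact_no_check (erefl true)].
Qed.

Lemma uniq_two a b x y z a' b' x' y' z' l : K23 g a b x y z -> K23 g a' b' x' y' z' ->
  [disjoint uset a b x y z & uset a' b' x' y' z'] -> uniq l ->
  (forall c, c \in l -> c \notin uset a b x y z /\ c \notin uset a' b' x' y' z') ->
  uniq ([:: a; b; x; y; z; a'; b'; x'; y'; z'] ++ l).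
Proof.
move=> k k' dis ul hl; have [[ku _ _ _] _] := K23P k; have [[ku' _ _ _] _] := K23P k'.
rewrite cat_uniq; apply/and3P; split=> //.
  rewrite -[[:: a, b & _]]/([:: a; b; x; y; z] ++ [:: a'; b'; x'; y'; z']) cat_uniq; apply/and3P; split=> //.
  apply/hasPn=> c cc; have : c \in uset a' b' x' y' z' by rewrite inE.
  by move/(disjointFl dis) => h; apply/negP=> cc'; move: h; rewrite inE cc'.
apply/hasPn=> c /hl[h1 h2]; apply/negP=> cc.
have : c \in [:: a; b; x; y; z] ++ [:: a'; b'; x'; y'; z'] by [].
by rewrite mem_cat => /orP[cc'|cc']; [case/negP: h1|case/negP: h2]; rewrite inE.
Qed.

Lemma sB a b x y z a' b' x' y' z' p : K23 g a b x y z -> K23 g a' b' x' y' z' ->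
  [disjoint uset a b x y z & uset a' b' x' y' z'] -> E g x x' -> E g y p -> E g y' p ->
  p \notin uset a b x y z -> p \notin uset a' b' x' y' z' -> False.
Proof.
move=> k k' dis xx yp yp' pU pU'; have [[_ ax ay az] [bx by_ bz]] := K23P k; have [[_ ax' ay' az'] [bx' by' bz']] := K23P k'.
apply: (d5 (vs := [:: a; b; x; y; z; a'; b'; x'; y'; z'] ++ [:: p])); apply: mk_models => //.
  by apply: uniq_two => // c; rewrite inE => /eqP->.
by rewrite /= ax ay az bx by_ bz ax' ay' az' bx' by' bz' xx yp yp'.
Qed.

Lemma bs3 : bnd_sound x0 g 1 3.
Proof. by have h1 := sA1; have h2 := sSm; have h3 := sB; apply: bnd_sound3. Qed.

Lemma d6 : dead x0 g (config 6).
Proof.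
apply: (@stage 3 1 [:: 0; 1; 2; 3; 4; 5] tA2); [exact: n1|exact: bs3|exact: (maskS d0 (maskS d1 (maskS d2 (maskS d3 (maskS d4 (maskS d5 (@mask0 _)))))))|exact_no_check (erefl true)].
Qed.

Lemma sA2 a b x y z a' b' x' y' z' : K23 g a b x y z -> K23 g a' b' x' y' z' ->
  [disjoint uset a b x y z & uset a' b' x' y' z'] -> E g x x' -> False.
Proof.
move=> k k' dis xx; have [[_ ax ay az] [bx by_ bz]] := K23P k; have [[_ ax' ay' az'] [bx' by' bz']] := K23P k'.
apply: (d6 (vs := [:: a; b; x; y; z; a'; b'; x'; y'; z'] ++ [::])); apply: mk_models => //.
  exact: uniq_two.
by rewrite /= ax ay az bx by_ bz ax' ay' az' bx' by' bz' xx.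
Qed.

Lemma d7 : dead x0 g (config 7).
Proof.
apply: (@stage 3 1 [:: 0; 1; 2; 3; 4; 6] tE2); [exact: n1|exact: bs3|exact: (maskS d0 (maskS d1 (maskS d2 (maskS d3 (maskS d4 (maskS d6 (@mask0 _)))))))|exact_no_check (erefl true)].
Qed.

(** Degrees 1 and 2 of [p] are [d3] and [d7]; in the second case the other neighbour of [p] lies
    outside the unit by [sSm]. *)
Lemma sE a b x y z p : K23 g a b x y z -> E g x p -> p \notin uset a b x y z -> #|nb g p| = 3.
Proof.
move=> k xp pU; have [[ku ax ay az] [bx by_ bz]] := K23P k; have px : E g p x by rewrite E_sym.
have u6 : uniq [:: a; b; x; y; z; p].
  by rewrite -[[:: _; _; _; _; _; _]]/(rcons [:: a; b; x; y; z] p) rcons_uniq ku andbT; move: pU; rewrite inE.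
apply/eqP; rewrite eqn_leq g3 leqNgt; apply/negP=> d2'.
have [d1'|d1'] := leqP #|nb g p| 1.
  apply: (d3 (vs := [:: a; b; x; y; z; p])); apply: mk_models => //; last by rewrite /= d1'.
  by rewrite /= ax ay az bx by_ bz xp.
have [r] : exists r, r \in nb g p :\ x.
  by apply/card_gt0P; move: d1'; rewrite (cardsD1 x) in_nb px; clear; lia.
rewrite in_setD1 in_nb => /andP[rx pr]; have rp : E g r p by rewrite E_sym.
have rU : r \notin uset a b x y z.
  rewrite in_uset; apply/negP=> /or4P[/eqP e|/eqP e|/eqP e|/orP[]/eqP e]; rewrite e in rp rx.
  - by case/negP: pU; apply: K23_U; have := K23_Ea g3 k rp; rewrite !inE => ->; rewrite !orbT.
  - by case/negP: pU; apply: K23_U; have := K23_Ea g3 (K23_swap k) rp; rewrite !inE => ->; rewrite !orbT.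
  - by rewrite eqxx in rx.
  - exact: (sSm k xp rp pU).
  - by apply: (sSm (K23_yz k) xp rp); rewrite -uset_yz.
apply: (d7 (vs := rcons [:: a; b; x; y; z; p] r)); apply: mk_models => //.
- rewrite rcons_uniq u6 andbT; move: rU; rewrite !inE !negb_or => /and5P[-> -> -> -> ->] /=; exact: (E_neq rp).
- by rewrite /= ax ay az bx by_ bz xp pr.
- by rewrite /= -ltnS d2'.
Qed.

Lemma d8 : dead x0 g (config 8).
Proof.
move=> vs ms; have [sz u _ _ _] := ms; rewrite size_mkseq in sz; have ok : mk_ok 6 Comb_es by [].
have EE e : e \in Comb_es -> E g (nth x0 vs e.1) (nth x0 vs e.2) by apply: (models_edge ms ok).
have dl i : i \in [:: 1; 3; 5] -> #|nb g (nth x0 vs i)| <= 1.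
  move=> ii; rewrite (m_deg g3 ms); move: ii; rewrite !inE => /or3P[]/eqP-> //.
case: vs sz u EE dl {ms} => [//|v0 [//|v1 [//|v2 [//|v3 [//|v4 [//|v5 [|//]]]]]]] _ u EE dl.
apply: (Comb_no g3 IH nQ dK dP u).
  by split; [apply: (EE (0,1))|apply: (EE (0,2))|apply: (EE (0,4))|apply: (EE (2,3))|apply: (EE (4,5))].
by split; [apply: (dl 1)|apply: (dl 3)|apply: (dl 5)].
Qed.

Lemma bs4 md : 0 < md -> (forall x, x \in V g -> md <= #|nb g x|) -> bnd_sound x0 g md 4.
Proof. by move=> md0 mdg; have h1 := sA1; have h2 := sSm; have h3 := sA2; have h4 := sE; apply: bnd_sound4. Qed.

(** A leaf with its neighbour is refuted at level 4 of [bnd], with combs among the excluded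
    configurations. *)
Lemma n2 x : x \in V g -> 2 <= #|nb g x|.
Proof.
move=> xV; have := n1 xV; rewrite leq_eqVlt => /orP[/eqP d1'|//]; exfalso.
have [u xu] : exists u, u \in nb g x by apply/card_gt0P; rewrite -d1'.
have dd : dead x0 g (mk 2 [:: (0,1)] [:: 0]).
  by apply: (@stage 4 1 [:: 0; 1; 2; 3; 4; 6; 7; 8] tD1); [exact: n1|exact: (@bs4 1 isT n1)|exact: (maskS d0 (maskS d1 (maskS d2 (maskS d3 (maskS d4 (maskS d6 (maskS d7 (maskS d8 (@mask0 _)))))))))|exact_no_check (erefl true)].
rewrite in_nb in xu; apply: (dd [:: x; u]); apply: mk_models => //=; rewrite ?inE ?(E_neq xu) ?xu //.
by rewrite -d1'.
Qed.

Lemma d9 : dead x0 g (config 9).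
Proof.
apply: (@stage 4 2 [:: 0; 1; 2; 4; 6; 7] tA3); [exact: n2|exact: (@bs4 2 isT n2)|exact: (maskS d0 (maskS d1 (maskS d2 (maskS d4 (maskS d6 (maskS d7 (@mask0 _)))))))|exact_no_check (erefl true)].
Qed.

Lemma sA3 a b x y z a' b' x' y' z' r : K23 g a b x y z -> K23 g a' b' x' y' z' ->
    [disjoint uset a b x y z & uset a' b' x' y' z'] -> E g x r -> E g x' r ->
    r \notin uset a b x y z -> r \notin uset a' b' x' y' z' -> False.
Proof.
move=> k k' dis xr xr' rU rU'; have [[_ ax ay az] [bx by_ bz]] := K23P k; have [[_ ax' ay' az'] [bx' by' bz']] := K23P k'.
apply: (d9 (vs := [:: a; b; x; y; z; a'; b'; x'; y'; z'] ++ [:: r])); apply: mk_models => //.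
  by apply: uniq_two => // c; rewrite inE => /eqP->.
by rewrite /= ax ay az bx by_ bz ax' ay' az' bx' by' bz' xr xr'.
Qed.

(** With [sA3] the estimate reaches level 5, where only isolated vertices and roots with a single
    unit are charged. *)
Lemma d10 : dead x0 g (config 10).
Proof.
apply: (@stage 5 2 [:: 0; 1; 2; 4; 6; 7; 9] tK23); [exact: n2| |exact: (maskS d0 (maskS d1 (maskS d2 (maskS d4 (maskS d6 (maskS d7 (maskS d9 (@mask0 _))))))))|exact_no_check (erefl true)].
by have h1 := sA1; have h2 := sSm; have h3 := sA2; have h4 := sE; have h5 := sA3; have h6 := n2; apply: bnd_sound5.
Qed.

Theorem noK a b x y z : ~ K23 g a b x y z.
Proof.
move=> k; have [[ku ax ay az] [bx by_ bz]] := K23P k.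
apply: (d10 (vs := [:: a; b; x; y; z])); apply: mk_models => //.
by rewrite /= ax ay az bx by_ bz.
Qed.

(** There are no units any more, so level 6 applies, and the deleted set may contain open vertices,
    fewer than the minimum degree. *)
Lemma n3 x : x \in V g -> 3 <= #|nb g x|.
Proof.
move=> xV; have := n2 xV; rewrite leq_eqVlt => /orP[/eqP d2'|//]; exfalso.
have dd : dead x0 g (mk 3 [:: (0,1); (0,2)] [:: 0]).
  by apply: (@stage 6 2 [:: 10] tD2); [exact: n2|by have h1 := noK; have h2 := n2; apply: bnd_sound6|exact: (maskS d10 (@mask0 _))|exact_no_check (erefl true)].
have /eqP/cards2P[s [t [st nx]]] := esym d2'.
have xs : E g x s by rewrite -in_nb nx in_set2 eqxx.
have xt : E g x t by rewrite -in_nb nx in_set2 eqxx orbT.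
apply: (dd [:: x; s; t]); apply: mk_models => //=; rewrite ?inE ?negb_or ?(E_neq xs) ?(E_neq xt) ?st ?xs ?xt //.
by rewrite -d2'.
Qed.

Lemma bs6 : bnd_sound x0 g 3 6.
Proof. by have h1 := noK; have h2 := n3; apply: bnd_sound6. Qed.

Lemma d11 : dead x0 g (config 11).
Proof. by apply: (@stage 6 3 [:: 10] tC3); [exact: n3|exact: bs6|exact: (maskS d10 (@mask0 _))|exact_no_check (erefl true)]. Qed.
(** The only certificate that refers to the 5-prism. *)
Lemma d12 : dead x0 g (config 12).
Proof.
by apply: (@stage 6 3 [:: 11; 15; 10] tC4); [exact: n3|exact: bs6|exact: (maskS d11 (maskS d15 (maskS d10 (@mask0 _))))|exact_no_check (erefl true)].
Qed.
Lemma d13 : dead x0 g (config 13).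
Proof.
by apply: (@stage 6 3 [:: 11; 12] tC5); [exact: n3|exact: bs6|exact: (maskS d11 (maskS d12 (@mask0 _)))|exact_no_check (erefl true)].
Qed.
Lemma d14 : dead x0 g (config 14).
Proof.
by apply: (@stage 6 3 [:: 11; 12; 13] tC6); [exact: n3|exact: bs6|exact: (maskS d11 (maskS d12 (maskS d13 (@mask0 _))))|exact_no_check (erefl true)].
Qed.
Lemma d_C7 : dead x0 g (mk 7 (cyc_es 7) [::]).
Proof.
by apply: (@stage 6 3 [:: 11; 12; 13; 14] tC7); [exact: n3|exact: bs6|exact: (maskS d11 (maskS d12 (maskS d13 (maskS d14 (@mask0 _)))))|exact_no_check (erefl true)].
Qed.

End Stages.

(* Summing the three arcs gives gl <= s1 + s2 + s3 + 3; tails of length 2 only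
   occur at the positions 0 and 4. *)
Lemma three_arcs gl : 7 < gl -> forall j1 j2 j3 s1 s2 s3, j1 < j2 -> j2 < j3 -> j3 < gl ->
  gl <= s1 + s2 + 2 + (j2 - j1) -> gl <= s2 + s3 + 2 + (j3 - j2) -> gl <= s1 + s3 + 2 + (gl - (j3 - j1)) ->
  let F s j := s <= 2 /\ (s = 2 -> j = 0 \/ j = 4) /\ (s = 1 -> gl = 8 -> j = 2 \/ j = 6) in
  F s1 j1 -> F s2 j2 -> F s3 j3 -> False.
Proof.
move=> gl8 j1 j2 j3 s1 s2 s3 l12 l23 l3 a12 a23 a13 F.
have sum : gl <= s1 + s2 + s3 + 3 by move: l12 l23 l3 a12 a23 a13; clear; lia.
case=> [+ [+ +]] [+ [+ +]] [+ [+ +]].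
case: s1 a12 a13 sum => [|[|[|//]]] a12 a13 sum _ b1 c1; case: s2 a12 a23 sum => [|[|[|//]]] a12 a23 sum _ b2 c2;
case: s3 a13 a23 sum => [|[|[|//]]] a13 a23 sum _ b3 c3; try (by move: gl8 sum; clear; lia).
- have := b2 erefl; have := b3 erefl; have gE : gl = 8 by move: gl8 sum; clear; lia.
  by have := c1 erefl gE; move: gE l12 l23 l3 a12 a23 a13; clear; lia.
- have := b1 erefl; have := b3 erefl; have gE : gl = 8 by move: gl8 sum; clear; lia.
  by have := c2 erefl gE; move: gE l12 l23 l3 a12 a23 a13; clear; lia.
- have := b1 erefl; have := b2 erefl; have gE : gl = 8 by move: gl8 sum; clear; lia.
  by have := c3 erefl gE; move: gE l12 l23 l3 a12 a23 a13; clear; lia.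
- by have := b1 erefl; have := b2 erefl; have := b3 erefl; move: l12 l23; clear; lia.
Qed.

(** * Cubic graphs of girth at least 8: the reduction along a shortest cycle *)

Section Girth.
Variables (T : finType) (x0 : T) (g : gr T).
Hypothesis g3 : sub3 g.
Hypothesis cub : forall x, x \in V g -> 3 <= #|nb g x|.

(* Non-backtracking walks, as vertex lists. *)
Fixpoint nbl (p : seq T) := match p with
  | x :: ((y :: q) as p') => [&& E g x y, (if q is z :: _ then x != z else true) & nbl p']
  | _ => true end.

Lemma nblE x y q : nbl (x :: y :: q) = [&& E g x y, (if q is z :: _ then x != z else true) & nbl (y :: q)].
Proof. by []. Qed.

Lemma nbl_path x p : nbl (x :: p) -> path (E g) x p.
Proof. by elim: p x => // y p IHp x; rewrite nblE /= => /and3P[-> _ /IHp]. Qed.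

Lemma nbl_cat p a b q : nbl (p ++ [:: a; b]) -> nbl (a :: b :: q) -> nbl (p ++ [:: a, b & q]).
Proof.
elim: p => // x p IHp; case: p IHp => [|y [|z p]] IHp.
- by move=> /= /and3P[-> -> _] /= ->.
- by move=> /= /and3P[-> -> h] h2; apply: IHp.
- by rewrite !cat_cons /= => /and3P[-> -> h] h2; apply: IHp.
Qed.

Lemma nbl_rev p : nbl p -> nbl (rev p).
Proof.
elim: p => // x [|y [|z q]] IHp //; first by rewrite /= E_sym.
move=> /= /and3P[xy xz h]; rewrite !rev_cons -!cats1 -!catA /=.
apply: (@nbl_cat (rev q) z y [:: x]).
  by have := IHp h; rewrite !rev_cons -!cats1 -!catA.
by rewrite /= E_sym; case/and3P: h => -> _ _; rewrite eq_sym xz E_sym xy.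
Qed.

Lemma nbl_drop p q : nbl (p ++ q) -> nbl q.
Proof.
elim: p => // x p IHp; rewrite cat_cons => h; apply: IHp; move: h.
by case: (p ++ q) => // y r; rewrite nblE => /and3P[].
Qed.

Lemma nbl_take p q : nbl (p ++ q) -> nbl p.
Proof.
elim: p => // x p IHp; case: p IHp => // y p IHp; rewrite !cat_cons !nblE => /and3P[-> h /IHp ->].
by rewrite andbT /=; case: p h {IHp}.
Qed.

Lemma dup_split (s : seq T) : ~~ uniq s -> exists z s1 s2 s3, s = s1 ++ z :: s2 ++ z :: s3.
Proof.
elim: s => // a s IHs /=; rewrite negb_and negbK; have [/splitPr[s2 s3] _|_ /IHs[z [s1 [s2 [s3 ->]]]]] := boolP (a \in s).
  by exists a, [::], s2, s3.
by exists z, (a :: s1), s2, s3.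
Qed.

Definition iscyc n (c : seq T) := [&& size c == n, 2 < n, uniq c & cycle (E g) c].

(** At a repeated vertex the walk contains a shorter closed one, again without backtracking. Without
    repetition it is a cycle, of length at least 3 because it never steps back. *)
Lemma closed_cycle x s : nbl (x :: rcons s x) -> exists n c, n <= (size s).+1 /\ iscyc n c.
Proof.
have [n] := ubnP (size s); elim: n x s => // n IHn x s /ltnSE sn h.
have [u|/dup_split[z [s1 [s2 [s3 sE]]]]] := boolP (uniq (x :: s)).
  exists (size s).+1, (x :: s); split=> //; rewrite /iscyc eqxx; apply/and4P; split=> //; last exact: (nbl_path h).
  by case: s h {u sn} => [|y [|]] //; rewrite /rcons nblE ?E_irr // eqxx andbF.
have sub : nbl (z :: rcons s2 z).
  have e : x :: rcons s x = s1 ++ ((z :: rcons s2 z) ++ rcons s3 x).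
    by rewrite -rcons_cons sE -cats1 -!catA /= -!catA /= -cats1 -catA /= cats1.
  by move: h; rewrite e => /nbl_drop/nbl_take.
have [|m [c [mc cc]]] := IHn z s2 _ sub.
  have := congr1 size sE; rewrite /= !size_cat /= size_cat /= => e; apply: leq_trans sn; move: e; clear; lia.
exists m, c; split=> //; apply: leq_trans mc _.
by have := congr1 size sE; rewrite /= !size_cat /= size_cat /=; clear; lia.
Qed.

Lemma long_walk x n : x \in V g -> exists y s, nbl (y :: s) /\ size s = n.
Proof.
move=> xV; suff [y [s [h sn yV]]] : exists y s, [/\ nbl (y :: s), size s = n & y \in V g] by exists y, s.
elim: n => [|n [y [s [h sn yV]]]]; first by exists x, [::].
have [z yz zs] : exists2 z, E g y z & (if s is t :: _ then z != t else true).
  case: s {h sn} => [|t s].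
    by have /card_gt0P[z] : 0 < #|nb g y| by [apply: leq_trans (cub yV)]; rewrite in_nb; exists z.
  have /card_gt0P[z] : 0 < #|nb g y :\ t| by have := cub yV; rewrite (cardsD1 t); case: (t \in _); clear; lia.
  by rewrite in_setD1 in_nb => /andP[]; exists z.
exists z, (y :: s); split; [|by rewrite /= sn|exact: E_Vr yz].
by rewrite /= E_sym yz /=; case: s zs h {sn} => //= t s -> ->.
Qed.

Lemma has_cycle x : x \in V g -> exists n, `[< exists c, iscyc n c >].
Proof.
move=> xV; have [y [s [h sn]]] := long_walk #|T| xV.
have nu : ~~ uniq (y :: s).
  by apply/negP=> u; have := max_card (mem (y :: s)); rewrite (card_uniqP u) /= sn ltnn.
have [z [s1 [s2 [s3 sE]]]] := dup_split nu.
have [|n [c [_ cc]]] := @closed_cycle z s2; last by exists n; apply/asboolP; exists c.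
move: h; rewrite sE => /nbl_drop; have -> : z :: s2 ++ z :: s3 = (z :: rcons s2 z) ++ s3 by rewrite /= cat_rcons.
exact: nbl_take.
Qed.

Section Shortest.
Variables (gl : nat) (cyc : seq T).
Hypothesis cycP : iscyc gl cyc.
Hypothesis glmin : forall n c, iscyc n c -> gl <= n.

Lemma walk_long x s : nbl (x :: rcons s x) -> gl <= (size s).+1.
Proof. by move/closed_cycle=> [n [c [nc /glmin gn]]]; apply: leq_trans nc. Qed.

Let gl2 : 2 < gl. Proof. by case/and4P: cycP. Qed.
Let gl0 : 0 < gl. Proof. by apply: leq_trans gl2. Qed.
(** Positions are read modulo [gl], so arcs may run past the end of the list. *)
Definition c i := nth x0 cyc (i %% gl).
Let sz : size cyc = gl. Proof. by case/and4P: cycP => /eqP. Qed.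

Lemma c_mod i : c (i + gl) = c i. Proof. by rewrite /c modnDr. Qed.

Lemma c_inj i j : i < gl -> j < gl -> c i = c j -> i = j.
Proof.
move=> ilt jlt /eqP; rewrite /c nth_uniq ?sz ?ltn_pmod //; last by case/and4P: cycP.
by rewrite !modn_small // => /eqP.
Qed.

Lemma cE i : E g (c i) (c i.+1).
Proof.
have cy : cycle (E g) cyc by case/and4P: cycP.
suff h j : j < gl -> E g (nth x0 cyc j) (nth x0 cyc (j.+1 %% gl)).
  by have := h _ (ltn_pmod i gl0); rewrite /c -addn1 modnDml addn1.
move=> jlt; move: cy sz; case: cyc => [|y p] /=; first by move=> _ e; rewrite -e in jlt.
move=> /(pathP x0) hp szp; have := hp j; rewrite size_rcons szp => /(_ jlt).
have -> : nth x0 (y :: rcons p y) j = nth x0 (y :: p) j.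
  by rewrite -rcons_cons nth_rcons /= szp jlt.
have [jl|jl] := ltnP j.+1 gl.
  rewrite modn_small //= nth_rcons; have -> : j < size p by rewrite -ltnS szp.
  by [].
have e : j.+1 = gl by apply/eqP; rewrite eqn_leq jlt jl.
rewrite e modnn /= nth_rcons; have -> : j = size p by move: e szp; clear; lia.
by rewrite ltnn eqxx.
Qed.

Lemma cV i : c i \in V g. Proof. exact: E_V (cE i). Qed.

Lemma c2 i : c i != c i.+2.
Proof.
rewrite /c nth_uniq ?sz ?ltn_pmod //; last by case/and4P: cycP.
rewrite -addn2 -[X in X %% _ == _]addn0 eqn_modDl !modn_small //.
Qed.

Fixpoint pre i n := if n is n'.+1 then c i :: pre i.+1 n' else [::].
Definition arc i n := pre i n.+1.

Lemma pre_snoc i n : pre i n.+1 = pre i n ++ [:: c (i + n)].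
Proof.
elim: n i => [|n IHn] i; first by rewrite /= addn0.
by rewrite -[pre i n.+2]/(c i :: pre i.+1 n.+1) IHn addSnnS.
Qed.

Lemma size_pre i n : size (pre i n) = n.
Proof. by elim: n i => //= n IHn i; rewrite IHn. Qed.

Lemma arcS i n : arc i n.+1 = c i :: arc i.+1 n. Proof. by []. Qed.

Lemma arc_last2 i n : arc i n.+1 = pre i n ++ [:: c (i + n); c (i + n.+1)].
Proof. by rewrite /arc pre_snoc pre_snoc -catA. Qed.

Lemma nbl_arc i n : nbl (arc i n).
Proof.
elim: n i => [//|n IHn] i; have := IHn i.+1; rewrite arcS; case: n {IHn} => [|n]; first by rewrite nblE cE.
by rewrite arcS => h; rewrite nblE h cE andbT; case: n {h} => [|n] /=; apply: c2.
Qed.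

(** The predecessor, shifted by a full turn to avoid truncated subtraction. *)
Definition prv i := i + gl.-1.
Lemma c_prv i : c (prv i).+1 = c i.
Proof. by rewrite -(c_mod i) /prv -addnS prednK. Qed.

(** The third neighbour of [c i]. The default [x0] is never reached, since all degrees are 3; see
    [dP]. *)
Definition d i : T := odflt x0 [pick u in nb g (c i) :\: [set c i.+1; c (prv i)]].

Lemma dP i : [/\ E g (c i) (d i), d i != c i.+1, d i != c (prv i)
  & nb g (c i) = [set c i.+1; c (prv i); d i]].
Proof.
have cp : E g (c i) (c (prv i)) by rewrite E_sym; have := cE (prv i); rewrite c_prv.
have ne : c i.+1 != c (prv i).
  have <- : c (prv i).+2 = c i.+1 by rewrite /prv -(c_mod i.+1); congr c; move: gl0; clear; lia.
  by rewrite eq_sym c2.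
rewrite /d; case: pickP => [u|h] /=.
  rewrite in_setD in_set2 negb_or in_nb => /andP[/andP[u1 u2] cu]; split=> //.
  apply: nb_card3; rewrite ?cE //= !inE negb_or ne /=; by rewrite eq_sym u1 eq_sym u2.
have : nb g (c i) :\: [set c i.+1; c (prv i)] = set0 by apply/setP=> u; rewrite h inE.
move/eqP; rewrite setD_eq0 => /subset_leq_card; rewrite cards2 ne => h2.
by have := leq_trans (cub (cV i)) h2.
Qed.

(* A walk t from w reaching the cycle at position j through d j. *)
Definition tail w t j := [/\ nbl (w :: t ++ [:: c j; c j.+1]), nbl (w :: t ++ [:: c j; c (prv j)]) & j < gl].

(** Each of the two arcs between [c j1] and [c j2] closes the tails to a walk from [w] to [w], which
    has at least [gl] edges by [walk_long]. A tail [t] has [size t + 1] edges, whence the summand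
    2. *)
Lemma two_tails w t1 j1 t2 j2 : tail w t1 j1 -> tail w t2 j2 -> j1 < j2 ->
  head (c j1) t1 != head (c j2) t2 ->
  gl <= size t1 + size t2 + 2 + (j2 - j1) /\ gl <= size t1 + size t2 + 2 + (gl - (j2 - j1)).
Proof.
have gen ta i n tb i' : nbl (w :: ta ++ [:: c i; c i.+1]) -> nbl (w :: tb ++ [:: c i'; c (prv i')]) ->
    c (i + n.+1) = c i' -> c (i + n) = c (prv i') -> head (c i) ta != head (c i') tb -> gl <= size ta + size tb + 2 + n.+1.
  move=> h1 h2 e1 e2 ne.
  have a1 : nbl ((w :: ta) ++ [:: c i, c i.+1 & pre i.+2 n]) by apply: nbl_cat => //; apply: (nbl_arc i n.+1).
  rewrite -[[:: c i, c i.+1 & _]]/(arc i n.+1) arc_last2 catA in a1.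
  have tb' : nbl ([:: c (i + n), c (i + n.+1) & rev (w :: tb)]).
    have := nbl_rev h2; rewrite -cat_cons rev_cat; have -> : rev [:: c i'; c (prv i')] = [:: c (prv i'); c i'] by [].
    by rewrite e1 e2.
  have := nbl_cat a1 tb'.
  have -> : ((w :: ta) ++ pre i n) ++ [:: c (i + n), c (i + n.+1) & rev (w :: tb)] = w :: rcons (ta ++ arc i n.+1 ++ rev tb) w.
    by rewrite arc_last2 rev_cons -!cats1 /= -!catA.
  move/walk_long; rewrite !size_cat size_rev [size (arc _ _)]size_pre; clear; lia.
move=> [p1 q1 l1] [p2 q2 l2] lt ne; split.
  have := @gen t1 j1 (j2 - j1).-1 t2 j2 p1 q2; have e : (j2 - j1).-1.+1 = j2 - j1 by move: lt; clear; lia.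
  rewrite e; apply=> //; first by congr c; move: lt; clear; lia.
  by rewrite -(c_mod (j1 + _)); congr c; rewrite /prv; move: lt gl0; clear; lia.
have := @gen t2 j2 (gl - (j2 - j1)).-1 t1 j1 p2 q1; have e : (gl - (j2 - j1)).-1.+1 = gl - (j2 - j1) by move: lt l2; clear; lia.
rewrite e [size t2 + _]addnC; apply=> //; last by rewrite eq_sym.
  by rewrite -(c_mod j1); congr c; move: lt l2; clear; lia.
by congr c; rewrite /prv; move: lt l2; clear; lia.
Qed.

(** Adding the bounds for the two arcs eliminates the positions. *)
Lemma two_tails' w t1 j1 t2 j2 : tail w t1 j1 -> tail w t2 j2 -> j1 != j2 ->
  head (c j1) t1 != head (c j2) t2 -> gl <= 2 * (size t1 + size t2 + 2).
Proof.
move=> h1 h2 ne hd; have [lt|gt|e] := ltngtP j1 j2; last by rewrite e eqxx in ne.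
  by have [] := two_tails h1 h2 lt hd; move: lt; clear; lia.
by rewrite eq_sym in hd; have [] := two_tails h2 h1 gt hd; move: gt; clear; lia.
Qed.

Lemma tail1 j w : j < gl -> w = d j -> tail w [::] j.
Proof.
move=> jlt ->; have [e1 n1 n2 _] := dP j; split=> //=; rewrite E_sym e1 ?n1 ?n2 ?cE //.
have := cE (prv j); rewrite c_prv E_sym => ->; by [].
Qed.

Lemma tail2 j w : j < gl -> E g w (d j) -> w != c j -> tail w [:: d j] j.
Proof.
move=> jlt wd wc; have [p1 p2 _] := tail1 jlt erefl; have [e1 n1 n2 _] := dP j.
by split=> //; move: p1 p2; rewrite /= => p1 p2; rewrite wd wc.
Qed.

Lemma tail3 j w e : j < gl -> E g w e -> E g e (d j) -> e != c j -> w != d j -> tail w [:: e; d j] j.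
Proof.
move=> jlt we ed ec wd; have [p1 p2 _] := tail2 jlt ed ec.
by split=> //; move: p1 p2; rewrite /= => p1 p2; rewrite we wd.
Qed.

Lemma chord i n : 0 < n -> E g (c (i + n)) (c i) -> c (i + n.-1) != c i -> gl <= n.+1.
Proof.
case: n => // n _ en ne; rewrite /= in ne.
have n0 : 0 < n by case: n ne {en} => //; rewrite addn0 eqxx.
have h : nbl (pre i n ++ [:: c (i + n), c (i + n.+1) & [:: c i]]).
  apply: nbl_cat; first by rewrite -arc_last2 nbl_arc.
  by rewrite !nblE ne en addnS cE.
have wl := @walk_long (c i) (pre i.+1 n.+1); rewrite size_pre in wl; apply: wl.
by rewrite -rcons_cons -[c i :: pre _ _]/(arc i n.+1) arc_last2 -cats1 -catA.
Qed.

(** A chord would cut off a cycle shorter than [gl]. *)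
Lemma d_off j h : j < gl -> h < gl -> d j != c h.
Proof.
move=> jlt hlt; apply/eqP=> e; have [e1 n1 n2 _] := dP j.
have hj : h != j by apply: contraTneq e1 => hj; rewrite e hj E_irr.
have [lt|gt|eq] := ltngtP j h; last by rewrite eq eqxx in hj.
  have n0 : 0 < h - j by rewrite subn_gt0.
  have := @chord j (h - j) n0; rewrite subnKC ?(ltnW lt) // -e E_sym => /(_ e1).
  have -> : j + (h - j).-1 = h.-1 by move: lt; clear; lia.
  case: eqP => [/c_inj ee|_ /(_ isT) le].
    have {}ee : h.-1 = j by apply: ee => //; move: hlt lt; clear; lia.
    by move: n1; rewrite e (_ : h = j.+1) ?eqxx //; move: ee lt; clear; lia.
  have [j0 hE] : j = 0 /\ h = gl.-1 by move: le hlt lt; clear; lia.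
  by move: n2; rewrite e hE j0 /prv add0n eqxx.
have n0 : 0 < j - h by rewrite subn_gt0.
have := @chord h (j - h) n0; rewrite subnKC ?(ltnW gt) // -e => /(_ e1).
have -> : h + (j - h).-1 = j.-1 by move: gt; clear; lia.
case: eqP => [|_ /(_ isT) le].
  rewrite e => /c_inj ee; have {}ee : j.-1 = h by apply: ee => //; move: jlt gt; clear; lia.
  by move: n2; rewrite e -(c_mod h) (_ : prv j = h + gl) ?eqxx // /prv; move: ee gt gl0; clear; lia.
have [h0 jE] : h = 0 /\ j = gl.-1 by move: le jlt gt; clear; lia.
by move: n1; rewrite e h0 jE prednK // -[gl]add0n c_mod eqxx.
Qed.

Lemma cyc_models : mk_ok gl (cyc_es gl) -> models x0 g (mk gl (cyc_es gl) [::]) cyc.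
Proof.
move=> ok; apply: mk_models => //; first by case/and4P: cycP.
have nc i : i < gl -> nth x0 cyc i = c i by move=> ilt; rewrite /c modn_small.
apply/allP=> e; rewrite inE => /orP[/eqP->|/mapP[i]] /=.
  have := cE gl.-1; rewrite prednK // -[c gl]/(c (0 + gl)) c_mod !nc //; by rewrite prednK.
rewrite mem_iota add0n /= => ilt ->; rewrite !nc ?cE //=; move: ilt; clear; lia.
Qed.

Hypothesis gl8 : 8 <= gl.

(** A centre is chosen and dominates three consecutive vertices of the cycle; a skipped vertex is
    dominated by its third neighbour, which is chosen instead. No vertex is skipped if 3 divides
    [gl], one for remainder 1, two for remainder 2; the skipped positions 0 and 4 then enclose the
    centre 2. *)
Definition ctr j := match gl %% 3 with 0 => j %% 3 == 0 | 1 => (0 < j) && (j %% 3 == 2)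
  | _ => (j == 2) || (4 < j) && (j %% 3 == 0) end.
Definition skp j := match gl %% 3 with 0 => false | 1 => j == 0 | _ => (j == 0) || (j == 4) end.
Definition nx j := if j.+1 == gl then 0 else j.+1.
Definition pv j := if j == 0 then gl.-1 else j.-1.

Lemma types j : j < gl -> [/\ ctr j + ctr (nx j) + ctr (pv j) + skp j = 1,
  skp j -> ~~ skp (nx j) && ~~ skp (pv j) && ~~ ctr (nx j) && ~~ ctr (pv j),
  skp j -> j = 0 \/ j = 4, gl = 8 -> ctr j -> j = 2 \/ j = 6 & nx j < gl /\ pv j < gl].
Proof.
move=> jlt; have : gl %% 3 < 3 by rewrite ltn_pmod.
have gE := divn_eq gl 3; move: (gl %/ 3) gE => k gE.
rewrite /ctr /skp /nx /pv; case r: (gl %% 3) => [|[|[|//]]] _; rewrite r in gE.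
- by case: (j.+1 =P gl) => h1; case: (j =P 0) => h2; split; move: gl8 gE jlt h1 h2; clear; lia.
- by case: (j.+1 =P gl) => h1; case: (j =P 0) => h2; split; move: gl8 gE jlt h1 h2; clear; lia.
- by case: (j.+1 =P gl) => h1; case: (j =P 0) => h2; split; move: gl8 gE jlt h1 h2; clear; lia.
Qed.

Lemma c_nx j : c j.+1 = c (nx j).
Proof. by rewrite /nx; case: eqP => [->|//]; rewrite -[gl]add0n c_mod. Qed.
Lemma c_pv j : c (prv j) = c (pv j).
Proof. by rewrite /pv /prv; case: eqP => [->//|j0]; rewrite -(c_mod j.-1); congr c; move: j0 gl0; clear; lia. Qed.

Let I1 := [set c (nat_of_ord j) | j : 'I_gl & ctr j].
Let I2 := [set d (nat_of_ord j) | j : 'I_gl & skp j].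
Let I := I1 :|: I2.
Let Y := clnb g I.

Lemma inI u : u \in I -> exists2 j, j < gl & (ctr j /\ u = c j) \/ (skp j /\ u = d j).
Proof.
rewrite in_setU => /orP[]/imsetP[j]; rewrite inE => h ->; exists j => //; auto.
Qed.
Lemma I_c j : j < gl -> ctr j -> c j \in I.
Proof. by move=> jlt h; rewrite in_setU; apply/orP; left; apply/imsetP; exists (Ordinal jlt); rewrite ?inE. Qed.
Lemma I_d j : j < gl -> skp j -> d j \in I.
Proof. by move=> jlt h; rewrite in_setU; apply/orP; right; apply/imsetP; exists (Ordinal jlt); rewrite ?inE. Qed.

Lemma cI j : j < gl -> c j \in I -> ctr j.
Proof.
move=> jlt /inI[h hlt [[ch e]|[_ e]]]; first by rewrite (c_inj jlt hlt e).
by have := d_off hlt jlt; rewrite e eqxx.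
Qed.

Lemma nbc j : nb g (c j) = [set c (nx j); c (pv j); d j].
Proof. by have [_ _ _] := dP j; rewrite c_nx c_pv. Qed.

Lemma in_nbc j u : E g (c j) u -> [\/ u = c (nx j), u = c (pv j) | u = d j].
Proof. by rewrite -in_nb nbc -setUA !in_setU !in_set1 => /or3P[]/eqP; [constructor 1|constructor 2|constructor 3]. Qed.

Lemma c_Y j : j < gl -> c j \in Y.
Proof.
move=> jlt; have [t1 _ _ _ [nlt plt]] := types jlt; apply/in_clnb.
have [cj|ncj] := boolP (ctr j); first by left; apply: I_c.
have [sj|nsj] := boolP (skp j).
  by right; exists (d j); [apply: I_d|rewrite E_sym; have [] := dP j].
have [cn|ncn] := boolP (ctr (nx j)).
  by right; exists (c (nx j)); [apply: I_c|rewrite E_sym -c_nx cE].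
have cp : ctr (pv j) by move: t1; rewrite (negbTE ncj) (negbTE nsj) (negbTE ncn); case: (ctr (pv j)).
by right; exists (c (pv j)); [apply: I_c|rewrite -c_pv; have := cE (prv j); rewrite c_prv].
Qed.

Lemma d_same i j : i < gl -> j < gl -> d i = d j -> i = j.
Proof.
move=> ilt jlt e; apply/eqP/negPn/negP=> ne.
have := two_tails' (tail1 ilt erefl) (tail1 jlt e) ne; rewrite /= => h.
have : c i != c j by apply: contraNneq ne => /c_inj ->.
by move/h; move: gl8; clear; lia.
Qed.

(** Two adjacent third neighbours would give [gl <= 6] by [two_tails']. *)
Lemma I_indep x y : x \in I -> y \in I -> ~~ E g x y.
Proof.
have cd i j : i < gl -> j < gl -> ctr i -> skp j -> ~~ E g (c i) (d j).
  move=> ilt jlt ci sj; apply/negP=> /in_nbc[e|e|e].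
  - by have [_ _ _ _ [nlt _]] := types ilt; have := d_off jlt nlt; rewrite e eqxx.
  - by have [_ _ _ _ [_ plt]] := types ilt; have := d_off jlt plt; rewrite e eqxx.
  - by have ij := d_same jlt ilt e; have [t1 _ _ _ _] := types ilt; move: t1; rewrite ci -ij sj; case: (ctr _); case: (ctr _).
move=> /inI[i ilt hi] /inI[j jlt hj]; case: hi hj => [[ci ->]|[si ->]] [[cj ->]|[sj ->]].
- apply/negP=> /in_nbc[e|e|e]; have [t1 _ _ _ [nlt plt]] := types ilt.
  + by have ee := c_inj jlt nlt e; move: t1; rewrite ci -ee cj; case: (ctr _).
  + by have ee := c_inj jlt plt e; move: t1; rewrite ci -ee cj; case: (ctr _).
  + by have := d_off ilt jlt; rewrite e eqxx.
- exact: cd.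
- by rewrite E_sym; apply: cd.
- have [ij|ne] := eqVneq i j; first by rewrite ij E_irr.
  apply/negP=> dd; have ncj : d i != c j by apply: d_off.
  have := two_tails' (tail1 ilt erefl) (tail2 jlt dd ncj) ne; rewrite /= => h.
  have : c i != d j by rewrite eq_sym; apply: d_off.
  by move/h; move: gl8; clear; lia.
Qed.

(** Each of the three neighbours of [w] gives a tail from [w] to the cycle, of size 0, of size 1 at
    a centre, or of size 2 at a skipped vertex. The tails end at three distinct positions, which lie
    too close together by [three_arcs]. *)
Lemma no_iso w : isoS g Y w -> False.
Proof.
case/and3P=> wV wY /subsetP nY.
have wc j : j < gl -> w != c j by move=> jlt; apply: contraNneq wY => ->; apply: c_Y.
have wI : w \notin I by apply: contra wY => wI; apply/in_clnb; left.
have nbI u : E g w u -> u \notin I.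
  by move=> wu; apply: contra wY => uI; apply/in_clnb; right; exists u; rewrite // E_sym.
have kind y : E g w y -> exists2 j, j < gl & [\/ w = d j /\ y = c j, ctr j /\ y = d j | [/\ skp j, E g y (d j) & y != c j]].
  move=> wy; have yw : E g y w by rewrite E_sym.
  have cyc_case h : h < gl -> y = c h -> exists2 j, j < gl & [\/ w = d j /\ y = c j, ctr j /\ y = d j | [/\ skp j, E g y (d j) & y != c j]].
    move=> hlt e; exists h => //; constructor 1; split=> //; have [_ _ _ _ [nlt plt]] := types hlt.
    move: yw; rewrite e => /in_nbc[ee|ee|//]; [have := wc _ nlt|have := wc _ plt]; by rewrite ee eqxx.
  have : y \in Y by apply: nY; rewrite in_nb.
  case/in_clnb=> [yI|[i /inI[j jlt ij] iy]]; first by have := nbI _ wy; rewrite yI.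
  have [_ _ _ _ [nlt plt]] := types jlt.
  case: ij => [[cj ie]|[sj ie]]; rewrite ie in iy.
    case: (in_nbc iy) => e; [exact: (cyc_case _ nlt)|exact: (cyc_case _ plt)|].
    by exists j => //; constructor 2.
  have [e|ne] := eqVneq y (c j); first exact: (cyc_case _ jlt).
  by exists j => //; constructor 3; split=> //; rewrite E_sym.
have wd j : j < gl -> skp j -> w != d j by move=> jlt sj; apply: contraNneq wI => ->; apply: I_d.
pose sz' (k : nat) j := k = 0 \/ k = 1 /\ ctr j \/ k = 2 /\ skp j.
pose Kd y j := [\/ w = d j /\ y = c j, ctr j /\ y = d j | [/\ skp j, E g y (d j) & y != c j]].
have kind' y : E g w y -> exists j t, [/\ tail w t j, head (c j) t = y, j < gl, sz' (size t) j & Kd y j].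
  move=> wy; have [j jlt kj] := kind y wy; exists j; case: (kj) => [[e1 e2]|[e1 e2]|[e1 e2 e3]].
  - by exists [::]; split=> //; [apply: tail1|left].
  - by exists [:: d j]; split=> //; [apply: tail2; rewrite -?e2 ?wc|right; left].
  - by exists [:: y; d j]; split=> //; [apply: tail3 => //; apply: wd|right; right].
have same y1 y2 j : E g w y1 -> E g w y2 -> y1 != y2 -> j < gl -> Kd y1 j -> Kd y2 j -> False.
  move=> wy1 wy2 n12 jlt; have [t1 _ _ _ _] := types jlt.
  have cs : ctr j -> skp j -> False by move=> cj sj; move: t1; rewrite cj sj; case: (ctr _); case: (ctr _).
  case=> [[a1 a2]|[a1 a2]|[a1 a2 a3]] [[b1 b2]|[b1 b2]|[b1 b2 b3]].
  - by rewrite a2 b2 eqxx in n12.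
  - by rewrite b2 -a1 E_irr in wy2.
  - by have := wd _ jlt b1; rewrite a1 eqxx.
  - by rewrite a2 -b1 E_irr in wy1.
  - by rewrite a2 b2 eqxx in n12.
  - exact: cs.
  - by have := wd _ jlt a1; rewrite b1 eqxx.
  - exact: cs.
  - have := @walk_long w [:: y1; d j; y2]; rewrite /rcons !nblE wy1 a2 [E g (d j) _]E_sym b2 [E g y2 _]E_sym wy2 n12 wd //= eq_sym wd //.
    by move=> /(_ isT) h; have := leq_trans gl8 h.
have [y1 wy1] : exists y, y \in nb g w by apply/card_gt0P; apply: leq_trans (cub wV).
have [y2] : exists y, y \in nb g w :\ y1.
  by apply/card_gt0P; have := cub wV; rewrite (cardsD1 y1) wy1; clear; lia.
rewrite in_setD1 => /andP[n21 wy2].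
have [y3] : exists y, y \in nb g w :\ y1 :\ y2.
  apply/card_gt0P; have := cub wV; rewrite (cardsD1 y1) wy1 (cardsD1 y2) in_setD1 n21 wy2; clear; lia.
rewrite !in_setD1 => /and3P[n32 n31 wy3]; rewrite !in_nb in wy1 wy2 wy3.
have [j1 [t1 [T1 h1 l1 s1 K1]]] := kind' _ wy1; have [j2 [t2 [T2 h2 l2 s2 K2]]] := kind' _ wy2.
have [j3 [t3 [T3 h3 l3 s3 K3]]] := kind' _ wy3.
have n12 : y1 != y2 by rewrite eq_sym.
have n13 : y1 != y3 by rewrite eq_sym.
have n23 : y2 != y3 by rewrite eq_sym.
have d12 : j1 != j2 by apply/eqP=> e; apply: (same y1 y2 j1) => //; rewrite e.
have d13 : j1 != j3 by apply/eqP=> e; apply: (same y1 y3 j1) => //; rewrite e.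
have d23 : j2 != j3 by apply/eqP=> e; apply: (same y2 y3 j2) => //; rewrite e.
have pair ta ja tb jb : tail w ta ja -> tail w tb jb -> head (c ja) ta != head (c jb) tb -> ja != jb ->
   (ja < jb -> gl <= size ta + size tb + 2 + (jb - ja) /\ gl <= size ta + size tb + 2 + (gl - (jb - ja))) /\
   (jb < ja -> gl <= size ta + size tb + 2 + (ja - jb) /\ gl <= size ta + size tb + 2 + (gl - (ja - jb))).
  move=> ha hb ne _; split=> lt; first exact: (two_tails ha hb lt ne).
  by rewrite eq_sym in ne; have := two_tails hb ha lt ne; rewrite [size tb + _]addnC.
have p12 := pair _ _ _ _ T1 T2; rewrite h1 h2 n12 in p12; have {}p12 := p12 isT d12.
have p13 := pair _ _ _ _ T1 T3; rewrite h1 h3 n13 in p13; have {}p13 := p13 isT d13.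
have p23 := pair _ _ _ _ T2 T3; rewrite h2 h3 n23 in p23; have {}p23 := p23 isT d23.
have fact j (t : seq T) : j < gl -> sz' (size t) j -> size t <= 2 /\ (size t = 2 -> j = 0 \/ j = 4) /\ (size t = 1 -> gl = 8 -> j = 2 \/ j = 6).
  move=> jlt st; have [_ _ q1 q2 _] := types jlt.
  by case: st => [->|[[-> cj]|[-> sj]]]; split=> //; split=> //; [move=> _ /q2; apply|move=> _; apply: q1].
have f1 := fact _ _ l1 s1; have f2 := fact _ _ l2 s2; have f3 := fact _ _ l3 s3.
have [[p12a p12b] [p13a p13b] [p23a p23b]] := And3 p12 p13 p23; move: d12 d13 d23; rewrite !neq_ltn.
have A := three_arcs gl8.
case/orP=> h12 /orP[]h13 /orP[]h23; try by move: h12 h13 h23; clear; lia.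
- exact: (A _ _ _ _ _ _ h12 h23 l3 (p12a h12).1 (p23a h23).1 (p13a h13).2 f1 f2 f3).
- by apply: (A _ _ _ _ _ _ h13 h23 l2 (p13a h13).1 _ (p12a h12).2 f1 f3 f2); rewrite [size t3 + _]addnC; exact: (p23b h23).1.
- by apply: (A _ _ _ _ _ _ h13 h12 l2 _ (p12a h12).1 _ f3 f1 f2); rewrite [size t3 + _]addnC; [exact: (p13b h13).1|exact: (p23b h23).2].
- by apply: (A _ _ _ _ _ _ h12 h13 l3 _ (p13a h13).1 (p23a h23).2 f2 f1 f3); rewrite [size t2 + _]addnC; exact: (p12b h12).1.
- by apply: (A _ _ _ _ _ _ h23 h13 l1 (p23a h23).1 _ _ f2 f3 f1); rewrite ?[size t3 + size t1]addnC ?[size t2 + size t1]addnC; [exact: (p13b h13).1|exact: (p12b h12).2].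
- by apply: (A _ _ _ _ _ _ h23 h12 l1 _ _ _ f3 f2 f1); rewrite ?[size t3 + _]addnC ?[size t2 + size t1]addnC; [exact: (p23b h23).1|exact: (p12b h12).1|exact: (p13b h13).2].
Qed.

Lemma nx_lt (j : 'I_gl) : nx j < gl. Proof. by have [_ _ _ _ []] := types (ltn_ord j). Qed.
Lemma pv_lt (j : 'I_gl) : pv j < gl. Proof. by have [_ _ _ _ []] := types (ltn_ord j). Qed.

Lemma sum_shift (F : nat -> nat) :
  \sum_(j < gl) F (nx j) = \sum_(j < gl) F j /\ \sum_(j < gl) F (pv j) = \sum_(j < gl) F j.
Proof.
split; [rewrite [RHS](reindex_inj (h := fun j => Ordinal (nx_lt j))) //|rewrite [RHS](reindex_inj (h := fun j => Ordinal (pv_lt j))) //].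
- move=> i j /(congr1 val) /=; rewrite /nx => e; apply/val_inj => /=; move: e (ltn_ord i) (ltn_ord j).
  by case: eqP; case: eqP; move: gl0; clear; lia.
- move=> i j /(congr1 val) /=; rewrite /pv => e; apply/val_inj => /=; move: e (ltn_ord i) (ltn_ord j).
  by case: eqP; case: eqP; move: gl0; clear; lia.
Qed.

Lemma I_count : #|I| <= \sum_(j < gl) (ctr j + skp j).
Proof.
apply: leq_trans (leq_card_setU _ _) _; rewrite big_split /=; apply: leq_add.
  by apply: leq_trans (leq_imset_card _ _) _; rewrite -sum1_card big_mkcond; apply: leq_sum => j _; rewrite inE; case: (ctr j).
by apply: leq_trans (leq_imset_card _ _) _; rewrite -sum1_card big_mkcond; apply: leq_sum => j _; rewrite inE; case: (skp j).
Qed.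

(** With s centres and t skipped vertices, summing [types] gives 3s + t = gl, and the right-hand
    side is gl - s + t = 2s + 2t. *)
Lemma type_count : 2 * \sum_(j < gl) (ctr j + skp j) <= \sum_(j < gl | ~~ ctr j) (1 + skp j).
Proof.
have e1 : \sum_(j < gl) (ctr j + ctr (nx j) + ctr (pv j) + skp j) = gl.
  by rewrite -[RHS]card_ord -sum1_card; apply: eq_bigr => j _; have [-> _ _ _ _] := types (ltn_ord j).
have [s1 s2] := sum_shift (fun j => ctr j : nat).
rewrite !big_split /= s1 s2 in e1.
have e2 : \sum_(j < gl | ~~ ctr j) (1 + skp j) + \sum_(j < gl) ctr j = gl + \sum_(j < gl) skp j.
  transitivity (\sum_(j < gl) (1 + skp j)); last by rewrite big_split /= sum1_card card_ord.
  rewrite [X in X + _ = _]big_mkcond -big_split /=; apply: eq_bigr => j _.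
  have [t1 _ _ _ _] := types (ltn_ord j); move: t1; case: (ctr j); case: (skp j) => //=; by case: (ctr _); case: (ctr _).
rewrite big_split /=; set S0 := \sum_(j < gl | _) _ in e2 *; set S1 := \sum_(j < gl) ctr j in e1 e2 *.
set S2 := \sum_(j < gl) skp j in e1 e2 *; move: e1 e2; clearbody S0 S1 S2; clear; lia.
Qed.

(** In a cubic graph the weight of [Y] minus the edges leaving it is the degree sum inside [Y]. The
    edges at [I], counted from both ends, give 6 |I|. The missing 2 |I| come from edges inside [Z],
    and those of the cycle are enough: a vertex that is not a centre has a neighbour in [Z] on the
    cycle, a skipped one has two. *)
Theorem shortest_no : (forall X : {set T}, X \subset V g -> X != set0 -> Q (del g X)) -> ~ Q g ->
  (forall a b x y z, ~ K23 g a b x y z) -> False.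
Proof.
move=> IHd nQ noK.
have IV : I \subset V g.
  by apply/subsetP=> u /inI[j jlt [[_ ->]|[_ ->]]]; [apply: cV|have [/E_Vr] := dP j].
have YV : Y \subset V g by apply/subsetP=> u /in_clnb[/(subsetP IV) //|[x _ /E_Vr]].
have deg u : u \in V g -> #|nb g u| = 3 by move=> uV; apply/eqP; rewrite eqn_leq g3 cub.
have IY u : u \in I -> u \in Y by move=> uI; apply/in_clnb; left.
have nbIY u : u \in I -> nb g u \subset Y.
  by move=> uI; apply/subsetP=> v; rewrite in_nb => uv; apply/in_clnb; right; exists u.
apply: (no_reduction_clnb g3 IHd nQ IV _ I_indep); rewrite -/Y.
  have [t1 _ _ _ [nlt plt]] := types gl0; apply/set0Pn.
  have [h|h] := boolP (ctr 0); first by exists (c 0); apply: I_c.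
  have [h2|h2] := boolP (ctr (nx 0)); first by exists (c (nx 0)); apply: I_c.
  have [h3|h3] := boolP (ctr (pv 0)); first by exists (c (pv 0)); apply: I_c.
  have [h4|h4] := boolP (skp 0); first by exists (d 0); apply: I_d.
  by move: t1; rewrite (negbTE h) (negbTE h2) (negbTE h3) (negbTE h4).
have s0 : sig (del g Y) = 0.
  have red a b x y z : K23 g a b x y z -> #|nb g x| = 3 by move/noK.
  apply: sig0 => B /(bt_end1 g3 red)[[w _ /no_iso //]|[a [b [w [y [z [/K23_del[/noK //]]]]]]]].
rewrite s0 muln0 addn0.
have -> : \sum_(x in Y) (6 - #|nb g x|) = \sum_(x in Y) #|nb g x :\: Y| + \sum_(x in Y) #|nb g x :&: Y|.
  rewrite -big_split /=; apply: eq_bigr => u uY; have := cardsID Y (nb g u); rewrite (deg u (subsetP YV _ uY)).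
  by clear; lia.
rewrite addnC leq_add2l.
have YI : Y :&: I = I by apply/setIidPr/subsetP.
rewrite (big_setID I) /= YI.
have -> : \sum_(x in I) #|nb g x :&: Y| = 3 * #|I|.
  by rewrite mulnC -sum_nat_const; apply: eq_bigr => u uI; rewrite (setIidPl (nbIY _ uI)) deg ?(subsetP IV).
pose Z := Y :\: I; rewrite -/Z.
have -> : \sum_(x in Z) #|nb g x :&: Y| = \sum_(x in Z) #|nb g x :&: I| + \sum_(x in Z) #|nb g x :&: Z|.
  rewrite -big_split /=; apply: eq_bigr => u _; rewrite -(cardsID I (nb g u :&: Y)) -setIA YI.
  by rewrite /Z setIDA.
have -> : \sum_(x in Z) #|nb g x :&: I| = 3 * #|I|.
  transitivity (\sum_(x in ~: I) #|nb g x :&: I|).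
    rewrite [RHS](big_setID Y) /= [X in _ + X]big1 ?addn0.
      by apply: eq_bigl => u; rewrite !inE andbC.
    move=> u; rewrite in_setD => /andP[uY _]; apply/eqP; rewrite cards_eq0 -subset0; apply/subsetP=> v.
    rewrite in_setI in_nb => /andP[uv vI]; case/negP: uY; apply/in_clnb; right; exists v => //; by rewrite E_sym.
  rewrite sum_cross mulnC -sum_nat_const; apply: eq_bigr => u uI.
  rewrite (_ : nb g u :\: I = nb g u) ?deg ?(subsetP IV) //; apply/setDidPl; rewrite disjoint_subset.
  by apply/subsetP=> v; rewrite in_nb => uv; apply/negP=> vI; have := I_indep uI vI; rewrite uv.
have cZ j : j < gl -> ~~ ctr j -> c j \in Z.
  by move=> jlt nc; rewrite in_setD c_Y // andbT; apply: contra nc; apply: cI.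
have low : \sum_(j < gl | ~~ ctr j) (1 + skp j) <= \sum_(x in Z) #|nb g x :&: Z|.
  pose A := [set c (nat_of_ord j) | j in [pred j : 'I_gl | ~~ ctr j]].
  have AZ : A \subset Z by apply/subsetP=> u /imsetP[j]; rewrite inE => nc ->; apply: cZ.
  apply: (@leq_trans (\sum_(x in A) #|nb g x :&: Z|)); last first.
    by rewrite [X in _ <= X](big_setID A) /= (setIidPr AZ) leq_addr.
  rewrite big_imset /=; last by move=> i j _ _ /c_inj e; apply/val_inj/e.
  apply: leq_sum => j nc; have [t1 t2 _ _ [nlt plt]] := types (ltn_ord j).
  have En : E g (c j) (c (nx j)) by rewrite -c_nx cE.
  have Ep : E g (c j) (c (pv j)) by rewrite -c_pv; have := cE (prv j); rewrite c_prv E_sym.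
  move: t1 t2; case: (skp j) => [t1 t2|t1 _]; rewrite ?addn0 /=.
    have /andP[/andP[_ h1] h2] := t2 isT.
    have ne : c (nx j) != c (pv j).
      apply: contraTneq isT => /c_inj e; have {}e := e nlt plt; move: e (ltn_ord j); rewrite /nx /pv.
      by case: eqP; case: eqP; move: gl8; clear; lia.
    have <- : #|[set c (nx j); c (pv j)]| = 1 + 1 by rewrite cards2 ne.
    by apply: subset_leq_card; apply/subsetP=> u; rewrite in_set2 in_setI in_nb => /orP[]/eqP->; rewrite ?En ?Ep cZ.
  have [cn|ncn] := boolP (ctr (nx j)).
    have ncp : ~~ ctr (pv j) by move: t1; rewrite cn (negbTE nc); case: (ctr (pv j)).
    by apply/card_gt0P; exists (c (pv j)); rewrite in_setI in_nb Ep cZ.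
  by apply/card_gt0P; exists (c (nx j)); rewrite in_setI in_nb En cZ.
have := I_count; have := type_count; move: low.
move: #|I| (\sum_(_ < gl) _) (\sum_(_ < gl | _) _) (\sum_(_ in Z) _); clear; lia.
Qed.

End Shortest.

Theorem girth_no x : x \in V g -> (forall X : {set T}, X \subset V g -> X != set0 -> Q (del g X)) -> ~ Q g ->
  (forall a b x y z, ~ K23 g a b x y z) ->
  (forall k, 2 < k < 8 -> dead x0 g (mk k (cyc_es k) [::])) -> False.
Proof.
move=> xV IHd nQ noK dC; case: (ex_minnP (has_cycle xV)) => gl /asboolP[cyc cycP] min.
have glmin n c' : iscyc n c' -> gl <= n by move=> h; apply: min; apply/asboolP; exists c'.
have [lt8|ge8] := ltnP gl 8; last exact: (shortest_no cycP glmin ge8 IHd nQ noK).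
have gl2 : 2 < gl by case/and4P: cycP.
have dd : dead x0 g (mk gl (cyc_es gl) [::]) by apply: dC; rewrite gl2.
apply: (dd cyc); apply: (cyc_models cycP).
by move: gl2 lt8; clear; do 8?[case: gl => [//|gl]].
Qed.
End Girth.

(** * From trees of units back to the bad family *)

(** [bad_built] starts with one unit already attached; admitting the lone root gives its two
    constructors a common form. *)
Inductive rooted_built : sgraph -> Prop :=
| rb_K1 : rooted_built K1
| rb_bad H : bad_built H -> rooted_built H.

Lemma attach_built (H : sgraph) (v : H) (w : Kmn 2 3) : rooted_built H -> deg v <= 2 -> deg w = 2 ->
  bad_built (attach v w).
Proof.
move=> h; case: H / h v => [|H h] v dv dw; last exact: bad_O1.
by case: v dv => dv; apply: bad_B1.
Qed.

Section Conv.
Variable T : finType.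
Implicit Types (g : gr T) (C : {set T}).

Lemma split_first (P : pred T) s : has P s -> exists p1 u p2, [/\ s = p1 ++ u :: p2, P u & all (predC P) p1].
Proof.
elim: s => //= a s IHs; have [Pa _|nPa /= /IHs[p1 [u [p2 [-> Pu al]]]]] := boolP (P a); first by exists [::], a, s.
by exists (a :: p1), u, p2; rewrite /= nPa.
Qed.

Section Tree.
Variable g : gr T.

(* The only edge leaving the last unit is its link, so a cycle through the
   root cannot enter that unit. *)
Lemma root_nocycle r C us s : utree g r C us -> 2 < size s -> ucycle (E g) s -> {subset s <= C} -> r \notin s.
Proof.
move=> ut s2 /andP[cy us_] sub; elim: ut s s2 cy us_ sub => {C us} [rV|C us v a b x y z ut IHu vC k nyz dis vx cr] s s2 cy us_ sub.
  apply/negP=> _; have : size s <= 1; last by move=> h; have := leq_trans s2 h.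
  rewrite -(cards1 r); rewrite -(card_uniqP us_); apply: subset_leq_card; apply/subsetP=> c /sub //.
apply/negP=> rs; set U := uset a b x y z in dis cr sub.
have [sC|nsC] := boolP (has (mem U) s); last first.
  have sC' : {subset s <= C}.
    move=> c cs; have := sub c cs; rewrite in_setU => /orP[//|cU].
    by case/negP: nsC; apply/hasP; exists c.
  by have := IHu s s2 cy us_ sC'; rewrite rs.
have rC := utree_r ut; have CU c : c \in C -> c \in U = false by exact: disjointFr.
have [i s' sE] := rot_to rs.
have cy' : cycle (E g) (r :: s') by rewrite -sE rot_cycle.
have un' : uniq (r :: s') by rewrite -sE rot_uniq.
have sub' c : c \in r :: s' -> c \in C :|: U by rewrite -sE mem_rot; apply: sub.
have size' : 1 < size s' by have := congr1 size sE; rewrite size_rot /= => e; move: s2; rewrite e.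
have hasU : has (mem U) s'.
  have : has (mem U) (r :: s') by rewrite -sE has_rot.
  by rewrite /= CU.
(* Started at [r], the cycle enters the last unit for the first time from [v], at [u = x]. *)
have [p1 [u [p2 [s'E uU al]]]] := split_first hasU.
rewrite s'E in cy' un' sub' size'.
have p1C c : c \in p1 -> c \in C.
  move=> cp; have /allP/(_ c cp) := al; have := sub' c; rewrite inE mem_cat cp orbT => /(_ isT).
  by rewrite in_setU /= => /orP[//|cU]; rewrite cU.
have lC : last r p1 \in C by have := mem_last r p1; rewrite inE => /orP[/eqP->//|/p1C].
move: cy'; rewrite /= rcons_cat cat_path /= => /and3P[_ lu pu].
have [lv ux] := cr _ _ lC uU lu.
have hasC : has (mem C) (rcons p2 r) by rewrite has_rcons /= rC.
(* It returns to [C] across the same link, so [u] is its only vertex in the unit, and nothing is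
   left but [r] and [u]. *)
have [q1 [w [q2 [pE wC al2]]]] := split_first hasC.
move: pu; rewrite pE cat_path /= => /and3P[_ lw _].
have q1U c : c \in q1 -> c \in U.
  move=> cq; have /allP/(_ c cq) := al2; rewrite /= => nC.
  have cp : c \in rcons p2 r by rewrite pE mem_cat cq.
  move: cp; rewrite mem_rcons inE => /orP[/eqP ce|cp]; first by rewrite ce rC in nC.
  by have := sub' c; rewrite inE mem_cat inE cp !orbT => /(_ isT); rewrite in_setU (negbTE nC).
have lU : last u q1 \in U by have := mem_last u q1; rewrite inE => /orP[/eqP->//|/q1U].
have wl : E g w (last u q1) by rewrite E_sym.
have [wv lx] := cr _ _ wC lU wl.
have q0 : q1 = [::].
  case: q1 pE al2 q1U lU lw wl lx => // c q pE _ q1U _ _ _ lx; exfalso.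
  have lm : last u (c :: q) \in c :: q by rewrite /= mem_last.
  have lp : last u (c :: q) \in rcons p2 r by rewrite pE mem_cat lm.
  rewrite lx -ux in lp; move: un'; rewrite /= cat_uniq /= => /and5P[_ _ _ up2 _].
  move: lp; rewrite mem_rcons inE (negbTE up2) orbF => /eqP ur; have uU' : u \in U := uU; by rewrite ur CU in uU'.
rewrite q0 /= in pE; have wp : w \in rcons p2 r by rewrite pE mem_head.
have wr : w = r.
  move: wp; rewrite mem_rcons inE => /orP[/eqP//|wp2]; exfalso.
  move: un'; rewrite /= mem_cat inE !negb_or cat_uniq /= => /andP[/and3P[_ _ rp2] /and4P[_ /norP[_ /hasPn h] _ _]].
  have := mem_last r p1; rewrite lv -wv inE => /orP[/eqP we|wp1].
    by rewrite we (negbTE rp2) in wp2.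
  by have := h _ wp2; rewrite /= wp1.
have p20 : p2 = [::].
  case: p2 pE un' {sub' size' hasC q0 wp s'E} => // c p2 [ce _] un'; exfalso.
  by move: un'; rewrite /= mem_cat !inE ce wr eqxx !orbT.
have p10 : p1 = [::].
  case: p1 un' lv {sub' size' s'E al p1C lC lu} => // c p1 un' /= lv; exfalso.
  by have := mem_last c p1; rewrite lv -wv wr => rin; move: un'; rewrite cons_uniq mem_cat rin.
by rewrite p20 p10 in size'.
Qed.

Hypothesis g3 : sub3 g.

(** The unit is induced: [a], [b] and [x] have three neighbours each and no room for more, and [y z]
    is a non-edge. *)
Lemma unit_edges C v a b x y z : K23 g a b x y z -> ~~ E g y z -> v \in C ->
  [disjoint C & uset a b x y z] -> E g v x ->
  (forall c u, c \in C -> u \in uset a b x y z -> E g c u -> c = v /\ u = x) ->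
  let f (k : Kmn 2 3) := match k with inl i => nth a [:: a; b] i | inr i => nth a [:: x; y; z] i end in
  [/\ injective f, forall s t, E g (f s) (f t) = edge s t & forall u, u \in uset a b x y z <-> exists k, u = f k].
Proof.
move=> k nyz vC dis vx cr f; have [[ku ax ay az] [bx by_ bz]] := K23P k.
have [[nab nax nay naz] [[nbx nby nbz] [nxy nxz nyz']]] := uniq5 ku.
have inU u : u \in [:: a; b; x; y; z] -> u \in C :|: uset a b x y z by move=> uu; rewrite in_setU [u \in uset _ _ _ _ _]inE uu orbT.
have Ea u : E g a u -> u \in [:: x; y; z] by exact: (K23_Ea g3 k).
have Eb u : E g b u -> u \in [:: x; y; z] by exact: (K23_Ea g3 (K23_swap k)).
have Ey u : E g y u -> u \in [:: a; b; x; y; z] -> u = a \/ u = b.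
  by move=> yu /inU; apply: (last_nb g3 k nyz vC dis vx cr yu).
have xU : x \in [:: a; b; x; y; z] by rewrite !inE eqxx !orbT.
have zU : z \in [:: a; b; x; y; z] by rewrite !inE eqxx !orbT.
have nab' : ~~ E g a b by apply/negP=> /Ea; rewrite !inE (negbTE nbx) (negbTE nby) (negbTE nbz).
have nyx : ~~ E g y x by apply/negP=> /Ey /(_ xU)[] e; rewrite e eqxx in nax nbx.
have nzx : ~~ E g z x.
  rewrite uset_yz in dis cr; have nzy : ~~ E g z y by rewrite E_sym.
  apply/negP=> zx; have [] := last_nb g3 (K23_yz k) nzy vC dis vx cr zx; rewrite ?in_setU ?in_uset ?eqxx ?orbT // => e;
    by rewrite e eqxx in nax nbx.
have es s t : E g s t = E g t s by rewrite E_sym.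
split.
- have fl (s : Kmn 2 3) : f s = nth a [:: a; b; x; y; z] (match s with inl i => nat_of_ord i | inr i => i.+2 end).
    by case: s => -[[|[|[|//]]] ?].
  move=> s t; rewrite !fl => /eqP; rewrite nth_uniq //; last 2 first.
  + by case: s => -[i ilt] /=; [apply: leq_trans ilt _|rewrite !ltnS].
  + by case: t => -[i ilt] /=; [apply: leq_trans ilt _|rewrite !ltnS].
  case: s => s; case: t => t /eqP; first by move/val_inj->.
  + by move=> e; have := ltn_ord s; rewrite e.
  + by move=> e; have := ltn_ord t; rewrite -e.
  + by case=> /val_inj->.
- case=> -[[|[|[|//]]] ?] [[[|[|[|//]]] ?]|[[|[|[|//]]] ?]] //=; rewrite ?E_irr // ?ax ?ay ?az ?bx ?by_ ?bz //;
  by rewrite ?(negbTE nab') ?(negbTE nyz) ?(negbTE nyx) ?(negbTE nzx) // es ?ax ?ay ?az ?bx ?by_ ?bz // ?(negbTE nab') ?(negbTE nyz) ?(negbTE nyx) ?(negbTE nzx).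
- move=> u; rewrite in_uset; split.
    case/or4P=> [/eqP->|/eqP->|/eqP->|/orP[]/eqP->].
    + by exists (inl (Ordinal (isT : 0 < 2))).
    + by exists (inl (Ordinal (isT : 1 < 2))).
    + by exists (inr (Ordinal (isT : 0 < 3))).
    + by exists (inr (Ordinal (isT : 1 < 3))).
    + by exists (inr (Ordinal (isT : 2 < 3))).
  by case=> -[[[|[|[|//]]] ?]|[[|[|[|//]]] ?]] -> //=; rewrite eqxx ?orbT.
Qed.

Lemma deg_port (i : 'I_3) : deg (inr i : Kmn 2 3) = 2.
Proof.
rewrite /deg (_ : nbrs (inr i : Kmn 2 3) = [set (inl j : Kmn 2 3) | j : 'I_2]); first by rewrite card_imset ?cardsT ?card_ord // => ? ? [].
apply/setP=> -[j|j]; rewrite !inE /=; first by apply/esym/imsetP; exists j.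
by apply/esym/negbTE/negP=> /imsetP[].
Qed.

(** The isomorphism is glued from those of the smaller tree and of the new unit. The degree
    condition of the attaching operation holds because [v] has the neighbour [x] outside the smaller
    tree. *)
Lemma utree_built r C us : utree g r C us -> exists (H : sgraph) (f : H -> T) (r' : H),
  [/\ injective f, forall s t, E g (f s) (f t) = edge s t, forall u, u \in C <-> exists s, u = f s,
      f r' = r & if us is [::] then rooted_built H else bad_built H].
Proof.
elim=> {C us} [rV|C us v a b x y z ut [H [f [r' [fi fe fC fr bH]]]] vC k nyz dis vx cr].
  exists K1, (fun _ => r), tt; split=> //; [by case=> -[]|by move=> s t; rewrite E_irr| |exact: rb_K1].
  by move=> u; rewrite in_set1; split=> [/eqP->|[_ ->]//]; exists tt.
have rbH : rooted_built H by case: us bH {ut} => // *; apply: rb_bad.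
have [fUi fUe fUC] := unit_edges k nyz vC dis vx cr; set fU := (fun k : Kmn 2 3 => _) in fUi fUe fUC.
have /fC[v' vE] := vC; pose w : Kmn 2 3 := inr (Ordinal (isT : 0 < 3)).
pose F (s : attach v' w) := match s with inl h => f h | inr k => fU k end.
have fCin h : f h \in C by apply/fC; exists h.
have fUin h : fU h \in uset a b x y z by apply/fUC; exists h.
have dv : deg v' <= 2.
  rewrite -ltnS; apply: leq_trans (g3 v); rewrite /deg -(card_imset _ fi); apply: proper_card; apply/properP; split.
    by apply/subsetP=> u /imsetP[h]; rewrite inE => vh ->; rewrite in_nb vE fe.
  exists x; first by rewrite in_nb.
  apply/negP=> /imsetP[h _ xe]; have := fCin h; rewrite -xe => xC.
  by have := disjointFr dis xC; rewrite in_uset eqxx !orbT.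
exists (attach v' w), F, (inl r'); split=> //.
- move=> [s|s] [t|t] /= e; [by rewrite (fi _ _ e)| | |by rewrite (fUi _ _ e)].
    by have := disjointFr dis (fCin s); rewrite e fUin.
  by have := disjointFr dis (fCin t); rewrite -e fUin.
- have cross h k' : E g (f h) (fU k') = (h == v') && (k' == w).
    apply/idP/andP=> [e|[/eqP-> /eqP->]]; last by rewrite -vE.
    have [e1 e2] := cr _ _ (fCin h) (fUin k') e; split; apply/eqP; first by apply: fi; rewrite e1.
    by apply: fUi; rewrite e2.
  by move=> [s|s] [t|t] /=; rewrite ?fe ?fUe ?cross // E_sym cross.
- move=> u; rewrite in_setU; split=> [/orP[/fC[h ->]|/fUC[h ->]]|[[h|h] ->]] /=.
  + by exists (inl h).
  + by exists (inr h).
  + by rewrite fCin.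
  + by rewrite fUin orbT.
- exact: attach_built rbH dv (deg_port _).
Qed.

End Tree.
End Conv.

(** * Comparison with components, bad components and [tc] of the given graph *)

Section OfSgraph.
Variable G : sgraph.
Definition ofG : gr G := Gr (@edge_sym G) (@edge_irrefl G) (fun x y (_ : edge x y) => in_setT x).

Lemma nb_ofG (x : G) : nb ofG x = nbrs x. Proof. by []. Qed.

Hypothesis hG : subcubic G.
Let g3 : sub3 ofG. Proof. by move=> x; apply: hG. Qed.

Lemma component_of (B : {set G}) r : r \in B -> (forall c u, c \in B -> edge c u -> u \in B) ->
  (forall c, c \in B -> connect edge r c) -> B \in components G.
Proof.
move=> rB cl con; apply/imsetP; exists r => //; apply/setP=> u; rewrite inE; apply/idP/idP=> [/con //|].
case/connectP=> p pp ->; elim: p r rB {con} pp => //= c p IHp r rB /andP[rc pp].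
by apply: (IHp c) => //; apply: cl rB rc.
Qed.

Lemma edge_connect_sym : connect_sym (@edge G).
Proof. by apply: sym_connect_sym => x y; rewrite edge_sym. Qed.

Lemma utree_connect r C us : utree ofG r C us -> forall c, c \in C -> connect edge r c.
Proof.
elim=> {C us} [_ c|C us v a b x y z _ IHu vC k _ _ vx _ c]; first by rewrite in_set1 => /eqP->; apply: connect0.
rewrite in_setU => /orP[/IHu //|cU]; apply: connect_trans (IHu v vC) _.
have [[_ ax ay az] [bx by_ bz]] := K23P k.
have cx : connect edge v x by apply: connect1.
have ca : connect edge v a by apply: connect_trans cx _; rewrite edge_connect_sym; apply: connect1.
have cb : connect edge v b by apply: connect_trans cx _; rewrite edge_connect_sym; apply: connect1.
move: cU; rewrite in_uset => /or4P[/eqP->|/eqP->|/eqP->|/orP[]/eqP->] //; apply: connect_trans ca _; exact: connect1.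
Qed.

Lemma bt1_bad B r us : utree ofG r B us -> us <> [::] -> bad (induced B).
Proof.
move=> ut us0; have [H [f [r' [fi fe fC fr bH]]]] := utree_built g3 ut.
exists H; split; first by case: us bH us0 {ut}.
have inv (u : induced B) : exists s, val u == f s by have /fC[s ->] := valP u; exists s.
pose h (u : induced B) : H := xchoose (inv u).
have hE u : f (h u) = val u by apply/esym/eqP/(xchooseP (inv u)).
exists h; split; last by move=> u v; rewrite -fe !hE.
have fB s : f s \in B by apply/fC; exists s.
exists (fun s => exist _ (f s) (fB s)) => [u|s]; first by apply/val_inj; rewrite /= hE.
by apply: fi; rewrite hE.
Qed.

(** Two points need an argument: [v1] is the unique vertex on no cycle of the bad graph, by
    [root_nocycle] and the 4-cycles of the units; and [v1] has two neighbours in [B], hence at most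
    one outside. *)
Lemma bt2_troublesome B : bt2 ofG B -> troublesome B.
Proof.
case=> v1 [v2 [w2 [C [us [[ut v2C v12 v2w2] [[w2C w21 nw2 nv1 BE] [nbC nv2 d3]]]]]]].
have [H [f [r' [fi fe fC fr bH]]]] := utree_built g3 ut.
have us0 : us <> [::].
  move=> e; rewrite e in ut; inversion ut as [rV CE|]; subst C.
  by move: w2C w21; rewrite in_set1 => ->.
have /fC[w' wE] := w2C.
have fCin h : f h \in C by apply/fC; exists h.
have degE h : deg h = #|nb ofG (f h) :&: C|.
  rewrite /deg -(card_imset _ fi); congr #|pred_of_set _|; apply/setP=> u; rewrite in_setI in_nb.
  apply/imsetP/andP=> [[s]|[hu /fC[s ue]]]; first by rewrite inE => hs ->; rewrite fe hs fCin.
  by exists s => //; rewrite inE -fe -ue.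
pose F (s : trouble_graph r' w') := if s is Some h then f h else v2.
have Fi : injective F.
  move=> [s|] [t|] //= e; [by rewrite (fi _ _ e)|by have := fCin s; rewrite e (negbTE v2C)|by have := fCin t; rewrite -e (negbTE v2C)].
have BF : B = [set F x | x : trouble_graph r' w'].
  rewrite BE; apply/setP=> u; rewrite in_setU1; apply/orP/imsetP=> [[/eqP->|/fC[s ->]]|[[s|] _ ->]] /=.
  - by exists None.
  - by exists (Some s).
  - by right.
  - by left.
exists H, r', w', F; split; [split|split; [split=> //|split]].
- exists H; split; first by case: us bH us0 {ut}.
  by exists id; split=> //; exists id.
- split.
    case=> c [c2 cc rc]; have := root_nocycle (s := [seq f i | i <- c]) ut; rewrite size_map => /(_ c2).
    have cc' : ucycle (@edge G) [seq f i | i <- c].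
      case/andP: cc => cy un; rewrite /ucycle map_inj_uniq // un andbT.
      by case: c cy {c2 rc un} => //= x c; rewrite -map_rcons path_map; apply: sub_path => s t; rewrite /= -fe.
    have sC : {subset [seq f i | i <- c] <= C} by move=> u /mapP[s _ ->].
    by move=> /(_ cc' sC); rewrite -fr map_f.
  move=> h nh; apply: contrapT => ne; apply: nh.
  have hr : f h != v1 by apply/eqP=> e; apply: ne; apply: fi; rewrite e.
  have [a [b [x [y [z [k /subsetP sub _ cE]]]]]] := utree_cov ut (fCin h) hr.
  have [[ku ax ay az] [bx by_ bz]] := K23P k.
  have pre u : u \in [:: a; b; x; y; z] -> exists s, u = f s by move=> uu; apply/fC; apply: sub; rewrite inE.
  have [a' aE] : exists s, a = f s by apply: pre; rewrite !inE eqxx ?orbT.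
  have [b' bE] : exists s, b = f s by apply: pre; rewrite !inE eqxx ?orbT.
  have [x' xE] : exists s, x = f s by apply: pre; rewrite !inE eqxx ?orbT.
  have [y' yE] : exists s, y = f s by apply: pre; rewrite !inE eqxx ?orbT.
  have [[nab nax nay naz] [[nbx nby nbz] [nxy nxz nyz]]] := uniq5 ku.
  have ax' : E ofG a x by []; have xb : E ofG x b by rewrite E_sym.
  have by' : E ofG b y by []; have ya : E ofG y a by rewrite E_sym.
  (* The 4-cycle through both sides and two ports, arranged to contain the given vertex. *)
  exists [:: a'; x'; b'; y']; split=> //.
    apply/andP; split; first by rewrite /= -!fe -aE -bE -xE -yE ax xb by_ ya.
    rewrite -(map_inj_uniq fi) /= -aE -bE -xE -yE !inE !negb_or nax nab nay nxy nby eq_sym nbx //.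
  by rewrite !inE -!(inj_eq fi) -aE -bE -xE -yE; case: cE => ->; rewrite eqxx ?orbT.
- by rewrite degE fr nv1.
- by apply: contraNneq w21 => e; rewrite wE e fr.
- by rewrite degE -wE nw2.
- move=> [s|] [t|] //=; first by rewrite -fe.
    by case/orP=> /eqP->; [rewrite fr|rewrite -wE edge_sym].
  by move=> /orP[]/eqP->; rewrite ?fr -?wE // edge_sym.
- move=> h hr; have hv : f h != v1 by rewrite -fr (inj_eq fi).
  rewrite /deg -[RHS](card_imset _ Fi); congr #|pred_of_set _|; apply/setP=> u.
  apply/idP/imsetP=> [|[[s|]]]; rewrite ?inE /=.
  + move=> hu; have : u \in B by apply: (subsetP (nbC _ (fCin h) hv)); rewrite in_nb.
    rewrite BF => /imsetP[[s|] _ ue]; last first.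
      exists None => //; rewrite inE /=; have : f h \in nb ofG v2 :&: C by rewrite in_setI fCin andbT nb_sym in_nb -[v2]/(F None) -ue.
      by rewrite nv2 in_set2 -fr wE !(inj_eq fi).
    by exists (Some s) => //; rewrite inE /= -fe -[f s]/(F (Some s)) -ue.
  + by move=> hs ->; rewrite -[edge _ _]/(E ofG (f h) (f s)) fe.
  + by move=> /orP[]/eqP-> ->; rewrite edge_sym ?fr -?wE // edge_sym.
- rewrite -/(F None) -nb_ofG; have := cardsID C (nb ofG v2); rewrite nv2 d3 cards2 (_ : v1 != w2) 1?eq_sym // => e.
  have -> : nb ofG (F None) :\: B = nb ofG v2 :\: C by apply/setP=> u; rewrite BE !in_setD in_setU1 in_nb; case: eqP => [->|//]; rewrite E_irr !andbF.
  by move: e; clear; lia.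
- rewrite /= fr -nb_ofG; have := cardsID B (nb ofG v1).
  have : 2 <= #|nb ofG v1 :&: B|.
    have [c] : exists c, c \in nb ofG v1 :&: C by apply/card_gt0P; rewrite nv1.
    rewrite in_setI => /andP[v1c cC]; have <- : #|[set v2; c]| = 2 by rewrite cards2; case: eqP => // e; rewrite e cC in v2C.
    apply: subset_leq_card; apply/subsetP=> u; rewrite in_set2 in_setI BE in_setU1 => /orP[]/eqP->; rewrite ?eqxx ?v1c ?cC ?orbT // andbT in_nb //.
  by have := g3 v1; clear; lia.
Qed.

(** A maximum packing splits into isolated vertices, bad components and troublesome configurations;
    the last form a disjoint family, as [tc] demands. *)
Lemma sig_le : sig ofG <= ndeg 0 G + (bad_components G + tc G).
Proof.
have [P [tP bP] <-] := sig_wit ofG.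
pose P0 := [set B in P | [exists r, (B == [set r]) && (deg r == 0)]].
pose P1 := [set B in P | (B \in components G) && `[< bad (induced B) >]].
pose P2 := [set B in P | `[< troublesome B >]].
have sub : P \subset P0 :|: (P1 :|: P2).
  apply/subsetP=> B BP; rewrite !in_setU !inE BP /=; case: (bP B BP) => [[r [us [ut cl]]]|/bt2_troublesome h]; last first.
    by rewrite (asboolT h) !orbT.
  case: us ut => [|u us] ut.
    have BE : B = [set r] by inversion ut.
    apply/orP; left; apply/existsP; exists r; rewrite BE eqxx /= /deg cards_eq0 -subset0; apply/subsetP=> v.
    rewrite inE => rv; have := cl r v; rewrite BE !in_set1 eqxx => /(_ isT rv)/eqP ve; by rewrite ve edge_irrefl in rv.
  apply/orP; right; apply/orP; left; apply/andP; split.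
    by apply: (component_of (utree_r ut) cl); apply: utree_connect ut.
  by apply/asboolP; apply: bt1_bad ut _.
apply: leq_trans (subset_leq_card sub) _; apply: leq_trans (leq_card_setU _ _) _; apply: leq_add.
  rewrite /ndeg; have s0 : P0 \subset [set [set r] | r in [set v : G | deg v == 0]].
    by apply/subsetP=> B; rewrite inE => /andP[_ /existsP[r /andP[/eqP-> r0]]]; apply/imsetP; exists r; rewrite ?inE.
  exact: leq_trans (subset_leq_card s0) (leq_imset_card _ _).
apply: leq_trans (leq_card_setU _ _) _; apply: leq_add.
  by apply: subset_leq_card; apply/subsetP=> B; rewrite !inE => /andP[_].
apply: (@leq_bigmax_cond _ _ (fun P : {set {set G}} => #|P|) P2); apply/andP; split.
  apply/trivIsetP=> A B; rewrite !inE => /andP[AP _] /andP[BP _]; exact: (trivIsetP tP).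
by apply/forall_inP=> B; rewrite inE => /andP[].
Qed.

(** A model in which every vertex has three known neighbours is closed under adjacency, and four
    rounds of neighbours from vertex 0 reach all of it, so it is a whole component. *)
Lemma model_component (H : sgraph) (L : seq H) (x0 : G) n es vs : models x0 ofG (mk n es [::]) vs -> mk_ok n es ->
  all (fun i => size (adj es i) == 3) (iota 0 n) ->
  all (fun i => i \in iter 4 (fun S => S ++ flatten [seq adj es j | j <- S]) [:: 0]) (iota 0 n) -> 0 < n ->
  size L = n -> uniq L -> #|H| <= n ->
  (forall h0 i j, i < n -> j < n -> edge (nth h0 L i) (nth h0 L j) = (j \in adj es i)) ->
  exists2 C, C \in components G & isomorphic (induced C) H.
Proof.
move=> ms ok /allP d3 /allP con n0 sL uL cH eL; have [sz u _ _ _] := ms; rewrite size_mkseq in sz.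
have lt' i : i < n -> i < size (mk n es [::]) by rewrite size_mkseq.
have ci i : i < n -> cli (mk n es [::]) i.
  by move=> ilt; rewrite /cli nbi_mk // (eqP (d3 i _)) ?orbT // mem_iota.
have EE i j : i < n -> j < n -> edge (nth x0 vs i) (nth x0 vs j) = (j \in adj es i).
  move=> ilt jlt; apply/idP/idP=> h.
    by have := m_clEi g3 ms (lt' _ ilt) (lt' _ jlt) (ci _ ilt) h; rewrite nbi_mk.
  by have := m_E ms (lt' _ ilt) (j := j); rewrite nbi_mk // => /(_ h).
have adjlt i j : i < n -> j \in adj es i -> j < n.
  by move=> ilt ji; have := m_lt ms (lt' _ ilt) (j := j); rewrite nbi_mk // size_mkseq; apply.
pose C := [set y in vs].
have inC i : i < n -> nth x0 vs i \in C by move=> ilt; rewrite inE mem_nth ?sz.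
exists C.
  apply: (component_of (inC 0 n0)).
    move=> c v; rewrite inE => /(nthP x0)[i]; rewrite sz => ilt <- iv.
    have [j] := m_clE g3 ms (lt' _ ilt) (ci _ ilt) iv; rewrite nbi_mk // => ji ->.
    by apply: inC; apply: adjlt ji.
  move=> c; rewrite inE => /(nthP x0)[i]; rewrite sz => ilt <-.
  have : i \in iota 0 n by rewrite mem_iota.
  move/con; have gen k : forall i, i \in iter k (fun S => S ++ flatten [seq adj es j | j <- S]) [:: 0] ->
      i < n /\ connect edge (nth x0 vs 0) (nth x0 vs i).
    elim: k => [|k IHk] j; first by rewrite inE => /eqP->; split=> //; apply: connect0.
    rewrite iterS mem_cat => /orP[/IHk //|/flattenP[l /mapP[h /IHk[hlt hc] ->] jh]].
    have jlt := adjlt _ _ hlt jh; split=> //; apply: connect_trans hc (connect1 _); by rewrite EE.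
  by case/gen.
have [h0 _] : exists h, h \in L by case: L sL {uL eL} => [|h L] e; [rewrite -e in n0|exists h; rewrite mem_head].
pose F (x : induced C) : H := nth h0 L (index (val x) vs).
have ix (x : induced C) : index (val x) vs < n by rewrite -sz index_mem; have := valP x; rewrite inE.
have vx (x : induced C) : nth x0 vs (index (val x) vs) = val x by rewrite nth_index //; have := valP x; rewrite inE.
exists F; split; last by move=> x y; rewrite eL // -EE // !vx.
apply: inj_card_bij.
  move=> x y /eqP; rewrite nth_uniq ?sL // => /eqP e; apply/val_inj; by rewrite -vx e vx.
apply: leq_trans cH _; rewrite card_sig -[X in _ <= X]/(#|C|) cardsE (card_uniqP u) sz //.
Qed.

End OfSgraph.

(** * The induction and the theorem *)

(** Induction on the number of vertices. A nonempty minimal counterexample is cubic by [n3], has no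
    unit by [noK] and no cycle of length 3 to 7 by the last stages, against [girth_no]. *)
Lemma gr_bound (T : finType) (x0 : T) n (g : gr T) :
  #|V g| < n -> sub3 g -> dead x0 g sK33 -> dead x0 g sPr -> Q g.
Proof.
elim: n g => // n IHn g gn g3 dK dP; apply: contrapT => nQ.
have IH (g' : gr T) : #|V g'| < #|V g| -> sub3 g' -> dead x0 g' sK33 -> dead x0 g' sPr -> Q g'.
  by move=> lt; apply: IHn; apply: leq_trans lt _; rewrite -ltnS.
have [V0|[x xV]] := set_0Vmem (V g).
  apply: nQ; exists set0; last by rewrite cards0.
  by split=> [|x y|x]; rewrite ?sub0set ?V0 ?inE.
apply: (girth_no (x0 := x0) g3 (n3 g3 IH nQ dK dP) xV (IHd g3 IH dK dP) nQ (noK g3 IH nQ dK dP)) => k k28.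
have : k \in [:: 3; 4; 5; 6; 7] by rewrite !inE; move: k28; clear; lia.
rewrite !inE => /or4P[/eqP->|/eqP->|/eqP->|/orP[]/eqP->].
- exact: (d11 g3 IH nQ dK dP).
- exact: (d12 g3 IH nQ dK dP).
- exact: (d13 g3 IH nQ dK dP).
- exact: (d14 g3 IH nQ dK dP).
- exact: (d_C7 g3 IH nQ dK dP).
Qed.

Lemma bigmin_le (I : eqType) (r : seq I) (P : pred I) (F : I -> nat) m i : i \in r -> P i ->
  \big[minn/m]_(j <- r | P j) F j <= F i.
Proof.
elim: r => // j r IHr; rewrite inE big_cons => /orP[/eqP<-|ir] Pi; first by rewrite Pi geq_minl.
by case: ifP => _; [apply: leq_trans (geq_minr _ _) _|]; apply: IHr.
Qed.

Lemma indep_dom_number_le (G : sgraph) (S : {set G}) : ids (ofG G) S -> indep_dom_number G <= #|S|.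
Proof.
move=> [_ Si Sd]; apply: bigmin_le; rewrite ?mem_index_enum //; apply/andP; split.
  by apply/forall_inP=> x xS; apply/forall_inP=> y yS; apply: Si.
apply/forall_inP=> x; rewrite in_setC => xS; have [y yS xy] := Sd x (in_setT x) xS.
by apply/exists_inP; exists y.
Qed.

Lemma wt_ofG (G : sgraph) : subcubic G ->
  wt (ofG G) + 2 * ndeg 0 G = 8 * ndeg 0 G + 5 * ndeg 1 G + 4 * ndeg 2 G + 3 * ndeg 3 G.
Proof.
move=> hG; have nE j : ndeg j G = \sum_(x : G) (deg x == j).
  by rewrite /ndeg -sum1_card big_mkcond; apply: eq_bigr => x _; rewrite inE; case: eqP.
have -> : wt (ofG G) = \sum_(x : G) (6 - deg x) by apply: eq_bigl => x; rewrite inE.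
rewrite !nE !big_distrr -!big_split /=; apply: eq_bigr => x _.
by move: (hG x); case: (deg x) => [|[|[|[|]]]].
Qed.

Lemma edge_table (H : sgraph) (L : seq H) h n es : size L = n ->
  all (fun i => all (fun j => edge (nth h L i) (nth h L j) == (j \in adj es i)) (iota 0 n)) (iota 0 n) ->
  forall h0 i j, i < n -> j < n -> edge (nth h0 L i) (nth h0 L j) = (j \in adj es i).
Proof.
move=> sL /allP al h0 i j ilt jlt.
have e k : k < n -> nth h0 L k = nth h L k by move=> kl; apply: set_nth_default; rewrite sL.
have ii : i \in iota 0 n by rewrite mem_iota.
by rewrite !e //; apply/eqP; have /allP := al i ii; apply; rewrite mem_iota.
Qed.

Lemma dead_K33 (G : sgraph) (x0 : G) : subcubic G ->
  (forall C : {set G}, C \in components G -> ~ isomorphic (induced C) (Kmn 3 3)) -> dead x0 (ofG G) sK33.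
Proof.
move=> hG nK vs ms.
pose L : seq (Kmn 3 3) := [:: inl (Ordinal (isT : 0 < 3)); inl (Ordinal (isT : 1 < 3));
  inr (Ordinal (isT : 0 < 3)); inr (Ordinal (isT : 1 < 3)); inr (Ordinal (isT : 2 < 3)); inl (Ordinal (isT : 2 < 3))].
have cH : #|{: 'I_3 + 'I_3}| = 6 by rewrite card_sum !card_ord.
have tb : all (fun i => all (fun j => @edge (Kmn 3 3) (nth (inl ord0) L i) (nth (inl ord0) L j) == (j \in adj K33_es i)) (iota 0 6)) (iota 0 6) by [].
have [C CG iC] := model_component hG ms isT isT isT isT (erefl : size L = 6) isT (eq_leq cH) (edge_table (erefl : size L = 6) tb).
exact: nK CG iC.
Qed.

Lemma dead_prism (G : sgraph) (x0 : G) : subcubic G ->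
  (forall C : {set G}, C \in components G -> ~ isomorphic (induced C) prism5) -> dead x0 (ofG G) sPr.
Proof.
move=> hG nK vs ms.
pose o0 := Ordinal (isT : 0 < 5); pose o1 := Ordinal (isT : 1 < 5); pose o2 := Ordinal (isT : 2 < 5).
pose o3 := Ordinal (isT : 3 < 5); pose o4 := Ordinal (isT : 4 < 5).
pose L : seq prism5 := [seq (i, false) | i <- [:: o0; o1; o2; o3; o4]] ++ [seq (i, true) | i <- [:: o0; o1; o2; o3; o4]].
have cH : #|{: 'I_5 * bool}| = 10 by rewrite card_prod card_ord card_bool.
have tb : all (fun i => all (fun j => @edge prism5 (nth (o0, true) L i) (nth (o0, true) L j) == (j \in adj prism_es i)) (iota 0 10)) (iota 0 10) by [].
have [C CG iC] := model_component hG ms isT isT isT isT (erefl : size L = 10) isT (eq_leq cH) (edge_table (erefl : size L = 10) tb).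
exact: nK CG iC.
Qed.

Theorem theorem6 (G : sgraph) (hG : subcubic G)
  (hK33 : forall C : {set G}, C \in components G ->
     ~ isomorphic (induced C) (Kmn 3 3))
  (hprism : forall C : {set G}, C \in components G ->
     ~ isomorphic (induced C) prism5) :
  8 * indep_dom_number G <=
    8 * ndeg 0 G + 5 * ndeg 1 G + 4 * ndeg 2 G + 3 * ndeg 3 G
    + 2 * tc G + 2 * bad_components G.
Proof.
have [S gS cS] : Q (ofG G).
  (* The empty graph is treated apart: it offers no default vertex [x0] for the models. *)
  have [G0|/card_gt0P[x0 _]] := posnP #|G|.
    exists set0; last by rewrite cards0.
    by split=> [|x y|x]; rewrite ?sub0set ?inE //; have := card0_eq G0 x.
  by apply: (gr_bound (x0 := x0) (ltnSn _)); [exact: hG|exact: dead_K33|exact: dead_prism].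
have := indep_dom_number_le gS; have := sig_le hG; have := wt_ofG hG; move: cS; clear; lia.
Qed.
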